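(* Let $(X,d,\mu)$ be a space of homogeneous type and $\mathcal{D}$ a dyadic system on $X$ with parameters $c_0$, $C_0$ and $\delta$. Fix $\alpha\ge\frac{3c_d^2}{\delta}$. Let $T$ be the operator associated to a kernel $K$, and assume that $K\in H_r$ for some $1<r\le\infty$ and that $K^*\in H_1$. Suppose that there exists $c>0$ such that for every ball $B$ and every measurable subset $E\subset B$ $$\int_B|T^*\chi_E|\,d\mu\le c\,\mu(B).$$ Then for every boundedly supported function $\vec f:X\to\mathbb{R}^n$ such that $|\vec f|\in L^{r}(X)$ there exists a sparse family $\mathcal{S}\subset\mathcal{D}$ such that for a.e. $x\in X$ $$T\vec f(x)\in c_{n,d}\,c_T\sum_{Q\in\mathcal{S}}\langle\langle\vec f\rangle\rangle_{r',\alpha Q}\,\chi_Q(x).$$ In other words, $$T\vec f(x)=c_{n,d}\,c_T\sum_{Q\in\mathcal{S}}\frac1{\mu(\alpha Q)}\int_{\alpha Q}\vec f(y)k_Q(x,y)\,d\mu(y)\,\chi_Q(x),$$ where the $k_Q$ are scalar functions with $$\Big\|\,\|k_Q(x,y)\|_{L^{r}(\alpha Q,\frac{d\mu(y)}{\mu(\alpha Q)})}\Big\|_{L^\infty(Q,d\mu(x))}\le1.$$ Furthermore, there exist $0<\tilde c_0\le\tilde C_0<\infty$, $0<\tilde\delta<1$ and $m\in\mathbb{N}$ such that there are dyadic systems $\mathcal{D}_1,\dots,\mathcal{D}_m$ with parameters $\tilde c_0,\tilde C_0,\tilde\delta$ and $m$ sparse families $\mathcal{S}_j\subset\mathcal{D}_j$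 such that $$T\vec f(x)=c_{n,d}\,c_T\sum_{j=1}^m\sum_{Q\in\mathcal{S}_j}\frac1{\mu(Q)}\int_Q\vec f(y)k_Q(x,y)\,d\mu(y)\,\chi_Q(x),$$ where the $k_Q$ are scalar functions with $$\Big\|\,\|k_Q(x,y)\|_{L^{r}(Q,\frac{d\mu(y)}{\mu(Q)})}\Big\|_{L^\infty(Q,d\mu(x))}\le1.$$ Here $c_{n,d}$ and $c_T$ denote constants: $c_{n,d}$ depends on $n$ and on the geometric data, and $c_T$ depends on $T$.
   Context: Space of homogeneous type $(X,d,\mu)$: $X$ is a set with a quasi-metric $d$, i.e. $d(x,y)\le c_d(d(x,z)+d(z,y))$ for some $c_d\ge1$, and a Borel measure $\mu$ with $\mu(B(x,2\rho))\le c_\mu\mu(B(x,\rho))$, where $B(x,\rho)=\{y:d(x,y)<\rho\}$. All balls are Borel sets with $0<\mu(B)<\infty$, and the Lebesgue differentiation theorem holds. For $B=B(x,\rho)$, $aB=B(x,a\rho)$. Dyadic system with parameters $0<c_0\le C_0<\infty$, $\delta\in(0,1)$: $\mathcal{D}=\bigcup_{k\in\mathbb{Z}}\mathcal{D}_k$, where $\mathcal{D}_k=\{Q_j^k\}_{j\in J_k}$ is a pairwise disjoint collection of measurable sets (''cubes'') with points $z_j^k$ such that (1) $X=\bigcup_{j\in J_k}Q_j^k$ for every $k$; (2) if $k\ge l$, $P\in\mathcal{D}_k$, $Q\in\mathcal{D}_l$, then $P\cap Q=\emptyset$ or $P\subseteq Q$; (3) $B(z_j^k,c_0\delta^k)\subseteq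 Q_j^k\subseteq B(z_j^k,C_0\delta^k)$. A cube carries its center and generation, and for $\alpha\ge1$, $\alpha Q_j^k:=B(z_j^k,\alpha C_0\delta^k)$. $\mathcal{S}$ is $\eta$-sparse ($0<\eta<1$) if for every $Q\in\mathcal{S}$ there is a measurable $E_Q\subset Q$ with $\mu(E_Q)\ge\eta\mu(Q)$ and the sets $E_Q$ are pairwise disjoint; ''sparse'' means $\eta$-sparse for some $\eta\in(0,1)$. $\langle g\rangle_{t,Q}=(\frac1{\mu(Q)}\int_Q|g|^td\mu)^{1/t}$. $\langle\langle\vec f\rangle\rangle_{t,Q}=\{\frac1{\mu(Q)}\int_Q\varphi\vec f\,d\mu:\ \|\varphi\|_{L^{t'}(Q,\frac{d\mu}{\mu(Q)})}\le1\}\subset\mathbb{R}^n$ ($\varphi$ scalar, $\frac1t+\frac1{t'}=1$). Sums of sets are Minkowski sums. $r'$ is the dual exponent of $r$ ($r'=1$ if $r=\infty$). Kernels: $K:X\times X\setminus\{(x,x):x\in X\}\to\mathbb{R}$. $K\in H_r$, $1\le r<\infty$, if $$\sup_B\sup_{x,z\in\frac1{2c_d}B}\sum_{k=1}^\infty\mu(2^kB)\big\langle(K(x,\cdot)-K(z,\cdot))\chi_{2^kB\setminus2^{k-1}B}\big\rangle_{r,2^kB}<\infty,$$ with $\langle\cdot\rangle_{r,2^kB}$ replaced by $\|\cdot\|_{L^\infty(2^kB)}$ for $r=\infty$ (supremum over balls $B$). $K^*(x,y)=K(y,x)$. $T$ is a linear operator associated to the kernel $K$, i.e. $Tf(x)=\int_XK(x,y)f(y)\,d\mu(y)$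 for $f$ continuous with compact support and $x\notin\operatorname{supp}f$; $T^*$ is the operator associated to $K^*$. $T$ acts on vector functions coordinatewise: $T\vec f=\sum_{j=1}^nT(\langle\vec f,\vec e_j\rangle)\vec e_j$ for an orthonormal basis $\{\vec e_j\}$ of $\mathbb{R}^n$. ''Boundedly supported'' means vanishing outside some ball.
   Formalization: Added: continuous compactly supported functions are dense in L^1 (else every T may be associated to K=0, e.g. on the irrationals), and T* is the adjoint of T, not merely associated to K*; the English fails without these. T acts on boundedly supported L^r functions; K is measurable. *)

(* Defs.v *)
From HB Require Import structures.
From mathcomp Require Import all_boot all_order all_algebra.
From mathcomp Require Import all_classical all_reals all_analysis.

Set Implicit Arguments.
Unset Strict Implicit.
Unset Printing Implicit Defensive.
Import Order.TTheory GRing.Theory Num.Theory.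
Import numFieldNormedType.Exports.

Local Open Scope classical_set_scope.
Local Open Scope ring_scope.

Notation Borel X := (g_sigma_algebraType (@open X)).

Section QuasiMetric.
Context {R : realType} {X : ptopologicalType}.
Implicit Types (d : X -> X -> R) (cd : R).

Record is_quasimetric d cd : Prop := {
  qm_ge0 : forall x y, 0 <= d x y;
  qm_eq0 : forall x y, d x y = 0 <-> x = y;
  qm_sym : forall x y, d x y = d y x;
  qm_cst : 1 <= cd;
  qm_triangle : forall x y z, d x y <= cd * (d x z + d z y) }.

Definition qball d (x : X) (rho : R) : set X := [set y | d x y < rho].

(* Balls of a quasi-metric need not be open, hence this form. *)
Definition quasimetric_topology d :=
  forall U : set X, open U <->
    forall x, U x -> exists2 rho, 0 < rho & qball d x rho `<=` U.

Definition bounded_support d (V : zmodType) (f : X -> V) :=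
  exists x rho, 0 < rho /\ forall y, ~ qball d x rho y -> f y = 0.

Definition supp (f : X -> R) : set X := closure [set x | f x != 0].

Definition Cc (f : X -> R) := continuous f /\ compact (supp f).

End QuasiMetric.

Section Norms.
Context {R : realType} {X : ptopologicalType}.
Variable mu : {measure set (Borel X) -> \bar R}.
Implicit Types (Q : set (Borel X)) (p t : \bar R) (g : Borel X -> R).

(* The norm of g in L^p(Q, dmu / mu(Q)) *)
Definition avgnorm p Q g : \bar R :=
  match p with
  | q%:E => ((((fine (mu Q))^-1)%:E * \int[mu]_(x in Q) (`|g x| `^ q)%:E)
             `^ q^-1)%E
  | _ => ('N[mu]_p[(fun x => (\1_Q x * g x)%R%:E)])%E
  end.

Definition enorm n (v : 'rV[R]_n) : R := Num.sqrt (\sum_(i < n) v 0 i ^+ 2).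

Definition avg n Q (f : Borel X -> 'rV[R]_n) : 'rV[R]_n :=
  \row_i ((fine (mu Q))^-1 * \int[mu]_(y in Q) f y 0 i).

Definition vintegrable n Q (f : Borel X -> 'rV[R]_n) :=
  forall i, mu.-integrable Q (fun y => (f y 0 i)%:E).

(* Integrability is automatic when |f| is in L^t(Q). *)
Definition convex_body n t Q (f : Borel X -> 'rV[R]_n) : set 'rV[R]_n :=
  [set v | exists phi : Borel X -> R,
    [/\ measurable_fun Q phi, (avgnorm (hoelder_conjugate t) Q phi <= 1)%E,
        vintegrable Q (fun y => phi y *: f y) &
        v = avg Q (fun y => phi y *: f y)]].

End Norms.

Section VectorSums.
Context {R : realType} {I : choiceType} {n : nat}.
Implicit Types (S : set I) (w : I -> 'rV[R]_n).

Definition vsummable S w := forall i, summable S (fun Q => (w Q 0 i)%:E).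

Definition vsum S w : 'rV[R]_n :=
  \row_i (fine (\esum_(Q in S) (Num.max (w Q 0 i) 0)%:E)
          - fine (\esum_(Q in S) (Num.max (- w Q 0 i) 0)%:E)).

(* Sums over infinite families converge unconditionally, i.e. absolutely. *)
Definition minkowski_sum S (A : I -> set 'rV[R]_n) : set 'rV[R]_n :=
  [set v | exists w, [/\ forall Q, S Q -> A Q (w Q), vsummable S w &
                         v = vsum S w]].

End VectorSums.

Section Spaces.
Context {R : realType} {X : ptopologicalType}.
Implicit Types (mu : {measure set (Borel X) -> \bar R}) (d : X -> X -> R).

Definition differentiation_property mu d :=
  forall f : Borel X -> R, measurable_fun setT f ->
    (forall x rho, 0 < rho ->
       mu.-integrable (qball d x rho) (EFin \o f)) ->
    {ae mu, forall x, (fine (mu (qball d x rho)))^-1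
                      * \int[mu]_(y in qball d x rho) f y
                        @[rho --> 0^'+] --> f x}.

Record homogeneous_type mu d (cd cmu : R) : Prop := {
  ht_quasimetric : is_quasimetric d cd;
  ht_topology : quasimetric_topology d;
  ht_ball_measurable : forall x rho, 0 < rho ->
    measurable (qball d x rho : set (Borel X));
  ht_ball_gt0 : forall x rho, 0 < rho -> (0 < mu (qball d x rho))%E;
  ht_ball_fin : forall x rho, 0 < rho -> (mu (qball d x rho) < +oo)%E;
  ht_doubling : forall x rho, 0 < rho ->
    (mu (qball d x (2 * rho)) <= cmu%:E * mu (qball d x rho))%E;
  ht_differentiation : differentiation_property mu d }.

(* X may fail to be locally compact, in which case Cc can be too small (even
   reduced to 0) for an operator to be related to its kernel through it. *)
Definition Cc_dense_L1 mu :=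
  forall f : Borel X -> R, mu.-integrable setT (EFin \o f) ->
  forall e : R, 0 < e -> exists2 g : X -> R, Cc g &
    (\int[mu]_x (`|f x - g x|)%:E < e%:E)%E.

End Spaces.

Section Dyadic.
Context {R : realType} {X : ptopologicalType}.
Variables (mu : {measure set (Borel X) -> \bar R}) (d : X -> X -> R).

(* A cube is remembered together with its generation and its center, so the
   same set may occur as several cubes of different generations. *)
Definition cube : choiceType := (int * X * set X)%type.
Implicit Types (P Q : cube) (D S : set cube).
Definition generation Q : int := Q.1.1.
Definition cube_center Q : X := Q.1.2.
Definition carrier Q : set (Borel X) := Q.2.

Definition dilate (C0 delta alpha : R) Q : set (Borel X) :=
  qball d (cube_center Q) (alpha * C0 * delta ^ generation Q).

Record dyadic_system (c0 C0 delta : R) D : Prop := {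
  ds_measurable : forall Q, D Q -> measurable (carrier Q);
  ds_disjoint : forall P Q, D P -> D Q -> generation P = generation Q -> P <> Q ->
    carrier P `&` carrier Q = set0;
  ds_cover : forall (k : int) (x : X),
    exists Q, [/\ D Q, generation Q = k & carrier Q x];
  ds_nested : forall P Q, D P -> D Q -> generation Q <= generation P ->
    carrier P `&` carrier Q = set0 \/ carrier P `<=` carrier Q;
  ds_inner : forall Q, D Q ->
    qball d (cube_center Q) (c0 * delta ^ generation Q) `<=` carrier Q;
  ds_outer : forall Q, D Q ->
    carrier Q `<=` qball d (cube_center Q) (C0 * delta ^ generation Q) }.

Definition eta_sparse (eta : R) S :=
  exists E : cube -> set (Borel X),
    (forall Q, S Q -> [/\ measurable (E Q), E Q `<=` carrier Q &
       (eta%:E * mu (carrier Q) <= mu (E Q))%E]) /\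
    (forall P Q, S P -> S Q -> P <> Q -> E P `&` E Q = set0).

Definition sparse S := exists2 eta : R, 0 < eta < 1 & eta_sparse eta S.

End Dyadic.
Arguments cube : clear implicits.

Section Operators.
Context {R : realType} {X : ptopologicalType}.
Variables (mu : {measure set (Borel X) -> \bar R}) (d : X -> X -> R) (cd : R).
Implicit Types (K : Borel X -> Borel X -> R) (r p : \bar R).
Implicit Types (T Ts : (Borel X -> R) -> (Borel X -> R)).

(* The values of a kernel on the diagonal are irrelevant. *)
Definition offdiag_measurable K :=
  measurable_fun [set z : Borel X * Borel X | z.1 <> z.2]
    (fun z => K z.1 z.2).

Definition transpose K : Borel X -> Borel X -> R := fun x y => K y x.

Definition hormander_sum r K (x0 : X) (rho : R) (x z : X) : \bar R :=
  (\sum_(1 <= k <oo)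
     let Bk := qball d x0 (2 ^+ k * rho) : set (Borel X) in
     let Bk1 := qball d x0 (2 ^+ k.-1 * rho) : set (Borel X) in
     mu Bk * avgnorm mu r Bk
       (fun y => (K x y - K z y) * \1_(Bk `\` Bk1) y)%R)%E.

Definition hormander r K :=
  (ereal_sup [set s | exists x0 rho x z,
     [/\ (0 < rho)%R, qball d x0 (rho / (2 * cd)) x,
         qball d x0 (rho / (2 * cd)) z & s = hormander_sum r K x0 rho x z]]
   < +oo)%E.

(* Boundedly supported functions in L^p *)
Definition bsL p : set (Borel X -> R) :=
  [set f : Borel X -> R | [/\ measurable_fun setT f, bounded_support d f &
               ('N[mu]_p[EFin \o f] < +oo)%E]].

(* T f only matters up to a null set, and only for f in bsL p. *)
Definition linear_operator p T :=
  (forall f, bsL p f -> measurable_fun setT (T f)) /\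
  (forall (a : R) f g, bsL p f -> bsL p g ->
     {ae mu, forall x, T (fun y => a * f y + g y) x = a * T f x + T g x}).

Definition associated_kernel T K :=
  forall f : X -> R, Cc f ->
    {ae mu, forall x : Borel X, ~ supp f x ->
       mu.-integrable setT (fun y => (K x y * f y)%:E) /\
       T f x = \int[mu]_y (K x y * f y)}.

(* A kernel alone does not determine an operator (a multiplication operator has
   kernel 0), so Ts is related to T by duality as well. *)
Definition adjoint_operators p q T Ts :=
  forall f g, bsL p f -> bsL q g ->
    [/\ mu.-integrable setT (fun x => (T f x * g x)%:E),
        mu.-integrable setT (fun x => (f x * Ts g x)%:E) &
        \int[mu]_x (T f x * g x) = \int[mu]_x (f x * Ts g x)].

Definition testing Ts :=
  exists2 c : R, 0 < c & forall x rho (E : set (Borel X)), 0 < rho ->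
    measurable E -> E `<=` qball d x rho ->
    (\int[mu]_(y in qball d x rho) (`|Ts (\1_E) y|)%:E
      <= c%:E * mu (qball d x rho))%E.

Definition vapply T n (f : Borel X -> 'rV[R]_n) : Borel X -> 'rV[R]_n :=
  fun x => \row_j T (fun y => f y 0 j) x.

Definition admissible r n (f : Borel X -> 'rV[R]_n) :=
  [/\ forall j, measurable_fun setT (fun x => f x 0 j), bounded_support d f &
      ('N[mu]_r[(fun x => (enorm (f x))%:E)] < +oo)%E].

(* The mixed norm condition on k over Q x P, P being alpha Q or Q *)
Definition unit_kernel r (Q P : set (Borel X)) (k : Borel X -> Borel X -> R) :=
  measurable_fun (Q `*` P) (fun z : Borel X * Borel X => k z.1 z.2) /\
  ('N[mu]_+oo[(fun x => (\1_Q x)%:E * avgnorm mu r P (k x))] <= 1)%E.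

Definition sparse_term n (Q P : set (Borel X)) (k : Borel X -> Borel X -> R)
    (f : Borel X -> 'rV[R]_n) (x : Borel X) : 'rV[R]_n :=
  \1_Q x *: avg mu P (fun y => k x y *: f y).

(* Absolute convergence, at x, of the series of the terms above *)
Definition sparse_series_cvg n (S : set (cube X)) (P : cube X -> set (Borel X))
    (k : cube X -> Borel X -> Borel X -> R) (f : Borel X -> 'rV[R]_n)
    (x : Borel X) :=
  (forall Q, S Q -> carrier Q x ->
     vintegrable mu (P Q) (fun y => k Q x y *: f y)) /\
  vsummable S (fun Q => sparse_term (carrier Q) (P Q) (k Q) f x).

End Operators.

(* Main.v *)
(** Fix a cube Q and a scalar function g supported in alpha Q.  A Calderon-Zygmund decomposition
    of g over the dyadic system, together with the testing condition for the good part and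
    K^* in H_1 for the bad part, gives a weak type estimate for T g on Q.  Combined with a maximal
    function and K in H_r it yields an exceptional set Om of small measure such that T g is bounded
    on Q off Om, and T(g 1_(alpha Q - alpha P)) is bounded on each subcube P that is at most half
    filled by Om.  The kernel is only used through the duality between T and Ts: the pairing of T h
    with a mean zero test function is represented by the kernel away from the support of h.

    For a vector function f, the set of averages of phi f over alpha Q, phi bounded with unit norm
    in L^r, has a basis in which every coordinate of f either has controlled L^(r') norm or
    corresponds to a line contained in that set, along which no control is needed.  The second
    alternative cannot be avoided, since f need not be in L^(r').  The scalar estimate applied to
    the coordinates expresses T(f 1_(alpha Q)) on Q as one term with kernel k_Q plus the functions
    T(f 1_(alpha P)) for P in a family of stopping cubes covering at most half of Q.  Iterating
    from a partition of X into cubes Q whose dilates contain the support of f gives the sparse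
    family.

    For the last part, cubes of generations that are multiples of M are colored so that cubes of the
    same color are far apart; clustering around the cubes of a given color produces a dyadic system
    in which each of them absorbs its dilate, and the sparse family is transported there. *)
From HB Require Import structures.
Require Import Defs.
From mathcomp Require Import all_boot all_order all_algebra.
From mathcomp Require Import all_classical all_reals all_analysis.
From mathcomp Require Import measurable_realfun ess_sup_inf.
From mathcomp Require Import ring lra zify.

Set Implicit Arguments.
Unset Strict Implicit.
Unset Printing Implicit Defensive.
Import Order.TTheory GRing.Theory Num.Theory.
Import numFieldNormedType.Exports.

Local Open Scope classical_set_scope.
Local Open Scope ring_scope.

(** * Balls of a quasi-metric and the doubling property *)

Section QuasiMetricBalls.
Context {R : realType} {X : ptopologicalType}.
Variables (mu : {measure set (Borel X) -> \bar R}) (d : X -> X -> R).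
Variables (cd cmu : R) (hX : homogeneous_type mu d cd cmu).
Let hq := ht_quasimetric hX.

(** The kernel is not given as locally integrable off the diagonal, and its action is prescribed on
    [Cc] only. Integrability is extracted from both Hörmander conditions together, one moving x and
    the other y, and the formula for [Ts] reaches bounded functions by an L^1 approximation with
    weights. A bound for T(g 1_(alpha Q - alpha P)) is first known on a part of P only; the
    oscillation estimate from H_r spreads it over P, which takes the place of a truncated maximal
    operator. The set of averages may be unbounded, so there is no John ellipsoid. Elimination is
    performed on sets stable under t v for |t| <= 1 and under (v + w)/4, at the price of a factor 2
    8^n. Where the set contains a line, the coefficient of T f is unbounded in x; its integer part
    selects one of countably many test functions, which keeps the kernel jointly measurable. In the
    bound on alpha, 3 c_d^2 is the radius from which H_r applies with room for the supports of
    continuous approximants; the further 1/delta pays for the passage from a top cube to its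
    parent. *)

Lemma cd_ge1 : 1 <= cd. Proof. exact: qm_cst hq. Qed.
Lemma cd_gt0 : 0 < cd. Proof. exact: lt_le_trans cd_ge1. Qed.
Lemma qd_ge0 x y : 0 <= d x y. Proof. exact: qm_ge0 hq _ _. Qed.
Lemma qd_sym x y : d x y = d y x. Proof. exact: qm_sym hq _ _. Qed.
Lemma qdxx x : d x x = 0. Proof. exact/(qm_eq0 hq). Qed.
Lemma qd_tri z x y : d x y <= cd * (d x z + d z y).
Proof. exact: qm_triangle hq _ _ _. Qed.

Lemma qball_center x rho : 0 < rho -> qball d x rho x.
Proof. by rewrite /qball/= qdxx. Qed.

Lemma qball_sub x y r s : cd * (d y x + r) <= s ->
  qball d x r `<=` qball d y s.
Proof.
move=> h z; rewrite /qball/= => xz; apply: le_lt_trans (qd_tri x y z) _.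
by apply: lt_le_trans h; rewrite ltr_pM2l ?cd_gt0// ltrD2l.
Qed.

Lemma qball_le x r s : r <= s -> qball d x r `<=` qball d x s.
Proof. by move=> rs z; rewrite /qball/= => /lt_le_trans; apply. Qed.

Lemma qball_le0 x r : r <= 0 -> qball d x r = set0.
Proof.
move=> r0; rewrite -subset0 => z; rewrite /qball/= => /lt_le_trans/(_ r0).
by rewrite ltNge qd_ge0.
Qed.

Lemma qball_measurable x r : measurable (qball d x r : set (Borel X)).
Proof.
have [r0|r0] := ltP 0 r; first exact: (ht_ball_measurable hX).
by rewrite qball_le0.
Qed.

Lemma qball_fin x r : (mu (qball d x r) < +oo)%E.
Proof.
have [r0|r0] := ltP 0 r; first exact: (ht_ball_fin hX).
by rewrite qball_le0// measure0.
Qed.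

Lemma qball_gt0 x r : 0 < r -> (0 < mu (qball d x r))%E.
Proof. exact: (ht_ball_gt0 hX). Qed.

Lemma le_qball (A : set (Borel X)) x r : measurable A -> A `<=` qball d x r ->
  (mu A <= mu (qball d x r))%E.
Proof. by move=> mA; apply: le_measure; rewrite inE//; exact: qball_measurable. Qed.

Lemma cmu_ge1 : 1 <= cmu.
Proof.
have := ht_doubling hX point ltr01.
rewrite mulr1 -lee_fin => h; rewrite leNgt; apply/negP; rewrite lte_fin => c1.
have : (mu (qball d point 1) <= mu (qball d point 2))%E.
  by apply: le_qball; [exact: qball_measurable|apply: qball_le; lra].
move=> /le_trans/(_ h); have m0 := qball_gt0 point ltr01.
have mf : mu (qball d point 1) \is a fin_num.
  by rewrite ge0_fin_numE// qball_fin.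
rewrite -(fineK mf) -EFinM lee_fin leNgt; move/negP; apply.
rewrite -[ltRHS]mul1r ltr_pM2r// -lte_fin fineK//.
Qed.

Lemma doubling_iter n x rho : 0 < rho ->
  (mu (qball d x (2 ^+ n * rho)) <= (cmu ^+ n)%:E * mu (qball d x rho))%E.
Proof.
move=> r0; elim: n => [|n ih]; first by rewrite !expr0 mul1r mul1e.
rewrite exprS -mulrA; apply: le_trans (ht_doubling hX _ _) _.
  by rewrite mulr_gt0// exprn_gt0.
by rewrite exprS EFinM -muleA lee_pmul2l ?lte_fin// (lt_le_trans ltr01 cmu_ge1).
Qed.

(** Since [A < 2 ^+ Num.bound A], that many doublings cover a dilation by [A]. The exponent is
    crude, but constants built from it depend on the geometry only. *)
Definition dblc (A : R) : R := cmu ^+ Num.bound A.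

Lemma dblc_ge1 A : 1 <= dblc A.
Proof. by rewrite /dblc exprn_ege1// cmu_ge1. Qed.

Lemma dblc_gt0 A : 0 < dblc A.
Proof. exact: lt_le_trans (dblc_ge1 A). Qed.

Lemma doubling A x rho : 0 < rho ->
  (mu (qball d x (A * rho)) <= (dblc A)%:E * mu (qball d x rho))%E.
Proof.
move=> r0; apply: le_trans (doubling_iter (Num.bound A) x r0).
apply: le_qball; first exact: qball_measurable.
by apply: qball_le; rewrite ler_pM2r// ltW// upper_nthrootP.
Qed.

Lemma doubling_center A a x y rho : 0 < rho -> d y x <= a * rho ->
  (mu (qball d x (A * rho)) <=
   (dblc (cd * (a + A)))%:E * mu (qball d y rho))%E.
Proof.
move=> r0 dxy; apply: le_trans (doubling _ _ r0).
apply: le_qball; first exact: qball_measurable.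
by apply: qball_sub; rewrite -mulrA ler_pM2l ?cd_gt0// mulrDl lerD2r.
Qed.

Lemma bigcup_qball x : \bigcup_n qball d x n%:R = setT.
Proof.
rewrite -subTset => y _; exists (Num.bound (d x y)) => //.
by rewrite /qball/= archi_boundP// qd_ge0.
Qed.

Lemma mu_sigma_finite : sigma_finite setT mu.
Proof.
exists (fun n => qball d point n%:R); first by rewrite bigcup_qball.
by move=> n; split; [exact: qball_measurable|exact: qball_fin].
Qed.

Lemma muT_gt0 : (0 < mu setT)%E.
Proof.
apply: lt_le_trans (qball_gt0 point ltr01) _.
by apply: le_measure; rewrite ?inE//; exact: qball_measurable.
Qed.

End QuasiMetricBalls.

Section IntPowers.
Context {R : realType} (delta : R).
Hypothesis hdelta : 0 < delta < 1.
Let d0 : 0 < delta. Proof. by case/andP: hdelta. Qed.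
Let d1 : delta < 1. Proof. by case/andP: hdelta. Qed.

Lemma dpow_gt0 (k : int) : 0 < delta ^ k. Proof. exact: exprz_gt0. Qed.

Lemma dpowD (k l : int) : delta ^ (k + l) = delta ^ k * delta ^ l.
Proof. by rewrite expfzDr// gt_eqF. Qed.

Lemma dpow_le (k l : int) : k <= l -> delta ^ l <= delta ^ k.
Proof.
move=> kl; rewrite -(subrK k l) dpowD ler_piMl ?(ltW (dpow_gt0 _))//.
have : 0 <= l - k by rewrite subr_ge0.
case: (l - k) => // n _; apply: exprn_ile1; exact: ltW.
Qed.

Lemma dpow_small (e : R) : 0 < e -> exists n : nat, delta ^+ n < e.
Proof.
move=> e0; have /cvgr0_norm_lt/(_ _ e0)[N _ h] : delta ^+ n @[n --> \oo] --> 0.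
  by apply: cvg_expr; rewrite gtr0_norm.
by exists N; have := h N (leqnn _); rewrite /= gtr0_norm// exprn_gt0.
Qed.

Lemma dpow_small_from (k : int) (e : R) : 0 < e ->
  exists l : int, k <= l /\ delta ^ l < e.
Proof.
move=> e0; have [n hn] := dpow_small (divr_gt0 e0 (dpow_gt0 k)).
exists (k + n%:Z); split; first by rewrite lerDl.
by rewrite dpowD mulrC -exprnP -ltr_pdivlMr// dpow_gt0.
Qed.

Lemma dpow_large_to (k : int) (e : R) :
  exists l : int, l <= k /\ e < delta ^ l.
Proof.
have [n hn] := dpow_small (divr_gt0 (dpow_gt0 k) (ltr_pwDl ltr01 (normr_ge0 e))).
exists (k - n%:Z); split; first by rewrite gerBl.
rewrite dpowD -invr_expz -exprnP.
have h : `|e| < 1 + `|e| by rewrite ltrDr.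
apply: le_lt_trans (ler_norm _) _; apply: lt_trans h _.
by move: hn; rewrite ltr_pdivlMr ?ltr_pwDl// => hn; rewrite ltr_pdivlMr ?exprn_gt0// mulrC.
Qed.
End IntPowers.

(** * Dyadic cubes *)

Section DyadicCubes.
Context {R : realType} {X : ptopologicalType}.
Variables (mu : {measure set (Borel X) -> \bar R}) (d : X -> X -> R).
Variables (cd cmu : R) (hX : homogeneous_type mu d cd cmu).
Variables (c0 C0 delta : R) (hc0 : 0 < c0 <= C0) (hdelta : 0 < delta < 1).
Variables (D : set (cube X)) (hD : dyadic_system d c0 C0 delta D).

Lemma c0_gt0 : 0 < c0. Proof. by case/andP: hc0. Qed.
Lemma C0_gt0 : 0 < C0. Proof. by case/andP: hc0 => /lt_le_trans; apply. Qed.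

Definition cub (k : int) (x : X) : cube X := sval (cid (ds_cover hD k x)).

Lemma cubP k x : [/\ D (cub k x), generation (cub k x) = k &
  carrier (cub k x) x].
Proof. exact: svalP (cid (ds_cover hD k x)). Qed.
Lemma cub_D k x : D (cub k x). Proof. by case: (cubP k x). Qed.
Lemma gen_cub k x : generation (cub k x) = k. Proof. by case: (cubP k x). Qed.
Lemma cub_in k x : carrier (cub k x) x. Proof. by case: (cubP k x). Qed.

Lemma cube_eq P Q x : D P -> D Q -> generation P = generation Q ->
  carrier P x -> carrier Q x -> P = Q.
Proof.
move=> DP DQ g Px Qx; apply: contrapT => PQ.
have := ds_disjoint hD DP DQ g PQ; rewrite -subset0 => /(_ x); exact.
Qed.

Lemma cub_uniq Q x : D Q -> carrier Q x -> Q = cub (generation Q) x.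
Proof.
by move=> DQ Qx; apply: (cube_eq (x := x)) => //;
  rewrite ?gen_cub//; [exact: cub_D|exact: cub_in].
Qed.

Lemma cube_nested P Q x : D P -> D Q -> generation Q <= generation P ->
  carrier P x -> carrier Q x -> carrier P `<=` carrier Q.
Proof.
move=> DP DQ g Px Qx; have [|//] := ds_nested hD DP DQ g.
by rewrite -subset0 => /(_ x) []; split.
Qed.

Lemma cube_measurable Q : D Q -> measurable (carrier Q).
Proof. exact: (ds_measurable hD). Qed.

Lemma cube_inner Q : D Q ->
  qball d (cube_center Q) (c0 * delta ^ generation Q) `<=` carrier Q.
Proof. exact: (ds_inner hD). Qed.

Lemma cube_outer Q x : D Q -> carrier Q x ->
  d (cube_center Q) x < C0 * delta ^ generation Q.
Proof. by move=> DQ; exact: (ds_outer hD DQ). Qed.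

Lemma cube_outer2 Q x y : D Q -> carrier Q x -> carrier Q y ->
  d x y < 2 * cd * C0 * delta ^ generation Q.
Proof.
move=> DQ Qx Qy; apply: le_lt_trans (qd_tri hX (cube_center Q) x y) _.
have := cube_outer DQ Qx; have := cube_outer DQ Qy.
rewrite (qd_sym hX x); have := cd_gt0 hX.
set a := d _ y; set b := d _ x; set c := C0 * _ => cd0 h1 h2.
have -> : 2 * cd * C0 * delta ^ generation Q = cd * (c + c).
  by rewrite -mulrA -/c; lra.
by rewrite ltr_pM2l// ltrD.
Qed.

Lemma center_in Q : D Q -> carrier Q (cube_center Q).
Proof.
move=> DQ; apply: (cube_inner DQ); apply: (qball_center hX).
by rewrite mulr_gt0 ?c0_gt0// dpow_gt0.
Qed.

Lemma cube_mu_gt0 Q : D Q -> (0 < mu (carrier Q))%E.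
Proof.
move=> DQ; have r0 : 0 < c0 * delta ^ generation Q.
  by rewrite mulr_gt0 ?c0_gt0// dpow_gt0.
apply: lt_le_trans (qball_gt0 hX (cube_center Q) r0) _.
apply: le_measure; rewrite ?inE; first exact: (qball_measurable hX).
  exact: cube_measurable.
exact: cube_inner.
Qed.

Lemma cube_mu_fin Q : D Q -> (mu (carrier Q) < +oo)%E.
Proof.
move=> DQ; apply: le_lt_trans (qball_fin hX (cube_center Q) (C0 * delta ^ generation Q)).
by apply: (le_qball hX); [exact: cube_measurable|exact: (ds_outer hD)].
Qed.

Lemma cube_mu_fin_num Q : D Q -> mu (carrier Q) \is a fin_num.
Proof. by move=> DQ; rewrite ge0_fin_numE// cube_mu_fin. Qed.

(* The factor by which a ball of radius A delta^k is larger than a cube of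
   generation k whose center is within a delta^k of its own center. *)
Definition cubc (a A : R) : R := dblc cmu (cd * (a / c0 + A / c0)).

Lemma cubc_ge1 a A : 1 <= cubc a A. Proof. exact: (dblc_ge1 hX). Qed.
Lemma cubc_gt0 a A : 0 < cubc a A. Proof. exact: (dblc_gt0 hX). Qed.

Lemma ball_le_cube a A x Q : D Q ->
  d (cube_center Q) x <= a * delta ^ generation Q ->
  (mu (qball d x (A * delta ^ generation Q)) <=
   (cubc a A)%:E * mu (carrier Q))%E.
Proof.
move=> DQ h; set k := generation Q.
have r0 : 0 < c0 * delta ^ k by rewrite mulr_gt0 ?c0_gt0// dpow_gt0.
have -> : A * delta ^ k = (A / c0) * (c0 * delta ^ k).
  by rewrite mulrA divfK// gt_eqF// c0_gt0.
apply: (@le_trans _ _ ((cubc a A)%:E * mu (qball d (cube_center Q) (c0 * delta ^ k)))%E).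
  apply: (doubling_center hX) => //.
  by rewrite mulrA divfK// gt_eqF// c0_gt0.
rewrite lee_pmul2l// ?lte_fin ?cubc_gt0//.
apply: le_measure; rewrite ?inE; first exact: (qball_measurable hX).
  exact: cube_measurable.
exact: cube_inner.
Qed.

(** A volume count: the cubes are disjoint, lie in one ball [B], and each carries at least the
    fraction [1 / cubc] of its measure. Duplicate-free lists make the bound usable for the degrees
    of a conflict graph. *)
Lemma finite_cubes k x A (N : nat) : cubc A (cd * (A + C0)) < N%:R ->
  forall s : seq (cube X), uniq s ->
  (forall Q, Q \in s -> [/\ D Q, generation Q = k &
     d (cube_center Q) x <= A * delta ^ k]) -> (size s < N)%N.
Proof.
move=> hN s us hs; set B := qball d x (cd * (A + C0) * delta ^ k).
have sub Q : Q \in s -> carrier Q `<=` B.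
  move=> /hs[DQ gQ dQ]; apply: subset_trans (ds_outer hD DQ) _.
  rewrite gQ; apply: (qball_sub hX).
  rewrite -mulrA ler_pM2l ?(cd_gt0 hX)// mulrDl lerD2r.
  by rewrite (qd_sym hX).
have mc Q : Q \in s -> measurable (carrier Q) by move=> /hs[DQ _ _]; exact: cube_measurable.
have tri : trivIset [set` s] (fun Q => carrier Q).
  apply/trivIsetP => P Q /= /hs[DP gP _] /hs[DQ gQ _] /eqP PQ.
  by apply: (ds_disjoint hD) => //; rewrite gP gQ.
have le1 : (\sum_(Q <- s) mu (carrier Q) <= mu B)%E.
  have -> : (\sum_(Q <- s) mu (carrier Q) = mu (\big[setU/set0]_(Q <- s) carrier Q))%E.
    clear -us tri mc; elim: s us tri mc => [|Q s ih]; first by rewrite !big_nil measure0.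
    move=> /= /andP[Qs us] tri mc; rewrite !big_cons measureU//.
    - rewrite ih//.
        by apply: sub_trivIset tri => P /= Ps; rewrite inE Ps orbT.
      by move=> P Ps; apply: mc; rewrite inE Ps orbT.
    - by apply: mc; rewrite inE eqxx.
    - rewrite big_seq; apply: bigsetU_measurable => P Ps.
      by apply: mc; rewrite inE Ps orbT.
    - rewrite -subset0 => y [Qy]; rewrite -bigcup_seq => -[P /= Ps Py].
      move/trivIsetP : tri => /(_ Q P); rewrite /= !inE eqxx Ps orbT.
      move=> /(_ isT isT); have QP : Q != P by apply: contraNneq Qs => ->.
      by move=> /(_ QP); rewrite -subset0 => /(_ y); apply.
  apply: le_measure; rewrite ?inE.
  - rewrite big_seq; apply: bigsetU_measurable => P; exact: mc.
  - exact: (qball_measurable hX).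
  - by rewrite -bigcup_seq => y [P /= /sub]; exact.
have Bf : mu B \is a fin_num by rewrite ge0_fin_numE// (qball_fin hX).
have [->//|s0] := eqVneq s [::]; first by rewrite -(ltr_nat R) (lt_trans _ hN)// cubc_gt0.
have [Q0 Q0s] : exists Q, Q \in s by case: (s) s0 => // Q s' _; exists Q; rewrite inE eqxx.
have c1 Q : Q \in s -> ((fine (mu B) / cubc A (cd * (A + C0)))%:E <= mu (carrier Q))%E.
  move=> Qs; have [DQ gQ dQ] := hs _ Qs.
  rewrite EFinM fineK// muleC lee_pdivrMl ?cubc_gt0// /B -gQ.
  by apply: ball_le_cube => //; rewrite gQ.
have B0 : 0 < fine (mu B).
  rewrite -lte_fin fineK//; have [DQ _ _] := hs _ Q0s.
  apply: lt_le_trans (cube_mu_gt0 DQ) _; apply: (le_qball hX); last exact: sub.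
  exact: mc.
have : (\sum_(Q <- s) (fine (mu B) / cubc A (cd * (A + C0)))%:E <= mu B)%E.
  apply: le_trans le1; rewrite big_seq [leRHS]big_seq.
  by apply: lee_sum => Q /c1.
rewrite sumEFin big_const_seq count_predT iter_addr_0 -{2}(fineK Bf) lee_fin.
rewrite -mulr_natl mulrCA -[leRHS]mulr1 ler_pM2l// ler_pdivrMr ?cubc_gt0// mul1r => h.
by rewrite -(ltr_nat R) (le_lt_trans h).
Qed.

Lemma finite_near_cubes k x A :
  finite_set [set Q | [/\ D Q, generation Q = k &
     d (cube_center Q) x <= A * delta ^ k]].
Proof.
apply: contrapT => /infinite_set_fset.
set N := Num.bound (cubc A (cd * (A + C0))).
move=> /(_ N)[B hB]; rewrite leqNgt => /negP; apply.
apply: (@finite_cubes k x A) => //.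
- by rewrite archi_boundP// ltW// cubc_gt0.
Qed.

(** In each generation only finitely many centers lie at bounded distance from a base point, so [D]
    is a countable union of finite sets. *)
Lemma countable_D : countable D.
Proof.
have -> : D = \bigcup_(kn in [set: int * nat])
    [set Q | [/\ D Q, generation Q = kn.1 &
       d (cube_center Q) point <= kn.2%:R * delta ^ kn.1]].
  apply/seteqP; split => [Q DQ|Q [kn _] []//].
  exists (generation Q, Num.bound (d (cube_center Q) point / delta ^ generation Q)) => //=.
  split => //; rewrite -ler_pdivrMr ?dpow_gt0// ltW// archi_boundP// divr_ge0//.
    exact: (qd_ge0 hX).
  by rewrite ltW// dpow_gt0.
apply: bigcup_countable => // -[k n] _; apply: finite_set_countable.
exact: finite_near_cubes.
Qed.

End DyadicCubes.

(** * Countable disjoint families of cubes *)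

Section DisjointFamilies.
Context {R : realType} {X : ptopologicalType}.
Variables (mu : {measure set (Borel X) -> \bar R}).
Implicit Types (M : set (cube X)) (G : cube X -> set (Borel X)).

Definition disjoint_family M := forall P Q, M P -> M Q -> P <> Q ->
  carrier P `&` carrier Q = set0.

Definition famU M G : set (Borel X) := \bigcup_(Q in M) G Q.

Lemma famU_measurable M G : countable M -> (forall Q, M Q -> measurable (G Q)) ->
  measurable (famU M G).
Proof.
move=> cM mG; rewrite /famU bigcup_mkcond.
have [->|/set0P[Q0 MQ0]] := eqVneq M set0.
  by rewrite bigcup0// => Q _; rewrite in_set0.
have [f /= hf] := countable_injP _ cM.
have -> : \bigcup_Q (if Q \in M then G Q else set0) =
  \bigcup_n \bigcup_(Q in [set Q | M Q /\ f Q = n]) G Q.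
  apply/seteqP; split => [y [Q _]|y [n _ [Q [MQ _] Gy]]].
    by case: ifPn => // /set_mem MQ Gy; exists (f Q) => //; exists Q.
  by exists Q => //; rewrite mem_set.
apply: bigcup_measurable => n _.
have [[Q [MQ fQ]]|h] := pselect (exists Q, M Q /\ f Q = n).
  rewrite (_ : [set Q | _] = [set Q]); first by rewrite bigcup_set1; exact: mG.
  apply/seteqP; split => [P [MP fP]|P ->//].
  by apply: hf; rewrite ?inE// fP.
by rewrite (_ : [set Q | _] = set0) ?bigcup_set0// -subset0 => Q hQ; apply: h; exists Q.
Qed.

Lemma famU_enum M G : countable M -> (forall Q, M Q -> measurable (G Q)) ->
  exists F : nat -> set (Borel X), exists c : nat -> option (cube X),
  [/\ famU M G = \bigcup_n F n, forall n, measurable (F n),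
      forall n Q, c n = Some Q -> M Q /\ F n = G Q,
      forall n, c n = None -> F n = set0 &
      forall n m Q, c n = Some Q -> c m = Some Q -> n = m].
Proof.
move=> cM mG; have [f /= hf] := countable_injP _ cM.
pose c n := if pselect (exists Q, M Q /\ f Q = n) is left h
            then Some (sval (cid h)) else None.
have cS n Q : c n = Some Q -> M Q /\ f Q = n.
  by rewrite /c; case: pselect => // h [<-]; exact: svalP (cid h).
exists (fun n => if c n is Some Q then G Q else set0), c; split.
- apply/seteqP; split => [y [Q MQ Gy]|y [n _]]; last first.
    by case E : (c n) => [Q|//] Gy; have [MQ _] := cS _ _ E; exists Q.
  exists (f Q) => //; have h : exists P, M P /\ f P = f Q by exists Q.
  case E : (c (f Q)) => [P|].
    by have [MP fP] := cS _ _ E; rewrite (hf P Q)// inE.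
  by move: E; rewrite /c; case: pselect.
- move=> n; case E : (c n) => [Q|//]; apply: mG; exact: (cS _ _ E).1.
- by move=> n Q E; rewrite E; split=> //; exact: (cS _ _ E).1.
- by move=> n ->.
- by move=> n m Q /cS[_ <-] /cS[_ <-].
Qed.

Lemma fam_le_integral M (f g : Borel X -> \bar R) : countable M ->
  (forall Q, M Q -> measurable (carrier Q)) -> disjoint_family M ->
  measurable_fun setT f -> measurable_fun setT g ->
  (forall x, 0 <= f x)%E -> (forall x, 0 <= g x)%E ->
  (forall Q, M Q -> (\int[mu]_(x in carrier Q) f x <= \int[mu]_(x in carrier Q) g x)%E) ->
  (\int[mu]_(x in famU M carrier) f x <= \int[mu]_(x in famU M carrier) g x)%E.
Proof.
move=> cM mM dM mf mg f0 g0 h.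
have [F [c [-> mF cS cN cinj]]] := famU_enum cM mM.
have tF : trivIset setT F.
  apply/trivIsetP => n m _ _ nm; case En : (c n) => [P|]; last by rewrite cN// set0I.
  case Em : (c m) => [Q|]; last by rewrite (cN m)// setI0.
  have [MP ->] := cS _ _ En; have [MQ ->] := cS _ _ Em.
  apply: dM => // PQ; move/eqP : nm; apply; apply: cinj Em.
  by rewrite En PQ.
have mF' : measurable (\bigcup_n F n) by exact: bigcupT_measurable.
rewrite !ge0_integral_bigcup//; try exact: measurable_funS mf; try exact: measurable_funS mg.
apply: lee_nneseries => [n _ _|n _].
  by apply: integral_ge0.
case En : (c n) => [P|]; last by rewrite cN// !integral_set0.
by have [MP ->] := cS _ _ En; exact: h.
Qed.

(** The sets [G Q] may overlap: subadditivity serves for them and additivity for the cubes alone.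
    This controls unions of enlarged cubes. *)
Lemma fam_le_measure M G (C : R) : 0 <= C -> countable M ->
  (forall Q, M Q -> measurable (carrier Q)) -> disjoint_family M ->
  (forall Q, M Q -> measurable (G Q)) ->
  (forall Q, M Q -> (mu (G Q) <= C%:E * mu (carrier Q))%E) ->
  (mu (famU M G) <= C%:E * mu (famU M carrier))%E.
Proof.
move=> C0 cM mM dM mG h; have [f /= hf] := countable_injP _ cM.
pose F (H : cube X -> set (Borel X)) n : set (Borel X) :=
  \bigcup_(Q in [set Q | M Q /\ f Q = n]) H Q.
have FE H n Q : M Q -> f Q = n -> F H n = H Q.
  move=> MQ fQ; rewrite /F (_ : [set Q | _] = [set Q]) ?bigcup_set1//.
  apply/seteqP; split => [P [MP fP]|P ->//].
  by apply: hf; rewrite ?inE// fP.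
have F0 H n : ~ (exists Q, M Q /\ f Q = n) -> F H n = set0.
  move=> nh; rewrite /F (_ : [set Q | _] = set0) ?bigcup_set0// -subset0 => Q hQ.
  by apply: nh; exists Q.
have UF H : famU M H = \bigcup_n F H n.
  apply/seteqP; split => [y [Q MQ Hy]|y [n _ [Q [MQ _] Hy]]]; last by exists Q.
  by exists (f Q) => //; exists Q.
have mF H : (forall Q, M Q -> measurable (H Q)) -> forall n, measurable (F H n).
  move=> mH n; have [[Q [MQ fQ]]|nh] := pselect (exists Q, M Q /\ f Q = n).
    by rewrite (FE _ _ _ MQ fQ); exact: mH.
  by rewrite F0.
have tF : trivIset setT (F carrier).
  apply/trivIsetP => n m _ _ /eqP nm.
  have [[Q [MQ fQ]]|nh] := pselect (exists Q, M Q /\ f Q = n); last by rewrite F0// set0I.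
  have [[P [MP fP]]|nh] := pselect (exists Q, M Q /\ f Q = m); last by rewrite (F0 _ m)// setI0.
  rewrite (FE _ _ _ MQ fQ) (FE _ _ _ MP fP); apply: dM => // QP.
  by apply: nm; rewrite -fQ -fP QP.
rewrite !UF; apply: le_trans (measure_sigma_subadditive mu (mF _ mG) _ (@subset_refl _ _)) _.
  by apply: bigcupT_measurable; exact: mF.
rewrite measure_bigcup//; last by move=> n _; exact: mF.
rewrite -nneseriesZl//.
under [leRHS]eq_eseriesl do rewrite in_setT.
apply: lee_nneseries => [n _ _|n _]; first exact: measure_ge0.
have [[Q [MQ fQ]]|nh] := pselect (exists Q, M Q /\ f Q = n).
  by rewrite !(FE _ _ _ MQ fQ); exact: h.
by rewrite !F0// measure0 mule0.
Qed.

(** Integrability of [u] over the union makes the series of integrals absolutely convergent; it is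
    then split into its positive and negative parts and estimated term by term. *)
Lemma fam_abs_integral M (u : Borel X -> R) (v : Borel X -> \bar R) : countable M ->
  (forall Q, M Q -> measurable (carrier Q)) -> disjoint_family M ->
  mu.-integrable (famU M carrier) (EFin \o u) -> measurable_fun setT v ->
  (forall x, 0 <= v x)%E ->
  (forall Q, M Q -> (`|\int[mu]_(x in carrier Q) (u x)%:E| <= \int[mu]_(x in carrier Q) v x)%E) ->
  (`|\int[mu]_(x in famU M carrier) (u x)%:E| <= \int[mu]_(x in famU M carrier) v x)%E.
Proof.
move=> cM mM dM; have [F [c [-> mF cS cN cinj]]] := famU_enum cM mM.
have tF : trivIset setT F.
  apply/trivIsetP => n m _ _ nm; case En : (c n) => [P|]; last by rewrite cN// set0I.
  case Em : (c m) => [Q|]; last by rewrite (cN m)// setI0.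
  have [MP ->] := cS _ _ En; have [MQ ->] := cS _ _ Em.
  apply: dM => // PQ; move/eqP : nm; apply; apply: cinj Em.
  by rewrite En PQ.
have mF' : measurable (\bigcup_n F n) by exact: bigcupT_measurable.
move=> iu mv v0 h.
have su := integrable_summable tF mF iu.
rewrite integral_bigcup// [leRHS]ge0_integral_bigcup//; last exact: measurable_funS mv.
have {}su : summable (fun i : nat => is_true (xpredT i))
    (fun i => (\int[mu]_(x in F i) (EFin \o u) x)%E).
  by rewrite (_ : (fun i : nat => _) = setT)//; apply/seteqP; split.
rewrite (summable_eseries su).
pose a (i : nat) := (\int[mu]_(x in F i) (EFin \o u) x)%E.
rewrite -/a; apply: le_trans (lee_abs_sub _ _) _.
have a0 n : (0 <= a^\+ n)%E by exact: funepos_ge0.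
have b0 n : (0 <= a^\- n)%E by exact: funeneg_ge0.
rewrite !gee0_abs ?nneseries_ge0// -nneseriesD//.
apply: lee_nneseries => [n _ _|n _]; first exact: adde_ge0.
have -> : (a^\+ n + a^\- n)%E = `|a n|%E.
  by rewrite -[RHS]/((abse \o a) n) fune_abse.
rewrite /a.
case En : (c n) => [P|]; last by rewrite cN// !integral_set0 abse0.
by have [MP ->] := cS _ _ En; exact: h.
Qed.

End DisjointFamilies.

(** * Dyadic density and maximal cubes *)

Section DensityMaximal.
Context {R : realType} {X : ptopologicalType}.
Variables (mu : {measure set (Borel X) -> \bar R}) (d : X -> X -> R).
Variables (cd cmu : R) (hX : homogeneous_type mu d cd cmu).
Variables (c0 C0 delta : R) (hc0 : 0 < c0 <= C0) (hdelta : 0 < delta < 1).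
Variables (D : set (cube X)) (hD : dyadic_system d c0 C0 delta D).
Local Notation cub := (cub hD).

Lemma cube_sub_qball x l : carrier (cub l x) `<=` qball d x (2 * cd * C0 * delta ^ l).
Proof.
move=> y Qy; have := cube_outer2 hX hD (cub_D hD l x) (cub_in hD l x) Qy.
by rewrite gen_cub.
Qed.

Lemma qball_le_cub A x l : (mu (qball d x (A * delta ^ l)) <=
   (cubc cd cmu c0 C0 A)%:E * mu (carrier (cub l x)))%E.
Proof.
have := @ball_le_cube _ _ _ _ _ _ hX _ _ _ hc0 hdelta _ hD C0 A x _ (cub_D hD l x).
rewrite gen_cub; apply; have := cube_outer hD (cub_D hD l x) (cub_in hD l x).
by rewrite gen_cub => /ltW.
Qed.

(** Differentiation of [\1_Om] along balls gives small balls about x where the complement of [Om]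
    has proportion below [e / C]. The cube at x of the matching generation lies in such a ball,
    whose measure is at most [C] times that of the cube. *)
Lemma dyadic_density (Om : set (Borel X)) (e : R) : measurable Om -> 0 < e ->
  {ae mu, forall x, Om x -> forall k0 : int, exists2 l : int, k0 <= l &
     (mu (carrier (cub l x) `\` Om) < e%:E * mu (carrier (cub l x)))%E}.
Proof.
move=> mOm e0.
have mI : measurable_fun setT (\1_Om : Borel X -> R) by exact: measurable_indic.
have := ht_differentiation hX mI; have Bint x rho : 0 < rho ->
    mu.-integrable (qball d x rho) (EFin \o (\1_Om : Borel X -> R)).
  move=> r0; apply: measurable_bounded_integrable => //.
  - exact: (qball_measurable hX).
  - exact: (qball_fin hX).
  - exists 1; split; first exact: num_real.
    move=> M M1 y _ /=; rewrite indicE ger0_norm ?ler0n//.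
    by apply: le_trans (ltW M1); case: (_ \in _).
move=> /(_ Bint); apply: (@filterS _ _ (ae_filter_ringOfSetsType mu)) => x + Omx k0.
rewrite indicE mem_set//= => cx.
pose C := cubc cd cmu c0 C0 (2 * cd * C0).
have C0' : 0 < C by exact: (cubc_gt0 hX).
have eC : 0 < e / C by rewrite divr_gt0.
move/cvgrPdist_lt : cx => /(_ _ eC); rewrite near_withinE.
move=> [rho0 /= rho00 hrho].
have r1 : 0 < rho0 / (2 * cd * C0).
  by rewrite divr_gt0// !mulr_gt0// ?(cd_gt0 hX)// (C0_gt0 hc0).
have [l [k0l hl]] := dpow_small_from hdelta k0 r1.
exists l => //; set rho := 2 * cd * C0 * delta ^ l.
have rho_gt0 : 0 < rho.
  by rewrite !mulr_gt0// ?(cd_gt0 hX)// ?(C0_gt0 hc0)// dpow_gt0.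
have rho_lt : rho < rho0.
  by rewrite /rho mulrC -ltr_pdivlMr// !mulr_gt0// ?(cd_gt0 hX)// (C0_gt0 hc0).
have := hrho rho; rewrite /ball/= sub0r normrN gtr0_norm// => /(_ rho_lt rho_gt0).
set B := qball d x rho.
have Bf : mu B \is a fin_num by rewrite ge0_fin_numE// (qball_fin hX).
have mB : measurable (B : set (Borel X)) by exact: (qball_measurable hX).
have B0 : 0 < fine (mu B) by rewrite -lte_fin fineK// (qball_gt0 hX).
have BO : mu (B `&` Om) \is a fin_num.
  rewrite ge0_fin_numE//; apply: le_lt_trans (qball_fin hX x rho).
  apply: le_measure; rewrite ?inE//; exact: measurableI.
rewrite /Rintegral integral_indic// setIC => h.
have : (mu (B `\` Om) < (e / C)%:E * mu B)%E.
  rewrite -(fineK Bf) -EFinM.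
  have -> : mu (B `\` Om) = ((fine (mu B) - fine (mu (B `&` Om)))%:E)%E.
    rewrite measureD//; last by rewrite (qball_fin hX).
    by rewrite EFinB !fineK.
  rewrite lte_fin; move: h; rewrite ltr_norml => /andP[_].
  rewrite ltrBlDr => h; have : fine (mu B) * 1 < fine (mu B) * (e / C + (fine (mu B))^-1 * fine (mu (B `&` Om))).
    by rewrite ltr_pM2l.
  by rewrite mulr1 mulrDr mulVKf ?gt_eqF// [_ * (e / C)]mulrC; lra.
move=> h2; apply: le_lt_trans (_ : _ <= mu (B `\` Om))%E _.
  apply: le_measure; rewrite ?inE; [apply: measurableD => //|exact: measurableD|].
    exact: (cube_measurable hD (cub_D _ _ _)).
  by apply: setSD; exact: cube_sub_qball.
apply: lt_le_trans h2 _.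
have -> : (e%:E = (e / C)%:E * C%:E)%E by rewrite -EFinM divfK// gt_eqF.
by rewrite -muleA lee_pmul2l// qball_le_cub.
Qed.

(** The lower bound [k] on generations makes maximal cubes exist, since finitely many generations
    separate [k] from that of a bad cube. Maximality compares generations as well as sets because
    one set can be a cube of several generations. *)
Definition maxcubes (k : int) (bad : cube X -> Prop) : set (cube X) :=
  [set Q | [/\ D Q, k < generation Q, bad Q &
    forall P, D P -> k < generation P < generation Q ->
      carrier Q `<=` carrier P -> ~ bad P]].

Lemma maxcubes_sub k bad : maxcubes k bad `<=` D. Proof. by move=> Q []. Qed.

Lemma maxcubes_disjoint k bad : disjoint_family (maxcubes k bad).
Proof.
move=> P Q hP hQ PQ; rewrite -subset0 => x [Px Qx].
wlog gPQ : P Q hP hQ PQ Px Qx / generation P <= generation Q.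
  move=> W; have [h|h] := leP (generation P) (generation Q); first exact: (W P Q).
  by apply: (W Q P) => //; [exact: nesym|exact: ltW].
have [DP kP bP _] := hP; have [DQ kQ bQ mQ] := hQ.
move: gPQ; rewrite le_eqVlt => /predU1P[e|lt].
  by apply: PQ; exact: (cube_eq hD DP DQ e Px Qx).
apply: (mQ P) => //; first by rewrite kP.
exact: (cube_nested hD DQ DP (ltW lt) Qx Px).
Qed.

Lemma maxcubes_countable k bad : countable (maxcubes k bad).
Proof.
apply: sub_countable (countable_D hX hc0 hdelta hD); apply: subset_card_le.
exact: maxcubes_sub.
Qed.

Lemma maxcubes_cover k bad Q : D Q -> k < generation Q -> bad Q ->
  exists2 P, maxcubes k bad P & carrier Q `<=` carrier P.
Proof.
move=> DQ kQ bQ.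
have [n hn] : exists n : nat, generation Q = k + n.+1%:Z.
  have : 0 <= generation Q - (k + 1) by rewrite subr_ge0 lezD1.
  case E : (generation Q - (k + 1)) => [n|//] _; exists n.
  by rewrite intS -E addrA addrCA subrr addr0.
elim/ltn_ind : n Q DQ kQ bQ hn => n ih Q DQ kQ bQ hn.
have [h|] := pselect (exists P, [/\ D P, k < generation P < generation Q,
    carrier Q `<=` carrier P & bad P]); last first.
  move=> nh; exists Q => //; split => // P DP gP QP bP.
  by apply: nh; exists P.
have [P [DP /andP[kP PQ] QP bP]] := h.
have [m hm] : exists m : nat, generation P = k + m.+1%:Z.
  have : 0 <= generation P - (k + 1) by rewrite subr_ge0 lezD1.
  case E : (generation P - (k + 1)) => [m|//] _; exists m.
  by rewrite intS -E addrA addrCA subrr addr0.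
have mn : (m < n)%N by move: PQ; rewrite hm hn ltrD2l ltz_nat ltnS.
have [P' hP' PP'] := ih m mn P DP kP bP hm.
by exists P' => //; exact: subset_trans PP'.
Qed.

(** The parent either has generation [k], where no cube is bad, or competes with [Q], and then
    maximality excludes it. Upper bounds on maximal cubes come from this. *)
Lemma maxcubes_parent k bad Q x : maxcubes k bad Q -> carrier Q x ->
  (forall P, D P -> generation P = k -> ~ bad P) ->
  ~ bad (cub (generation Q - 1) x).
Proof.
move=> [DQ kQ bQ mQ] Qx hk.
have : k <= generation Q - 1 by rewrite lerBrDr lezD1.
rewrite le_eqVlt => /predU1P[e|lt].
  by apply: hk; [exact: cub_D|rewrite gen_cub].
apply: mQ; first exact: cub_D.
  by rewrite gen_cub lt/= gtrBl.
apply: (cube_nested hD DQ (cub_D hD _ _) _ Qx (cub_in hD _ _)).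
by rewrite gen_cub gerBl.
Qed.

Lemma cub_le_cub (k : int) (n : nat) x :
  (mu (carrier (cub k x)) <= (cubc cd cmu c0 C0 (2 * cd * C0 / delta ^+ n))%:E *
     mu (carrier (cub (k + n%:Z) x)))%E.
Proof.
apply: le_trans (qball_le_cub _ _ _).
apply: (le_qball hX); first exact: (cube_measurable hD (cub_D _ _ _)).
have -> : 2 * cd * C0 / delta ^+ n * delta ^ (k + n%:Z) = 2 * cd * C0 * delta ^ k.
  rewrite (dpowD hdelta) -exprnP mulrAC -!mulrA divff ?mulr1//.
  by rewrite gt_eqF// exprn_gt0//; case/andP: hdelta.
exact: cube_sub_qball.
Qed.

End DensityMaximal.

(** * Adjacent dyadic systems *)

(** An index has fewer than [N] smaller neighbours, so one of [N] colours is still free when its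
    turn comes. *)
Lemma greedy_coloring (adj : rel nat) (N : nat) :
  (forall n s, uniq s -> (forall m, m \in s -> (m < n)%N && adj m n) -> (size s < N)%N) ->
  exists c : nat -> nat, (forall n, (c n < N)%N) /\
    forall m n, (m < n)%N -> adj m n -> c m <> c n.
Proof.
move=> h.
pose fresh n (s : seq nat) :=
  find (fun i => all (fun m => adj m n ==> (nth 0%N s m != i)) (iota 0 n)) (iota 0 N).
have freshP n s : (fresh n s < N)%N /\
    forall m, (m < n)%N -> adj m n -> nth 0%N s m != fresh n s.
  set P := fun i => all (fun m => adj m n ==> (nth 0%N s m != i)) (iota 0 n).
  have hP : has P (iota 0 N).
    apply: contrapT => /negP /hasPn nP.
    have := h n [seq m <- iota 0 n | adj m n].
    rewrite filter_uniq ?iota_uniq// => /(_ isT)/=.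
    have h1 m : m \in [seq m <- iota 0 n | adj m n] -> (m < n)%N && adj m n.
      by rewrite mem_filter mem_iota/= add0n => /andP[-> ->].
    move=> /(_ h1); rewrite ltnNge => /negP; apply.
    rewrite -(size_map (nth 0%N s)) -[leqLHS](size_iota 0 N).
    apply: uniq_leq_size; first exact: iota_uniq.
    move=> i iN; have := nP _ iN; rewrite -has_predC => /hasP[m mn /=].
    rewrite negb_imply negbK => /andP[am /eqP <-].
    by apply: map_f; rewrite mem_filter am.
  have fN : (fresh n s < N)%N by move: hP; rewrite has_find size_iota.
  split => // m mn am.
  have := nth_find 0%N hP; rewrite -/(fresh n s) nth_iota// add0n.
  by move=> /allP/(_ m); rewrite mem_iota/= add0n mn => /(_ isT)/implyP/(_ am).
(* The colour of [n] depends on all the previous ones, hence a recursion on the list of the first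
   [n] colours. *)
pose fix cl n := if n is n'.+1 then rcons (cl n') (fresh n' (cl n')) else [::].
have scl n : size (cl n) = n by elim: n => //= n ih; rewrite size_rcons ih.
pose c n := fresh n (cl n).
have clE n m : (m < n)%N -> nth 0%N (cl n) m = c m.
  elim: n => // n ih; rewrite ltnS leq_eqVlt /= nth_rcons scl.
  by move=> /orP[/eqP ->|mn]; [rewrite ltnn eqxx|rewrite mn ih].
exists c; split => [n|m n mn am]; first exact: (freshP n (cl n)).1.
by have /eqP := (freshP n (cl n)).2 m mn am; rewrite clE.
Qed.

(** The infinite pigeonhole principle along the indices that satisfy [P]. *)
Lemma infinitely_often_finite (T : Type) (F : set T) (g : nat -> T) (P : nat -> Prop) :
  finite_set F -> (forall n, F (g n)) -> (forall N, exists n, (N <= n)%N /\ P n) ->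
  exists w, forall N, exists n, [/\ (N <= n)%N, P n & g n = w].
Proof.
move=> fF Fg hP; apply: contrapT => nh.
have h w : exists N, forall n, (N <= n)%N -> P n -> g n <> w.
  apply: contrapT => nw; apply: nh; exists w => N; apply: contrapT => nN.
  by apply: nw; exists N => n Nn Pn gw; apply: nN; exists n.
have [b hb] := choice h.
have [N hN] : exists N, forall w, F w -> (b w <= N)%N.
  have /finite_fsetP[B BE] : finite_set (b @` F) by exact: finite_image.
  exists (\max_(i <- finmap.enum_fset B) i)%N => w Fw.
  apply: (@leq_bigmax_seq _ _ xpredT id) => //.
  have : (b @` F) (b w) by exists w.
  by rewrite BE.
have [n [Nn Pn]] := hP N.
by apply: (hb (g n) n _ Pn) => //; exact: leq_trans (hN _ (Fg n)) Nn.
Qed.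

Lemma NegzS_add1 n : Negz n.+1 + 1 = Negz n.
Proof. by rewrite !NegzE [in LHS]intS opprD addrAC addNr add0r. Qed.

Section AdjacentSystem.
Context {R : realType} {X : ptopologicalType}.
Variables (mu : {measure set (Borel X) -> \bar R}) (d : X -> X -> R).
Variables (cd cmu : R) (hX : homogeneous_type mu d cd cmu).
Variables (c0 C0 delta : R) (hc0 : 0 < c0 <= C0) (hdelta : 0 < delta < 1).
Variables (D : set (cube X)) (hD : dyadic_system d c0 C0 delta D).

(** Cubes of one generation with close centers are in conflict. The volume count bounds the degrees
    of this graph uniformly, so greedy colouring along an enumeration of [D] needs a number of
    colours that does not depend on the generation. *)
Lemma cube_coloring (A : R) : exists N, exists col : cube X -> nat,
  (forall Q, D Q -> (col Q < N)%N) /\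
  forall P Q, D P -> D Q -> generation P = generation Q -> col P = col Q ->
    d (cube_center P) (cube_center Q) <= A * delta ^ generation Q -> P = Q.
Proof.
have [f /= hf] := countable_injP _ (countable_D hX hc0 hdelta hD).
pose adjc P Q := [/\ D P, D Q, generation P = generation Q &
  d (cube_center P) (cube_center Q) <= A * delta ^ generation Q].
pose adj : rel nat := fun m n => `[< exists P Q, [/\ f P = m, f Q = n & adjc P Q] >].
pose N := Num.bound (cubc cd cmu c0 A (cd * (A + C0))).
have hN : cubc cd cmu c0 A (cd * (A + C0)) < N%:R.
  by rewrite archi_boundP// ltW// (cubc_gt0 hX).
have hadj n s : uniq s -> (forall m, m \in s -> (m < n)%N && adj m n) -> (size s < N)%N.
  move=> us hs; case: s us hs => [|m0 s0].
    move=> _ _; rewrite -(ltr_nat R); apply: lt_trans hN; exact: (cubc_gt0 hX).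
  set s := m0 :: s0 => us hs.
  have [Q [DQ fQ]] : exists Q, D Q /\ f Q = n.
    have /hs/andP[_ /asboolP[P [Q [_ fQ [_ DQ _ _]]]]] : m0 \in s by rewrite inE eqxx.
    by exists Q.
  have hm m : exists P, m \in s -> f P = m /\ adjc P Q.
    case ms : (m \in s); last by exists Q.
    have /hs/andP[_ /asboolP[P [Q' [fP fQ' aPQ]]]] := ms.
    exists P => _; split => //; rewrite (_ : Q = Q')//.
    by apply: hf; rewrite ?inE// ?fQ//; case: aPQ.
  have [p hp] := choice hm.
  rewrite -(size_map p); apply: (finite_cubes hX hc0 hdelta hD (k := generation Q)
    (x := cube_center Q) hN).
    rewrite map_inj_in_uniq// => m m' ms m's pmm'.
    by rewrite -(hp m ms).1 -(hp m' m's).1 pmm'.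
  by move=> P /mapP[m ms ->]; have [_ []] := hp m ms.
have [c [cN hc]] := greedy_coloring hadj.
exists N, (c \o f); split=> [Q _|P Q DP DQ gPQ /= cPQ dPQ]; first exact: cN.
have aPQ : adj (f P) (f Q) by apply/asboolP; exists P, Q; split.
have aQP : adj (f Q) (f P).
  by apply/asboolP; exists Q, P; split => //; split => //; rewrite (qd_sym hX) gPQ.
have [/hc/(_ aPQ)//|/hc/(_ aQP)/nesym//|e] := ltngtP (f P) (f Q).
by apply: hf; rewrite ?inE.
Qed.

Variables (M : nat) (A2 : R) (col : cube X -> nat) (j : nat).
Hypothesis hA2 : 0 <= A2.
(** All distances are in units of [delta ^ k]. [E] bounds the distance from a point to its node of
    generation k, and [adj_radius] the accumulated error of all finer generations. [A1] bounds the
    distance from a coloured cube to a base cube reached from a point within [A2] of its center. *)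
Let A1 : R := cd * (cd * (A2 + C0) + C0).
Let E : R := cd * (A1 + C0).
Definition adj_radius : R := 2 * cd * E.
Local Notation E' := adj_radius.
Local Notation tau := (delta ^+ M).
Hypothesis htau : cd * E' * tau <= c0 / 2.
Hypothesis htau2 : 2 * cd * tau <= 1.
Hypothesis hM : (0 < M)%N.
Hypothesis hcol : forall P Q, D P -> D Q -> generation P = generation Q -> col P = col Q ->
  d (cube_center P) (cube_center Q) <= 2 * cd * A1 * delta ^ generation Q -> P = Q.

Let cd0 := cd_gt0 hX.
Let cd1 := cd_ge1 hX.
Let C00 := C0_gt0 hc0.
Let A1_ge0 : 0 <= A1.
Proof.
have [? ?] := (ltW cd0, ltW C00).
by rewrite /A1 mulr_ge0// addr_ge0// mulr_ge0// addr_ge0.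
Qed.
Let E_gt0 : 0 < E. Proof. by rewrite mulr_gt0// ltr_wpDl. Qed.
Let E'_gt0 : 0 < E'. Proof. by rewrite /adj_radius; apply: mulr_gt0 => //; apply: mulr_gt0. Qed.
Let tau01 : 0 < tau < 1.
Proof.
case/andP: hdelta => d0 d1; rewrite exprn_gt0//=.
by rewrite exprn_ilt1 ?ltW// -lt0n.
Qed.
Lemma tauE (k : int) : delta ^ (k * M%:Z) = tau ^ k.
Proof. by rewrite mulrC -exprz_exp exprnP. Qed.

Local Notation base k x := (cub hD (k * M%:Z) x).

Definition near_colored (Q' Q : cube X) := [/\ D Q, generation Q = generation Q',
  col Q = j & d (cube_center Q) (cube_center Q') <= A1 * delta ^ generation Q'].

(** A cube close to one of colour [j] is replaced by it, and kept otherwise. The separation [hcol]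
    makes the coloured neighbour unique, and a coloured cube is its own neighbour, so the operation
    is idempotent. *)
Definition cluster (Q' : cube X) : cube X :=
  if pselect (exists Q, near_colored Q' Q) is left h then sval (cid h) else Q'.

Lemma cluster_near Q' Q : near_colored Q' Q -> cluster Q' = Q.
Proof.
move=> h; rewrite /cluster; case: pselect => [e|]; last by move=> []; exists Q.
have [DP gP cP dP] := svalP (cid e); have [DQ gQ cQ dQ] := h.
apply: hcol => //; rewrite ?gP ?gQ ?cP ?cQ//.
apply: le_trans (qd_tri hX (cube_center Q') _ _) _.
rewrite (qd_sym hX (cube_center Q')).
set a := d _ _ in dP *; set b := d _ _ in dQ *; set t := A1 * _ in dP dQ *.
have -> : 2 * cd * A1 * delta ^ generation Q' = cd * (t + t) by rewrite /t; lra.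
by rewrite ler_pM2l// lerD.
Qed.

Lemma cluster_D Q : D Q -> D (cluster Q).
Proof.
move=> DQ; rewrite /cluster; case: pselect => [e|//].
by have [] := svalP (cid e).
Qed.

Lemma cluster_gen Q : generation (cluster Q) = generation Q.
Proof.
by rewrite /cluster; case: pselect => [e|//]; have [] := svalP (cid e).
Qed.

Lemma cluster_dist Q : d (cube_center (cluster Q)) (cube_center Q) <= A1 * delta ^ generation Q.
Proof.
rewrite /cluster; case: pselect => [e|_]; first by have [] := svalP (cid e).
by rewrite (qdxx hX) mulr_ge0// ltW// dpow_gt0.
Qed.

Lemma cluster_colored Q : D Q -> col Q = j -> cluster Q = Q.
Proof.
move=> DQ cQ; apply: cluster_near; split => //.
by rewrite (qdxx hX) mulr_ge0// ltW// dpow_gt0.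
Qed.

Lemma cluster_idem Q : cluster (cluster Q) = cluster Q.
Proof.
rewrite {2 3}/cluster; case: pselect => [e|n]; first last.
  by rewrite /cluster; case: pselect.
by have [DP gP cP _] := svalP (cid e); exact: cluster_colored.
Qed.

Definition node (k : int) (x : X) : cube X := cluster (base k x).

Lemma node_D k x : D (node k x).
Proof. by apply: cluster_D; exact: cub_D. Qed.

Lemma node_gen k x : generation (node k x) = k * M%:Z.
Proof. by rewrite cluster_gen gen_cub. Qed.

Lemma node_dist k x : d (cube_center (node k x)) x <= E * tau ^ k.
Proof.
apply: le_trans (qd_tri hX (cube_center (base k x)) _ _) _.
rewrite -mulrA ler_pM2l// mulrDl; apply: lerD.
  by have := cluster_dist (base k x); rewrite gen_cub tauE.
by have := cube_outer hD (cub_D hD _ _) (cub_in hD (k * M%:Z) x); rewrite gen_cub tauE => /ltW.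
Qed.

(** The ancestor of generation [k] of the node of generation [k + n] at x: at every step the parent
    of a node is the node at its center. *)
Fixpoint thread (k : int) (n : nat) (x : X) : cube X :=
  if n is n'.+1 then node k (cube_center (thread (k + 1) n' x)) else node k x.

Lemma thread_node k n x : exists y, thread k n x = node k y.
Proof. by case: n => [|n] /=; [exists x|exists (cube_center (thread (k + 1) n x))]. Qed.

(** The bound does not depend on [n]: by [htau2] the error inherited from generation k + 1 is at
    most [E * tau ^ k], like the error of the new step, and [adj_radius] is [cd] times their sum. *)
Lemma thread_dist k n x : d (cube_center (thread k n x)) x <= E' * tau ^ k.
Proof.
have c1 : 1 <= cd := cd1.
elim: n k => [|n ih] k /=.
  apply: le_trans (node_dist k x) _; rewrite ler_pM2r ?(dpow_gt0 tau01)//.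
  by rewrite /adj_radius ler_peMl ?(ltW E_gt0)//; lra.
apply: le_trans (qd_tri hX (cube_center (thread (k + 1) n x)) _ _) _.
have h1 := node_dist k (cube_center (thread (k + 1) n x)).
have h2 := ih (k + 1); rewrite (dpowD tau01) expr1z in h2.
have t0 : 0 < tau ^ k by rewrite (dpow_gt0 tau01).
have h3 : E' * (tau ^ k * tau) <= E * tau ^ k.
  have -> : E' * (tau ^ k * tau) = (2 * cd * tau) * (E * tau ^ k) by rewrite /adj_radius; lra.
  by rewrite ler_piMl// mulr_ge0 ?ltW.
have -> : E' * tau ^ k = cd * (E * tau ^ k + E * tau ^ k) by rewrite /adj_radius; lra.
by rewrite ler_pM2l// lerD// (le_trans h2).
Qed.

Lemma thread_D k n x : D (thread k n x).
Proof. by have [y ->] := thread_node k n x; exact: node_D. Qed.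

Lemma thread_gen k n x : generation (thread k n x) = k * M%:Z.
Proof. by have [y ->] := thread_node k n x; exact: node_gen. Qed.

Lemma thread_base k n x y : base (k + n%:Z) x = base (k + n%:Z) y ->
  thread k n x = thread k n y.
Proof.
elim: n k => [|n ih] k /=; first by rewrite addr0 /node => ->.
by rewrite intS addrA => /ih ->.
Qed.

(* The ancestors of generation k of the nodes containing x, cofinally in the
   generation of these nodes. *)
Definition limit_nodes (k : int) (x : X) : set (cube X) :=
  [set v | forall N, exists n, (N <= n)%N /\ thread k n x = v].

Lemma limit_nodesP k x v : limit_nodes k x v ->
  [/\ D v, generation v = k * M%:Z, cluster v = v &
      d (cube_center v) x <= E' * tau ^ k].
Proof.
move=> /(_ 0%N)[n [_ <-]]; split; first exact: thread_D.
- exact: thread_gen.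
- by have [y ->] := thread_node k n x; rewrite cluster_idem.
- exact: thread_dist.
Qed.

Lemma thread_finite k x : finite_set [set Q | [/\ D Q, generation Q = k * M%:Z &
  d (cube_center Q) x <= E' * delta ^ (k * M%:Z)]].
Proof. exact: (finite_near_cubes hX hc0 hdelta hD). Qed.

Lemma limit_nodes_nonempty k x : exists v, limit_nodes k x v.
Proof.
have [||w hw] := @infinitely_often_finite _ _ (fun n => thread k n x) (fun=> True)
  (thread_finite k x).
- by move=> n; split; [exact: thread_D|exact: thread_gen|rewrite tauE; exact: thread_dist].
- by move=> N; exists N.
by exists w => N; have [n [Nn _ nw]] := hw N; exists n.
Qed.

(** Among the indices at which the thread passes through [v], pigeonhole on the finitely many nodes
    of generation k + 1 near x finds one that recurs. *)
Lemma limit_nodes_child k x v : limit_nodes k x v ->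
  exists2 w, limit_nodes (k + 1) x w & node k (cube_center w) = v.
Proof.
move=> hv.
have [||w hw] := @infinitely_often_finite _ _ (fun n => thread (k + 1) n x)
  (fun n => thread k n.+1 x = v) (thread_finite (k + 1) x).
- by move=> n; split; [exact: thread_D|exact: thread_gen|rewrite tauE; exact: thread_dist].
- move=> N; have [[|n] [Nn nv]] := hv N.+1 => //; exists n; split => //.
exists w; first by move=> N; have [n [Nn _ nw]] := hw N; exists n.
by have [n [_ <- <-]] := hw 0%N.
Qed.

Lemma limit_nodes_parent k x w : limit_nodes (k + 1) x w ->
  limit_nodes k x (node k (cube_center w)).
Proof.
move=> hw N; have [n [Nn nw]] := hw N.
by exists n.+1; split; [exact: leqW|rewrite /= nw].
Qed.

(** A limit superior of the sets where the thread equals [v], each of which is a countable union of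
    base cubes because [thread k n] is constant on cubes of the generation it starts from. *)
Lemma limit_nodes_measurable k v :
  measurable ([set x | limit_nodes k x v] : set (Borel X)).
Proof.
rewrite (_ : [set x | _] = \bigcap_N \bigcup_(n in [set n | (N <= n)%N])
    [set x | thread k n x = v]); last first.
  apply/seteqP; split => [x hx N _|x hx N].
    by have [n [Nn nv]] := hx N; exists n.
  by have [n Nn nv] := hx N I; exists n.
apply: bigcapT_measurable => N; apply: bigcup_measurable => n _.
have -> : [set x | thread k n x = v] =
    famU [set Q | [/\ D Q, generation Q = (k + n%:Z) * M%:Z &
      exists2 x, carrier Q x & thread k n x = v]] carrier.
  apply/seteqP; split => [x xv|x [Q [DQ gQ [y Qy yv]] Qx]].
    exists (base (k + n%:Z) x); last exact: cub_in.
    by split; [exact: cub_D|exact: gen_cub|exists x => //; exact: cub_in].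
  rewrite /= -yv; apply: thread_base.
  by rewrite -gQ -(cub_uniq hD DQ Qx) -(cub_uniq hD DQ Qy).
apply: famU_measurable => [|Q []]; last by move=> /(cube_measurable hD).
apply: sub_countable (countable_D hX hc0 hdelta hD); apply: subset_card_le.
by move=> Q [].
Qed.

(** The choice among limit nodes must depend measurably on the point, so nodes are numbered and the
    least number wins. *)
Definition code : cube X -> nat :=
  sval (cid (countable_injP _ (countable_D hX hc0 hdelta hD))).

Lemma code_inj P Q : D P -> D Q -> code P = code Q -> P = Q.
Proof.
by move=> DP DQ; apply: (svalP (cid (countable_injP _ (countable_D hX hc0 hdelta hD))));
  rewrite inE.
Qed.

Definition is_least (S : set (cube X)) v := S v /\
  forall w, S w -> (code v <= code w)%N.

Lemma least_exists S : (exists v, S v) -> exists v, is_least S v.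
Proof.
move=> [v Sv]; have : exists n, `[< exists2 w, S w & code w = n >].
  by exists (code v); apply/asboolP; exists v.
move=> /ex_minnP[n /asboolP[w Sw wn] hn]; exists w; split => // u Su.
by rewrite wn; apply: hn; apply/asboolP; exists u.
Qed.

Lemma least_uniq S v w : S `<=` D -> is_least S v -> is_least S w -> v = w.
Proof.
move=> SD [Sv hv] [Sw hw]; apply: code_inj; [exact: SD|exact: SD|].
by apply/eqP; rewrite eqn_leq hv// hw.
Qed.

Definition least (S : set (cube X)) : cube X :=
  if pselect (exists v, S v) is left h then sval (cid (least_exists h))
  else (0, point, set0).

Lemma leastP S : (exists v, S v) -> is_least S (least S).
Proof. by move=> h; rewrite /least; case: pselect => // e; exact: svalP (cid _). Qed.

(** A coherent choice of one limit node per generation. At generation 0 the least one is taken, then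
    at each finer generation the least one whose parent is already chosen; coarser generations, from
    [Negz 0], that is -1, are forced by taking parents. *)
Fixpoint branch_pos (n : nat) (x : X) : cube X :=
  if n is m.+1 then least [set v | limit_nodes n%:Z x v /\
                                 node m%:Z (cube_center v) = branch_pos m x]
  else least (limit_nodes 0 x).

Fixpoint branch_neg (n : nat) (x : X) : cube X :=
  if n is m.+1 then node (Negz n) (cube_center (branch_neg m x))
  else node (Negz 0) (cube_center (branch_pos 0 x)).

Definition branch (k : int) (x : X) : cube X :=
  match k with Posz n => branch_pos n x | Negz n => branch_neg n x end.

Lemma branch_pos_limit n x : limit_nodes n%:Z x (branch_pos n x).
Proof.
elim: n => [|n ih]; first by have [] := leastP (limit_nodes_nonempty 0 x).
have [w hw wn] := limit_nodes_child ih.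
by have [|[]] := @leastP [set v | limit_nodes n.+1%:Z x v /\
   node n%:Z (cube_center v) = branch_pos n x]; first by
   exists w; rewrite /= intS addrC.
Qed.

Lemma branch_limit k x : limit_nodes k x (branch k x).
Proof.
case: k => n /=; first exact: branch_pos_limit.
elim: n => [|n ih] /=; apply: limit_nodes_parent.
  exact: branch_pos_limit.
by rewrite NegzS_add1.
Qed.

Lemma branch_parent k x : branch k x = node k (cube_center (branch (k + 1) x)).
Proof.
case: k => n.
  rewrite (_ : n%:Z + 1 = n.+1%:Z); last by rewrite intS addrC.
  have [w hw wn] := limit_nodes_child (branch_pos_limit n x).
  have [|[_ e] _] := @leastP [set v | limit_nodes n.+1%:Z x v /\
      node n%:Z (cube_center v) = branch_pos n x]; last exact: esym e.
  by exists w; rewrite /= intS addrC.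
by case: n => [//|n]; rewrite NegzS_add1.
Qed.

(** Each branch determines its parent, hence all coarser branches. This is the nestedness of the
    cells. *)
Lemma branch_eq (k l : int) x y : l <= k -> branch k x = branch k y ->
  branch l x = branch l y.
Proof.
move=> lk; have -> : k = l + `|k - l|%N by rewrite gez0_abs ?subr_ge0// addrCA subrr addr0.
move: `|k - l|%N => n; clear lk k; elim: n l => [|n ih] l; first by rewrite addr0.
rewrite intS addrA => /ih h; by rewrite branch_parent h -branch_parent.
Qed.

Lemma branch_near k x : [/\ D (branch k x), generation (branch k x) = k * M%:Z,
  cluster (branch k x) = branch k x & d (cube_center (branch k x)) x <= E' * tau ^ k].
Proof. exact: limit_nodesP (branch_limit k x). Qed.

(** The least element of [S x] is [u] where [u] belongs to [S x] and none of the countably many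
    cubes of smaller code does. The other generations follow by induction and by taking parents. *)
Lemma branch_measurable k v : D v -> measurable ([set x | branch k x = v] : set (Borel X)).
Proof.
have least_meas (S : X -> set (cube X)) u : D u -> (forall x, S x `<=` D) ->
    (forall x, exists w, S x w) ->
    (forall w, D w -> measurable ([set x | S x w] : set (Borel X))) ->
    measurable ([set x | least (S x) = u] : set (Borel X)).
  move=> Du SD S0 mS.
  have -> : [set x | least (S x) = u] = [set x | S x u] `\`
      \bigcup_(w in [set w | D w /\ (code w < code u)%N]) [set x | S x w].
    apply/seteqP; split => [x <-|x [Sxu nS]].
      have [h1 h2] := leastP (S0 x); split => // -[w [Dw wu] Sxw].
      by have := h2 _ Sxw; rewrite leqNgt wu.
    apply: least_uniq (leastP (S0 x)) _; [exact: SD|split => // w Sxw].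
    rewrite leqNgt; apply/negP => wu; apply: nS; exists w => //; split => //.
    exact: SD Sxw.
  apply: measurableD; first exact: mS.
  apply: (@famU_measurable _ [set w | D w /\ (code w < code u)%N] (fun w => [set x | S x w])).
    apply: sub_countable (countable_D hX hc0 hdelta hD); apply: subset_card_le.
    by move=> Q [].
  by move=> w [Dw _]; exact: mS.
have mpos n u : D u -> measurable ([set x | branch_pos n x = u] : set (Borel X)).
  elim: n u => [|n ih] u Du.
    apply: (least_meas (limit_nodes 0)) => //.
    - by move=> x w /limit_nodesP[].
    - exact: limit_nodes_nonempty.
    - by move=> w _; exact: limit_nodes_measurable.
  apply: (least_meas (fun x => [set v | limit_nodes n.+1%:Z x v /\
                    node n%:Z (cube_center v) = branch_pos n x])) => //.
  - by move=> x w [/limit_nodesP[]].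
  - move=> x; have [w hw wn] := limit_nodes_child (branch_pos_limit n x).
    by exists w; rewrite /= intS addrC.
  - move=> w Dw.
    have -> : [set x | limit_nodes n.+1%:Z x w /\ node n%:Z (cube_center w) = branch_pos n x] =
      [set x | limit_nodes n.+1%:Z x w] `&` [set x | branch_pos n x = node n%:Z (cube_center w)].
      by apply/seteqP; split => x [].
    apply: measurableI; first exact: limit_nodes_measurable.
    by apply: ih; exact: node_D.
have mchild (m : int) (B : X -> cube X) u : (forall x, D (B x)) ->
    (forall w, D w -> measurable ([set x | B x = w] : set (Borel X))) ->
    measurable ([set x | node m (cube_center (B x)) = u] : set (Borel X)).
  move=> BD mB; have -> : [set x | node m (cube_center (B x)) = u] =
      famU [set w | D w /\ node m (cube_center w) = u] (fun w => [set x | B x = w]).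
    apply/seteqP; split => [x xu|x [w [Dw wu] Bw]].
    - by exists (B x).
    - by move: Bw => /= ->.
  apply: famU_measurable => [|w []]; last by move=> /mB.
  apply: sub_countable (countable_D hX hc0 hdelta hD); apply: subset_card_le.
  by move=> Q [].
move=> Dv; case: k => n; first exact: mpos.
elim: n v Dv => [|n ih] v Dv /=.
  apply: mchild; last exact: (mpos 0%N).
  by move=> x; have [] := limit_nodesP (branch_pos_limit 0 x).
apply: mchild ih.
by move=> x; have [] := branch_near (Negz n) x.
Qed.

Definition cell (k : int) (v : cube X) : cube X :=
  (k, cube_center v, [set x | branch k x = v]).

Definition adj_system : set (cube X) :=
  [set P | exists k v, [/\ D v, generation v = k * M%:Z, cluster v = v & P = cell k v]].

(** For the inner ball: if x is within [c0 / (2 * cd)] of the center of [v], the next node on the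
    branch of x is so near to x, by [htau], that its center falls in the inner ball of [v], where
    the base cube is [v] itself. The factor 2 in the outer radius only makes the inequality
    strict. *)
Lemma adj_systemP : dyadic_system d (c0 / (2 * cd)) (2 * E') tau adj_system.
Proof.
have t0 k : 0 < tau ^ k by rewrite (dpow_gt0 tau01).
split.
- by move=> _ [k [v [Dv _ _ ->]]]; exact: branch_measurable.
- move=> _ _ [k [v [Dv _ _ ->]]] [k' [v' [Dv' _ _ ->]]]; rewrite /generation/= => <- ne.
  by rewrite -subset0 => x [/= xv xv']; apply: ne; rewrite -xv -xv'.
- move=> k x; exists (cell k (branch k x)); split => //.
  by exists k, (branch k x); split => //; have [] := branch_near k x.
- move=> _ _ [k [v [Dv _ _ ->]]] [l [w [Dw _ _ ->]]]; rewrite /generation/= => lk.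
  have [h|/set0P[x [/= xv xw]]] := eqVneq (carrier (cell k v) `&` carrier (cell l w)) set0.
    by left.
  right => y /= yv; rewrite -xw; apply: branch_eq lk _.
  by rewrite yv xv.
- move=> _ [k [v [Dv gv cv ->]]] x; rewrite /generation/= /qball/= => hx.
  rewrite branch_parent; set w := branch (k + 1) x.
  have [Dw _ _ dw] := branch_near (k + 1) x; rewrite -/w in Dw dw.
  have vw : carrier v (cube_center w).
    apply: (cube_inner hD Dv); rewrite /qball/= gv tauE.
    apply: le_lt_trans (qd_tri hX x _ _) _; rewrite (qd_sym hX x).
    move: dw; rewrite (dpowD tau01) expr1z => dw.
    have h1 : cd * (E' * (tau ^ k * tau)) <= c0 / 2 * tau ^ k.
      have -> : cd * (E' * (tau ^ k * tau)) = (cd * E' * tau) * tau ^ k.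
        by rewrite [tau ^ k * tau]mulrC !mulrA.
      by rewrite ler_pM2r.
    have h2 : cd * d (cube_center v) x < c0 / 2 * tau ^ k.
      have -> : c0 / 2 * tau ^ k = cd * (c0 / (2 * cd) * tau ^ k).
        by field; rewrite gt_eqF.
      by rewrite ltr_pM2l.
    have h3 : cd * d (cube_center w) x <= cd * (E' * (tau ^ k * tau)) by rewrite ler_pM2l.
    by rewrite mulrDr; lra.
  by rewrite /node -gv -(cub_uniq hD Dv vw).
- move=> _ [k [v [Dv gv cv ->]]] x; rewrite /generation/= /qball/= => <-.
  have [_ _ _ h] := branch_near k x; apply: le_lt_trans h _.
  by rewrite ltr_pM2r//; have := E'_gt0; lra.
Qed.

(** If x is within [A2] of the center of [Q], the next node [w] on its branch is within [C0] of x
    and the base cube at [w] has its center within [C0] of [w]. Two triangle inequalities give [A1],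
    so that base cube is clustered to [Q]. *)
Lemma adj_system_ball k Q : D Q -> generation Q = k * M%:Z -> col Q = j ->
  adj_system (cell k Q) /\
  qball d (cube_center Q) (A2 * delta ^ generation Q) `<=` carrier (cell k Q).
Proof.
move=> DQ gQ cQ; split.
  by exists k, Q; split => //; exact: cluster_colored.
have t0 : 0 < tau ^ k by rewrite (dpow_gt0 tau01).
move=> x; rewrite /qball/= gQ tauE => hx.
rewrite branch_parent; set w := branch (k + 1) x.
have [Dw _ _ dw] := branch_near (k + 1) x; rewrite -/w in Dw dw.
apply: cluster_near; split => //; rewrite gen_cub// tauE.
set Q' := base k _.
have dQ' : d (cube_center w) (cube_center Q') <= C0 * tau ^ k.
  have := cube_outer hD (cub_D hD (k * M%:Z) (cube_center w)) (cub_in hD _ _).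
  by rewrite gen_cub tauE (qd_sym hX) => /ltW.
apply: le_trans (qd_tri hX (cube_center w) _ _) _.
rewrite /A1 -[cd * _ * _]mulrA ler_pM2l// mulrDl lerD//.
apply: le_trans (qd_tri hX x _ _) _.
rewrite -[cd * _ * _]mulrA ler_pM2l// mulrDl lerD//; first exact: ltW.
rewrite (qd_sym hX); apply: le_trans dw _.
rewrite (dpowD tau01) expr1z mulrCA mulrC ler_pM2r//.
have h1 : E' * tau <= cd * (E' * tau).
  by rewrite ler_peMl// mulr_ge0// ?(ltW E'_gt0)//; case/andP: tau01 => /ltW.
rewrite mulrA in h1; apply: le_trans h1 _; apply: le_trans htau _.
by case/andP: hc0; lra.
Qed.
End AdjacentSystem.

Section AdjacentSystems.
Context {R : realType} {X : ptopologicalType}.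
Variables (mu : {measure set (Borel X) -> \bar R}) (d : X -> X -> R).
Variables (cd cmu : R) (hX : homogeneous_type mu d cd cmu).
Variables (c0 C0 delta : R) (hc0 : 0 < c0 <= C0) (hdelta : 0 < delta < 1).
Variables (D : set (cube X)) (hD : dyadic_system d c0 C0 delta D).

Lemma adjacent_systems (A2 : R) : 0 <= A2 ->
  exists M N : nat, exists tc0 tC0 : R, exists Ds : nat -> set (cube X),
  exists col : cube X -> nat, exists cl : int -> cube X -> cube X,
  [/\ (0 < M)%N, 0 < tc0 <= tC0,
      forall j, dyadic_system d tc0 tC0 (delta ^+ M) (Ds j),
      forall Q, D Q -> (col Q < N)%N &
      forall k Q, D Q -> generation Q = k * M%:Z ->
        [/\ Ds (col Q) (cl k Q), generation (cl k Q) = k,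
            cube_center (cl k Q) = cube_center Q &
            qball d (cube_center Q) (A2 * delta ^ generation Q)
              `<=` carrier (cl k Q)]].
Proof.
move=> hA2; have cd0 := cd_gt0 hX; have cd1 := cd_ge1 hX; have C00 := C0_gt0 hc0.
have c00 := c0_gt0 hc0; case/andP : (hc0) => _ c0C0.
case/andP : (hdelta) => d0 d1.
pose A1 := cd * (cd * (A2 + C0) + C0).
have [N [col [colN hcol]]] := cube_coloring hX hc0 hdelta hD (2 * cd * A1).
pose E' := adj_radius cd C0 A2.
have E'0 : 0 < E'.
  have [c0' C0'] := (ltW cd0, ltW C00).
  rewrite /E' /adj_radius; apply: mulr_gt0; first by rewrite mulr_gt0.
  by rewrite mulr_gt0// ltr_wpDl// mulr_ge0// addr_ge0// mulr_ge0// addr_ge0.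
(* The two bounds are those required by [htau] and [htau2]. The exponent [M = n.+1] is positive and
   still satisfies them. *)
have e0 : 0 < Num.min (c0 / 2 / (cd * E')) (2 * cd)^-1.
  rewrite lt_min; apply/andP; split; last by rewrite invr_gt0 mulr_gt0.
  by apply: divr_gt0; [exact: divr_gt0|exact: mulr_gt0].
have [n] := dpow_small hdelta e0; rewrite lt_min => /andP[h1 h2].
pose M := n.+1.
have le : delta ^+ M <= delta ^+ n by rewrite /M exprS ler_piMl ?exprn_ge0// ltW.
have htau : cd * E' * delta ^+ M <= c0 / 2.
  rewrite mulrC -ler_pdivlMr; last exact: mulr_gt0.
  exact: le_trans le (ltW h1).
have htau2 : 2 * cd * delta ^+ M <= 1.
  rewrite mulrC -ler_pdivlMr ?mul1r; last exact: mulr_gt0.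
  exact: le_trans le (ltW h2).
exists M, N, (c0 / (2 * cd)), (2 * E'),
  (fun j => adj_system hX hc0 hdelta hD M A2 col j), col,
  (fun k Q => cell hX hc0 hdelta hD M A2 col (col Q) k Q); split => //.
- rewrite divr_gt0 ?mulr_gt0//= ler_pdivrMr ?mulr_gt0//.
  apply: le_trans c0C0 _; have C0E : C0 <= E'.
    rewrite /E' /adj_radius -mulrA; have [c0' C0'] := (ltW cd0, ltW C00).
    have hA1 : 0 <= cd * (cd * (A2 + C0) + C0).
      by rewrite mulr_ge0// addr_ge0// mulr_ge0// addr_ge0.
    set t := _ + C0; have t0 : C0 <= t by rewrite lerDr.
    have t1 : t <= cd * t by rewrite ler_peMl// (le_trans C0').
    have t2 : cd * t <= cd * (cd * t) by rewrite ler_pM2l.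
    by lra.
  have E2 : E' <= cd * E' by rewrite ler_peMl// ltW.
  by lra.
- by move=> j; exact: (adj_systemP hX hc0 hdelta hD j hA2 htau htau2 (ltn0Sn _) hcol).
- move=> k Q DQ gQ.
  by have [? ?] := adj_system_ball hX hc0 hdelta hD hA2 htau htau2 (ltn0Sn _) hcol DQ gQ erefl.
Qed.
End AdjacentSystems.

(** * Almost everywhere statements *)

Section AlmostEverywhere.
Context d {T : measurableType d} {R : realType}.
Variable mu : {measure set T -> \bar R}.
Implicit Types P Q : T -> Prop.

Lemma ae_mono P Q : (forall x, P x -> Q x) ->
  {ae mu, forall x, P x} -> {ae mu, forall x, Q x}.
Proof. exact: (@filterS _ _ (ae_filter_ringOfSetsType mu)). Qed.

Lemma ae_and P Q : {ae mu, forall x, P x} -> {ae mu, forall x, Q x} ->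
  {ae mu, forall x, P x /\ Q x}.
Proof. exact: (@filterI _ _ (ae_filter_ringOfSetsType mu)). Qed.

Lemma ae_all P : (forall x, P x) -> {ae mu, forall x, P x}.
Proof.
by move=> h; exists set0; split => // x []; exact: h.
Qed.

Lemma ae_countable (I : Type) (S : set I) (P : I -> T -> Prop) : countable S ->
  (forall i, S i -> {ae mu, forall x, P i x}) ->
  {ae mu, forall x, forall i, S i -> P i x}.
Proof.
move=> cS h; have [f /= hf] := countable_injP _ cS.
have : {ae mu, forall x, forall n i, S i -> f i = n -> P i x}.
  apply/ae_foralln => n.
  have [[i [Si fi]]|nh] := pselect (exists i, S i /\ f i = n); last first.
    by apply: ae_all => x i Si fi; case: nh; exists i.
  apply: ae_mono (h i Si) => x Pix j Sj fj.
  by rewrite (hf j i)// ?inE// fj.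
by apply: ae_mono => x hx i Si; exact: hx Si erefl.
Qed.

Lemma ae_finite (n : nat) (P : 'I_n -> T -> Prop) :
  (forall i, {ae mu, forall x, P i x}) -> {ae mu, forall x, forall i, P i x}.
Proof.
move=> h; have : {ae mu, forall x, forall i, [set: 'I_n] i -> P i x}.
  apply: ae_countable => //; exact: countableP.
by apply: ae_mono => x hx i; exact: hx.
Qed.

Lemma ae_notin (A : set T) (P : T -> Prop) : measurable A -> mu A = 0%E ->
  (forall x, ~ A x -> P x) -> {ae mu, forall x, P x}.
Proof.
move=> mA A0 h; exists A; split => // x /= nP.
by apply: contrapT => nA; apply: nP; exact: h.
Qed.

End AlmostEverywhere.

(** * The topology of a quasi-metric *)

Section QuasiMetricTopology.
Context {R : realType} {X : ptopologicalType}.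
Variables (mu : {measure set (Borel X) -> \bar R}) (d : X -> X -> R).
Variables (cd cmu : R) (hX : homogeneous_type mu d cd cmu).

(** Balls may fail to be open. The open set required is that of the points with some ball inside
    [V]: a ball of radius [s / (2 * cd)] about such a point consists of such points. *)
Lemma nbhs_qball (x : X) (V : set X) :
  nbhs x V <-> exists2 rho, 0 < rho & qball d x rho `<=` V.
Proof.
have cd0 := cd_gt0 hX; split.
  rewrite nbhsE => -[U [oU Ux] UV].
  have [rho r0 h] := (ht_topology hX U).1 oU _ Ux.
  by exists rho => //; exact: subset_trans UV.
move=> [rho r0 h]; rewrite nbhsE.
pose I := [set y | exists2 s, 0 < s & qball d y s `<=` V].
exists I; last first.
  by move=> y [s s0]; apply; exact: (qball_center hX).
split; last by exists rho.
apply/(ht_topology hX) => y [s s0 ys].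
have s2 : 0 < s / (2 * cd) by rewrite divr_gt0// mulr_gt0.
exists (s / (2 * cd)) => // z yz; exists (s / (2 * cd)) => //.
apply: subset_trans ys; apply: (qball_sub hX).
have e : cd * (s / (2 * cd) + s / (2 * cd)) = s by field; rewrite gt_eqF.
by rewrite -[leRHS]e ler_pM2l// lerD2r ltW.
Qed.

Lemma closure_qball (A : set X) z : closure A z ->
  forall rho, 0 < rho -> exists2 y, A y & d z y < rho.
Proof.
move=> cA rho r0; have /cA[y [Ay zy]] : nbhs z (qball d z rho).
  by apply/nbhs_qball; exists rho.
by exists y.
Qed.

(** Each point a of the closed set gets a ball of radius [rho a / (2 * cd)]. A point z of the
    closure of their union that left [B] would satisfy [rho a <= d a z] for some a with z close to
    that ball, which forces [d a z] below any given bound, whereas z has positive distance to the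
    closed set. *)
Lemma normal_quasimetric : normal_space X.
Proof.
have cd0 := cd_gt0 hX; have cd1 := cd_ge1 hX.
move=> A cA B nB.
have hB a : exists rho, A a -> 0 < rho /\ qball d a rho `<=` B.
  have [Aa|nA] := pselect (A a); last by exists 0.
  have /nbhs_qball[rho r0 h] : nbhs a B by exact: nB.
  by exists rho.
have [rho hrho] := choice hB.
pose U := \bigcup_(a in A) qball d a (rho a / (2 * cd)).
exists U.
  move=> a Aa; apply/nbhs_qball; exists (rho a / (2 * cd)).
    by rewrite divr_gt0 ?mulr_gt0//; exact: (hrho a Aa).1.
  by move=> y ay; exists a.
move=> z clz; apply: contrapT => nBz.
have nAz : ~ A z.
  by move=> Az; apply: nBz; apply: (hrho z Az).2; apply: (qball_center hX); exact: (hrho z Az).1.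
have [t t0 ht] : exists2 t, 0 < t & qball d z t `<=` ~` A.
  by apply/nbhs_qball; apply: open_nbhs_nbhs; split => //; exact: closed_openC.
pose s := t / (4 * cd); have s0 : 0 < s by rewrite divr_gt0// mulr_gt0.
have [y [a Aa ay] zy] := closure_qball clz s0.
rewrite /qball/= in ay.
have [ra hra] := hrho a Aa.
have h1 : rho a <= d a z.
  by rewrite leNgt; apply/negP => h; apply: nBz; exact: hra.
have h2 := qd_tri hX y a z; rewrite (qd_sym hX y z) in h2.
have h3 : cd * d a y < rho a / 2.
  have -> : rho a / 2 = cd * (rho a / (2 * cd)) by field; rewrite gt_eqF.
  by rewrite ltr_pM2l.
have h4 : cd * d z y < t / 4.
  have -> : t / 4 = cd * s by rewrite /s; field; rewrite gt_eqF.
  by rewrite ltr_pM2l.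
rewrite mulrDr in h2.
apply: (ht a) => //; rewrite /qball/= (qd_sym hX).
by lra.
Qed.

(** Sets at positive distance have disjoint closures, and normality provides a Urysohn function. *)
Lemma cutoff_exists (A B : set X) (e : R) : 0 < e ->
  (forall x y, A x -> B y -> e <= d x y) ->
  exists eta : X -> R, [/\ continuous eta, forall x, 0 <= eta x <= 1,
    forall x, A x -> eta x = 1 & forall x, B x -> eta x = 0].
Proof.
move=> e0 hAB; have cd0 := cd_gt0 hX; have cd1 := cd_ge1 hX.
have dis : closure B `&` closure A = set0.
  rewrite -subset0 => z [cB cA].
  have s0 : 0 < e / (4 * cd) by rewrite divr_gt0// mulr_gt0.
  have [x Ax zx] := closure_qball cA s0; have [y By zy] := closure_qball cB s0.
  have := hAB _ _ Ax By; have := qd_tri hX z x y; rewrite (qd_sym hX x z).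
  have : cd * (d z x + d z y) < cd * (e / (4 * cd) + e / (4 * cd)).
    by rewrite ltr_pM2l// ltrD.
  have -> : cd * (e / (4 * cd) + e / (4 * cd)) = e / 2 by field; rewrite gt_eqF.
  by lra.
have sep := normal_separatorP.1 normal_quasimetric _ _
  (@closed_closure _ B) (@closed_closure _ A) dis.
have [f [cf rf f0 f1]] := (@uniform_separatorP X R _ _).1 (sep R).
exists f; split => //.
- by move=> x; have /rf/= : range f (f x) by exists x.
- by move=> x Ax; apply: f1; exists x => //; exact: subset_closure.
- by move=> x Bx; apply: f0; exists x => //; exact: subset_closure.
Qed.

Lemma continuous_borel (f : X -> R) : continuous f ->
  measurable_fun setT (f : Borel X -> R).
Proof.
move=> cf; apply: (measurability _ (RGenOpens.measurableE R)) => //.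
move=> _ [_ [a [b ->]] <-]; rewrite setTI.
apply: sub_sigma_algebra; apply: open_comp => [x _|]; first exact: cf.
exact: interval_open.
Qed.

End QuasiMetricTopology.

(** * Test functions *)

Section FiniteNorms.
Context {R : realType} {X : ptopologicalType}.
Variables (mu : {measure set (Borel X) -> \bar R}) (d : X -> X -> R).
Variables (cd cmu : R) (hX : homogeneous_type mu d cd cmu).
Implicit Types (f g s : Borel X -> R).

Lemma bounded_support_comb (V W Z : zmodType) (f : X -> V) (g : X -> W) (h : X -> Z) :
  bounded_support d f -> bounded_support d g ->
  (forall y, f y = 0 -> g y = 0 -> h y = 0) -> bounded_support d h.
Proof.
move=> [x [rho [r0 hf]]] [y [s [s0 hg]]] hh.
exists x, (Num.max rho (cd * (d x y + s))); split; first by rewrite lt_max r0.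
move=> z nz; apply: hh.
  by apply: hf => xz; apply: nz; move: xz; apply: (qball_le (d := d)); rewrite le_max lexx.
apply: hg => yz; apply: nz; move: yz; apply: (qball_sub hX).
by rewrite le_max lexx orbT.
Qed.

Lemma bounded_support_sub (V W : zmodType) (f : X -> V) (h : X -> W) :
  bounded_support d f -> (forall y, f y = 0 -> h y = 0) -> bounded_support d h.
Proof. by move=> bf fh; apply: (bounded_support_comb bf bf) => y /fh. Qed.

Lemma Lnorm_finP (q : R) f : 0 < q ->
  ('N[mu]_(q%:E)[EFin \o f] < +oo)%E <-> (\int[mu]_x (`|f x| `^ q)%:E < +oo)%E.
Proof.
move=> q0; rewrite unlock /=.
rewrite (_ : (\int[mu]_x _)%E = (\int[mu]_x (`|f x| `^ q)%:E)%E)//.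
split; last exact: poweR_lty.
by rewrite !ltey => h; apply: contra h => /eqP h; rewrite (eqy_poweR _ h)// invr_gt0.
Qed.

Lemma Lnorm_inftyP f :
  ('N[mu]_(+oo)[EFin \o f] < +oo)%E <-> exists M : R, {ae mu, forall x, `|f x| <= M}.
Proof.
rewrite unlock /= (muT_gt0 hX); split.
  move=> h; have h0 : (0 <= ess_sup mu (abse \o (EFin \o f)))%E.
    apply: ess_sup_gee; first exact: (muT_gt0 hX).
    by apply: ae_all => x /=; rewrite lee_fin.
  exists (fine (ess_sup mu (abse \o (EFin \o f)))).
  apply: ae_mono (ess_sup_ge mu (abse \o (EFin \o f))) => x /=.
  by rewrite -lee_fin fineK// ge0_fin_numE.
move=> [M hM]; apply: (@le_lt_trans _ _ M%:E); last exact: ltry.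
by apply/ess_supP; apply: ae_mono hM => x /=; rewrite lee_fin.
Qed.

Lemma measurable_normpow f (q : R) : measurable_fun setT f ->
  measurable_fun setT (fun x => (`|f x| `^ q)%:E).
Proof.
move=> mf; apply/measurable_EFinP.
apply: (measurableT_comp (measurable_powR q)); exact: measurableT_comp.
Qed.

Lemma bsL_sub p f g : (1 <= p)%E -> bsL mu d p g -> measurable_fun setT f ->
  (forall x, `|f x| <= `|g x|) -> bsL mu d p f.
Proof.
move=> p1 [mg bg Ng] mf fg; split => //.
  by apply: (bounded_support_sub bg) => y gy; apply/eqP; rewrite -normr_le0 (le_trans (fg y))// gy normr0.
case: p p1 Ng => [q q1||//].
- have q0 : 0 < q by rewrite (lt_le_trans ltr01).
  move=> /(Lnorm_finP _ q0) h; apply/(Lnorm_finP _ q0); apply: le_lt_trans h.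
  apply: ge0_le_integral => //.
  - exact: measurable_normpow.
  - exact: measurable_normpow.
  - by move=> x _; rewrite lee_fin ge0_ler_powR// ?nnegrE// ltW.
- move=> _ /Lnorm_inftyP[M hM]; apply/Lnorm_inftyP; exists M.
  by apply: ae_mono hM => x; exact: le_trans.
Qed.

Lemma bsL_lin p f g (a : R) : (1 <= p)%E -> bsL mu d p f -> bsL mu d p g ->
  bsL mu d p (fun x => a * f x + g x).
Proof.
move=> p1 [mf bf Nf] [mg bg Ng]; split.
- by apply: measurable_funD => //; exact: measurable_funM.
- by apply: (bounded_support_comb bf bg) => y -> ->; rewrite mulr0 addr0.
case: p p1 Nf Ng => [q q1||//].
- have q0 : 0 < q by rewrite (lt_le_trans ltr01).
  move=> /(Lnorm_finP _ q0) hf /(Lnorm_finP _ q0) hg; apply/(Lnorm_finP _ q0).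
  apply: (@le_lt_trans _ _ (\int[mu]_x (((2 * `|a|) `^ q)%:E * (`|f x| `^ q)%:E +
     (2 `^ q)%:E * (`|g x| `^ q)%:E)))%E.
    apply: ge0_le_integral => //.
    - apply: measurable_normpow; apply: measurable_funD => //; exact: measurable_funM.
    - by apply: emeasurable_funD; apply: measurable_funeM; exact: measurable_normpow.
    - move=> x _; rewrite -!EFinM -EFinD lee_fin -!powRM ?mulr_ge0//.
      have [h|h] := leP (`|a| * `|f x|) `|g x|.
        apply: (@le_trans _ _ ((2 * `|g x|) `^ q)); last by rewrite lerDr powR_ge0.
        rewrite ge0_ler_powR// ?nnegrE ?mulr_ge0// ?(ltW q0)//.
        by apply: le_trans (ler_normD _ _) _; rewrite normrM; lra.
      apply: (@le_trans _ _ ((2 * `|a| * `|f x|) `^ q)); last by rewrite lerDl powR_ge0.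
      rewrite ge0_ler_powR// ?nnegrE ?mulr_ge0// ?(ltW q0)//.
      by apply: le_trans (ler_normD _ _) _; rewrite normrM; lra.
  rewrite ge0_integralD//; try by apply: measurable_funeM; exact: measurable_normpow.
  rewrite !ge0_integralZl//; do ?[exact: measurable_normpow| by rewrite lee_fin powR_ge0].
  apply: lte_add_pinfty; apply: lte_mul_pinfty.
  - by rewrite lee_fin powR_ge0.
  - by [].
  - exact: hf.
  - by rewrite lee_fin powR_ge0.
  - by [].
  - exact: hg.
- move=> _ /Lnorm_inftyP[M hM] /Lnorm_inftyP[N hN]; apply/Lnorm_inftyP.
  exists (`|a| * M + N); apply: ae_mono (ae_and hM hN) => x [h1 h2].
  by apply: le_trans (ler_normD _ _) _; rewrite normrM lerD// ler_wpM2l.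
Qed.

Definition test_fun (M : R) s :=
  [/\ measurable_fun setT s, forall x, `|s x| <= M & bounded_support d s].

Lemma test_fun_bsL M s p : (1 <= p)%E -> test_fun M s -> bsL mu d p s.
Proof.
move=> p1 [ms sM bs]; split => //; case: p p1 => [q q1||//]; last first.
  by move=> _; apply/Lnorm_inftyP; exists M; exact: ae_all.
have q0 : 0 < q by rewrite (lt_le_trans ltr01).
have M0 : 0 <= M by rewrite (le_trans _ (sM point)).
apply/(Lnorm_finP _ q0); have [a [rho [r0 hs]]] := bs.
rewrite (_ : (\int[mu]_x _)%E = (\int[mu]_(x in qball d a rho) (`|s x| `^ q)%:E)%E); last first.
  rewrite [RHS]integral_mkcond; apply: eq_integral => x _; rewrite patchE.
  case: ifPn => // /negP; rewrite inE => /hs ->.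
  by rewrite normr0 powR0// gt_eqF.
apply: (@le_lt_trans _ _ ((M `^ q)%:E * mu (qball d a rho))%E); last first.
  by rewrite lte_mul_pinfty// ?lee_fin ?powR_ge0// (qball_fin hX).
rewrite -integral_cst; last exact: (qball_measurable hX).
apply: ge0_le_integral => //.
- exact: (qball_measurable hX).
- by apply: measurable_funTS; exact: measurable_normpow.
- by move=> x _; rewrite /= lee_fin ge0_ler_powR// ?nnegrE ?ltW.
Qed.

Lemma bsL_integrable p f : (1 <= p)%E -> bsL mu d p f ->
  mu.-integrable setT (EFin \o f).
Proof.
move=> p1 [mf [a [rho [r0 hs]]] Nf]; apply/integrableP; split; first exact/measurable_EFinP.
pose B : set (Borel X) := qball d a rho; have mB : measurable B by exact: (qball_measurable hX).
have -> : (\int[mu]_x `|(EFin \o f) x| = \int[mu]_(x in B) `|f x|%:E)%E.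
  rewrite [RHS]integral_mkcond; apply: eq_integral => x _; rewrite patchE/=.
  by case: ifPn => // /negP; rewrite inE => /hs ->; rewrite normr0.
have mnf : measurable_fun B (fun x => `|f x|%:E).
  by apply: measurable_funTS; apply/measurable_EFinP; exact: measurableT_comp.
case: p p1 Nf => [q q1||//].
  have q0 : 0 < q by rewrite (lt_le_trans ltr01).
  move=> /(Lnorm_finP _ q0) h.
  apply: (@le_lt_trans _ _ (\int[mu]_(x in B) (1 + (`|f x| `^ q)%:E))%E).
    apply: ge0_le_integral => //.
    - by apply: emeasurable_funD => //; apply: measurable_funTS; exact: measurable_normpow.
    - move=> x _; rewrite -EFinD lee_fin.
      have [h1|h1] := leP `|f x| 1; first by rewrite ler_wpDr ?powR_ge0.
      by rewrite ler_wpDl// le1r_powR// ltW.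
  rewrite ge0_integralD//; try by apply: measurable_funTS; exact: measurable_normpow.
  rewrite integral_cst// mul1e lte_add_pinfty// ?(qball_fin hX)//.
  apply: le_lt_trans h; apply: ge0_subset_integral => //.
  exact: measurable_normpow.
move=> _ /Lnorm_inftyP[M hM].
have M0 : 0 <= `|M| by [].
apply: (@le_lt_trans _ _ (`|M|%:E * mu B)%E); last first.
  by rewrite lte_mul_pinfty// (qball_fin hX).
rewrite -integral_cst//; apply: ae_ge0_le_integral => //.
by apply: ae_mono hM => x h _ /=; rewrite lee_fin (le_trans h)// ler_norm.
Qed.

Lemma bsL_indic p (A : set (Borel X)) x rho : (1 <= p)%E -> measurable A ->
  A `<=` qball d x rho -> bsL mu d p (\1_A).
Proof.
move=> p1 mA AB; apply: (@test_fun_bsL 1) => //; split.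
- exact: measurable_indic.
- by move=> y; rewrite indicE; case: (_ \in _); rewrite ?normr1 ?normr0.
- exists x, (Num.max rho 1); split; first by rewrite lt_max ltr01 orbT.
  move=> y ny; rewrite indicE memNset// => /AB h; apply: ny.
  by move: h; apply: (qball_le (d := d)); rewrite le_max lexx.
Qed.

Lemma bsL_restr p f (A : set (Borel X)) : (1 <= p)%E -> measurable A ->
  bsL mu d p f -> bsL mu d p (fun x => \1_A x * f x).
Proof.
move=> p1 mA hf; apply: (bsL_sub p1 hf); first by apply: measurable_funM => //; case: hf.
move=> x; rewrite normrM ler_piMl// indicE.
by case: (_ \in _); rewrite ?normr1 ?normr0.
Qed.

End FiniteNorms.

(** The integrals over [w <= N] increase to the full integral. An integrable weight is thus bounded
    up to an arbitrarily small part. *)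
Lemma integral_above_small dT (T : measurableType dT) (R : realType)
    (mu : {measure set T -> \bar R}) (A : set T) (w : T -> R) (e : R) :
  measurable A -> mu.-integrable A (EFin \o w) -> (forall x, 0 <= w x) -> 0 < e ->
  exists N : nat, (\int[mu]_(x in A `&` [set x | (N%:R < w x)%R]) (w x)%:E < e%:E)%E /\
    measurable (A `&` [set x | (N%:R < w x)%R]).
Proof.
move=> mA iw w0 e0.
have mwE := measurable_int _ iw; have mw : measurable_fun A w by exact/measurable_EFinP.
pose F n := A `&` [set x | w x <= n%:R].
have mF n : measurable (F n).
  rewrite /F (_ : [set x | _] = w @^-1` `]-oo, n%:R]); last first.
    by apply/seteqP; split => x /=; rewrite in_itv.
  by apply: mw => //; exact: measurable_itv.
have mG n : measurable (A `&` [set x | (n%:R < w x)%R]).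
  rewrite (_ : [set x | _] = w @^-1` `]n%:R, +oo[); last first.
    by apply/seteqP; split => x /=; rewrite in_itv/= andbT.
  by apply: mw => //; exact: measurable_itv.
have FA n : F n `<=` A by move=> x [].
have UF : \bigcup_n F n = A.
  apply/seteqP; split => [x [n _ []]//|x Ax]; exists (Num.bound (w x)) => //.
  by split => //=; rewrite ltW// archi_boundP.
have If : (\int[mu]_(x in A) (w x)%:E \is a fin_num)%E by exact: integrable_fin_num.
have split_int n : (\int[mu]_(x in A) (w x)%:E = \int[mu]_(x in F n) (w x)%:E +
     \int[mu]_(x in A `&` [set x | (n%:R < w x)%R]) (w x)%:E)%E.
  have AE : A = F n `|` (A `&` [set x | (n%:R < w x)%R]).
    rewrite /F -setIUr (_ : _ `|` _ = setT) ?setIT//.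
    by rewrite -subTset => x _ /=; case: (leP (w x) n%:R); [left|right].
  rewrite [in LHS]AE ge0_integral_setU//.
  - by rewrite -AE.
  - by move=> x _; rewrite lee_fin.
  - by apply/disj_setPS => x [[_ /= h] [_ /=]]; rewrite ltNge h.
apply: contrapT => /forallNP h.
have cv : (\int[mu]_(x in F n) (w x)%:E @[n --> \oo] --> \int[mu]_(x in A) (w x)%:E)%E.
  rewrite -UF; apply: ge0_nondecreasing_set_cvg_integral => //.
  - move=> n m nm; apply/subsetPset => x [Ax wx]; split => //=.
    by rewrite (le_trans wx)// ler_nat.
  - by move=> n; exact: measurable_funS mwE.
  - by move=> n x _; rewrite lee_fin.
have : (\int[mu]_(x in A) (w x)%:E <= \int[mu]_(x in A) (w x)%:E - e%:E)%E.
  apply: (@cvge_le _ _ _ _ _ _ _ _ cv); apply: nearW => n.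
  have := h n; move=> /not_andP[/negP|//]; rewrite -leNgt => hn.
  rewrite leeBrDr// [leRHS](split_int n) leeD2l//.
by rewrite leNgt lteBlDr// lteDl// lte_fin e0.
Qed.

(** * Weighted approximation by continuous functions of compact support *)

Section CcApproximation.
Context {R : realType} {X : ptopologicalType}.
Variables (mu : {measure set (Borel X) -> \bar R}) (d : X -> X -> R).
Variables (cd cmu : R) (hX : homogeneous_type mu d cd cmu).
Hypothesis hCc : Cc_dense_L1 mu.

(** Truncation to [[-M, M]], written with absolute values so that continuity is immediate. *)
Let clip (M t : R) : R := (`|t + M| - `|t - M|) / 2.

Let clip_le (M t : R) : 0 <= M -> `|clip M t| <= M.
Proof.
move=> M0; rewrite /clip normf_div (@ger0_norm _ 2)// ler_pdivrMr//.
have h : `| `|t + M| - `|t - M| | <= `|(t + M) - (t - M)| by exact: ler_dist_dist.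
apply: le_trans h _; rewrite (_ : _ - _ = M * 2); last lra.
by rewrite ger0_norm// mulr_ge0.
Qed.

Let clip_near (M t s : R) : `|s| <= M -> `|clip M t - s| <= `|t - s|.
Proof.
move=> sM; rewrite /clip; have [h1 h2] : - M <= s /\ s <= M by move: sM; rewrite ler_norml => /andP[].
by case: (ger0P (t + M)) => a; case: (ger0P (t - M)) => b;
  case: (ger0P (t - s)) => e; rewrite ler_norml; apply/andP; split; lra.
Qed.

(** An L^1 approximant of [s] is clipped at [M] and multiplied by a cutoff. Where [w] exceeds [N]
    the error is at most [2 * M] and the weight has small integral; elsewhere the weight costs a
    factor [N], chosen before the approximant. The radius of the support, [3 / 2 * cd * sa], is
    [3 * cd ^+ 2 * sa] divided by [2 * cd], the proportion in the Hörmander condition. *)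
Lemma Cc_approx (a : X) (sa M e : R) (s w : Borel X -> R) :
  0 < sa -> 0 < e -> test_fun d M s ->
  (forall x, ~ qball d a sa x -> s x = 0) ->
  (forall x, 0 <= w x) -> mu.-integrable (qball d a (3 / 2 * cd * sa)) (EFin \o w) ->
  exists u : X -> R, [/\ Cc u, forall x, `|u x| <= M,
    forall x, ~ qball d a (3 / 2 * cd * sa) x -> u x = 0,
    forall y, 3 * cd ^+ 2 * sa <= d a y -> ~ supp u y &
    (\int[mu]_(x in qball d a (3 / 2 * cd * sa)) (w x * `|u x - s x|)%:E < e%:E)%E].
Proof.
move=> sa0 e0 [ms sM bs] s0 w0 iw.
have cd0 := cd_gt0 hX; have cd1 := cd_ge1 hX.
pose A' : set (Borel X) := qball d a (3 / 2 * cd * sa); rewrite -/A' in iw *.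
have mA' : measurable (A' : set (Borel X)) by exact: (qball_measurable hX).
have M0 : 0 <= M by exact: le_trans (sM point).
have [eta [ceta eta01 eta1 eta0]] : exists eta : X -> R, [/\ continuous eta,
    forall x, 0 <= eta x <= 1, forall x, qball d a sa x -> eta x = 1 &
    forall x, (~` A') x -> eta x = 0].
  apply: (cutoff_exists hX (e := sa / 2)); first by rewrite divr_gt0.
  move=> x y; rewrite /qball/= => ax /negP; rewrite -leNgt => ay.
  have := qd_tri hX x a y => h; rewrite leNgt; apply/negP => xy.
  have : cd * (d a x + d x y) < cd * (sa + sa / 2) by rewrite ltr_pM2l// ltrD.
  by lra.
have e1 : 0 < e / (4 * M + 4) by rewrite divr_gt0//; lra.
have [N [hN mG]] := integral_above_small mA' iw w0 e1.
set G := A' `&` _ in hN mG.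
have is_ : mu.-integrable setT (EFin \o s).
  exact: (bsL_integrable hX (p := 1%E) _ (test_fun_bsL hX _ (And3 ms sM bs))).
have e2 : 0 < e / (2 * N.+1%:R) by rewrite divr_gt0// mulr_gt0.
have [g [cg compg] hg] := hCc is_ e2.
pose u x := eta x * clip M (g x).
have mg : measurable_fun setT (g : Borel X -> R) by exact: (continuous_borel cg).
have cu : continuous u.
  move=> x; apply: (@continuousM _ _ eta (fun x => clip M (g x))); first exact: ceta.
  rewrite /clip; apply: (@continuousM _ _ _ (cst 2^-1)); last exact: cvg_cst.
  apply: continuousB.
    apply: continuous_comp; last exact: norm_continuous.
    by apply: continuousD; [exact: cg|exact: cvg_cst].
  apply: continuous_comp; last exact: norm_continuous.
  by apply: continuousB; [exact: cg|exact: cvg_cst].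
have mu_ : measurable_fun setT (u : Borel X -> R) by exact: (continuous_borel cu).
have u_le x : `|u x| <= M.
  have /andP[h0 h1] := eta01 x; rewrite normrM ger0_norm// -[leRHS]mul1r.
  by apply: ler_pM => //; exact: clip_le.
have clip0 : clip M 0 = 0 by rewrite /clip add0r sub0r normrN subrr mul0r.
have u0 x : ~ A' x -> u x = 0 by move=> nA; rewrite /u eta0// mul0r.
have us x : `|u x - s x| <= `|s x - g x|.
  rewrite (distrC (s x)) /u; have [ax|nax] := pselect (qball d a sa x).
    by rewrite eta1// mul1r; exact: clip_near.
  rewrite s0// !subr0 normrM; have /andP[h0 h1] := eta01 x.
  rewrite ger0_norm// -[leRHS]mul1r; apply: ler_pM => //.
  by have := @clip_near M (g x) 0; rewrite !subr0 normr0; apply.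
have us2 x : `|u x - s x| <= 2 * M.
  by apply: le_trans (ler_normB _ _) _; have := u_le x; have := sM x; lra.
exists u; split => //.
- split => //; apply: (subclosed_compact _ compg); first exact: closed_closure.
  apply: closure_subset => x /=; apply: contra_neq => g0.
  by rewrite /u g0 clip0 mulr0.
- move=> y hy cy.
  have r0 : 0 < sa * cd by rewrite mulr_gt0.
  have [z /eqP uz yz] := closure_qball hX cy r0.
  have Az : A' z by apply: contrapT => /u0.
  have := qd_tri hX z a y; rewrite (qd_sym hX z) => h.
  move: Az; rewrite /A' /qball/= => az.
  have : cd * (d a z + d y z) < cd * (3 / 2 * cd * sa + sa * cd) by rewrite ltr_pM2l// ltrD.
  have : cd * (3 / 2 * cd * sa + sa * cd) <= 3 * cd ^+ 2 * sa.
    rewrite expr2; have : 0 <= cd * cd * sa by rewrite !mulr_ge0// ltW.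
    by lra.
  by lra.
- apply: (@le_lt_trans _ _ (\int[mu]_(x in A')
      ((N%:R * `|s x - g x|)%:E + (2 * M * (\1_G x * w x))%:E))%E).
    have mw : measurable_fun A' w by move/integrableP: iw => [/measurable_EFinP].
    apply: ge0_le_integral => //.
    + by move=> x _; rewrite lee_fin mulr_ge0.
    + apply/measurable_EFinP; apply: measurable_funM => //.
      apply: measurableT_comp => //; apply: measurable_funTS.
      exact: measurable_funB.
    + apply: emeasurable_funD; apply/measurable_EFinP.
        apply: measurable_funM => //; apply: measurableT_comp => //.
        by apply: measurable_funTS; exact: measurable_funB.
      apply: measurable_funM => //; apply: measurable_funM => //.
    + move=> x Ax; rewrite -EFinD lee_fin indicE.
      have [h|h] := leP (w x) N%:R.
        apply: (@le_trans _ _ (N%:R * `|s x - g x|)).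
          by apply: ler_pM.
        rewrite lerDl !mulr_ge0//; by case: (_ \in _).
      rewrite mem_set//= mul1r; apply: (@le_trans _ _ (2 * M * w x)).
        by rewrite mulrC ler_wpM2r.
      by rewrite lerDr mulr_ge0.
  have mw : measurable_fun A' w by move/integrableP: iw => [/measurable_EFinP].
  have m1 : measurable_fun A' (fun x => (N%:R * `|s x - g x|)%:E).
    apply/measurable_EFinP; apply: measurable_funM => //; apply: measurableT_comp => //.
    by apply: measurable_funTS; exact: measurable_funB.
  have m3 : measurable_fun A' (fun x => (\1_G x * w x)%:E).
    by apply/measurable_EFinP; apply: measurable_funM.
  have m2 : measurable_fun A' (fun x => (2 * M * (\1_G x * w x))%:E).
    apply/measurable_EFinP; apply: measurable_funM => //; exact/measurable_EFinP.
  have p3 x : (0 <= (\1_G x * w x)%:E)%E by rewrite lee_fin mulr_ge0//; case: (_ \in _).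
  have p2 x : (0 <= (2 * M * (\1_G x * w x))%:E)%E.
    by rewrite lee_fin mulr_ge0 ?mulr_ge0//; case: (_ \in _).
  have p1 x : (0 <= (N%:R * `|s x - g x|)%:E)%E by rewrite lee_fin mulr_ge0.
  rewrite ge0_integralD//.
  have -> : e%:E = ((e / 2)%:E + (e / 2)%:E)%E by rewrite -EFinD; congr EFin; lra.
  apply: (@le_lt_trans _ _ ((e / 2)%:E + \int[mu]_(x in A') (2 * M * (\1_G x * w x))%:E)%E).
    apply: leeD2r; under eq_integral do rewrite EFinM.
    have mD : measurable_fun setT (fun x : Borel X => `|s x - g x|%:E).
      by apply/measurable_EFinP; apply: measurableT_comp => //; exact: measurable_funB.
    rewrite ge0_integralZl//; last exact: measurable_funTS.
    apply: (@le_trans _ _ (N%:R%:E * (e / (2 * N.+1%:R))%:E)%E).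
      apply: lee_wpmul2l => //; apply: le_trans (ltW hg).
      exact: ge0_subset_integral.
    rewrite -EFinM lee_fin.
    have -> : N%:R * (e / (2 * N.+1%:R)) = e / 2 * (N%:R / N.+1%:R).
      by field; rewrite nat1r pnatr_eq0.
    by rewrite ler_piMr ?divr_ge0 ?(ltW e0)// ler_pdivrMr// mul1r ler_nat.
  + rewrite lteD2lE//; under eq_integral do rewrite EFinM.
    rewrite ge0_integralZl//; last by rewrite lee_fin mulr_ge0.
    have -> : (\int[mu]_(x in A') (\1_G x * w x)%:E = \int[mu]_(x in G) (w x)%:E)%E.
      have GA : G = A' `&` G by rewrite setIC; apply/esym/setIidl => x [].
      rewrite [in RHS]GA [RHS]integral_mkcondr; apply: eq_integral => x _.
      by rewrite patchE indicE; case: (_ \in _); rewrite ?mul1r ?mul0r.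
    apply: (@le_lt_trans _ _ ((2 * M)%:E * (e / (4 * M + 4))%:E)%E).
      by apply: lee_wpmul2l; [rewrite lee_fin mulr_ge0|exact: ltW].
    rewrite -EFinM lte_fin mulrA ltr_pdivrMr; last lra.
    by lra.
Qed.
End CcApproximation.

(** * Kernels *)

Lemma countable_bigcup_measurable dT (T : measurableType dT) (I : Type) (S : set I)
    (F : I -> set T) : countable S -> (forall i, S i -> measurable (F i)) ->
  measurable (\bigcup_(i in S) F i).
Proof.
move=> cS mF; have [f /= hf] := countable_injP _ cS.
have -> : \bigcup_(i in S) F i =
    \bigcup_n \bigcup_(i in [set i | S i /\ f i = n]) F i.
  apply/seteqP; split => [x [i Si Fx]|x [n _ [i [Si _] Fx]]]; last by exists i.
  by exists (f i) => //; exists i.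
apply: bigcup_measurable => n _.
have [[i [Si fi]]|h] := pselect (exists i, S i /\ f i = n).
  rewrite (_ : [set i | _] = [set i]); first by rewrite bigcup_set1; exact: mF.
  apply/seteqP; split => [k [Sk fk]|k ->//].
  by apply: hf; rewrite ?inE// fk.
by rewrite (_ : [set i | _] = set0) ?bigcup_set0// -subset0 => i hi; apply: h; exists i.
Qed.

Section SigmaFiniteAlias.
Context dT (T : measurableType dT) (R : realType) (m : {measure set T -> \bar R}).
Hypothesis sfm : sigma_finite setT m.

(** The alias attaches to a measure the sigma-finite structure on which Tonelli's theorem is stated,
    out of the proof [sfm]. *)
Definition sigma_finite_alias of sigma_finite setT m : set T -> \bar R := m.
Local Notation ms := (sigma_finite_alias sfm).
HB.instance Definition _ := Measure.copy ms m.
HB.instance Definition _ := Measure_isSigmaFinite.Build _ _ _ ms sfm.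
End SigmaFiniteAlias.

Section Tonelli.
Context {R : realType} {X : ptopologicalType}.
Variables (mu : {measure set (Borel X) -> \bar R}) (d : X -> X -> R).
Variables (cd cmu : R) (hX : homogeneous_type mu d cd cmu).
Variable (f : Borel X * Borel X -> \bar R).
Hypotheses (mf : measurable_fun setT f) (f0 : forall z, (0 <= f z)%E).

Local Notation mus := (sigma_finite_alias (mu_sigma_finite hX)).

Lemma tonelli : (\int[mu]_x \int[mu]_y f (x, y) = \int[mu]_y \int[mu]_x f (x, y))%E.
Proof. exact: (@fubini_tonelli _ _ _ _ _ mus mus f mf f0). Qed.

Lemma tonelli_measurable1 : measurable_fun setT (fun x => \int[mu]_y f (x, y))%E.
Proof. exact: (@measurable_fun_fubini_tonelli_F _ _ _ _ _ mus f mf f0). Qed.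

Lemma tonelli_measurable2 : measurable_fun setT (fun y => \int[mu]_x f (x, y))%E.
Proof. exact: (@measurable_fun_fubini_tonelli_G _ _ _ _ _ mus f mf f0). Qed.
End Tonelli.

Lemma avgnorm_ge0 (R : realType) (X : ptopologicalType)
    (mu : {measure set (Borel X) -> \bar R}) p (Q : set (Borel X)) g :
  (0 <= avgnorm mu p Q g)%E.
Proof. by case: p => [q||]; [exact: poweR_ge0|exact: Lnorm_ge0|exact: Lnorm_ge0]. Qed.

(** * The dual exponent and Hölder's inequality for averages *)

Section DualExponent.
Context {R : realType} {X : ptopologicalType}.
Variables (mu : {measure set (Borel X) -> \bar R}).
Variables (r : \bar R) (hr : (1 < r)%E).

(** The dual exponent as a real number: [1 < r] makes it finite, and 1 is its value at [r = +oo]. *)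
Definition dualp : R := if r is q%:E then q / (q - 1) else 1.

Lemma dualp_ge1 : 1 <= dualp.
Proof.
rewrite /dualp; case: r hr => [q||]//; rewrite lte_fin => q1.
by rewrite ler_pdivlMr ?subr_gt0// mul1r gerBl.
Qed.

Lemma dualp_gt0 : 0 < dualp. Proof. exact: lt_le_trans dualp_ge1. Qed.

(** The hypothesis bounds an average of [h], so the right-hand side is [L] times a single term of
    the Hörmander sum, for finite and infinite [r] alike. *)
Lemma avg_hoelder (B : set (Borel X)) (phi h : Borel X -> R) (L : R) :
  measurable B -> (0 < mu B)%E -> (mu B < +oo)%E -> measurable_fun setT phi ->
  measurable_fun setT h -> 0 <= L ->
  (\int[mu]_(y in B) (`|h y| `^ dualp)%:E <= (L `^ dualp)%:E * mu B)%E ->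
  (\int[mu]_(y in B) (`|phi y| * `|h y|)%:E <= L%:E * (mu B * avgnorm mu r B phi))%E.
Proof.
move=> mB B0 Bf mphi mh L0; have := dualp_gt0; rewrite /dualp.
have Bfn : mu B \is a fin_num by rewrite ge0_fin_numE.
case: r hr => [q||]// hr' p0 hL; last first.
  have hL' : (\int[mu]_(y in B) `|h y|%:E <= L%:E * mu B)%E.
    move: hL; under eq_integral do rewrite powRr1//.
    by rewrite powRr1.
  rewrite /avgnorm; set N := Lnorm _ _ _.
  have N0 : (0 <= N)%E by exact: Lnorm_ge0.
  apply: (@le_trans _ _ (N * \int[mu]_(y in B) `|h y|%:E)%E); last first.
    by rewrite (muleC (mu B)) [leRHS]muleCA; exact: lee_wpmul2l.
  have mnh : measurable_fun B (fun y => `|h y|%:E).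
    by apply: measurable_funTS; apply/measurable_EFinP; exact: measurableT_comp.
  rewrite -ge0_integralZl//; apply: ae_ge0_le_integral => //.
  - apply: measurable_funTS; apply/measurable_EFinP; apply: measurable_funM; exact: measurableT_comp.
  - by move=> y _; rewrite mule_ge0.
  - exact: measurable_funeM.
  have : {ae mu, forall x, (`|(\1_B x * phi x)%:E| <= N)%E}.
    rewrite /N unlock /=; case: ifPn => [_|]; first exact: (ess_sup_ge mu).
    move=> /negP; rewrite (lt_le_trans B0)//.
    by apply: le_measure; rewrite ?inE.
  apply: ae_mono => x; rewrite /= indicE => hx Bx.
  rewrite EFinM; apply: lee_wpmul2r => //.
  by move: hx; rewrite mem_set//= mul1r.
move: hr'; rewrite lte_fin => q1; have q0 : 0 < q by exact: lt_trans q1.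
set p := q / (q - 1) in p0 hL *.
have q10 : q - 1 != 0 by rewrite gt_eqF// subr_gt0.
have pq : q^-1 + p^-1 = 1 by rewrite /p; field; rewrite q10 gt_eqF.
have m0 : 0 < fine (mu B) by rewrite -lte_fin fineK.
pose f1 (y : Borel X) := phi y * \1_B y; pose g1 (y : Borel X) := h y * \1_B y.
have mf1 : measurable_fun setT f1 by apply: measurable_funM => //; exact: measurable_indic.
have mg1 : measurable_fun setT g1 by apply: measurable_funM => //; exact: measurable_indic.
have := hoelder mu mf1 mg1 q0 p0 pq; rewrite Lnorm1.
have restr (v w : Borel X -> R) : (forall y, w y = v y * \1_B y) -> forall s : R, 0 < s ->
    (\int[mu]_x `|(EFin \o w) x| `^ s = \int[mu]_(y in B) (`|v y| `^ s)%:E)%E.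
  move=> wE s s0; rewrite [RHS]integral_mkcond; apply: eq_integral => y _.
  rewrite patchE /= wE indicE; case: (_ \in _); first by rewrite mulr1.
  by rewrite mulr0 normr0 powR0// gt_eqF.
have -> : (\int[mu]_x `|(EFin \o (f1 \* g1)%R) x| = \int[mu]_(y in B) (`|phi y| * `|h y|)%:E)%E.
  rewrite [RHS]integral_mkcond; apply: eq_integral => y _.
  rewrite patchE /= /f1 /g1 indicE; case: (_ \in _); first by rewrite !mulr1 normrM.
  by rewrite !mulr0 normr0.
move=> hoel; apply: le_trans hoel _.
rewrite unlock /= (restr phi f1)// (restr h g1)//.
set a := (\int[mu]_(y in B) (`|phi y| `^ q)%:E)%E.
have a0 : (0 <= a)%E by apply: integral_ge0 => y _; rewrite lee_fin powR_ge0.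
apply: (@le_trans _ _ (a `^ q^-1 * ((L `^ p)%:E * mu B) `^ p^-1)%E).
  apply: lee_wpmul2l; first exact: poweR_ge0.
  apply: gt0_ler_poweR; last exact: hL.
  - by rewrite invr_ge0 ltW.
  - rewrite in_itv/= leey andbT.
    by apply: integral_ge0 => y _; rewrite lee_fin powR_ge0.
  - by rewrite in_itv/= leey andbT mule_ge0// lee_fin powR_ge0.
rewrite /avgnorm -/a poweRM// ?lee_fin ?invr_ge0 ?powR_ge0 ?fine_ge0//.
rewrite poweRM ?lee_fin ?powR_ge0// -(fineK Bfn) !poweR_EFin -powRrM divff ?gt_eqF// powRr1//.
set m := fine (mu B) in m0 *.
rewrite muleCA; apply: lee_wpmul2l; first by rewrite lee_fin.
rewrite [leRHS]muleA -EFinM [leLHS]muleC; apply: lee_wpmul2r; first exact: poweR_ge0.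
rewrite lee_fin -(powR_inv1 (ltW m0)) -powRrM mulN1r powRN.
rewrite ler_pdivlMr ?powR_gt0// -powRD; last by rewrite (gt_eqF m0) implybT.
by rewrite addrC pq powRr1// ltW.
Qed.

End DualExponent.

(** * Hörmander's condition as an integral over the complement of a ball *)

Section HormanderAnnuli.
Context {R : realType} {X : ptopologicalType}.
Variables (mu : {measure set (Borel X) -> \bar R}) (d : X -> X -> R).
Variables (cd cmu : R) (hX : homogeneous_type mu d cd cmu).
Variables (c0 C0 delta : R) (hc0 : 0 < c0 <= C0) (hdelta : 0 < delta < 1).
Variables (D : set (cube X)) (hD : dyadic_system d c0 C0 delta D).

Let offdiag : set (Borel X * Borel X) := [set z | z.1 <> z.2].

(** Measurability is needed in the product sigma-algebra. Distinct points lie in distinct cubes of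
    some fine generation, so the set is a countable union of products of disjoint cubes. *)
Lemma offdiag_set_measurable : measurable offdiag.
Proof.
have -> : offdiag = \bigcup_(PQ in [set PQ : cube X * cube X | [/\ D PQ.1, D PQ.2,
    generation PQ.1 = generation PQ.2 & PQ.1 <> PQ.2]]) (carrier PQ.1 `*` carrier PQ.2).
  apply/seteqP; split => [[x y] /= xy|[x y] [[P Q] /= [DP DQ g ne]] [/= Px Qy] /= xy].
    have dxy : 0 < d x y.
      by rewrite lt_neqAle (qd_ge0 hX) andbT; apply/eqP => /esym/(qm_eq0 (ht_quasimetric hX)).
    have c0' : 0 < 2 * cd * C0 by rewrite !mulr_gt0// ?(cd_gt0 hX)// (C0_gt0 hc0).
    have [l [_ hl]] := dpow_small_from hdelta 0 (divr_gt0 dxy c0').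
    exists (cub hD l x, cub hD l y); last by split; exact: cub_in.
    split; rewrite /= ?gen_cub//; do ?exact: cub_D.
    move=> e; have := cube_outer2 hX hD (cub_D hD l x) (cub_in hD l x).
    move=> /(_ y); rewrite {1}e => /(_ (cub_in hD l y)); rewrite gen_cub.
    by move: hl; rewrite ltr_pdivlMr// mulrC => /lt_trans h /h; rewrite ltxx.
  apply: ne; have e : x = y by exact: xy.
  by apply: (cube_eq hD DP DQ g (x := y)) => //; rewrite -e.
apply: countable_bigcup_measurable; last first.
  by move=> [P Q] [/= DP DQ _ _]; apply: measurableX; exact: (cube_measurable hD).
have cD := countable_D hX hc0 hdelta hD.
apply: (@sub_countable _ _ _ (D `*` D)); last exact: countableX.
by apply: subset_card_le => -[P Q] [].
Qed.

Variables (K : Borel X -> Borel X -> R).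
Hypothesis mK : offdiag_measurable K.

Definition K0 (z : Borel X * Borel X) : R := ((fun z => K z.1 z.2) \_ offdiag) z.

Lemma K0E x y : x <> y -> K0 (x, y) = K x y.
Proof. by move=> xy; rewrite /K0 patchE mem_set. Qed.

Lemma K0_measurable : measurable_fun setT K0.
Proof. by apply/(measurable_restrictT _ _).1; [exact: offdiag_set_measurable|exact: mK]. Qed.

(** [good] and [hold] stand for a Hölder inequality, so that one proof serves both for H_r with
    L^(r') growth of [h] and for H_1 of the transpose with a uniform bound. The complement of the
    ball is cut into annuli; x and z are inside the ball, so the diagonal is never met. *)
Lemma hormander_annuli (r : \bar R)
    (good : set (Borel X) -> (Borel X -> R) -> R -> Prop)
    (hold : forall (B : set (Borel X)) (phi h : Borel X -> R) (L : R),
      measurable B -> (0 < mu B)%E -> (mu B < +oo)%E -> measurable_fun setT phi ->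
      measurable_fun setT h -> 0 <= L -> good B h L ->
      (\int[mu]_(y in B) (`|phi y| * `|h y|)%:E <= L%:E * (mu B * avgnorm mu r B phi))%E)
    (k : Borel X -> Borel X -> R) (k0 : Borel X * Borel X -> R) :
  (forall x y, x <> y -> k0 (x, y) = k x y) -> measurable_fun setT k0 ->
  hormander mu d cd r k ->
  exists2 H : R, 0 <= H & forall x0 rho x z (h : Borel X -> R) (L : R), 0 < rho ->
    qball d x0 (rho / (2 * cd)) x -> qball d x0 (rho / (2 * cd)) z ->
    measurable_fun setT h -> 0 <= L ->
    (forall i, good (qball d x0 (2 ^+ i.+1 * rho)) h L) ->
    (\int[mu]_(y in ~` qball d x0 rho) (`|k0 (x, y) - k0 (z, y)| * `|h y|)%:E <=
      (L * H)%:E)%E.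
Proof.
move=> k0E mk0; rewrite /hormander; set S := ereal_sup _ => Sfin.
have avg0 B phi : (0 <= avgnorm mu r B phi)%E := avgnorm_ge0 mu r B phi.
have S0 : (0 <= S)%E.
  have z0 : qball d point (1 / (2 * cd)) point.
    by apply: (qball_center hX); rewrite divr_gt0// mulr_gt0// (cd_gt0 hX).
  apply: le_trans (ereal_sup_ubound (x := hormander_sum mu d r k point 1 point point) _).
    by apply: nneseries_ge0 => n _ _; rewrite mule_ge0.
  by exists point, 1, point, point.
exists (fine S); first by rewrite fine_ge0.
move=> x0 rho x z h L rho0 xB zB mh L0 hL.
have cd0 := cd_gt0 hX; have cd1 := cd_ge1 hX.
have hS : (hormander_sum mu d r k x0 rho x z <= S)%E.
  by apply: ereal_sup_ubound; exists x0, rho, x, z.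
have B0 : qball d x0 (rho / (2 * cd)) `<=` qball d x0 rho.
  apply: (qball_le (d := d)); rewrite ler_pdivrMr ?mulr_gt0// ler_peMr ?ltW//; lra.
pose Bn n : set (Borel X) := qball d x0 (2 ^+ n * rho).
have mBn n : measurable (Bn n) by exact: (qball_measurable hX).
pose An n : set (Borel X) := Bn n.+1 `\` Bn n.
have mAn n : measurable (An n) by exact: measurableD.
have Bmono n m : (n <= m)%N -> Bn n `<=` Bn m.
  move=> nm; apply: (qball_le (d := d)); rewrite ler_pM2r// ler_eXn2l//; lra.
have UA : ~` qball d x0 rho = \bigcup_n An n.
  apply/seteqP; split => [y ny|y [n _ [_ nB]] yB]; last first.
    by apply: nB; apply: (Bmono 0%N) => //; rewrite /Bn expr0 mul1r.
  have ex : exists n, `[< Bn n y >].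
    exists (Num.bound (d x0 y / rho)); apply/asboolP; rewrite /Bn /qball/=.
    by rewrite -ltr_pdivrMr// upper_nthrootP.
  case: (ex_minnP ex) => -[|n] /asboolP yB hn.
    by case: ny; move: yB; rewrite /Bn expr0 mul1r.
  exists n => //; split => // yn; have /hn : `[< Bn n y >] by apply/asboolP.
  by rewrite ltnn.
have tA : trivIset setT An.
  apply/trivIsetP => n m _ _; wlog nm : n m / (n < m)%N.
    move=> W; rewrite neq_ltn => /orP[nm|mn]; first by apply: W => //; rewrite neq_ltn nm.
    by rewrite setIC; apply: W => //; rewrite neq_ltn mn.
  move=> _; rewrite -subset0 => y [[yn _] [_ ym]]; apply: ym; exact: (Bmono n.+1).
have ms u : measurable_fun setT (fun y : Borel X => k0 (u, y)).
  exact: measurable_fun_pair2.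
have mI : measurable_fun setT (fun y : Borel X => (`|k0 (x, y) - k0 (z, y)| * `|h y|)%:E).
  apply/measurable_EFinP; apply: measurable_funM; apply: measurableT_comp => //.
  exact: measurable_funB.
rewrite UA ge0_integral_bigcup//; last exact: measurable_funTS.
apply: (@le_trans _ _ (L%:E * hormander_sum mu d r k x0 rho x z)%E); last first.
  rewrite EFinM fineK ?ge0_fin_numE//; apply: lee_wpmul2l => //.
rewrite /hormander_sum -nneseriesZl; last by move=> i _; rewrite mule_ge0.
(* The Hörmander sum starts at 1 while the annuli are numbered from 0. *)
rewrite -(nneseries_addn 1 (f := fun k => _)); last by move=> i; rewrite mule_ge0// mule_ge0.
apply: lee_nneseries => [n _ _|n _]; first exact: integral_ge0.
rewrite addn1/=; pose phi (y : Borel X) := (k x y - k z y) * \1_(An n) y.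
have phiE y : phi y = (k0 (x, y) - k0 (z, y)) * \1_(An n) y.
  rewrite /phi indicE; case: (boolP (_ \in _)) => [|_]; last by rewrite !mulr0.
  rewrite inE => -[_ yn]; have nB : ~ qball d x0 rho y.
    by move=> yB; apply: yn; apply: (Bmono 0%N n) => //; rewrite /Bn expr0 mul1r.
  by rewrite !k0E//; [move=> e; apply: nB; rewrite -e; exact: B0..].
have mphi : measurable_fun setT phi.
  rewrite (_ : phi = fun y => (k0 (x, y) - k0 (z, y)) * \1_(An n) y); last exact/funext.
  apply: measurable_funM; [exact: measurable_funB|exact: measurable_indic].
have r1 : 0 < 2 ^+ n.+1 * rho by rewrite mulr_gt0// exprn_gt0.
have := hold _ phi h L (mBn n.+1) (qball_gt0 hX x0 r1) (qball_fin hX _ _) mphi mh L0 (hL n).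
apply: le_trans.
have mph : measurable_fun setT (fun y : Borel X => (`|phi y| * `|h y|)%:E).
  by apply/measurable_EFinP; apply: measurable_funM; exact: measurableT_comp.
rewrite (_ : (\int[mu]_(y in An n) _)%E = (\int[mu]_(y in An n) (`|phi y| * `|h y|)%:E)%E).
  apply: ge0_subset_integral => //; last by move=> y [].
  - exact: measurable_funTS.
by apply: eq_integral => y yA; rewrite phiE indicE yA mulr1.
Qed.

End HormanderAnnuli.

Section IndicatorIntegrals.
Context dT {T : measurableType dT} {R : realType}.
Variable mu : {measure set T -> \bar R}.
Implicit Types (A : set T) (g : T -> R).

Lemma integral_indicM A g :
  (\int[mu]_x (\1_A x * g x)%:E = \int[mu]_(x in A) (g x)%:E)%E.
Proof.
rewrite [RHS]integral_mkcond; apply: eq_integral => x _.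
by rewrite patchE indicE; case: (_ \in _); rewrite ?mul1r ?mul0r.
Qed.

Lemma Rintegral_indicM A g : \int[mu]_x (\1_A x * g x) = \int[mu]_(x in A) g x.
Proof. by rewrite /Rintegral integral_indicM. Qed.

Lemma integrable_indicM A g : measurable A ->
  mu.-integrable setT (fun x => (\1_A x * g x)%:E) <-> mu.-integrable A (EFin \o g).
Proof.
move=> mA; rewrite (_ : (fun x => _) = (EFin \o g) \_ A); last first.
  apply/funext => x; rewrite patchE indicE.
  by case: (_ \in _); rewrite ?mul1r ?mul0r.
by split; rewrite -integrable_mkcond.
Qed.

Lemma Rintegral_ae_eq A f g : measurable A -> measurable_fun A f -> measurable_fun A g ->
  {ae mu, forall x, A x -> f x = g x} -> \int[mu]_(x in A) f x = \int[mu]_(x in A) g x.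
Proof.
move=> mA mf mg fg; rewrite /Rintegral; congr fine.
apply: ae_eq_integral => //; [exact/measurable_EFinP|exact/measurable_EFinP|].
by apply: ae_mono fg => x h Ax; rewrite /= h.
Qed.

Lemma abs_Rintegral_le A f : measurable A -> mu.-integrable A (EFin \o f) ->
  (`|\int[mu]_(x in A) f x|%:E <= \int[mu]_(x in A) `|f x|%:E)%E.
Proof.
move=> mA fi; rewrite EFin_normr_Rintegral//.
have mf := measurable_int _ fi.
exact: le_abse_integral.
Qed.

Lemma ge0_le_integral' A (f g : T -> \bar R) : measurable A ->
  (forall x, A x -> (0 <= f x)%E) -> measurable_fun A f -> measurable_fun A g ->
  (forall x, A x -> (f x <= g x)%E) ->
  (\int[mu]_(x in A) f x <= \int[mu]_(x in A) g x)%E.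
Proof. by move=> mA f0 mf mg fg; exact: ge0_le_integral. Qed.

End IndicatorIntegrals.

Section ProductMeasurability.
Context {R : realType} {X : ptopologicalType}.
Implicit Types (g : Borel X -> R).

Lemma measurable_comp_fst g : measurable_fun setT g ->
  measurable_fun setT (fun z : Borel X * Borel X => g z.1).
Proof. by move=> mg; exact: (measurableT_comp mg measurable_fst). Qed.

Lemma measurable_comp_snd g : measurable_fun setT g ->
  measurable_fun setT (fun z : Borel X * Borel X => g z.2).
Proof. by move=> mg; exact: (measurableT_comp mg measurable_snd). Qed.
End ProductMeasurability.

(** * Kernel formulas for bounded functions *)

Section KernelRepresentation.
Context {R : realType} {X : ptopologicalType}.
Variables (mu : {measure set (Borel X) -> \bar R}) (d : X -> X -> R).
Variables (cd cmu : R) (hX : homogeneous_type mu d cd cmu).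
Hypothesis hCc : Cc_dense_L1 mu.
Variables (r : \bar R) (hr : (1 < r)%E) (K : Borel X -> Borel X -> R).
Variables (T Ts : (Borel X -> R) -> (Borel X -> R)).
Hypothesis hT : linear_operator mu d r T.
Hypothesis hTs : linear_operator mu d +oo%E Ts.
Hypothesis hass : associated_kernel mu Ts (transpose K).
Hypothesis hadj : adjoint_operators mu d r +oo%E T Ts.
Variable (k0 : Borel X * Borel X -> R).
Hypotheses (k0E : forall x y, x <> y -> k0 (x, y) = K x y)
  (mk0 : measurable_fun setT k0).
Variables (Hr H1 : R).
Local Notation p := (dualp r).
Hypothesis Hr0 : 0 <= Hr.
Hypothesis HR : forall x0 rho x z (h : Borel X -> R) (L : R), 0 < rho ->
    qball d x0 (rho / (2 * cd)) x -> qball d x0 (rho / (2 * cd)) z ->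
    measurable_fun setT h -> 0 <= L ->
    (forall i, (\int[mu]_(y in qball d x0 (2 ^+ i.+1 * rho)) (`|h y| `^ p)%:E <=
       (L `^ p)%:E * mu (qball d x0 (2 ^+ i.+1 * rho)))%E) ->
    (\int[mu]_(y in ~` qball d x0 rho) (`|k0 (x, y) - k0 (z, y)| * `|h y|)%:E <=
      (L * Hr)%:E)%E.
Hypothesis HH1 : forall y0 rho y z, 0 < rho ->
    qball d y0 (rho / (2 * cd)) y -> qball d y0 (rho / (2 * cd)) z ->
    (\int[mu]_(x in ~` qball d y0 rho) `|k0 (x, y) - k0 (x, z)|%:E <= H1%:E)%E.

Let cd0 := cd_gt0 hX.
Let cd1 := cd_ge1 hX.
Let r1 : (1 <= r)%E. Proof. exact: ltW. Qed.
Let i1 : (1 <= +oo :> \bar R)%E. Proof. exact: leey. Qed.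

Lemma mk0x (x : Borel X) : measurable_fun setT (fun y : Borel X => k0 (x, y)).
Proof. exact: measurable_fun_pair2. Qed.
Lemma mk0y (y : Borel X) : measurable_fun setT (fun x : Borel X => k0 (x, y)).
Proof. exact: measurable_fun_pair1. Qed.

Lemma HRone x0 rho x z : 0 < rho ->
    qball d x0 (rho / (2 * cd)) x -> qball d x0 (rho / (2 * cd)) z ->
    (\int[mu]_(y in ~` qball d x0 rho) `|k0 (x, y) - k0 (z, y)|%:E <= Hr%:E)%E.
Proof.
move=> r0 hx hz; have := @HR x0 rho x z (cst 1) 1 r0 hx hz (measurable_cst _) ler01.
rewrite mul1r /= => h; under eq_integral => y _ do rewrite -[`|_ - _|]mulr1 -[X in _ * X]normr1.
apply: h => i; rewrite -integral_cst; last exact: (qball_measurable hX).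
by rewrite normr1.
Qed.

Lemma test_dual h M s : bsL mu d r h -> test_fun d M s ->
  [/\ mu.-integrable setT (fun x => (T h x * s x)%:E),
      mu.-integrable setT (fun x => (h x * Ts s x)%:E) &
      \int[mu]_x (T h x * s x) = \int[mu]_x (h x * Ts s x)].
Proof. by move=> hh ts; apply: hadj => //; exact: (test_fun_bsL hX i1 ts). Qed.

Lemma test_Ts_measurable M s : test_fun d M s -> measurable_fun setT (Ts s).
Proof. by move=> ts; apply: hTs.1; exact: (test_fun_bsL hX i1 ts). Qed.

Lemma Tmeas h : bsL mu d r h -> measurable_fun setT (T h).
Proof. exact: hT.1. Qed.

Lemma param_Rintegral_measurable (f : Borel X * Borel X -> R) : measurable_fun setT f ->
  measurable_fun setT (fun y : Borel X => \int[mu]_x f (x, y)).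
Proof.
move=> mf; pose fE z := (f z)%:E; have mfE : measurable_fun setT fE by exact/measurable_EFinP.
apply: (@measurableT_comp _ _ _ _ _ _ (@fine R)); first exact: fine_measurable.
rewrite (_ : (fun y => _) = (fun y => \int[mu]_x fE^\+ (x, y) - \int[mu]_x fE^\- (x, y))%E).
  apply: emeasurable_funB; apply: (tonelli_measurable2 hX).
  - exact: measurable_funepos.
  - by move=> z; exact: funepos_ge0.
  - exact: measurable_funeneg.
  - by move=> z; exact: funeneg_ge0.
apply/funext => y; rewrite /= integralE.
by congr (_ - _)%E; apply: eq_integral => x _; rewrite /= ?funeposE ?funenegE.
Qed.

Section Pieces.
Variables (a b : X) (sa sb : R) (F : set (Borel X)).
Hypotheses (sa0 : 0 < sa) (sb0 : 0 < sb) (mF : measurable F) (F0 : (0 < mu F)%E).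
Hypothesis Fb : F `<=` qball d b sb.
Hypothesis Fa : forall y, F y -> 3 * cd ^+ 2 * sa <= d a y.
Let A : set (Borel X) := qball d a sa.
Let A' : set (Borel X) := qball d a (3 / 2 * cd * sa).
Hypothesis A'b : forall x, A' x -> 2 * cd * sb <= d b x.

Let mA : measurable A. Proof. exact: (qball_measurable hX). Qed.
Let mA' : measurable A'. Proof. exact: (qball_measurable hX). Qed.
Let AA' : A `<=` A'.
Proof.
apply: (qball_le (d := d)); rewrite ler_peMl ?ltW//; have : 1 <= cd := cd1; lra.
Qed.
Let muF : (mu F < +oo)%E.
Proof. by apply: le_lt_trans (le_qball hX mF Fb) _; exact: (qball_fin hX). Qed.
Let muA' : (mu A' < +oo)%E. Proof. exact: (qball_fin hX). Qed.
Let rho0 : 0 < 3 * cd ^+ 2 * sa.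
Proof. by rewrite !mulr_gt0// exprn_gt0. Qed.
Let rhoE : 3 * cd ^+ 2 * sa / (2 * cd) = 3 / 2 * cd * sa.
Proof. by field; rewrite gt_eqF. Qed.

(** [F] avoids the ball of radius [3 * cd ^+ 2 * sa] about [a], and [A'] is its contraction by
    [2 * cd], so H_r applies. The hypothesis on [A'] gives the symmetric estimate in the other
    variable. *)
Lemma piece_diff_F x z : A' x -> A' z ->
  (\int[mu]_(y in F) `|k0 (x, y) - k0 (z, y)|%:E <= Hr%:E)%E.
Proof.
move=> Ax Az; apply: le_trans (HRone rho0 (x := x) (z := z) (x0 := a) _ _).
- apply: ge0_subset_integral => //; first exact: measurableC (qball_measurable hX _ _).
  + apply: measurable_funTS; apply/measurable_EFinP; apply: measurableT_comp => //.
    by apply: measurable_funB; exact: mk0x.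
  + by move=> y Fy /=; rewrite /qball/=; apply/negP; rewrite -leNgt; exact: Fa.
- by rewrite rhoE.
- by rewrite rhoE.
Qed.

Lemma piece_diff_A y z : F y -> F z ->
  (\int[mu]_(x in A') `|k0 (x, y) - k0 (x, z)|%:E <= H1%:E)%E.
Proof.
move=> Fy Fz; have e : 2 * cd * sb / (2 * cd) = sb by field; rewrite gt_eqF.
apply: le_trans (HH1 (rho := 2 * cd * sb) (y0 := b) (y := y) (z := z) _ _ _).
- apply: ge0_subset_integral => //; first exact: measurableC (qball_measurable hX _ _).
  + apply: measurable_funTS; apply/measurable_EFinP; apply: measurableT_comp => //.
    by apply: measurable_funB; exact: mk0y.
  + by move=> x Ax /=; rewrite /qball/=; apply/negP; rewrite -leNgt; exact: A'b.
- by rewrite !mulr_gt0.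
- by rewrite e; exact: Fb.
- by rewrite e; exact: Fb.
Qed.

(** On some [FN] of positive measure [k0 (a, _)] is bounded by [N], and H_r makes [k0] integrable
    over [A'] times [FN]. Tonelli then gives one point y1 of [F] with a finite x-integral, and H_1
    compares every other point of [F] with y1, uniformly. *)
Lemma piece_bound : exists2 C : R, 0 <= C &
  forall y, F y -> (\int[mu]_(x in A') `|k0 (x, y)|%:E <= C%:E)%E.
Proof.
have aA' : A' a by apply: (qball_center hX); rewrite !mulr_gt0// divr_gt0.
pose FN (n : nat) : set (Borel X) := F `&` [set y | `|k0 (a, y)| <= n%:R].
have mFN n : measurable (FN n).
  rewrite /FN (_ : [set y | _] = (fun y => `|k0 (a, y)|) @^-1` `]-oo, n%:R]); last first.
    by apply/seteqP; split => x /=; rewrite in_itv.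
  rewrite -[X in measurable (_ `&` X)]setTI; apply: measurableI => //.
  have mm : measurable_fun setT (fun y : Borel X => `|k0 (a, y)|).
    by apply: measurableT_comp => //; exact: mk0x.
  by apply: mm => //; exact: measurable_itv.
have [N FN0] : exists N, (0 < mu (FN N))%E.
  apply: contrapT => /forallNP h; move: F0.
  have -> : F = \bigcup_n FN n.
    apply/seteqP; split => [y Fy|y [n _ []]//].
    exists (Num.bound `|k0 (a, y)|) => //; split => //=.
    by rewrite ltW// archi_boundP.
  have : mu (\bigcup_n FN n) = 0%E.
    apply/eqP; rewrite eq_le measure_ge0 andbT.
    apply: le_trans (measure_sigma_subadditive mu mFN _ (@subset_refl _ _)) _.
      exact: bigcupT_measurable.
    rewrite eseries0// => n _ _; apply/eqP; rewrite eq_le measure_ge0 andbT.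
    by rewrite leNgt; apply/negP; exact: h.
  by move=> ->; rewrite ltxx.
pose f z := (\1_A' z.1 * (\1_(FN N) z.2 * `|k0 z|))%:E.
have mf : measurable_fun setT f.
  apply/measurable_EFinP; apply: measurable_funM.
    by apply: measurable_comp_fst; exact: measurable_indic.
  apply: measurable_funM; last exact: measurableT_comp.
  by apply: measurable_comp_snd; exact: measurable_indic.
have f0 z : (0 <= f z)%E.
  by rewrite lee_fin !mulr_ge0// indicE; case: (_ \in _).
have fin : (\int[mu]_y \int[mu]_x f (x, y) < +oo)%E.
  rewrite -(tonelli hX mf f0).
  apply: (@le_lt_trans _ _ (\int[mu]_(x in A') (Hr + N%:R * fine (mu F))%:E)%E).
    rewrite [leRHS]integral_mkcond; apply: ge0_le_integral' => //.
    - by move=> x _; exact: integral_ge0.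
    - exact: (tonelli_measurable1 hX).
    - by apply/(measurable_restrictT _ _).1.
    - move=> x _; rewrite patchE; case: ifPn => [|/negP]; rewrite inE => Ax; last first.
        by rewrite (eq_integral (cst 0%E)) ?integral0// => y _; rewrite /f/= indicE memNset// mul0r.
      rewrite (eq_integral (fun y => (\1_(FN N) y * `|k0 (x, y)|)%:E)); last first.
        by move=> y _; rewrite /f/= (indicE _ A') mem_set// mul1r.
      rewrite integral_indicM.
      apply: (@le_trans _ _ (\int[mu]_(y in FN N) (`|k0 (x, y) - k0 (a, y)|%:E + N%:R%:E))%E).
        apply: ge0_le_integral' => //.
        - apply: measurable_funTS; apply/measurable_EFinP; apply: measurableT_comp => //; exact: mk0x.
        - apply: emeasurable_funD => //; apply: measurable_funTS; apply/measurable_EFinP.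
          by apply: measurableT_comp => //; apply: measurable_funB; exact: mk0x.
        - move=> y [_ /= h]; rewrite -EFinD lee_fin.
          have := ler_normD (k0 (x, y) - k0 (a, y)) (k0 (a, y)); rewrite subrK; lra.
      have md : measurable_fun setT (fun y : Borel X => `|k0 (x, y) - k0 (a, y)|%:E).
        apply/measurable_EFinP.
        by apply: measurableT_comp => //; apply: measurable_funB; exact: mk0x.
      rewrite ge0_integralD//; last exact: measurable_funTS.
      rewrite EFinD; apply: leeD.
        apply: le_trans (piece_diff_F Ax aA'); apply: ge0_subset_integral => //.
        - exact: measurable_funTS.
        - by move=> y [].
      rewrite integral_cst// EFinM fineK ?ge0_fin_numE//; apply: lee_wpmul2l => //.
      by apply: le_measure; rewrite ?inE// => y [].
  by rewrite integral_cst// lte_mul_pinfty// lee_fin addr_ge0// mulr_ge0// fine_ge0.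
have [y1 Fy1 hy1] : exists2 y1, FN N y1 & (\int[mu]_x f (x, y1) < +oo)%E.
  apply: contrapT => nh.
  have ai : mu.-integrable setT (fun y => \int[mu]_x f (x, y))%E.
    apply/integrableP; split; first exact: (tonelli_measurable2 hX).
    under eq_integral do rewrite gee0_abs ?integral_ge0//.
    exact: fin.
  have [Z [mZ Z0 hZ]] := integrable_ae measurableT ai.
  have : (mu (FN N) <= mu Z)%E.
    apply: le_measure; rewrite ?inE// => y FNy; apply: hZ => /= h; apply: nh.
    by exists y => //; move: (h I); rewrite ge0_fin_numE// integral_ge0.
  by rewrite Z0 leNgt FN0.
have h1 : (\int[mu]_(x in A') `|k0 (x, y1)|%:E < +oo)%E.
  rewrite -integral_indicM; move: hy1; rewrite /f/=.
  by under eq_integral do rewrite (indicE _ (FN N)) mem_set// mul1r.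
exists (H1 + fine (\int[mu]_(x in A') `|k0 (x, y1)|%:E)).
  rewrite addr_ge0// ?fine_ge0 ?integral_ge0// -lee_fin.
  apply: le_trans (piece_diff_A (y := y1) (z := y1) _ _); last 2 first.
  - by case: Fy1.
  - by case: Fy1.
  exact: integral_ge0.
move=> y Fy; rewrite EFinD fineK; last by rewrite ge0_fin_numE// integral_ge0.
have md : measurable_fun setT (fun x : Borel X => `|k0 (x, y) - k0 (x, y1)|%:E).
  apply/measurable_EFinP.
  by apply: measurableT_comp => //; apply: measurable_funB; exact: mk0y.
have mn y' : measurable_fun setT (fun x : Borel X => `|k0 (x, y')|%:E).
  by apply/measurable_EFinP; apply: measurableT_comp => //; exact: mk0y.
apply: (@le_trans _ _ (\int[mu]_(x in A') (`|k0 (x, y) - k0 (x, y1)|%:E + `|k0 (x, y1)|%:E))%E).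
  apply: ge0_le_integral' => //.
  - exact: measurable_funTS.
  - by apply: emeasurable_funD; exact: measurable_funTS.
  - move=> x _; rewrite -EFinD lee_fin.
    by have := ler_normD (k0 (x, y) - k0 (x, y1)) (k0 (x, y1)); rewrite subrK.
rewrite ge0_integralD//; do ?exact: measurable_funTS.
by apply: leeD2r; apply: piece_diff_A => //; case: Fy1.
Qed.

(** It suffices to compare integrals over all [G] inside [F]. For an approximant u in [Cc] the
    formula is known. Replacing u by [s] changes one side by a pairing with [T \1_G], by duality,
    and the other by a pairing with the kernel integrated over [G]. *)
Lemma piece_repr M s : test_fun d M s -> (forall x, ~ A x -> s x = 0) ->
  {ae mu, forall y, F y -> Ts s y = \int[mu]_x (k0 (x, y) * s x)}.
Proof.
move=> ts s0; have [ms sM bs] := ts.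
have M0 : 0 <= M by exact: le_trans (sM point).
have [C C0 hC] := piece_bound.
have nA' u : (forall x, ~ A' x -> u x = 0) -> test_fun d M u ->
  forall y, F y -> mu.-integrable setT (fun x => (k0 (x, y) * u x)%:E) /\
    (\int[mu]_x (`|k0 (x, y)| * `|u x|)%:E <= (M * C)%:E)%E.
  move=> u0 [mu_ uM _] y Fy.
  have mk : measurable_fun setT (fun x : Borel X => k0 (x, y) * u x).
    by apply: measurable_funM => //; exact: mk0y.
  have le : (\int[mu]_x (`|k0 (x, y)| * `|u x|)%:E <= (M * C)%:E)%E.
    apply: (@le_trans _ _ (\int[mu]_x (M%:E * (\1_A' x * `|k0 (x, y)|)%:E))%E).
      apply: ge0_le_integral' => //.
      - apply/measurable_EFinP; apply: measurable_funM; apply: measurableT_comp => //.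
        exact: mk0y.
      - apply: measurable_funeM; apply/measurable_EFinP; apply: measurable_funM => //.
        by apply: measurableT_comp => //; exact: mk0y.
      - move=> x _; rewrite -EFinM lee_fin indicE.
        case: (boolP (x \in A')) => [_|/negP]; last first.
          by rewrite inE => /u0 ->; rewrite normr0 mulr0 mul0r mulr0.
        by rewrite mul1r mulrC ler_wpM2r.
    have mI : measurable_fun setT (fun x : Borel X => (\1_A' x * `|k0 (x, y)|)%:E).
      apply/measurable_EFinP; apply: measurable_funM => //.
      by apply: measurableT_comp => //; exact: mk0y.
    have pI x : (0 <= (\1_A' x * `|k0 (x, y)|)%:E)%E.
      by rewrite lee_fin mulr_ge0// indicE; case: (_ \in _).
    rewrite ge0_integralZl//.
    by rewrite EFinM integral_indicM; apply: lee_wpmul2l => //; exact: hC.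
  split => //; apply/integrableP; split; first exact/measurable_EFinP.
  under eq_integral do rewrite /= normrM.
  by apply: le_lt_trans le _; rewrite ltry.
pose kap (u : Borel X -> R) (y : Borel X) : R := \int[mu]_x (k0 (x, y) * u x).
have mkap u : measurable_fun setT u -> measurable_fun setT (kap u).
  move=> mu_; apply: (@param_Rintegral_measurable (fun z => k0 z * u z.1)).
  by apply: measurable_funM => //; exact: measurable_comp_fst.
have kap_le u : (forall x, ~ A' x -> u x = 0) -> test_fun d M u ->
    forall y, F y -> `|kap u y| <= M * C.
  move=> u0 tu y Fy; have [ik le] := nA' u u0 tu y Fy.
  rewrite -lee_fin; apply: le_trans (abs_Rintegral_le measurableT ik) _.
  by under eq_integral do rewrite normrM.
have s0' x : ~ A' x -> s x = 0 by move=> nx; apply: s0 => /AA'.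
have ikapF u (G : set (Borel X)) : measurable G -> G `<=` F ->
    (forall x, ~ A' x -> u x = 0) -> test_fun d M u -> mu.-integrable G (EFin \o kap u).
  move=> mG GF u0 tu; apply: measurable_bounded_integrable => //.
  - by apply: le_lt_trans muF; apply: le_measure; rewrite ?inE.
  - by apply: measurable_funTS; apply: mkap; case: tu.
  - exists (M * C); split; first exact: num_real.
    by move=> t ht y Gy /=; apply: le_trans (ltW ht); apply: kap_le => //; exact: GF.
have iTsG (G : set (Borel X)) u : measurable G -> G `<=` F -> test_fun d M u ->
    mu.-integrable G (EFin \o Ts u) /\ \int[mu]_(y in G) Ts u y = \int[mu]_x (T \1_G x * u x).
  move=> mG GF tu; have bG := bsL_indic hX r1 mG (subset_trans GF Fb).
  have [_ i2 e] := test_dual bG tu; split; last by rewrite -Rintegral_indicM e.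
  by apply/integrable_indicM.
suff hG (G : set (Borel X)) : measurable G -> G `<=` F ->
    \int[mu]_(y in G) Ts s y = \int[mu]_(y in G) kap s y.
  have iF := (iTsG F s mF (@subset_refl _ _) ts).1.
  have ikF := ikapF s F mF (@subset_refl _ _) s0' ts.
  have := @integral_ae_eq _ _ _ mu F mF (EFin \o kap s) (EFin \o Ts s) iF
    (measurable_int _ ikF).
  have hE (E : set (Borel X)) : E `<=` F -> measurable E ->
      (\int[mu]_(y in E) (EFin \o Ts s) y = \int[mu]_(y in E) (EFin \o kap s) y)%E.
    move=> EF mE; have := hG E mE EF; rewrite /Rintegral => h.
    have i1' := integrable_fin_num mE (iTsG E s mE EF ts).1.
    have i2' := integrable_fin_num mE (ikapF s E mE EF s0' ts).
    by rewrite -(fineK i1') -(fineK i2'); congr EFin.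
  move=> /(_ hE); apply: ae_mono => y h Fy.
  by have := h Fy => -[].
move=> mG GF; have bG := bsL_indic hX r1 mG (subset_trans GF Fb).
apply/eqP; rewrite -subr_eq0 -normr_le0; apply/ler_addgt0Pr => e e0; rewrite add0r.
pose f z := (\1_A' z.1 * (\1_G z.2 * `|k0 z|))%:E.
have mf : measurable_fun setT f.
  apply/measurable_EFinP; apply: measurable_funM.
    by apply: measurable_comp_fst; exact: measurable_indic.
  apply: measurable_funM; last exact: measurableT_comp.
  by apply: measurable_comp_snd; exact: measurable_indic.
have f0 z : (0 <= f z)%E.
  by rewrite lee_fin !mulr_ge0// indicE; case: (_ \in _).
pose W x := (\int[mu]_y f (x, y))%E.
have W0 x : (0 <= W x)%E by exact: integral_ge0.
have mW : measurable_fun setT W by exact: (tonelli_measurable1 hX).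
have muG : (mu G < +oo)%E by apply: le_lt_trans muF; apply: le_measure; rewrite ?inE.
have iW : mu.-integrable setT W.
  apply/integrableP; split => //; under eq_integral do rewrite gee0_abs//.
  rewrite /W (tonelli hX mf f0).
  apply: (@le_lt_trans _ _ (\int[mu]_(y in G) C%:E)%E); last first.
    by rewrite integral_cst// lte_mul_pinfty.
  rewrite [leRHS]integral_mkcond; apply: ge0_le_integral' => //.
  - by move=> x _; exact: integral_ge0.
  - exact: (tonelli_measurable2 hX).
  - by apply/(measurable_restrictT _ _).1.
  - move=> y _; rewrite patchE; case: ifPn => [|/negP]; rewrite inE => Gy; last first.
      by rewrite (eq_integral (cst 0%E)) ?integral0// => x _; rewrite /f/= (indicE _ G) memNset// mul0r mulr0.
    rewrite (eq_integral (fun x => (\1_A' x * `|k0 (x, y)|)%:E)); last first.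
      by move=> x _; rewrite /f/= (indicE _ G) mem_set// mul1r.
    by rewrite integral_indicM; apply: hC; exact: GF.
(* The weight dominates both errors at once: the kernel side through [W], the operator side through
   [T \1_G]. *)
pose w x := fine (W x) + `|T \1_G x|.
have w0 x : 0 <= w x by rewrite addr_ge0// fine_ge0.
have mfW : measurable_fun setT (fun x => fine (W x)).
  by apply: (@measurableT_comp _ _ _ _ _ _ (@fine R)) => //; exact: fine_measurable.
have iw : mu.-integrable A' (EFin \o w).
  have iWf : mu.-integrable A' (fun x => (fine (W x))%:E).
    apply: (@integrableS _ _ _ _ setT) => //.
    apply: le_integrable iW => //; first exact/measurable_EFinP.
    move=> x _; rewrite /= ger0_norm ?fine_ge0// gee0_abs//.
    by case: (W x) (W0 x) => [t||]//= _; rewrite leey.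
  have iT : mu.-integrable A' (fun x => `|T \1_G x|%:E).
    apply: integrable_norm.
    have tA : test_fun d 1 (\1_A').
      split; [exact: measurable_indic| |].
      + by move=> y; rewrite indicE; case: (_ \in _); rewrite ?normr1 ?normr0.
      + exists a, (3 / 2 * cd * sa); split; first by rewrite !mulr_gt0// divr_gt0.
        by move=> y ny; rewrite indicE memNset.
    have [i _ _] := test_dual bG tA; apply/(integrable_indicM mu _ mA').
    by apply: eq_integrable i => // x _; rewrite mulrC.
  by have := integrableD mA' iWf iT.
have [u [ccu uM u0 su hu]] := Cc_approx hX hCc sa0 e0 ts s0 w0 iw.
have mu_ : measurable_fun setT (u : Borel X -> R) by apply: continuous_borel; case: ccu.
have tu : test_fun d M u.
  split => //; exists a, (3 / 2 * cd * sa); split => //.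
  by rewrite !mulr_gt0// divr_gt0.
have Tsu : \int[mu]_(y in G) Ts u y = \int[mu]_(y in G) kap u y.
  apply: Rintegral_ae_eq => //.
  - by apply: measurable_funTS; exact: test_Ts_measurable tu.
  - by apply: measurable_funTS; exact: mkap.
  apply: ae_mono (hass ccu) => y hy Gy.
  have nsy := su y (Fa (GF _ Gy)); have [_ ->] := hy nsy.
  congr Rintegral; apply/funext => x; rewrite /transpose.
  have [e1|/eqP xy] := eqVneq x y; last by rewrite k0E.
  have ux : u x = 0.
    apply: contrapT => /eqP ux; apply: nsy; rewrite -e1.
    exact: subset_closure.
  by rewrite ux !mulr0.
have [iTs iTsE] := iTsG G s mG GF ts; have [iTu iTuE] := iTsG G u mG GF tu.
have -> : \int[mu]_(y in G) Ts s y - \int[mu]_(y in G) kap s y =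
    \int[mu]_x (T \1_G x * (s x - u x)) + \int[mu]_(y in G) (kap u y - kap s y).
  have [i1' _ _] := test_dual bG ts; have [i2' _ _] := test_dual bG tu.
  have -> : (fun x => T \1_G x * (s x - u x)) = (fun x => T \1_G x * s x - T \1_G x * u x).
    by apply/funext => x; rewrite mulrBr.
  rewrite (RintegralB measurableT i1' i2') (RintegralB mG (ikapF u G mG GF u0 tu) (ikapF s G mG GF s0' ts)).
  by rewrite -iTsE -iTuE Tsu addrA subrK.
have us0 x : ~ A' x -> u x - s x = 0 by move=> nx; rewrite u0// s0'// subr0.
have mus : measurable_fun setT (fun x : Borel X => `|u x - s x|).
  by apply: measurableT_comp => //; exact: measurable_funB.
have mT : measurable_fun setT (T \1_G) by exact: Tmeas bG.
have E1 : (`|\int[mu]_x (T \1_G x * (s x - u x))|%:E <=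
    \int[mu]_(x in A') (`|T \1_G x| * `|u x - s x|)%:E)%E.
  have iTd : mu.-integrable setT (EFin \o (fun x => T \1_G x * (s x - u x))).
    have [i1' _ _] := test_dual bG ts; have [i2' _ _] := test_dual bG tu.
    apply: eq_integrable (integrableB measurableT i1' i2') => // x _ /=.
    by rewrite mulrBr EFinB.
  apply: le_trans (abs_Rintegral_le measurableT iTd) _.
  rewrite -[leRHS]integral_indicM; apply: ge0_le_integral' => //.
  - apply/measurable_EFinP; apply: measurableT_comp => //; apply: measurable_funM => //.
    exact: measurable_funB.
  - apply/measurable_EFinP; apply: measurable_funM; first exact: measurable_indic.
    by apply: measurable_funM => //; exact: measurableT_comp.
  - move=> x _; rewrite lee_fin indicE normrM distrC.
    case: (boolP (x \in A')) => [|/negP]; rewrite inE => h; first by rewrite mul1r.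
    by rewrite us0// normr0 mulr0 mul0r.
pose g z := (\1_A' z.1 * (\1_G z.2 * `|k0 z|) * `|u z.1 - s z.1|)%:E.
have mg : measurable_fun setT g.
  apply/measurable_EFinP; apply: measurable_funM; first exact/measurable_EFinP.
  exact: (measurable_comp_fst mus).
have g0 z : (0 <= g z)%E.
  by rewrite lee_fin !mulr_ge0// indicE; case: (_ \in _).
have mfx x : measurable_fun setT (fun y : Borel X => f (x, y)).
  by apply: measurable_fun_pair2.
have E2 : (`|\int[mu]_(y in G) (kap u y - kap s y)|%:E <=
    \int[mu]_(x in A') (fine (W x) * `|u x - s x|)%:E)%E.
  have iKd : mu.-integrable G (EFin \o (fun y => kap u y - kap s y)).
    have := integrableB mG (ikapF u G mG GF u0 tu) (ikapF s G mG GF s0' ts).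
    by apply: eq_integrable => // y _ /=; rewrite EFinB.
  apply: le_trans (abs_Rintegral_le mG iKd) _.
  have -> : (\int[mu]_(x in A') (fine (W x) * `|u x - s x|)%:E = \int[mu]_x \int[mu]_y g (x, y))%E.
    rewrite -[LHS]integral_indicM; apply: ae_eq_integral => //.
    - apply/measurable_EFinP; apply: measurable_funM => //; exact: measurable_funM.
    - exact: (tonelli_measurable1 hX).
    apply: ae_mono (integrable_ae measurableT iW) => x /(_ I) Wfin _.
    rewrite (eq_integral (fun y => `|u x - s x|%:E * f (x, y))%E); last first.
      by move=> y _; rewrite /g /f -EFinM mulrC.
    rewrite ge0_integralZl// -/(W x) -(fineK Wfin) -EFinM /= indicE.
    case: (boolP (x \in A')) => [_|/negP]; first by rewrite mul1r mulrC.
    by rewrite inE => h; rewrite us0// normr0 mulr0 !mul0r.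
  rewrite (tonelli hX mg g0) -[leLHS]integral_indicM; apply: ge0_le_integral' => //.
  - apply/measurable_EFinP; apply: measurable_funM; first exact: measurable_indic.
    by apply: measurableT_comp => //; apply: measurable_funB; exact: mkap.
  - exact: (tonelli_measurable2 hX).
  - move=> y _; rewrite indicE; case: (boolP (y \in G)) => [|_]; last first.
      by rewrite mul0r; exact: integral_ge0.
    rewrite inE mul1r => Gy; have Fy := GF _ Gy.
    have [iu _] := nA' u u0 tu y Fy; have [is_ _] := nA' s s0' ts y Fy.
    rewrite /kap -(RintegralB measurableT iu is_).
    apply: le_trans (abs_Rintegral_le measurableT _) _.
      have := integrableB measurableT iu is_.
      by apply: eq_integrable => // x _ /=; rewrite EFinB.
    apply: ge0_le_integral' => //.
    + apply/measurable_EFinP; apply: measurableT_comp => //; apply: measurable_funB.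
        by apply: measurable_funM => //; exact: mk0y.
      by apply: measurable_funM => //; exact: mk0y.
    + exact: measurable_fun_pair1.
    + move=> x _; rewrite /g/= lee_fin -mulrBr normrM (indicE _ G) mem_set// mul1r indicE.
      case: (boolP (x \in A')) => [_|/negP]; first by rewrite mul1r.
      by rewrite inE => h; rewrite us0// normr0 !mulr0.
apply: le_trans (ler_normD _ _) _; rewrite -lee_fin EFinD.
apply: le_trans (leeD E1 E2) _; apply: le_trans (ltW hu).
rewrite -ge0_integralD//.
- apply: ge0_le_integral' => //.
  + by move=> x _; rewrite adde_ge0// lee_fin mulr_ge0// fine_ge0.
  + apply: measurable_funTS; apply: emeasurable_funD; apply/measurable_EFinP.
      by apply: measurable_funM => //; exact: measurableT_comp.
    exact: measurable_funM.
  + apply: measurable_funTS; apply/measurable_EFinP; apply: measurable_funM => //.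
    by apply: measurable_funD => //; exact: measurableT_comp.
  + by move=> x _; rewrite -EFinD lee_fin /w mulrDl addrC.
- apply: measurable_funTS; apply/measurable_EFinP.
  by apply: measurable_funM => //; exact: measurableT_comp.
- by move=> x _; rewrite lee_fin mulr_ge0// fine_ge0.
- by apply: measurable_funTS; apply/measurable_EFinP; exact: measurable_funM.
Qed.

End Pieces.

Variables (c0 C0 delta : R) (hc0 : 0 < c0 <= C0) (hdelta : 0 < delta < 1).
Variables (D : set (cube X)) (hD : dyadic_system d c0 C0 delta D).

Lemma small_generation (e : R) : 0 < e -> exists l : int, C0 * delta ^ l <= e.
Proof.
move=> e0; have C00 := C0_gt0 hc0.
have [l [_ hl]] := dpow_small_from hdelta 0 (divr_gt0 e0 C00); exists l.
by rewrite mulrC ltW// -ltr_pdivlMr.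
Qed.

Lemma generation_family l : [/\ countable [set Q | D Q /\ generation Q = l],
  forall Q, D Q /\ generation Q = l -> measurable (carrier Q),
  disjoint_family [set Q | D Q /\ generation Q = l] &
  famU [set Q | D Q /\ generation Q = l] carrier = setT].
Proof.
split.
- apply: sub_countable (countable_D hX hc0 hdelta hD); apply: subset_card_le.
  by move=> Q [].
- by move=> Q [DQ _]; exact: (cube_measurable hD).
- move=> P Q [DP gP] [DQ gQ]; apply: (ds_disjoint hD) => //.
  by rewrite gP gQ.
- rewrite -subTset => x _; exists (cub hD l x); last exact: cub_in.
  by split; [exact: cub_D|exact: gen_cub].
Qed.

(** The far region is cut into cubes so small that each of them and the ball are mutually far at
    their own scales; the null sets of countably many pieces are then discarded together. *)
Lemma kernel_repr_far z sg M s : 0 < sg -> test_fun d M s ->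
  (forall x, ~ qball d z sg x -> s x = 0) ->
  {ae mu, forall y, 3 * cd ^+ 2 * sg <= d z y ->
     Ts s y = \int[mu]_x (k0 (x, y) * s x) /\
     (\int[mu]_(x in qball d z sg) `|k0 (x, y)|%:E < +oo)%E}.
Proof.
move=> sg0 ts s0.
have c1 : 1 <= cd := cd1.
have e0 : 0 < sg / (2 * cd + 1) by rewrite divr_gt0//; lra.
have [l hl] := small_generation e0.
have [cM mM _ UM] := generation_family l.
suff h : {ae mu, forall y, forall Q, D Q /\ generation Q = l ->
    carrier Q y -> 3 * cd ^+ 2 * sg <= d z y ->
    Ts s y = \int[mu]_x (k0 (x, y) * s x) /\
    (\int[mu]_(x in qball d z sg) `|k0 (x, y)|%:E < +oo)%E}.
  apply: ae_mono h => y hy; apply: (hy (cub hD l y)); last exact: cub_in.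
  by split; [exact: cub_D|exact: gen_cub].
apply: (ae_countable (S := [set Q | D Q /\ generation Q = l])) => // Q [DQ gQ].
pose F : set (Borel X) := carrier Q `&` ~` qball d z (3 * cd ^+ 2 * sg).
have mF : measurable F.
  apply: measurableI; first exact: (cube_measurable hD).
  exact: measurableC (qball_measurable hX _ _).
have [F0|F0] := eqVneq (mu F) 0%E.
  apply: (ae_notin mF F0) => y nF Qy hy; case: nF; split => //=.
  by rewrite /qball/=; apply/negP; rewrite -leNgt.
have {}F0 : (0 < mu F)%E by rewrite lt0e F0/=.
have sb0 : 0 < C0 * delta ^ l by rewrite mulr_gt0 ?(C0_gt0 hc0)// dpow_gt0.
have Fb : F `<=` qball d (cube_center Q) (C0 * delta ^ l).
  by rewrite -gQ => y [Qy _]; exact: (ds_outer hD DQ).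
have Fa y : F y -> 3 * cd ^+ 2 * sg <= d z y.
  by move=> [_ /=]; rewrite /qball/= => /negP; rewrite -leNgt.
have [y0 Fy0] : exists y0, F y0.
  apply: contrapT => /forallNP h; move: F0; rewrite (_ : F = set0) ?measure0 ?ltxx//.
  by rewrite -subset0 => y /h.
have A'b x : qball d z (3 / 2 * cd * sg) x -> 2 * cd * (C0 * delta ^ l) <= d (cube_center Q) x.
  rewrite /qball/= => zx; set b := cube_center Q; set sb := C0 * delta ^ l in hl sb0 *.
  have h1 := Fa _ Fy0; have h2 := qd_tri hX x z y0; have h3 := qd_tri hX b x y0.
  have h4 : d b y0 < sb by exact: Fb.
  rewrite (qd_sym hX x b) in h3.
  have h5 : cd * (3 * cd * sg) <= cd * (d z x + d x y0) by apply: le_trans h2; move: h1; rewrite expr2 mulrCA !mulrA mulrAC.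
  rewrite ler_pM2l// in h5.
  have h6 : cd * (3 / 2 * sg) <= cd * (d b x + d b y0) by lra.
  rewrite ler_pM2l// in h6.
  move: hl; rewrite ler_pdivlMr; [lra|lra].
have [C CC hC] := piece_bound sg0 sb0 mF F0 Fb Fa A'b.
apply: ae_mono (piece_repr sg0 sb0 mF F0 Fb Fa A'b ts s0) => y hy Qy yz.
have Fy : F y by split => //=; rewrite /qball/=; apply/negP; rewrite -leNgt.
split; first exact: hy.
apply: le_lt_trans (_ : _ <= C%:E)%E (ltry _).
apply: le_trans (hC y Fy); apply: ge0_subset_integral => //; do ?exact: (qball_measurable hX).
- apply: measurable_funTS; apply/measurable_EFinP; apply: measurableT_comp => //; exact: mk0y.
- by apply: (qball_le (d := d)); rewrite ler_peMl ?ltW//; lra.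
Qed.

Lemma test_integrable M s : test_fun d M s -> mu.-integrable setT (EFin \o s).
Proof.
by move=> ts; exact: (bsL_integrable hX (p := 1%E) _ (test_fun_bsL hX _ ts)).
Qed.

(** After passage to [Ts s], the mean zero of [s] allows [k0 (z, y)] to be subtracted from
    [k0 (x, y)]; Tonelli and H_r conclude. Dividing by the L^1 norm of [s], this is the oscillation
    of [T h] near z. *)
Lemma dual_osc_T z sg M s h L : 0 < sg -> test_fun d M s ->
  (forall x, ~ qball d z sg x -> s x = 0) -> \int[mu]_x s x = 0 ->
  bsL mu d r h -> (forall y, qball d z (3 * cd ^+ 2 * sg) y -> h y = 0) -> 0 <= L ->
  (forall i, (\int[mu]_(y in qball d z (2 ^+ i.+1 * (3 * cd ^+ 2 * sg))) (`|h y| `^ p)%:E <=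
     (L `^ p)%:E * mu (qball d z (2 ^+ i.+1 * (3 * cd ^+ 2 * sg))))%E) ->
  `|\int[mu]_x (T h x * s x)| <= L * Hr * \int[mu]_x `|s x|.
Proof.
move=> sg0 ts s0 is0 hh h0 L0 hL; have [ms sM bs] := ts.
have c1 : 1 <= cd := cd1.
have [_ i2 ->] := test_dual hh ts.
have [mh _ _] := hh.
have mTs := test_Ts_measurable ts.
have is_ := test_integrable ts.
pose f u := (`|k0 u - k0 (z, u.2)| * `|s u.1| * `|h u.2|)%:E.
have mf : measurable_fun setT f.
  apply/measurable_EFinP; apply: measurable_funM; last first.
    by apply: (@measurable_comp_snd _ _ (fun y => `|h y|)); exact: measurableT_comp.
  apply: measurable_funM; last first.
    by apply: (@measurable_comp_fst _ _ (fun y => `|s y|)); exact: measurableT_comp.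
  apply: measurableT_comp => //; apply: measurable_funB => //.
  exact: (measurable_comp_snd (mk0x z)).
have f0 u : (0 <= f u)%E by rewrite lee_fin !mulr_ge0.
have inS : mu.-integrable setT (EFin \o (fun x => `|s x|)) by exact: integrable_norm.
have fins : (\int[mu]_x `|s x|%:E)%E \is a fin_num by exact: integrable_fin_num.
rewrite -lee_fin EFinM [X in (_ <= _ * X)%E]fineK//.
apply: le_trans (abs_Rintegral_le measurableT i2) _.
apply: (@le_trans _ _ (\int[mu]_y \int[mu]_x f (x, y))%E).
  apply: ae_ge0_le_integral => //.
  - apply/measurable_EFinP; apply: measurableT_comp => //; exact: measurable_funM.
  - by move=> y _; exact: integral_ge0.
  - exact: (tonelli_measurable2 hX).
  apply: ae_mono (kernel_repr_far sg0 ts s0) => y hy _.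
  have [near|far] := ltP (d z y) (3 * cd ^+ 2 * sg).
    by rewrite h0// mul0r normr0; exact: integral_ge0.
  have [-> kfin] := hy far.
  have mk y' : measurable_fun setT (fun x : Borel X => k0 (x, y')) by exact: mk0y.
  have ik : mu.-integrable setT (fun x => (k0 (x, y) * s x)%:E).
    apply/integrableP; split; first by apply/measurable_EFinP; exact: measurable_funM.
    apply: (@le_lt_trans _ _ (\int[mu]_x (M%:E * (\1_(qball d z sg) x * `|k0 (x, y)|)%:E))%E).
      apply: ge0_le_integral' => //.
      + by apply/measurable_EFinP; apply: measurableT_comp => //; exact: measurable_funM.
      + apply: measurable_funeM; apply/measurable_EFinP; apply: measurable_funM.
          by apply: measurable_indic; exact: (qball_measurable hX).
        exact: measurableT_comp.
      + move=> x _; rewrite -EFinM /= lee_fin normrM indicE.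
        case: (boolP (x \in _)) => [_|/negP]; first by rewrite mul1r mulrC ler_wpM2r.
        by rewrite inE => /s0 ->; rewrite normr0 !mul0r !mulr0.
    have M0 : 0 <= M by exact: le_trans (sM point).
    have mI : measurable_fun setT (fun x : Borel X => (\1_(qball d z sg) x * `|k0 (x, y)|)%:E).
      apply/measurable_EFinP; apply: measurable_funM; last exact: measurableT_comp.
      by apply: measurable_indic; exact: (qball_measurable hX).
    have pI (x : Borel X) : (0 <= (\1_(qball d z sg) x * `|k0 (x, y)|)%:E)%E.
      by rewrite lee_fin mulr_ge0// indicE; case: (_ \in _).
    by rewrite ge0_integralZl// integral_indicM lte_mul_pinfty.
  have izs : mu.-integrable setT (fun x => (k0 (z, y) * s x)%:E).
    by have := integrableZl measurableT (k0 (z, y)) is_; apply: eq_integrable => // x _; rewrite /= EFinM.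
  have -> : \int[mu]_x (k0 (x, y) * s x) = \int[mu]_x ((k0 (x, y) - k0 (z, y)) * s x).
    have -> : (fun x => (k0 (x, y) - k0 (z, y)) * s x) = (fun x => k0 (x, y) * s x - k0 (z, y) * s x).
      by apply/funext => x; rewrite mulrBl.
    by rewrite (RintegralB measurableT ik izs) RintegralZl// is0 mulr0 subr0.
  have idd : mu.-integrable setT (EFin \o (fun x => (k0 (x, y) - k0 (z, y)) * s x)).
    by have := integrableB measurableT ik izs; apply: eq_integrable => // x _; rewrite /= mulrBl EFinB.
  rewrite normrM EFinM; apply: (@le_trans _ _ (`|h y|%:E * \int[mu]_x `|(k0 (x, y) - k0 (z, y)) * s x|%:E)%E).
    by apply: lee_wpmul2l => //; exact: abs_Rintegral_le.
  rewrite -ge0_integralZl//.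
    apply: ge0_le_integral' => //.
    + apply: measurable_funeM; apply/measurable_EFinP; apply: measurableT_comp => //.
      by apply: measurable_funM => //; exact: measurable_funB.
    + exact: measurable_fun_pair1.
    + by move=> x _; rewrite /f/= -EFinM normrM mulrC.
  apply/measurable_EFinP; apply: measurableT_comp => //.
  by apply: measurable_funM => //; exact: measurable_funB.
rewrite -(tonelli hX mf f0).
rewrite -integralZl//; apply: ge0_le_integral' => //.
- by move=> x _; exact: integral_ge0.
- exact: (tonelli_measurable1 hX).
- by apply: measurable_funeM; apply/measurable_EFinP; exact: measurableT_comp.
move=> x _.
have mkd : measurable_fun setT (fun y : Borel X => (`|k0 (x, y) - k0 (z, y)| * `|h y|)%:E).
  apply/measurable_EFinP; apply: measurable_funM; apply: measurableT_comp => //.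
  by apply: measurable_funB; exact: mk0x.
rewrite (eq_integral (fun y => `|s x|%:E * (`|k0 (x, y) - k0 (z, y)| * `|h y|)%:E)%E); last first.
  by move=> y _; rewrite /f/= -EFinM mulrAC mulrC.
rewrite ge0_integralZl// muleC.
have [xB|nx] := pselect (qball d z sg x); last by rewrite s0// normr0 !mule0.
apply: lee_wpmul2r => //.
have rho0 : 0 < 3 * cd ^+ 2 * sg by rewrite !mulr_gt0// exprn_gt0.
have rhoE : 3 * cd ^+ 2 * sg / (2 * cd) = 3 / 2 * cd * sg by field; rewrite gt_eqF.
have inner y : qball d z sg y -> qball d z (3 * cd ^+ 2 * sg / (2 * cd)) y.
  by rewrite rhoE; apply: (qball_le (d := d)); rewrite ler_peMl ?ltW//; lra.
have := HR rho0 (inner _ xB) (inner _ (qball_center hX z sg0)) mh L0 hL.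
apply: le_trans; rewrite -[leRHS]integral_indicM; apply: ge0_le_integral' => //.
- apply/measurable_EFinP; apply: measurable_funM.
    by apply: measurable_indic; apply: measurableC; exact: (qball_measurable hX).
  exact/measurable_EFinP.
- move=> y _; rewrite lee_fin indicE; case: (boolP (y \in _)) => [_|/negP]; first by rewrite mul1r.
  by rewrite inE => /contrapT /h0 ->; rewrite normr0 !mulr0.
Qed.

(** Here [b] is localised but [s] may spread far from z, so [s] is cut along small cubes to bring
    each pairing under the kernel formula. The pieces are added up again before H_1 is applied,
    which avoids a loss from their number. *)
Lemma dual_osc_Ts z sg M s b : 0 < sg -> test_fun d M s ->
  (forall x, qball d z (3 * cd ^+ 2 * sg) x -> s x = 0) ->
  bsL mu d r b -> (forall y, ~ qball d z sg y -> b y = 0) -> \int[mu]_y b y = 0 ->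
  `|\int[mu]_x (T b x * s x)| <= M * H1 * \int[mu]_y `|b y|.
Proof.
move=> sg0 ts s0 hb b0 ib0; have [ms sM bs] := ts; have [mb bbs _] := hb.
have M0 : 0 <= M by exact: le_trans (sM point).
have c1 : 1 <= cd := cd1.
(* The cubes are small enough for each one that meets the far region to be separated from the ball
   about z in both senses required of a piece. *)
have e0 : 0 < sg / (3 * cd ^+ 2 + 1) by rewrite divr_gt0// addr_gt0// mulr_gt0// exprn_gt0.
have [l hl] := small_generation e0; set sa := C0 * delta ^ l in hl.
have sa0 : 0 < sa by rewrite mulr_gt0 ?(C0_gt0 hc0)// dpow_gt0.
have {}hl : 3 * (cd * (cd * sa)) + sa <= sg.
  move: hl; rewrite ler_pdivlMr; last by rewrite addr_gt0// mulr_gt0// exprn_gt0.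
  by rewrite expr2; lra.
have cs1 : sa <= cd * sa by rewrite ler_peMl// ltW.
have cs2 : cd * sa <= cd * (cd * sa) by rewrite ler_pM2l.
have [cM mM dM UM] := generation_family l.
pose f u := (`|s u.1| * (`|b u.2| * `|k0 u - k0 (u.1, z)|))%:E.
have mf : measurable_fun setT f.
  apply/measurable_EFinP; apply: measurable_funM.
    by apply: (@measurable_comp_fst _ _ (fun y => `|s y|)); exact: measurableT_comp.
  apply: measurable_funM.
    by apply: (@measurable_comp_snd _ _ (fun y => `|b y|)); exact: measurableT_comp.
  apply: measurableT_comp => //; apply: measurable_funB => //.
  exact: (measurable_comp_fst (mk0y z)).
have f0 u : (0 <= f u)%E by rewrite lee_fin !mulr_ge0.
pose v x := (\int[mu]_y f (x, y))%E.
have mv : measurable_fun setT v by exact: (tonelli_measurable1 hX).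
have v0 x : (0 <= v x)%E by exact: integral_ge0.
have [iTs _ _] := test_dual hb ts.
have ibb := bsL_integrable hX r1 hb.
have inb : mu.-integrable setT (EFin \o (fun x => `|b x|)) by exact: integrable_norm.
have finb : (\int[mu]_x `|b x|%:E)%E \is a fin_num by exact: integrable_fin_num.
pose Bz : set (Borel X) := qball d z sg.
have mBz : measurable Bz by exact: (qball_measurable hX).
have piece Q : D Q /\ generation Q = l ->
    (`|\int[mu]_(x in carrier Q) (T b x * s x)%:E| <= \int[mu]_(x in carrier Q) v x)%E.
  move=> [DQ gQ]; have mQ := cube_measurable hD DQ.
  have [[x1 Qx1 far]|nofar] := pselect (exists2 x1, carrier Q x1 & 3 * cd ^+ 2 * sg <= d z x1); last first.
    rewrite (eq_integral (cst 0%E)) ?integral0 ?abse0 ?integral_ge0// => x; rewrite inE => Qx.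
    rewrite s0 ?mulr0// /qball/= ltNge; apply/negP => hx; apply: nofar; by exists x.
  pose a := cube_center Q.
  have ax1 : d a x1 < sa by have := cube_outer hD DQ Qx1; rewrite gQ.
  have far' : 3 * (cd * (cd * sg)) <= d z x1 by move: far; rewrite expr2 -!mulrA.
  have Fa y : Bz y -> 3 * cd ^+ 2 * sa <= d a y.
    rewrite /Bz /qball/= => zy.
    have h2 := qd_tri hX y z x1; have h3 := qd_tri hX a y x1.
    rewrite (qd_sym hX y a) in h3.
    have h4 : cd * (3 * (cd * sg)) <= cd * (d z y + d y x1) by lra.
    rewrite ler_pM2l// in h4.
    have h6 : sg <= cd * sg by rewrite ler_peMl// ltW.
    have h5 : cd * (2 * sg) <= cd * (d a y + d a x1) by lra.
    rewrite ler_pM2l// in h5.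
    by rewrite expr2 -!mulrA; lra.
  have A'b x : qball d a (3 / 2 * cd * sa) x -> 2 * cd * sg <= d z x.
    rewrite /qball/= => ax.
    have h2 := qd_tri hX x z x1; have h3 := qd_tri hX a x x1.
    rewrite (qd_sym hX x a) in h3.
    have h5 : cd * (d a x + d a x1) <= cd * (3 / 2 * cd * sa + sa) by rewrite ler_pM2l// lerD// ltW.
    have h6 : cd * (3 * (cd * sg)) <= cd * (d z x + d x x1) by lra.
    rewrite ler_pM2l// in h6.
    have h7 : sg <= cd * sg by rewrite ler_peMl// ltW.
    have h8 : cd * (3 / 2 * cd * sa + sa) = 3 / 2 * (cd * (cd * sa)) + cd * sa by ring.
    by lra.
  pose sQ (x : Borel X) := \1_(carrier Q) x * s x.
  have tsQ : test_fun d M sQ.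
    split.
    - by apply: measurable_funM => //; exact: measurable_indic.
    - move=> x; rewrite normrM -[leRHS]mul1r ler_pM// indicE.
      by case: (_ \in _); rewrite ?normr1 ?normr0.
    - by apply: (bounded_support_sub hX bs) => y sy; rewrite /sQ sy mulr0.
  have sQ0 x : ~ qball d a sa x -> sQ x = 0.
    move=> nx; rewrite /sQ indicE memNset ?mul0r// => Qx; apply: nx.
    by have := cube_outer hD DQ Qx; rewrite gQ.
  have muB : (0 < mu Bz)%E by exact: (qball_gt0 hX).
  have [C CC hC] := piece_bound sa0 sg0 mBz muB (@subset_refl _ _) Fa A'b.
  have rep := piece_repr sa0 sg0 mBz muB (@subset_refl _ _) Fa A'b tsQ sQ0.
  have [ibq1 ibq2 ibq] := test_dual hb tsQ.
  have zB : Bz z by exact: (qball_center hX).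
  pose A' : set (Borel X) := qball d a (3 / 2 * cd * sa).
  have AA' : qball d a sa `<=` A'.
    by apply: (qball_le (d := d)); rewrite ler_peMl ?ltW//; lra.
  have ik y : Bz y -> mu.-integrable setT (fun x => (k0 (x, y) * sQ x)%:E).
    move=> By; have [msQ sQM _] := tsQ.
    have mk : measurable_fun setT (fun x : Borel X => k0 (x, y)) by exact: mk0y.
    have mI : measurable_fun setT (fun x : Borel X => (\1_A' x * `|k0 (x, y)|)%:E).
      apply/measurable_EFinP; apply: measurable_funM; last exact: measurableT_comp.
      by apply: measurable_indic; exact: (qball_measurable hX).
    have pI (x : Borel X) : (0 <= (\1_A' x * `|k0 (x, y)|)%:E)%E.
      by rewrite lee_fin mulr_ge0// indicE; case: (_ \in _).
    apply/integrableP; split; first by apply/measurable_EFinP; exact: measurable_funM.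
    apply: (@le_lt_trans _ _ (\int[mu]_x (M%:E * (\1_A' x * `|k0 (x, y)|)%:E))%E).
      apply: ge0_le_integral' => //.
      + by apply/measurable_EFinP; apply: measurableT_comp => //; exact: measurable_funM.
      + exact: measurable_funeM.
      + move=> x _; rewrite -EFinM /= lee_fin normrM indicE.
        case: (boolP (x \in _)) => [_|/negP]; first by rewrite mul1r mulrC ler_wpM2r.
        by rewrite inE => nx; rewrite sQ0 ?normr0 ?mulr0 ?mul0r ?mulr0// => /AA'.
    rewrite ge0_integralZl// integral_indicM lte_mul_pinfty//.
    exact: le_lt_trans (hC y By) (ltry _).
  (* As [b] has mean zero, this constant may be subtracted from [Ts sQ], which produces the
     difference [k0 (x, y) - k0 (x, z)]. *)
  pose c := \int[mu]_x (k0 (x, z) * sQ x).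
  have e1 : (\int[mu]_(x in carrier Q) (T b x * s x)%:E = (\int[mu]_x (T b x * sQ x))%:E)%E.
    rewrite -integral_indicM /Rintegral fineK; last exact: integrable_fin_num.
    by apply: eq_integral => x _; rewrite /sQ mulrCA.
  have e2 : \int[mu]_x (T b x * sQ x) = \int[mu]_y (b y * (Ts sQ y - c)).
    have -> : (fun y => b y * (Ts sQ y - c)) = (fun y => b y * Ts sQ y - c * b y).
      by apply/funext => y; rewrite mulrBr [b y * c]mulrC.
    have icb : mu.-integrable setT (fun y => (c * b y)%:E).
      by have := integrableZl measurableT c ibb; apply: eq_integrable => // x _; rewrite /= EFinM.
    by rewrite (RintegralB measurableT ibq2 icb) RintegralZl// ib0 mulr0 subr0.
  have ibc : mu.-integrable setT (EFin \o (fun y => b y * (Ts sQ y - c))).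
    have icb : mu.-integrable setT (fun y => (c * b y)%:E).
      by have := integrableZl measurableT c ibb; apply: eq_integrable => // x _; rewrite /= EFinM.
    have := integrableB measurableT ibq2 icb; apply: eq_integrable => // y _ /=.
    by rewrite mulrBr EFinB [b y * c]mulrC.
  pose g u := ((\1_(carrier Q) u.1)%:E * f u)%E.
  have mg : measurable_fun setT g.
    apply: emeasurable_funM => //; apply/measurable_EFinP.
    by apply: measurable_comp_fst; exact: measurable_indic.
  have g0 u : (0 <= g u)%E by rewrite mule_ge0// lee_fin indicE; case: (_ \in _).
  have -> : (\int[mu]_(x in carrier Q) v x = \int[mu]_x \int[mu]_y g (x, y))%E.
    rewrite integral_mkcond; apply: eq_integral => x _; rewrite patchE /g/=.
    have mfx : measurable_fun setT (fun y : Borel X => f (x, y)) by exact: measurable_fun_pair2.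
    case: ifPn => xQ; first by apply: eq_integral => y _; rewrite indicE xQ mul1e.
    rewrite (eq_integral (cst 0%E)) ?integral0// => y _; rewrite indicE (negbTE xQ) mul0e//.
  rewrite e1 e2 abse_EFin (tonelli hX mg g0).
  apply: le_trans (abs_Rintegral_le measurableT ibc) _.
  have mTsQ := test_Ts_measurable tsQ.
  apply: ae_ge0_le_integral => //.
  - apply/measurable_EFinP; apply: measurableT_comp => //; apply: measurable_funM => //.
    exact: measurable_funB.
  - by move=> y _; exact: integral_ge0.
  - exact: (tonelli_measurable2 hX).
  apply: ae_mono rep => y hy _.
  have [By|nBy] := pselect (Bz y); last by rewrite b0// mul0r normr0; exact: integral_ge0.
  rewrite hy// /c -(RintegralB measurableT (ik y By) (ik z zB)).
  have idd : mu.-integrable setT (EFin \o (fun x => k0 (x, y) * sQ x - k0 (x, z) * sQ x)).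
    by have := integrableB measurableT (ik y By) (ik z zB); apply: eq_integrable => // x _; rewrite /= EFinB.
  rewrite normrM EFinM; apply: (@le_trans _ _ (`|b y|%:E * \int[mu]_x `|k0 (x, y) * sQ x - k0 (x, z) * sQ x|%:E)%E).
    by apply: lee_wpmul2l => //; exact: abs_Rintegral_le.
  have [msQ _ _] := tsQ.
  have mdd : measurable_fun setT (fun x : Borel X => `|k0 (x, y) * sQ x - k0 (x, z) * sQ x|%:E).
    apply/measurable_EFinP; apply: measurableT_comp => //.
    by apply: measurable_funB; apply: measurable_funM => //; exact: mk0y.
  rewrite -ge0_integralZl//; apply: ge0_le_integral' => //.
  + exact: measurable_funeM.
  + exact: measurable_fun_pair1.
  + move=> x _; rewrite /g /f/= -!EFinM lee_fin -mulrBl normrM /sQ normrM.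
    rewrite indicE; case: (_ \in _); last by rewrite normr0 !mul0r !mulr0.
    by rewrite normr1 !mul1r; lra.
have iTU : mu.-integrable (famU [set Q | D Q /\ generation Q = l] carrier)
    (EFin \o (fun x => T b x * s x)) by rewrite UM.
have := fam_abs_integral cM mM dM iTU mv v0 piece; rewrite UM => h.
rewrite -lee_fin /Rintegral -abse_EFin fineK; last exact: integrable_fin_num.
rewrite EFinM fineK//; apply: le_trans h _.
rewrite /v (tonelli hX mf f0) -integralZl//; apply: ge0_le_integral' => //.
- by move=> y _; exact: integral_ge0.
- exact: (tonelli_measurable2 hX).
- by apply: measurable_funeM; apply/measurable_EFinP; exact: measurableT_comp.
move=> y _; have [By|nBy] := pselect (Bz y); last first.
  rewrite b0// normr0 mule0 (eq_integral (cst 0%E)) ?integral0// => x _.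
  by rewrite /f/= b0// normr0 mul0r mulr0.
have mkd : measurable_fun setT (fun x : Borel X => `|k0 (x, y) - k0 (x, z)|%:E).
  by apply/measurable_EFinP; apply: measurableT_comp => //; apply: measurable_funB; exact: mk0y.
have e2 : 2 * cd * sg / (2 * cd) = sg by field; rewrite gt_eqF.
have rho0 : 0 < 2 * cd * sg by rewrite !mulr_gt0.
have := HH1 (y0 := z) (y := y) (z := z) rho0; rewrite e2 => /(_ By (qball_center hX z sg0)) hh.
pose Fz : set (Borel X) := ~` qball d z (2 * cd * sg).
have mFz : measurable Fz by apply: measurableC; exact: (qball_measurable hX).
apply: (@le_trans _ _ (\int[mu]_x ((M * `|b y|)%:E * (\1_Fz x * `|k0 (x, y) - k0 (x, z)|)%:E))%E).
  apply: ge0_le_integral' => //.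
  - exact: measurable_fun_pair1.
  - apply: measurable_funeM; apply/measurable_EFinP; apply: measurable_funM.
      exact: measurable_indic.
    exact/measurable_EFinP.
  - move=> x _; rewrite /f/= -EFinM lee_fin indicE.
    case: (boolP (x \in Fz)) => [_|/negP].
      by rewrite mul1r mulrA ler_wpM2r// ler_wpM2r.
    rewrite inE /Fz => /contrapT xin; rewrite s0 ?normr0 ?mul0r ?mulr0//.
    move: xin; apply: (qball_le (d := d)); rewrite ler_pM2r// expr2 mulrA ler_pM2r//.
    by lra.
have mI : measurable_fun setT (fun x : Borel X => (\1_Fz x * `|k0 (x, y) - k0 (x, z)|)%:E).
  apply/measurable_EFinP; apply: measurable_funM; first exact: measurable_indic.
  exact/measurable_EFinP.
have pI (x : Borel X) : (0 <= (\1_Fz x * `|k0 (x, y) - k0 (x, z)|)%:E)%E.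
  by rewrite lee_fin mulr_ge0// indicE; case: (_ \in _).
rewrite ge0_integralZl ?lee_fin ?mulr_ge0// integral_indicM.
apply: (@le_trans _ _ ((M * `|b y|)%:E * H1%:E)%E).
  by apply: lee_wpmul2l => //; rewrite lee_fin mulr_ge0.
by rewrite -!EFinM lee_fin mulrAC.
Qed.

End KernelRepresentation.

(** * Weak type estimate *)

Section Piecewise.
Context {R : realType} {X : ptopologicalType}.
Implicit Types (M : set (cube X)) (phi : cube X -> Borel X -> R).

Definition piecewise M phi (x : Borel X) : R :=
  if pselect (exists P, M P /\ carrier P x) is left e then phi (sval (cid e)) x else 0.

Lemma piecewiseE M phi P x : disjoint_family M -> M P -> carrier P x ->
  piecewise M phi x = phi P x.
Proof.
move=> dM MP Px; rewrite /piecewise; case: pselect => [e|]; last by case; exists P.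
have [MQ Qx] := svalP (cid e); congr (phi _ x).
apply: contrapT => ne; have := dM _ _ MQ MP ne.
by rewrite -subset0 => /(_ x); apply.
Qed.

Lemma piecewise0 M phi x : ~ famU M carrier x -> piecewise M phi x = 0.
Proof.
move=> nU; rewrite /piecewise; case: pselect => // -[P [MP Px]].
by case: nU; exists P.
Qed.

Lemma piecewise_measurable M phi : countable M -> disjoint_family M ->
  (forall P, M P -> measurable (carrier P)) ->
  (forall P, M P -> measurable_fun setT (phi P)) ->
  measurable_fun setT (piecewise M phi).
Proof.
move=> cM dM mM mphi _ Y mY; rewrite setTI.
have mU : measurable (famU M carrier) by exact: famU_measurable.
have -> : piecewise M phi @^-1` Y =
    famU M (fun P => carrier P `&` phi P @^-1` Y) `|`
    (~` famU M carrier `&` [set _ | Y 0]).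
  apply/seteqP; split => [x /= Yx|x [[P MP [Px /= Yx]]|[nU Y0]]] /=.
  - have [[P MP Px]|nU] := pselect (famU M carrier x).
      by left; exists P => //; split => //=; rewrite -(piecewiseE phi dM MP Px).
    by right; split => //=; rewrite -(piecewise0 phi nU).
  - by rewrite (piecewiseE phi dM MP Px).
  - by rewrite piecewise0.
apply: measurableU.
  apply: famU_measurable => // P MP; apply: measurableI; first exact: mM.
  by rewrite -[_ @^-1` _]setTI; exact: mphi.
apply: measurableI; first exact: measurableC.
have [Y0|nY0] := pselect (Y 0).
  by rewrite (_ : [set _ | _] = setT)//; apply/seteqP; split.
by rewrite (_ : [set _ | _] = set0)//; apply/seteqP; split.
Qed.

End Piecewise.

(** * Dilated cubes and the maximal function *)

Section Maximal.
Context {R : realType} {X : ptopologicalType}.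
Variables (mu : {measure set (Borel X) -> \bar R}) (d : X -> X -> R).
Variables (cd cmu : R) (hX : homogeneous_type mu d cd cmu).
Variables (c0 C0 delta : R) (hc0 : 0 < c0 <= C0) (hdelta : 0 < delta < 1).
Variables (D : set (cube X)) (hD : dyadic_system d c0 C0 delta D).
Variables (alpha : R) (halpha : 3 * cd ^+ 2 / delta <= alpha).
Local Notation cub := (cub hD).
Local Notation dil := (dilate d C0 delta alpha).
Let cd0 := cd_gt0 hX.
Let cd1 : 1 <= cd := cd_ge1 hX.
Let C00 := C0_gt0 hc0.
Let d0 : 0 < delta. Proof. by case/andP: hdelta. Qed.
Let d1 : delta < 1. Proof. by case/andP: hdelta. Qed.
Let dp (k : int) : 0 < delta ^ k := dpow_gt0 hdelta k.

Lemma alpha_ge : 3 * cd ^+ 2 <= alpha.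
Proof.
apply: le_trans halpha; rewrite ler_pdivlMr// ler_piMr// ?mulr_ge0 ?sqr_ge0// ltW//.
Qed.

Lemma alpha_ge3 : 3 <= alpha.
Proof.
apply: le_trans alpha_ge; by rewrite -[leLHS]mulr1 ler_pM2l// exprn_ege1.
Qed.
Let a3 := alpha_ge3.

Lemma dil_radius_gt0 (Q : cube X) : 0 < alpha * C0 * delta ^ generation Q.
Proof. by rewrite !mulr_gt0//; have := a3; lra. Qed.

Lemma dil_measurable (Q : cube X) : measurable (dil Q).
Proof. exact: (qball_measurable hX). Qed.

Lemma dil_gt0 (Q : cube X) : (0 < mu (dil Q))%E.
Proof. by apply: (qball_gt0 hX); exact: dil_radius_gt0. Qed.

Lemma dil_fin (Q : cube X) : (mu (dil Q) < +oo)%E.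
Proof. exact: (qball_fin hX). Qed.

Lemma cube_sub_dil Q : D Q -> carrier Q `<=` dil Q.
Proof.
move=> DQ; apply: subset_trans (ds_outer hD DQ) _.
apply: (qball_le (d := d)); rewrite ler_pM2r// ler_peMl ?ltW//; have := a3; lra.
Qed.

Definition dilc : R := cubc cd cmu c0 0 (alpha * C0).

Lemma dilc_ge1 : 1 <= dilc. Proof. exact: (cubc_ge1 hX). Qed.

Lemma dil_le Q : D Q -> (mu (dil Q) <= dilc%:E * mu (carrier Q))%E.
Proof.
move=> DQ; have := ball_le_cube hX hc0 hdelta hD (a := 0) (alpha * C0) (x := cube_center Q) DQ.
by apply; rewrite (qdxx hX) mul0r.
Qed.

Lemma scale_exists (rho : R) : 0 < rho ->
  exists l : int, delta ^ (l + 1) < rho /\ rho <= delta ^ l.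
Proof.
move=> r0; have [l0 [_ h0]] := dpow_large_to hdelta 0 rho.
have [l1 [l01 h1]] := dpow_small_from hdelta l0 r0.
have ex : exists n : nat, delta ^ (l0 + n%:Z) < rho.
  exists `|l1 - l0|%N; rewrite gez0_abs ?subr_ge0//.
  by rewrite addrCA subrr addr0.
case: (ex_minnP ex) => -[|n] hn hmin.
  by move: hn; rewrite addr0 => /(lt_trans h0); rewrite ltxx.
exists (l0 + n%:Z); split; first by rewrite -addrA -PoszD addn1.
by rewrite leNgt; apply/negP => /hmin; rewrite ltnn.
Qed.

Definition cz_bad (F : Borel X -> R) (lambda : R) (P : cube X) : Prop :=
  (lambda%:E * mu (carrier P) < \int[mu]_(x in carrier P) (F x)%:E)%E.

Section CZ.
Variables (F : Borel X -> R) (lambda : R) (k : int).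
Hypotheses (mF : measurable_fun setT F) (F0 : forall x, 0 <= F x) (l0 : 0 < lambda).
Local Notation M := (maxcubes D k (cz_bad F lambda)).

Lemma cz_measurable P : M P -> measurable (carrier P).
Proof. by move=> [DP _ _ _]; exact: (cube_measurable hD). Qed.

Lemma cz_countable : countable M. Proof. exact: (maxcubes_countable hX hc0 hdelta hD). Qed.
Lemma cz_disjoint : disjoint_family M. Proof. exact: (maxcubes_disjoint hD). Qed.

Lemma czU_measurable : measurable (famU M carrier).
Proof. by apply: famU_measurable; [exact: cz_countable|exact: cz_measurable]. Qed.

Lemma cz_measure : (lambda%:E * mu (famU M carrier) <= \int[mu]_x (F x)%:E)%E.
Proof.
have mFE : measurable_fun setT (fun x => (F x)%:E) by exact/measurable_EFinP.
rewrite -integral_cst; last exact: czU_measurable.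
apply: (@le_trans _ _ (\int[mu]_(x in famU M carrier) (F x)%:E)%E); last first.
  apply: ge0_subset_integral => //; first exact: czU_measurable.
  by move=> x _; rewrite lee_fin.
apply: (fam_le_integral cz_countable cz_measurable cz_disjoint) => //.
- by move=> x /=; rewrite lee_fin ltW.
- by move=> P MP; rewrite integral_cst; [case: MP => _ _ /ltW|exact: cz_measurable].
Qed.

Lemma cz_enlarged (A : R) : 0 <= A ->
  (mu (famU M (fun P => qball d (cube_center P) (A * delta ^ generation P))) <=
   (cubc cd cmu c0 0 A)%:E * mu (famU M carrier))%E.
Proof.
move=> A0; apply: fam_le_measure.
- by rewrite ltW// (cubc_gt0 hX).
- exact: cz_countable.
- exact: cz_measurable.
- exact: cz_disjoint.
- by move=> P _; exact: (qball_measurable hX).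
- move=> P [DP _ _ _]; have := ball_le_cube hX hc0 hdelta hD (a := 0) A (x := cube_center P) DP.
  by apply; rewrite (qdxx hX) mul0r.
Qed.

End CZ.

(** A weak type estimate for the uncentered maximal function, localised to [Q]. [Om] is the union of
    the enlarged maximal cubes where the average of [F] exceeds [lam], and [Lam] is chosen so that
    its measure is at most [e] times that of [Q]. *)
Lemma maximal_lemma : exists2 CM : R, 1 <= CM &
  forall (e : R) Q (t : R) (F : Borel X -> R), 0 < e <= 1 -> D Q -> 0 < t ->
  measurable_fun setT F -> (forall x, 0 <= F x) -> (forall x, ~ dil Q x -> F x = 0) ->
  (\int[mu]_x (F x)%:E <= t%:E * mu (dil Q))%E ->
  exists Om : set (Borel X), [/\ measurable Om, (mu Om <= e%:E * mu (carrier Q))%E &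
    forall x, carrier Q x -> ~ Om x -> forall z rho, qball d z rho x ->
      (\int[mu]_(y in qball d z rho) (F y)%:E <= (CM * t / e)%:E * mu (qball d z rho))%E].
Proof.
(* If a maximal bad cube contains a point y of the ball and the ball is not larger than that cube,
   then x is this close to its center: [C0] from the center to y, and [2 * cd] between two points of
   the ball. *)
pose A4 := cd * (C0 + 2 * cd).
have A40 : 0 <= A4 by rewrite mulr_ge0 ?ltW// addr_gt0// mulr_gt0.
pose C5 := cubc cd cmu c0 0 A4.
pose Lam := C5 * dilc.
have C5g : 1 <= C5 by exact: (cubc_ge1 hX).
have Lg : 1 <= Lam by rewrite -[leLHS]mulr1 ler_pM// dilc_ge1.
pose C7 := dblc cmu (cd * (cd * (1 + C0 / delta) + alpha * C0 / delta)).
pose C8 := dblc cmu (cd * (1 + 2 * cd * C0 / delta)).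
have C7g : 1 <= C7 by exact: (dblc_ge1 hX).
have C8g : 1 <= C8 by exact: (dblc_ge1 hX).
exists (C7 + Lam * C8).
  by rewrite ler_wpDr// mulr_ge0//; lra.
move=> e Q t F /andP[e0 e1] DQ t0 mF F0 Fs hF.
set k := generation Q; pose lam := Lam * t / e.
have lam0 : 0 < lam by rewrite divr_gt0// mulr_gt0//; lra.
have mFE : measurable_fun setT (fun x => (F x)%:E) by exact/measurable_EFinP.
pose M := maxcubes D k (cz_bad F lam).
pose Om : set (Borel X) := famU M (fun P => qball d (cube_center P) (A4 * delta ^ generation P)).
exists Om; split.
- by apply: famU_measurable; [exact: cz_countable|move=> P _; exact: (qball_measurable hX)].
- apply: le_trans (cz_enlarged F lam k A40) _; rewrite -/C5.
  have h1 := cz_measure k mF F0 lam0; rewrite -/M in h1 *.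
  have h2 : (lam%:E * mu (famU M carrier) <= (t * dilc)%:E * mu (carrier Q))%E.
    apply: le_trans h1 (le_trans hF _); rewrite EFinM -muleA.
    by apply: lee_wpmul2l; [rewrite lee_fin ltW|exact: dil_le].
  rewrite -lee_pdivlMl// in h2; apply: le_trans (_ : _ <= C5%:E * (lam^-1%:E * ((t * dilc)%:E * mu (carrier Q))))%E _.
    by apply: lee_wpmul2l => //; rewrite lee_fin; lra.
  rewrite !muleA -!EFinM; apply: lee_wpmul2r => //; rewrite lee_fin.
  have -> : C5 * lam^-1 * (t * dilc) = e by rewrite /lam /Lam; field; rewrite !gt_eqF//; have := dilc_ge1; lra.
  exact: lexx.
move=> x Qx nOm z rho zx.
have r0 : 0 < rho by apply: le_lt_trans zx; exact: (qd_ge0 hX).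
pose B : set (Borel X) := qball d z rho.
have mB : measurable B by exact: (qball_measurable hX).
have [l [l1 l2]] := scale_exists r0.
(* A ball at least of the scale of [Q] is compared with the whole of [dil Q], which gives [C7]. A
   smaller one is covered by cubes of its own scale, none of them bad since x is outside [Om]; this
   gives [C8]. *)
have [lk|kl] := leP l k.
  apply: (@le_trans _ _ (t%:E * mu (dil Q))%E).
    by apply: le_trans hF; apply: ge0_subset_integral => // y _; rewrite lee_fin.
  have rk : delta * delta ^ k <= rho.
    apply: ltW; apply: le_lt_trans l1; rewrite (dpowD hdelta) expr1z mulrC ler_pM2r//.
    exact: (dpow_le hdelta).
  have h : (mu (dil Q) <= C7%:E * mu B)%E.
    apply: le_trans (doubling_center hX (alpha * C0 / delta) (a := cd * (1 + C0 / delta)) (x := cube_center Q) (y := z) r0 _).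
      apply: (le_qball hX); first exact: dil_measurable.
      apply: (qball_le (d := d)); rewrite -/k -[leRHS]mulrA ler_pM2l ?ler_pdivlMl//.
      by rewrite mulr_gt0//; have := a3; lra.
    apply: le_trans (qd_tri hX x _ _) _; rewrite -mulrA ler_pM2l// mulrDl mul1r lerD//; first exact: ltW.
    rewrite (qd_sym hX); apply: le_trans (ltW (cube_outer hD DQ Qx)) _.
    by rewrite -[leRHS]mulrA ler_pM2l// ler_pdivlMl.
  apply: le_trans (lee_wpmul2l _ h) _; first by rewrite lee_fin ltW.
  rewrite muleA -EFinM; apply: lee_wpmul2r => //; rewrite lee_fin.
  rewrite ler_pdivlMr//; have [h1 h2] : t * C7 * e <= t * C7 /\ 0 <= Lam * C8 * t.
    have tC7 : 0 <= t * C7 by rewrite mulr_ge0 ?(ltW t0)//; lra.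
    split; first by rewrite ler_piMr.
    by apply: mulr_ge0 (ltW t0); apply: mulr_ge0; lra.
  by rewrite mulrDl; lra.
pose V := [set P | [/\ D P, generation P = l & exists2 y, carrier P y & B y]].
have cV : countable V.
  apply: sub_countable (countable_D hX hc0 hdelta hD); apply: subset_card_le.
  by move=> P [].
have mV P : V P -> measurable (carrier P) by move=> [DP _ _]; exact: (cube_measurable hD).
have dV : disjoint_family V.
  by move=> P P' [DP gP _] [DP' gP' _]; apply: (ds_disjoint hD) => //; rewrite gP gP'.
have good P : V P -> (\int[mu]_(x in carrier P) (F x)%:E <= lam%:E * mu (carrier P))%E.
  move=> [DP gP [y Py By]]; rewrite leNgt; apply/negP => bad.
  have kP : k < generation P by rewrite gP.
  have [P' MP' PP'] := maxcubes_cover DP kP (bad : cz_bad F lam P).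
  apply: nOm; exists P' => //; have [DP' _ _ _] := MP'.
  have gPP' : delta ^ l <= delta ^ generation P'.
    apply: (dpow_le hdelta); rewrite -gP leNgt; apply/negP => h.
    have [_ _ _ mP'] := MP'; apply: (mP' P) => //; first by rewrite kP h.
    apply: (cube_nested hD DP' DP (ltW h) (PP' _ Py) Py).
  rewrite /qball/= /A4; apply: le_lt_trans (qd_tri hX y _ _) _.
  rewrite -mulrA ltr_pM2l// mulrDl; apply: ltr_leD.
    exact: (cube_outer hD DP' (PP' _ Py)).
  apply: le_trans (qd_tri hX z _ _) _; rewrite (qd_sym hX y z).
  apply: (@le_trans _ _ (cd * (rho + rho))); first by rewrite ler_pM2l// lerD// ltW.
  have rg := le_trans l2 gPP'.
  by rewrite -[leRHS]mulrA [leRHS]mulrCA ler_pM2l//; lra.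
apply: (@le_trans _ _ (\int[mu]_(y in famU V carrier) (F y)%:E)%E).
  apply: ge0_subset_integral => //; first exact: famU_measurable.
  - exact: measurable_funTS.
  - by move=> y _; rewrite lee_fin.
  - move=> y By; exists (cub l y); last exact: cub_in.
    by split; [exact: cub_D|exact: gen_cub|exists y => //; exact: cub_in].
apply: (@le_trans _ _ (lam%:E * mu (famU V carrier))%E).
  rewrite -integral_cst; last exact: famU_measurable.
  apply: fam_le_integral => //.
  - by move=> y /=; rewrite lee_fin ltW.
  - by move=> P VP; rewrite integral_cst; [exact: good|exact: mV].
have hV : (mu (famU V carrier) <= C8%:E * mu B)%E.
  apply: le_trans (doubling hX (cd * (1 + 2 * cd * C0 / delta)) z r0).
  apply: (le_qball hX); first exact: famU_measurable.
  move=> y' [P [DP gP [y Py By]] Py']; rewrite /qball/=.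
  apply: le_lt_trans (qd_tri hX y _ _) _; rewrite -[ltRHS]mulrA ltr_pM2l// mulrDl mul1r.
  apply: ltr_leD => //; apply: le_trans (ltW (cube_outer2 hX hD DP Py Py')) _.
  rewrite gP -[leRHS]mulrA ler_pM2l; last by rewrite !mulr_gt0.
  rewrite mulrC ler_pdivlMr//; move: l1; rewrite (dpowD hdelta) expr1z; exact: ltW.
apply: le_trans (lee_wpmul2l _ hV) _; first by rewrite lee_fin ltW.
rewrite muleA -EFinM; apply: lee_wpmul2r => //; rewrite lee_fin /lam.
have te : 0 <= t / e by rewrite divr_ge0// ltW.
have -> : Lam * t / e * C8 = Lam * C8 * (t / e) by ring.
have -> : (C7 + Lam * C8) * t / e = C7 * (t / e) + Lam * C8 * (t / e) by ring.
by rewrite lerDr mulr_ge0//; lra.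
Qed.

End Maximal.

Section LevelSets.
Context dT {T : measurableType dT} {R : realType}.
Variable mu : {measure set T -> \bar R}.
Implicit Types (A : set T) (u : T -> R).

Definition level A u (s : R) : set T := A `&` [set x | s < `|u x|].

Lemma level_measurable A u s : measurable A -> measurable_fun setT u ->
  measurable (level A u s).
Proof.
move=> mA mu_; apply: measurableI => //.
rewrite (_ : [set x | _] = (fun x => `|u x|) @^-1` `]s, +oo[).
  by rewrite -[_ @^-1` _]setTI; apply: measurableT_comp => //; exact: measurable_itv.
by apply/seteqP; split => x /=; rewrite in_itv/= andbT.
Qed.

Lemma level_measure A u (s c : R) m : measurable A -> measurable_fun setT u -> 0 < s ->
  (\int[mu]_(x in A) `|u x|%:E <= c%:E * m)%E ->
  (mu (level A u s) <= (c / s)%:E * m)%E.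
Proof.
move=> mA mu_ s0 h; have mL := level_measurable s mA mu_.
have mau : measurable_fun setT (fun x => `|u x|%:E).
  by apply/measurable_EFinP; exact: measurableT_comp.
rewrite mulrC EFinM -muleA lee_pdivlMl//; apply: le_trans h.
rewrite -integral_cst//.
apply: (@le_trans _ _ (\int[mu]_(x in level A u s) `|u x|%:E)%E).
  apply: ge0_le_integral' => //.
  - by move=> x _; rewrite lee_fin ltW.
  - exact: measurable_funTS.
  - by move=> x [_ /ltW]; rewrite lee_fin.
by apply: ge0_subset_integral => //; [exact: measurable_funTS|move=> x []].
Qed.

Lemma integrable_cst_on A (c : R) : measurable A -> (mu A < +oo)%E ->
  mu.-integrable A (fun=> c%:E).
Proof.
move=> mA fA; apply/integrableP; split => //.
rewrite (_ : (fun _ => _) = cst `|c|%:E)// integral_cst// lte_mul_pinfty//.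
Qed.

Lemma integrable_scale A u (c : R) : measurable A -> mu.-integrable A (EFin \o u) ->
  mu.-integrable A (fun x => (c * u x)%:E).
Proof.
by move=> mA iu; have := integrableZl mA c iu; exact: eq_integrable.
Qed.

Lemma ae_le_measure A B : measurable A -> measurable B ->
  {ae mu, forall x, A x -> B x} -> (mu A <= mu B)%E.
Proof.
move=> mA mB h; rewrite (measureDI mu mA mB) [X in (X + _)%E]measure_negligible.
- by rewrite add0e le_measure ?inE//; exact: measurableI.
- exact: measurableD.
- apply: negligibleS h => x [Ax nBx] /=; apply/not_implyP; split => //.
Qed.

(** The sign is written with two indicators because the testing condition concerns indicators. *)
Definition sign_on A u (x : T) : R :=
  \1_(A `&` [set x | 0 < u x]) x - \1_(A `&` [set x | u x < 0]) x.

Lemma measurable_gt0 u : measurable_fun setT u -> measurable [set x | 0 < u x].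
Proof.
move=> mu_; rewrite (_ : [set x | _] = u @^-1` `]0, +oo[).
  by rewrite -[_ @^-1` _]setTI; exact: mu_.
by apply/seteqP; split => x /=; rewrite in_itv/= andbT.
Qed.

Lemma measurable_lt0 u : measurable_fun setT u -> measurable [set x | u x < 0].
Proof.
move=> mu_; rewrite (_ : [set x | _] = u @^-1` `]-oo, 0[).
  by rewrite -[_ @^-1` _]setTI; exact: mu_.
by apply/seteqP; split => x /=; rewrite in_itv.
Qed.

Lemma sign_on_measurable A u : measurable A -> measurable_fun setT u ->
  measurable_fun setT (sign_on A u).
Proof.
move=> mA mu_; apply: measurable_funB; apply: measurable_indic; apply: measurableI => //.
  exact: measurable_gt0.
exact: measurable_lt0.
Qed.

Lemma sign_onE A u x : u x * sign_on A u x = \1_A x * `|u x|.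
Proof.
rewrite /sign_on !indicE !in_setI.
have [Ax|nAx] := boolP (x \in A); last by rewrite /= subrr mulr0 mul0r.
have -> : (x \in [set x | 0 < u x]) = (0 < u x) by apply/idP/idP; rewrite inE.
have -> : (x \in [set x | u x < 0]) = (u x < 0) by apply/idP/idP; rewrite inE.
have [u0|u0|u0] := ltgtP (u x) 0.
- by rewrite ltr0_norm//= sub0r mulrN mulr1 mul1r.
- by rewrite gtr0_norm//= subr0 mulr1 mul1r.
- by rewrite u0 normr0 mul0r mulr0.
Qed.

Lemma sign_on0 A u x : ~ A x -> sign_on A u x = 0.
Proof. by move=> nA; rewrite /sign_on !indicE !memNset ?subrr// => -[]. Qed.

Lemma sign_on_le1 A u x : `|sign_on A u x| <= 1.
Proof.
rewrite /sign_on !indicE; case: (_ \in _); case: (_ \in _);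
  by rewrite /= ?subrr ?subr0 ?sub0r ?normrN ?normr0 ?normr1.
Qed.

End LevelSets.

(** * Calderon-Zygmund decomposition *)

Section WeakType.
Context {R : realType} {X : ptopologicalType}.
Variables (mu : {measure set (Borel X) -> \bar R}) (d : X -> X -> R).
Variables (cd cmu : R) (hX : homogeneous_type mu d cd cmu).
Variables (c0 C0 delta : R) (hc0 : 0 < c0 <= C0) (hdelta : 0 < delta < 1).
Variables (D : set (cube X)) (hD : dyadic_system d c0 C0 delta D).
Local Notation cub := (cub hD).
Let cd0 := cd_gt0 hX.
Let C00 := C0_gt0 hc0.
Let dp (k : int) : 0 < delta ^ k := dpow_gt0 hdelta k.

Section Decomposition.
Variables (h : Borel X -> R) (lam : R) (k : int).
Hypotheses (ih : mu.-integrable setT (EFin \o h)) (lam0 : 0 < lam).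
Let F x := `|h x|.
Local Notation M := (maxcubes D k (cz_bad mu F lam)).
Local Notation U := (famU M carrier).
Hypothesis kgood : forall P, D P -> generation P = k -> ~ cz_bad mu F lam P.
Definition czc : R := cubc cd cmu c0 C0 (2 * cd * C0 / delta ^+ 1).

Lemma mh : measurable_fun setT h.
Proof. by apply/measurable_EFinP; exact: measurable_int ih. Qed.
Lemma mF : measurable_fun setT F.
Proof. apply: measurableT_comp => //; exact: mh. Qed.
Lemma mFE : measurable_fun setT (fun x => (F x)%:E).
Proof. by apply/measurable_EFinP; exact: mF. Qed.
Let mU : measurable U := czU_measurable hX hc0 hdelta hD F lam k.

(** At a density point of the set where [h] is large off [U], some cube is more than half filled by
    it. The average of [|h|] there would exceed [lam], so the cube would lie in [U]. The half is the
    reason for the factor 2. *)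
Lemma cz_off : {ae mu, forall x, ~ U x -> `|h x| <= 2 * lam}.
Proof.
pose Om : set (Borel X) := level setT h (2 * lam) `\` U.
have mOm : measurable Om.
  by apply: measurableD => //; apply: level_measurable => //; exact: mh.
have := dyadic_density hX hc0 hdelta hD mOm (e := 1 / 2) ltac:(by lra).
apply: ae_mono => x hx nU; rewrite leNgt; apply/negP => hl.
have [l kl hl2] := hx (conj (conj I hl) nU) (k + 1).
have DP : D (cub l x) := cub_D hD l x.
have mP : measurable (carrier (cub l x)) := cube_measurable hD DP.
have kP : k < generation (cub l x) by rewrite gen_cub (lt_le_trans _ kl)// ltrDl.
have [|P MP PP] := maxcubes_cover DP kP (bad := cz_bad mu F lam); last first.
  by apply: nU; exists P => //; apply: PP; exact: cub_in.
rewrite /cz_bad; set P := carrier _ in mP hl2 *.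
have Pf : mu P \is a fin_num by exact: (cube_mu_fin_num hX hD DP).
have mPO : measurable (P `&` Om) by exact: measurableI.
apply: (@lt_le_trans _ _ ((2 * lam)%:E * mu (P `&` Om))%E); last first.
  rewrite -integral_cst//; apply: (@le_trans _ _ (\int[mu]_(x in P `&` Om) (F x)%:E)%E).
    apply: ge0_le_integral' => //.
    - by move=> y _; rewrite /= lee_fin mulr_ge0// ltW.
    - apply: measurable_funTS; exact: mFE.
    - by move=> y [_ [[_ /ltW ?] _]]; rewrite lee_fin.
  by apply: ge0_subset_integral => //; [apply: measurable_funTS; exact: mFE|move=> y _; rewrite lee_fin; exact: normr_ge0].
have hs : mu P = (mu (P `\` Om) + mu (P `&` Om))%E.
  by rewrite -measureDI// setDE setIC.
have f1 : mu (P `\` Om) \is a fin_num.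
  rewrite ge0_fin_numE// (le_lt_trans (le_measure _ _ _ (@subDsetl _ P Om)))// ?inE//.
  - exact: measurableD.
  - by rewrite -ge0_fin_numE.
have f2 : mu (P `&` Om) \is a fin_num.
  rewrite ge0_fin_numE// (le_lt_trans (le_measure _ _ _ (@subIsetl _ P Om)))// ?inE//.
  by rewrite -ge0_fin_numE.
move: hl2; rewrite hs -(fineK f1) -(fineK f2) -EFinD -!EFinM !lte_fin.
set a := fine _; set b := fine _ => hab; by rewrite [2 * lam]mulrC -mulrA ltr_pM2l//; lra.
Qed.

Lemma cz_parent_le P : M P ->
  (\int[mu]_(x in carrier P) `|h x|%:E <= (czc * lam)%:E * mu (carrier P))%E.
Proof.
move=> MP; have [DP kP _ _] := MP; pose x := cube_center P.
have Px : carrier P x := center_in hX hc0 hdelta hD DP.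
have mP := cube_measurable hD DP.
have nb : ~ cz_bad mu F lam (cub (generation P - 1) x).
  by apply: maxcubes_parent kgood; [exact: MP|exact: Px].
set P' := cub _ _ in nb.
have DP' : D P' := cub_D hD _ _.
apply: (@le_trans _ _ (\int[mu]_(x in carrier P') `|h x|%:E)%E).
  apply: ge0_subset_integral => //.
  - exact: (cube_measurable hD).
  - apply: measurable_funTS; exact: mFE.
  - apply: (cube_nested hD DP DP' _ Px (cub_in hD _ _)).
    by rewrite gen_cub gerBl.
have : (\int[mu]_(x in carrier P') `|h x|%:E <= lam%:E * mu (carrier P'))%E.
  by rewrite leNgt; apply/negP.
move=> h1; apply: le_trans h1 _; rewrite mulrC EFinM -muleA; apply: lee_wpmul2l.
  by rewrite lee_fin ltW.
have := cub_le_cub hX hc0 hdelta hD (generation P - 1) 1 x.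
by rewrite subrK -(cub_uniq hD DP Px).
Qed.

(** Off the bad cubes [h] is cut at [2 * lam], which changes it on a null set only but makes the
    good part bounded at every point, as test functions have to be. *)
Definition cz_good : Borel X -> R := fun x =>
  piecewise M (fun P _ => (fine (mu (carrier P)))^-1 * \int[mu]_(y in carrier P) h y) x
  + \1_(~` U `&` [set y | `|h y| <= 2 * lam]) x * h x.

Lemma cz_set_measurable : measurable (~` U `&` [set y : Borel X | `|h y| <= 2 * lam]).
Proof.
apply: measurableI; first exact: measurableC.
have -> : [set y : Borel X | `|h y| <= 2 * lam] = ~` level setT h (2 * lam).
  apply/seteqP; split => y /=; first by rewrite leNgt => /negP hy [].
  by move=> hy; rewrite leNgt; apply/negP => ?; apply: hy.
by apply: measurableC; apply: level_measurable => //; exact: mh.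
Qed.

Lemma cz_good_measurable : measurable_fun setT cz_good.
Proof.
apply: measurable_funD.
  apply: piecewise_measurable => //.
  - exact: (cz_countable hX hc0 hdelta hD).
  - exact: (cz_disjoint hD).
  - exact: (cz_measurable hD).
apply: measurable_funM; last exact: mh.
by apply: measurable_indic; exact: cz_set_measurable.
Qed.

Lemma cz_good_in P x : M P -> carrier P x ->
  cz_good x = (fine (mu (carrier P)))^-1 * \int[mu]_(y in carrier P) h y.
Proof.
have dM : disjoint_family M by exact: (cz_disjoint hD).
move=> MP Px; rewrite /cz_good (piecewiseE _ dM MP Px).
by rewrite indicE memNset ?mul0r ?addr0// => -[] /=; case; exists P.
Qed.

Lemma cz_good_out x : ~ U x -> cz_good x = \1_[set y | `|h y| <= 2 * lam] x * h x.
Proof.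
move=> nU; rewrite /cz_good piecewise0// add0r !indicE in_setI.
by rewrite (@mem_set _ (~` U))//.
Qed.

Lemma cz_avg_le P : M P ->
  (`|\int[mu]_(y in carrier P) h y|%:E <= \int[mu]_(y in carrier P) `|h y|%:E)%E.
Proof.
move=> MP; apply: abs_Rintegral_le; first exact: (cz_measurable hD MP).
by apply: integrableS ih => //; exact: (cz_measurable hD MP).
Qed.

Lemma cz_good_le x : `|cz_good x| <= (2 + czc) * lam.
Proof.
have cz1 : 1 <= czc by exact: (cubc_ge1 hX).
have [[P MP Px]|nU] := pselect (U x); last first.
  rewrite cz_good_out// normrM indicE; have [hx|_] := boolP (_ \in _); last first.
    by rewrite normr0 mul0r mulr_ge0 ?(ltW lam0)//; lra.
  rewrite normr1 mul1r; apply: le_trans (_ : 2 * lam <= _); first by rewrite inE in hx.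
  by rewrite ler_pM2r//; lra.
have [DP _ _ _] := MP.
have Pf := cube_mu_fin_num hX hD DP.
have P0 : 0 < fine (mu (carrier P)) by rewrite -lte_fin fineK// (cube_mu_gt0 hX hc0 hdelta hD DP).
rewrite (cz_good_in MP Px) normrM gtr0_norm ?invr_gt0// ler_pdivrMl//.
have := le_trans (cz_avg_le MP) (cz_parent_le MP).
rewrite -[mu _]fineK// -EFinM lee_fin => /le_trans; apply.
by rewrite mulrC ler_pM2l// ler_pM2r//; lra.
Qed.

Lemma cz_good_supp z A : 0 <= A -> (forall x, ~ qball d z (A * delta ^ k) x -> h x = 0) ->
  forall x, ~ qball d z (cd * (A + 2 * cd * C0) * delta ^ k) x -> cz_good x = 0.
Proof.
move=> A0 hs x nx; have [[P MP Px]|nU] := pselect (U x); last first.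
  rewrite cz_good_out// hs ?mulr0// => /= xz; apply: nx.
  apply: lt_le_trans xz _; rewrite ler_pM2r//.
  have c1 : 1 <= cd := cd_ge1 hX.
  apply: le_trans (_ : A + 2 * cd * C0 <= _); first by rewrite lerDl !mulr_ge0// ltW.
  by rewrite ler_peMl// addr_ge0// !mulr_ge0// ltW.
exfalso; have [DP kP bad _] := MP.
have [[y Py hy]|no] := pselect (exists2 y, carrier P y & h y != 0).
  have yz : d z y < A * delta ^ k.
    by apply: contrapT => nyz; move: hy; rewrite hs// eqxx.
  apply: nx; rewrite /qball/=; apply: le_lt_trans (qd_tri hX y _ _) _.
  rewrite -mulrA ltr_pM2l// mulrDl ltrD//.
  apply: lt_le_trans (cube_outer2 hX hD DP Py Px) _.
  by rewrite ler_pM2l ?(dpow_le hdelta) ?ltW// !mulr_gt0.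
move: bad; rewrite /cz_bad integral0_eq; last first.
  move=> y Py; have [hy|hy] := eqVneq (h y) 0; first by rewrite /F hy normr0.
  by case: no; exists y.
by rewrite ltNge mule_ge0// lee_fin ltW.
Qed.

Definition cz_rest : Borel X -> R := fun x => h x - cz_good x.

Lemma cz_rest_measurable : measurable_fun setT cz_rest.
Proof. by apply: measurable_funB; [exact: mh|exact: cz_good_measurable]. Qed.

Lemma cz_rest_off : {ae mu, forall x, ~ U x -> cz_rest x = 0}.
Proof.
apply: ae_mono cz_off => x hx nU; rewrite /cz_rest cz_good_out// indicE mem_set ?mul1r ?subrr//.
exact: hx.
Qed.

Lemma cz_rest_mean P : M P -> mu.-integrable setT (EFin \o cz_rest) ->
  \int[mu]_(x in carrier P) cz_rest x = 0.
Proof.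
move=> MP ib; have [DP _ _ _] := MP; have mP := cube_measurable hD DP.
have Pf := cube_mu_fin_num hX hD DP.
have P0 : 0 < fine (mu (carrier P)) by rewrite -lte_fin fineK// (cube_mu_gt0 hX hc0 hdelta hD DP).
set a := (fine (mu (carrier P)))^-1 * \int[mu]_(y in carrier P) h y.
have -> : \int[mu]_(x in carrier P) cz_rest x = \int[mu]_(x in carrier P) (h x - a).
  by apply: eq_Rintegral => x; rewrite inE => Px; rewrite /cz_rest (cz_good_in MP Px).
rewrite RintegralB//.
- by rewrite Rintegral_cst// /a mulrAC mulVf ?mul1r ?subrr// gt_eqF.
- exact: integrableS ih.
- by apply: integrable_cst_on => //; rewrite -ge0_fin_numE.
Qed.

Lemma cz_rest_le P : M P ->
  (\int[mu]_(x in carrier P) `|cz_rest x|%:E <= \int[mu]_(x in carrier P) (2 * `|h x|)%:E)%E.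
Proof.
move=> MP; have [DP _ _ _] := MP; have mP := cube_measurable hD DP.
have Pf := cube_mu_fin_num hX hD DP.
have P0 : 0 < fine (mu (carrier P)) by rewrite -lte_fin fineK// (cube_mu_gt0 hX hc0 hdelta hD DP).
set a := (fine (mu (carrier P)))^-1 * \int[mu]_(y in carrier P) h y.
apply: (@le_trans _ _ (\int[mu]_(x in carrier P) (`|h x|%:E + `|a|%:E))%E).
  apply: ge0_le_integral' => //.
  - apply/measurable_EFinP; apply: measurableT_comp => //.
    by apply: measurable_funTS; exact: cz_rest_measurable.
  - apply: emeasurable_funD => //; apply: measurable_funTS; exact: mFE.
  - move=> x Px; rewrite /cz_rest (cz_good_in MP Px) -EFinD lee_fin; exact: ler_normB.
have mP1 : measurable_fun (carrier P) (fun x => `|h x|%:E).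
  by apply: measurable_funTS; exact: mFE.
rewrite ge0_integralD// integral_cst//.
under [leRHS]eq_integral do rewrite mulr_natl mulr2n EFinD.
rewrite ge0_integralD//; apply: leeD2l.
apply: le_trans (cz_avg_le MP).
rewrite -[mu _]fineK// -EFinM lee_fin /a normrM gtr0_norm ?invr_gt0//.
by rewrite mulrAC mulVf ?mul1r// gt_eqF.
Qed.

End Decomposition.

End WeakType.

(** * Estimates for T on scalar functions *)

Section ScalarOperator.
Context {R : realType} {X : ptopologicalType}.
Variables (mu : {measure set (Borel X) -> \bar R}) (d : X -> X -> R).
Variables (cd cmu : R) (hX : homogeneous_type mu d cd cmu).
Variables (c0 C0 delta : R) (hc0 : 0 < c0 <= C0) (hdelta : 0 < delta < 1).
Variables (D : set (cube X)) (hD : dyadic_system d c0 C0 delta D).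
Variables (alpha : R) (halpha : 3 * cd ^+ 2 / delta <= alpha).
Variables (r : \bar R) (hr : (1 < r)%E).
Variables (T Ts : (Borel X -> R) -> (Borel X -> R)).
Hypothesis hT : linear_operator mu d r T.
Hypothesis hTs : linear_operator mu d +oo%E Ts.
Hypothesis hadj : adjoint_operators mu d r +oo%E T Ts.
Variables (ct : R) (ct0 : 0 < ct).
Hypothesis htest : forall x rho (E : set (Borel X)), 0 < rho ->
    measurable E -> E `<=` qball d x rho ->
    (\int[mu]_(y in qball d x rho) (`|Ts (\1_E) y|)%:E
      <= ct%:E * mu (qball d x rho))%E.
Variables (Hr H1 : R) (Hr0 : 0 <= Hr) (H10 : 0 <= H1).
Local Notation p := (dualp r).
Hypothesis oscT : forall z sg M s h L, 0 < sg -> test_fun d M s ->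
  (forall x, ~ qball d z sg x -> s x = 0) -> \int[mu]_x s x = 0 ->
  bsL mu d r h -> (forall y, qball d z (3 * cd ^+ 2 * sg) y -> h y = 0) -> 0 <= L ->
  (forall i, (\int[mu]_(y in qball d z (2 ^+ i.+1 * (3 * cd ^+ 2 * sg))) (`|h y| `^ p)%:E <=
     (L `^ p)%:E * mu (qball d z (2 ^+ i.+1 * (3 * cd ^+ 2 * sg))))%E) ->
  `|\int[mu]_x (T h x * s x)| <= L * Hr * \int[mu]_x `|s x|.
Hypothesis oscTs : forall z sg M s b, 0 < sg -> test_fun d M s ->
  (forall x, qball d z (3 * cd ^+ 2 * sg) x -> s x = 0) ->
  bsL mu d r b -> (forall y, ~ qball d z sg y -> b y = 0) -> \int[mu]_y b y = 0 ->
  `|\int[mu]_x (T b x * s x)| <= M * H1 * \int[mu]_y `|b y|.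
Local Notation cub := (cub hD).
Local Notation dil := (dilate d C0 delta alpha).
Local Notation dilc := (dilc cd cmu c0 C0 alpha).
Let cd0 : 0 < cd := cd_gt0 hX.
Let C00 : 0 < C0 := C0_gt0 hc0.
Let dp (k : int) : 0 < delta ^ k := dpow_gt0 hdelta k.
Let r1 : (1 <= r)%E := ltW hr.
Let a3 := alpha_ge3 hX hdelta halpha.

(** Testing by duality: the pairing of [T g] with an indicator is that of [g] with [Ts] of the
    indicator, which [htest] controls. The absolute value takes two indicators, one for each sign,
    hence the factor 2. *)
Lemma good_part (g : Borel X -> R) z rho (L : R) (E : set (Borel X)) : 0 < rho -> 0 <= L ->
  bsL mu d r g -> (forall x, `|g x| <= L) -> (forall x, ~ qball d z rho x -> g x = 0) ->
  measurable E -> E `<=` qball d z rho ->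
  (\int[mu]_(x in E) `|T g x|%:E <= (2 * L * ct)%:E * mu (qball d z rho))%E.
Proof.
move=> rho0 L0 bg gL gs mE Eb; have mTg := hT.1 g bg.
pose B : set (Borel X) := qball d z rho.
have mB : measurable B by exact: (qball_measurable hX).
have Bf : mu B \is a fin_num by rewrite ge0_fin_numE//; exact: (qball_fin hX).
have one (A : set (Borel X)) : measurable A -> A `<=` B ->
    `|\int[mu]_x (T g x * \1_A x)| <= L * ct * fine (mu B).
  move=> mA AB; have bA : bsL mu d +oo%E (\1_A) by exact: (bsL_indic hX (leey 1%E) mA AB).
  have [_ i2 ->] := hadj bg bA.
  rewrite -lee_fin; apply: le_trans (abs_Rintegral_le measurableT i2) _.
  have mTs := hTs.1 _ bA.
  have mg : measurable_fun setT g by case: bg.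
  have m1 : measurable_fun setT (fun x => `|Ts \1_A x|%:E).
    by apply/measurable_EFinP; exact: measurableT_comp.
  apply: (@le_trans _ _ (\int[mu]_(x in B) (L%:E * `|Ts \1_A x|%:E))%E).
    under [leRHS]eq_integral do rewrite -EFinM.
    rewrite -[leRHS]integral_indicM; apply: ge0_le_integral' => //.
    - by apply/measurable_EFinP; apply: measurableT_comp => //; exact: measurable_funM.
    - apply/measurable_EFinP; apply: measurable_funM; first exact: measurable_indic.
      by apply: measurable_funM => //; exact: measurableT_comp.
    - move=> x _; rewrite lee_fin normrM indicE; have [xB|xB] := boolP (x \in B).
        by rewrite mul1r ler_wpM2r.
      by rewrite gs ?normr0 ?mul0r// => h; rewrite notin_setE in xB.
  rewrite ge0_integralZl//; last exact: measurable_funTS.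
  rewrite -mulrA EFinM; apply: lee_wpmul2l; first by rewrite lee_fin.
  by rewrite EFinM fineK//; exact: htest.
pose s := sign_on E (T g).
pose Ep := E `&` [set x | 0 < T g x]; pose En := E `&` [set x | T g x < 0].
have mEp : measurable Ep by apply: measurableI => //; exact: measurable_gt0.
have mEn : measurable En by apply: measurableI => //; exact: measurable_lt0.
have EpB : Ep `<=` B by move=> x [/Eb].
have EnB : En `<=` B by move=> x [/Eb].
have [ip _ _] := hadj bg (bsL_indic hX (leey 1%E) mEp EpB).
have [iN _ _] := hadj bg (bsL_indic hX (leey 1%E) mEn EnB).
rewrite -integral_indicM.
under eq_integral do rewrite -sign_onE /sign_on mulrBr EFinB.
rewrite integralB//.
have -> : (\int[mu]_x (T g x * \1_Ep x)%:E)%E = (\int[mu]_x (T g x * \1_Ep x))%:E.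
  by rewrite /Rintegral fineK//; exact: (integrable_fin_num _ ip).
have -> : (\int[mu]_x (T g x * \1_En x)%:E)%E = (\int[mu]_x (T g x * \1_En x))%:E.
  by rewrite /Rintegral fineK//; exact: (integrable_fin_num _ iN).
rewrite -EFinB -(fineK Bf) -EFinM lee_fin.
have := one _ mEp EpB; have := one _ mEn EnB; rewrite !ler_norml.
move=> /andP[h1 _] /andP[_ h2]; lra.
Qed.

(** Against the sign of [T b] on [E], duality turns the integral into that of [b * Ts s], and this
    is decomposed over the bad cubes. The infinite sum is thus taken under an integral and never
    inside [T]. Each mean zero piece is far from [E] in its own scale. *)
Lemma bad_part (h : Borel X -> R) (lam : R) (k : int) (E : set (Borel X)) z rho :
  0 < lam -> bsL mu d r h ->
  (forall P, D P -> generation P = k -> ~ cz_bad mu (fun x => `|h x|) lam P) ->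
  let M := maxcubes D k (cz_bad mu (fun x => `|h x|) lam) in
  let b := cz_rest mu D h lam k in
  bsL mu d r b -> measurable E -> E `<=` qball d z rho ->
  (forall P, M P -> forall x, qball d (cube_center P) (3 * cd ^+ 2 * C0 * delta ^ generation P) x ->
     ~ E x) ->
  (\int[mu]_(x in E) `|T b x|%:E <= (2 * H1)%:E * \int[mu]_x `|h x|%:E)%E.
Proof.
move=> lam0 bh kgood M b bb mE Eb Es; have mTb := hT.1 b bb.
have ih := bsL_integrable hX r1 bh.
have ib := bsL_integrable hX r1 bb.
have mb : measurable_fun setT b by case: bb.
have mhh : measurable_fun setT h by case: bh.
pose s := sign_on E (T b).
have ts : test_fun d 1 s.
  split; [exact: sign_on_measurable|move=> x; exact: sign_on_le1|].
  exists z, (`|rho| + 1); split; first by rewrite ltr_wpDl.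
  move=> y ny; apply: sign_on0 => Ey; apply: ny; apply: lt_le_trans (Eb _ Ey) _.
  by apply: le_trans (ler_norm _) _; rewrite lerDl.
have bs := test_fun_bsL (p := +oo%E) hX (leey _) ts.
have [i1 i2 eq12] := hadj bb bs.
have cM : countable M by exact: (cz_countable hX hc0 hdelta hD).
have dM : disjoint_family M by exact: (cz_disjoint hD).
have mM P : M P -> measurable (carrier P) by exact: (cz_measurable hD).
pose U := famU M carrier.
have mU : measurable U by exact: famU_measurable.
have mTs := hTs.1 _ bs.
have mbTs : measurable_fun setT (fun x => b x * Ts s x) by exact: measurable_funM.
have -> : (\int[mu]_(x in E) `|T b x|%:E)%E = (\int[mu]_x (T b x * s x))%:E.
  rewrite -integral_indicM; under eq_integral do rewrite -sign_onE.
  by rewrite /Rintegral fineK//; exact: (integrable_fin_num _ i1).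
rewrite eq12.
have -> : \int[mu]_x (b x * Ts s x) = \int[mu]_(x in U) (b x * Ts s x).
  rewrite -[RHS]Rintegral_indicM; apply: Rintegral_ae_eq => //.
    by apply: measurable_funM => //; exact: measurable_indic.
  apply: ae_mono (cz_rest_off hX hc0 hdelta hD k ih lam0) => x hx _.
  rewrite indicE; have [|nU] := boolP (x \in _); first by rewrite mul1r.
  by rewrite notin_setE in nU; rewrite [b x]hx// mul0r mulr0.
have iU : mu.-integrable U (fun x => (b x * Ts s x)%:E) by exact: integrableS i2.
apply: (@le_trans _ _ (\int[mu]_(x in U) (H1%:E * `|b x|%:E))%E).
  apply: (@le_trans _ _ `|\int[mu]_(x in U) (b x * Ts s x)%:E|%E).
    rewrite /Rintegral fineK ?lee_abs//; exact: (integrable_fin_num _ iU).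
  have mab : measurable_fun setT (fun x => `|b x|%:E).
    by apply/measurable_EFinP; exact: measurableT_comp.
  apply: fam_abs_integral => //.
  - exact: measurable_funeM.
  - by move=> x; rewrite mule_ge0// lee_fin.
  - move=> P MP; have [DP _ _ _] := MP; have mP := mM _ MP.
    pose bP x := \1_(carrier P) x * b x.
    have bbP : bsL mu d r bP by exact: (bsL_restr hX r1 mP bb).
    have [j1 j2 j12] := hadj bbP bs.
    have sg0 : 0 < C0 * delta ^ generation P by exact: mulr_gt0.
    have bPs y : ~ qball d (cube_center P) (C0 * delta ^ generation P) y -> bP y = 0.
      move=> ny; rewrite /bP indicE memNset ?mul0r// => Py; apply: ny.
      exact: (cube_outer hD DP Py).
    have bP0 : \int[mu]_y bP y = 0.
      by rewrite Rintegral_indicM; exact: (cz_rest_mean hX hc0 hdelta hD ih MP ib).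
    have sP x : qball d (cube_center P) (3 * cd ^+ 2 * (C0 * delta ^ generation P)) x -> s x = 0.
      by move=> hx; apply: sign_on0; apply: (Es P MP); rewrite -mulrA.
    have := oscTs sg0 ts sP bbP bPs bP0.
    rewrite j12 mul1r => hb.
    have e1 : (\int[mu]_(x in carrier P) (b x * Ts s x)%:E)%E = (\int[mu]_x (bP x * Ts s x))%:E.
      rewrite /Rintegral fineK; last exact: (integrable_fin_num _ j2).
      by rewrite -[LHS]integral_indicM; apply: eq_integral => x _; rewrite mulrA.
    rewrite e1 -[`|_|%E]/(`|_|%:E)%E.
    rewrite ge0_integralZl//; last exact: measurable_funTS.
    have ia : mu.-integrable setT (fun x => `|bP x|%:E).
      by have := integrable_abse (bsL_integrable hX r1 bbP).
    have <- : (\int[mu]_x `|bP x|%:E)%E = (\int[mu]_(x in carrier P) `|b x|%:E)%E.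
      rewrite -[RHS]integral_indicM; apply: eq_integral => x _.
      by rewrite /bP normrM ger0_norm// indicE.
    have <- : (\int[mu]_x `|bP x|)%:E = (\int[mu]_x `|bP x|%:E)%E.
      by rewrite /Rintegral fineK//; exact: (integrable_fin_num _ ia).
    by rewrite -EFinM lee_fin.
have mab : measurable_fun setT (fun x => `|b x|%:E).
  by apply/measurable_EFinP; exact: measurableT_comp.
have mah : measurable_fun setT (fun x => `|h x|%:E).
  by apply/measurable_EFinP; exact: measurableT_comp.
rewrite ge0_integralZl//; last exact: measurable_funTS.
rewrite mulrC EFinM -muleA; apply: lee_wpmul2l; first by rewrite lee_fin.
have mah2 : measurable_fun setT (fun x => (2 * `|h x|)%:E).
  apply/measurable_EFinP; apply: measurable_funM => //; exact: measurableT_comp.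
apply: (@le_trans _ _ (\int[mu]_(x in U) (2 * `|h x|)%:E)%E).
  apply: fam_le_integral => //.
  - by move=> P MP; exact: (cz_rest_le hX hc0 hdelta hD ih MP).
rewrite -ge0_integralZl//; under [leRHS]eq_integral do rewrite -EFinM.
apply: ge0_subset_integral => //.
Qed.

(** [wkC1] compares [dil Q] with cubes of the generation of [Q] that meet it, [wkC2] the enlarged
    bad cubes with the bad cubes, [wkC4] a ball containing the support of the good part with [Q];
    [wkC3] bounds the good part in units of [lam]. [wkLam] makes the cubes of the initial generation
    good and the enlarged bad cubes small. *)
Definition wkC1 : R := cubc cd cmu c0 (cd * (C0 + alpha * C0)) (alpha * C0).
Definition wkC2 : R := cubc cd cmu c0 0 (3 * cd ^+ 2 * C0).
Definition wkC3 : R := 2 + czc cd cmu c0 C0 delta.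
Definition wkC4 : R := cubc cd cmu c0 0 (cd * (alpha * C0 + 2 * cd * C0)).
Definition wkLam : R := 3 * wkC2 * dilc + wkC1.
Definition wkA : R := 12 * (wkC3 * wkC4 * ct * wkLam + H1 * dilc + 1).

Lemma wkA_gt0 : 0 < wkA.
Proof.
rewrite mulr_gt0// ltr_wpDl// addr_ge0//; last first.
  by rewrite mulr_ge0// ltW// (cubc_gt0 hX).
have c1 a A : 0 <= cubc cd cmu c0 a A by rewrite ltW// (cubc_gt0 hX).
have w3 : 0 <= wkC3 by apply: addr_ge0 => //; exact: c1.
have wl : 0 <= wkLam.
  by apply: addr_ge0; [rewrite mulr_ge0 ?mulr_ge0//|]; exact: c1.
by rewrite mulr_ge0// mulr_ge0 ?(ltW ct0)// mulr_ge0//; exact: c1.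
Qed.

(** One factor [1 / e] comes from the threshold [lam], which makes the enlarged bad cubes small, and
    the other from Chebyshev's inequality for the good part. The good part, the bad part off those
    cubes and the cubes themselves each receive a third of [e]. *)
Lemma weak_type (e : R) Q (t : R) (h : Borel X -> R) : 0 < e <= 1 -> D Q -> 0 < t ->
  bsL mu d r h -> (forall x, ~ dil Q x -> h x = 0) ->
  (\int[mu]_x `|h x|%:E <= t%:E * mu (dil Q))%E ->
  (mu (level (carrier Q) (T h) (wkA * t / e ^+ 2)) <= e%:E * mu (carrier Q))%E.
Proof.
move=> /andP[e0 e1] DQ t0 bh hs hI.
have C1g : 1 <= wkC1 by exact: (cubc_ge1 hX).
have C2g : 1 <= wkC2 by exact: (cubc_ge1 hX).
have C3g : 1 <= wkC3 by rewrite /wkC3; have : 1 <= czc cd cmu c0 C0 delta by [exact: (cubc_ge1 hX)]; lra.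
have C4g : 1 <= wkC4 by exact: (cubc_ge1 hX).
have dg : 1 <= dilc by exact: (dilc_ge1 hX).
have Lg : 1 <= wkLam.
  rewrite /wkLam; apply: le_trans C1g _; rewrite lerDr !mulr_ge0//; lra.
have A0 := wkA_gt0.
set k := generation Q; pose lam := wkLam * t / e.
have lam0 : 0 < lam by rewrite divr_gt0// mulr_gt0//; lra.
have ih := bsL_integrable hX r1 bh.
have mhh : measurable_fun setT h by case: bh.
pose F x := `|h x|.
have mFF : measurable_fun setT F by exact: measurableT_comp.
have mQ := cube_measurable hD DQ.
have Qf := cube_mu_fin_num hX hD DQ.
have hdil := dil_le hX hc0 hdelta hD alpha DQ.
pose M := maxcubes D k (cz_bad mu F lam).
have kgood P : D P -> generation P = k -> ~ cz_bad mu F lam P.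
  move=> DP gP; rewrite /cz_bad; apply/negP; rewrite -leNgt.
  have [[y Py yQ]|no] := pselect (exists2 y, carrier P y & dil Q y); last first.
    rewrite integral0_eq ?mule_ge0 ?lee_fin ?(ltW lam0)// => y Py.
    by rewrite /F hs ?normr0// => yQ; apply: no; exists y.
  apply: (@le_trans _ _ (t%:E * mu (dil Q))%E).
    apply: le_trans hI; apply: ge0_subset_integral => //; first exact: (cube_measurable hD).
      by apply/measurable_EFinP.
    by move=> x _; rewrite lee_fin; exact: normr_ge0.
  have hP : (mu (dil Q) <= wkC1%:E * mu (carrier P))%E.
    rewrite /dilate -/k -gP; apply: (ball_le_cube hX hc0 hdelta hD) => //.
    apply: le_trans (qd_tri hX y _ _) _; rewrite -mulrA ler_pM2l// mulrDl lerD//.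
      exact: ltW (cube_outer hD DP Py).
    by rewrite (qd_sym hX) gP; exact: ltW.
  apply: le_trans (lee_wpmul2l _ hP) _; first by rewrite lee_fin ltW.
  rewrite muleA -EFinM; apply: lee_wpmul2r => //; rewrite lee_fin /lam.
  rewrite ler_pdivlMr// [wkLam * t]mulrC -mulrA ler_pM2l//.
  apply: le_trans (_ : wkC1 <= _); first by rewrite ler_piMr//; lra.
  by rewrite /wkLam lerDr mulr_ge0// ?mulr_ge0//; lra.
pose g := cz_good mu D h lam k; pose b := cz_rest mu D h lam k.
pose rho := cd * (alpha * C0 + 2 * cd * C0) * delta ^ k.
have aC : 0 <= alpha * C0 by rewrite mulr_ge0 ?(ltW C00)//; have := a3; lra.
have rho0 : 0 < rho.
  by rewrite /rho !mulr_gt0// ltr_wpDl// !mulr_gt0.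
have gle x : `|g x| <= wkC3 * lam by exact: (cz_good_le hX hc0 hdelta hD ih lam0 kgood).
have gs x : ~ qball d (cube_center Q) rho x -> g x = 0.
  by apply: (cz_good_supp hX hc0 hdelta hD lam0) => //.
have mg : measurable_fun setT g by exact: (cz_good_measurable hX hc0 hdelta hD lam k ih).
have tg : test_fun d (wkC3 * lam) g by split => //; exists (cube_center Q), rho; split.
have bg := test_fun_bsL hX r1 tg.
have bb : bsL mu d r b.
  have := bsL_lin hX (-1) r1 bg bh; rewrite (_ : (fun _ => _) = b)//.
  by apply/funext => x; rewrite /b /cz_rest mulN1r addrC.
pose Us : set (Borel X) := famU M (fun P => qball d (cube_center P) (3 * cd ^+ 2 * C0 * delta ^ generation P)).
have cM : countable M by exact: (cz_countable hX hc0 hdelta hD).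
have mUs : measurable Us by apply: famU_measurable => // P _; exact: (qball_measurable hX).
pose s2 := wkA * t / (2 * e ^+ 2).
have e20 : 0 < e ^+ 2 by exact: exprn_gt0.
have s20 : 0 < s2 by rewrite divr_gt0// mulr_gt0.
have mTg := hT.1 g bg; have mTb := hT.1 b bb; have mTh := hT.1 h bh.
have QB : carrier Q `<=` qball d (cube_center Q) rho.
  move=> x Qx; apply: lt_le_trans (cube_outer hD DQ Qx) _; rewrite ler_pM2r//.
  have c1 : 1 <= cd := cd_ge1 hX.
  have h2 : C0 <= 2 * cd * C0 by rewrite ler_peMl ?(ltW C00)//; lra.
  apply: le_trans h2 _; apply: le_trans (_ : alpha * C0 + 2 * cd * C0 <= _).
    by rewrite lerDr.
  by rewrite ler_peMl// addr_ge0// !mulr_ge0// ltW.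
have mQU : measurable (carrier Q `\` Us) by exact: measurableD.
have m1 : (mu (level (carrier Q) (T g) s2) <= (e / 3)%:E * mu (carrier Q))%E.
  have hB : (mu (qball d (cube_center Q) rho) <= wkC4%:E * mu (carrier Q))%E.
    have := ball_le_cube hX hc0 hdelta hD (a := 0) (cd * (alpha * C0 + 2 * cd * C0)) (x := cube_center Q) DQ.
    by apply; rewrite (qdxx hX) mul0r.
  have L0 : 0 <= wkC3 * lam by rewrite mulr_ge0 ?(ltW lam0)//; lra.
  have hg := good_part rho0 L0 bg gle gs mQ QB.
  have hg2 : (\int[mu]_(x in carrier Q) `|T g x|%:E <=
      (2 * (wkC3 * lam) * ct * wkC4)%:E * mu (carrier Q))%E.
    apply: le_trans hg _; rewrite [X in (_ <= X * _)%E]EFinM -muleA; apply: lee_wpmul2l => //.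
    by rewrite lee_fin mulr_ge0 ?(ltW ct0)// mulr_ge0.
  apply: le_trans (level_measure mQ mTg s20 hg2) _.
  apply: lee_wpmul2r => //; rewrite lee_fin ler_pdivrMr// /s2 /lam.
  have -> : 2 * (wkC3 * (wkLam * t / e)) * ct * wkC4 = (2 * (t / e)) * (wkC3 * wkC4 * ct * wkLam) by ring.
  have -> : e / 3 * (wkA * t / (2 * e ^+ 2)) = (2 * (t / e)) * (wkA / 12) by field; rewrite gt_eqF.
  rewrite ler_pM2l ?mulr_gt0 ?invr_gt0//.
  have hh : 0 <= H1 * dilc by rewrite mulr_ge0//; lra.
  by rewrite /wkA; lra.
have m2 : (mu Us <= (e / 3)%:E * mu (carrier Q))%E.
  have A30 : 0 <= 3 * cd ^+ 2 * C0 by rewrite !mulr_ge0// ltW.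
  apply: le_trans (cz_enlarged hX hc0 hdelta hD F lam k A30) _.
  rewrite -/wkC2 -/M.
  have h1 := cz_measure hX hc0 hdelta hD k mFF (fun x => normr_ge0 (h x)) lam0; rewrite -/M in h1.
  have h2 : (lam%:E * mu (famU M carrier) <= (t * dilc)%:E * mu (carrier Q))%E.
    apply: le_trans h1 (le_trans hI _); rewrite EFinM -muleA.
    by apply: lee_wpmul2l; [rewrite lee_fin ltW|].
  rewrite -lee_pdivlMl// in h2.
  apply: (@le_trans _ _ (wkC2%:E * (lam^-1%:E * ((t * dilc)%:E * mu (carrier Q))))%E).
    by apply: lee_wpmul2l => //; rewrite lee_fin; lra.
  rewrite !muleA -!EFinM; apply: lee_wpmul2r => //; rewrite lee_fin /lam.
  have -> : wkC2 * (wkLam * t / e)^-1 * (t * dilc) = (e / wkLam) * (wkC2 * dilc).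
    by field; rewrite !gt_eqF//; lra.
  have -> : e / 3 = (e / wkLam) * (wkLam / 3) by field; rewrite gt_eqF//; lra.
  rewrite ler_pM2l; last by rewrite divr_gt0//; lra.
  by rewrite /wkLam; lra.
have m3 : (mu (level (carrier Q `\` Us) (T b) s2) <= (e / 3)%:E * mu (carrier Q))%E.
  have hb := bad_part lam0 bh kgood bb mQU (subset_trans (@subDsetl _ _ _) QB).
  have hb2 : (\int[mu]_(x in carrier Q `\` Us) `|T b x|%:E <=
      (2 * H1 * (t * dilc))%:E * mu (carrier Q))%E.
    apply: le_trans (hb _) _.
      by move=> P MP x xP [_]; apply; exists P.
    rewrite [X in (_ <= X * _)%E]EFinM -muleA; apply: lee_wpmul2l; first by rewrite lee_fin mulr_ge0.
    apply: le_trans hI _; rewrite EFinM -muleA.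
    by apply: lee_wpmul2l; [rewrite lee_fin ltW|].
  apply: le_trans (level_measure mQU mTb s20 hb2) _.
  apply: lee_wpmul2r => //; rewrite lee_fin ler_pdivrMr// /s2.
  have -> : 2 * H1 * (t * dilc) = (2 * t) * (H1 * dilc) by ring.
  have -> : e / 3 * (wkA * t / (2 * e ^+ 2)) = (2 * t) * (wkA / 12 / e) by field; rewrite gt_eqF.
  rewrite ler_pM2l ?mulr_gt0// ler_pdivlMr//.
  have hh : 0 <= H1 * dilc by rewrite mulr_ge0//; lra.
  have hh2 : 0 <= wkC3 * wkC4 * ct * wkLam.
    by apply: mulr_ge0; [apply: mulr_ge0 (ltW ct0); apply: mulr_ge0|]; lra.
  apply: le_trans (_ : H1 * dilc <= _); first by rewrite ler_piMr.
  by rewrite /wkA; lra.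
pose W := level (carrier Q) (T g) s2 `|` (Us `|` level (carrier Q `\` Us) (T b) s2).
have mW : measurable W.
  by apply: measurableU; [|apply: measurableU => //]; exact: level_measurable.
apply: (@le_trans _ _ (mu W)).
  apply: ae_le_measure => //; first exact: level_measurable.
  apply: ae_mono (hT.2 1 g b bg bb) => x.
  rewrite (_ : (fun y => _) = h); last by apply/funext => y; rewrite /b /cz_rest mul1r addrCA subrr addr0.
  move=> hx [Qx /= lx].
  have [h1|h1] := ltP s2 `|T g x|; first by left.
  have [xU|xU] := pselect (Us x); first by right; left.
  right; right; split => //=.
  rewrite ltNge; apply/negP => h2.
  have : `|T h x| <= s2 + s2.
    rewrite hx mul1r; apply: le_trans (ler_normD _ _) _; exact: lerD.
  have -> : s2 + s2 = wkA * t / e ^+ 2 by rewrite /s2; field; rewrite gt_eqF.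
  by rewrite leNgt lx.
apply: le_trans (measureU2 _ _ _) _.
- exact: level_measurable.
- by apply: measurableU => //; exact: level_measurable.
apply: (@le_trans _ _ ((e / 3)%:E * mu (carrier Q) + ((e / 3)%:E * mu (carrier Q) + (e / 3)%:E * mu (carrier Q)))%E).
  apply: leeD => //; apply: le_trans (measureU2 _ _ _) _ => //; first exact: level_measurable.
  exact: leeD.
by rewrite -(fineK Qf) -!EFinM -!EFinD lee_fin; lra.
Qed.

(** A bound for [T h] on any part of [P] of positive measure spreads to almost all of [P]: if [T h]
    exceeded [W] in one sign on a set of positive measure, its average there and its average over
    [G] would differ by more than the oscillation allows. The [+ 1] makes the contradiction
    strict. *)
Lemma osc_bound P (h : Borel X -> R) (L A : R) (G : set (Borel X)) : D P ->
  bsL mu d r h -> (forall y, dil P y -> h y = 0) -> 0 <= L -> 0 <= A ->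
  (forall i, (\int[mu]_(y in qball d (cube_center P) (2 ^+ i.+1 * (3 * cd ^+ 2 * (C0 * delta ^ generation P)))) (`|h y| `^ p)%:E <=
     (L `^ p)%:E * mu (qball d (cube_center P) (2 ^+ i.+1 * (3 * cd ^+ 2 * (C0 * delta ^ generation P)))))%E) ->
  measurable G -> G `<=` carrier P -> (0 < mu G)%E -> (forall x, G x -> `|T h x| <= A) ->
  {ae mu, forall x, carrier P x -> `|T h x| <= A + 2 * L * Hr + 1}.
Proof.
move=> DP bh hdil L0 A0 growth mG GP G0 hG.
have mP := cube_measurable hD DP; have Pf := cube_mu_fin_num hX hD DP.
have mTh := hT.1 h bh.
pose W := A + 2 * L * Hr + 1.
have sub_fin (E : set (Borel X)) : measurable E -> E `<=` carrier P -> mu E \is a fin_num.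
  move=> mE EP; rewrite ge0_fin_numE// (le_lt_trans (le_measure _ _ _ EP)) ?inE//.
  by rewrite -ge0_fin_numE.
set z := cube_center P in growth *; pose sg := C0 * delta ^ generation P.
have sg0 : 0 < sg by exact: mulr_gt0.
have Psg : carrier P `<=` qball d z sg by exact: (ds_outer hD DP).
have int_on (E : set (Borel X)) : measurable E -> E `<=` carrier P ->
    mu.-integrable setT (fun x => (T h x * \1_E x)%:E) /\ mu.-integrable E (EFin \o T h).
  move=> mE EP; have bE := bsL_indic hX (leey 1%E) mE (subset_trans EP Psg).
  have [i1 _ _] := hadj bh bE; split => //.
  by apply/integrable_indicM => //; under eq_fun do rewrite mulrC.
have half (sigma : R) : `|sigma| = 1 -> mu (carrier P `&` [set x | W < sigma * T h x]) = 0%E.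
  move=> sigma1; set E := _ `&` _.
  have mE : measurable E.
    apply: measurableI => //.
    rewrite (_ : [set x | _] = (fun x => sigma * T h x) @^-1` `]W, +oo[).
      rewrite -[_ @^-1` _]setTI; apply: measurable_funM => //; exact: measurable_itv.
    by apply/seteqP; split => x /=; rewrite in_itv/= andbT.
  have EP : E `<=` carrier P by move=> x [].
  apply/eqP; rewrite eq_le measure_ge0 andbT leNgt; apply/negP => E0.
  have Ef := sub_fin _ mE EP; have Gf := sub_fin _ mG GP.
  pose a := (fine (mu E))^-1; pose b := (fine (mu G))^-1.
  have fE : 0 < fine (mu E) by rewrite -lte_fin fineK.
  have fG : 0 < fine (mu G) by rewrite -lte_fin fineK.
  have a0 : 0 < a by rewrite invr_gt0. have b0 : 0 < b by rewrite invr_gt0.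
  have [iE iE'] := int_on _ mE EP; have [iG iG'] := int_on _ mG GP.
  have iI (F : set (Borel X)) : measurable F -> F `<=` carrier P -> mu.-integrable setT (EFin \o (\1_F : Borel X -> R)).
    by move=> mF FP; exact: (bsL_integrable hX (leey 1%E) (bsL_indic hX (leey 1%E) mF (subset_trans FP Psg))).
  have vI (F : set (Borel X)) : measurable F -> \int[mu]_x (\1_F x : R) = fine (mu F).
    by move=> mF; rewrite /Rintegral integral_indic// setIT.
  (* Mean zero, L^1 norm at most 2, and its pairing with [T h] is the difference of the averages
     over [E] and [G]. *)
  pose s x : R := a * \1_E x - b * \1_G x.
  have ms : measurable_fun setT s.
    by apply: measurable_funB; apply: measurable_funM => //; exact: measurable_indic.
  have sle x : `|s x| <= a * \1_E x + b * \1_G x.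
    apply: le_trans (ler_normB _ _) _.
    by rewrite !ger0_norm// mulr_ge0 ?(ltW a0) ?(ltW b0)// indicE.
  have ts : test_fun d (a + b) s.
    split; first exact: ms.
      move=> y; apply: le_trans (sle y) _; rewrite !indicE.
      by apply: lerD; rewrite ler_piMr ?(ltW a0) ?(ltW b0)//; case: (_ \in _).
    exists z, sg; split => // y ny; rewrite /s !indicE !memNset ?mulr0 ?subrr//.
      by move=> /GP/Psg.
    by move=> /EP/Psg.
  have s0 x : ~ qball d z sg x -> s x = 0.
    move=> ny; rewrite /s !indicE !memNset ?mulr0 ?subrr//.
      by move=> /GP/Psg.
    by move=> /EP/Psg.
  have IE := iI _ mE EP; have IG := iI _ mG GP.
  have IaE : mu.-integrable setT (EFin \o (fun x => a * \1_E x)) by exact: integrable_scale.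
  have IbG : mu.-integrable setT (EFin \o (fun x => b * \1_G x)) by exact: integrable_scale.
  have sI : \int[mu]_x s x = 0.
    rewrite RintegralB// !RintegralZl// !vI// mulVf ?gt_eqF// mulVf ?gt_eqF//.
    by rewrite subrr.
  have sN : \int[mu]_x `|s x| <= 2.
    apply: (@le_trans _ _ (\int[mu]_x (a * \1_E x + b * \1_G x))).
      apply: le_Rintegral => //.
      - by have := integrable_abse (bsL_integrable hX r1 (test_fun_bsL hX r1 ts)).
      - by have := integrableD measurableT IaE IbG; exact: eq_integrable.
    rewrite RintegralD// !RintegralZl// !vI// mulVf ?gt_eqF// mulVf ?gt_eqF//; lra.
  have hz y : qball d z (3 * cd ^+ 2 * sg) y -> h y = 0.
    move=> yz; apply: hdil; apply: lt_le_trans yz _; rewrite /sg mulrA ler_pM2r// ler_pM2r//.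
    exact: (alpha_ge hX hdelta halpha).
  have := oscT sg0 ts s0 sI bh hz L0 growth; apply/negP; rewrite -ltNge.
  have vE (F : set (Borel X)) : \int[mu]_x (T h x * \1_F x) = \int[mu]_(x in F) T h x.
    by rewrite -[RHS]Rintegral_indicM; apply: eq_Rintegral => x _; rewrite mulrC.
  have -> : \int[mu]_x (T h x * s x) = a * \int[mu]_(x in E) T h x - b * \int[mu]_(x in G) T h x.
    rewrite -!vE -!RintegralZl// -RintegralB//; [|exact: integrable_scale|exact: integrable_scale].
    by apply: eq_Rintegral => x _; rewrite /s; ring.
  have e1 : W <= a * (sigma * \int[mu]_(x in E) T h x).
    rewrite ler_pdivlMl// -RintegralZl// mulrC -Rintegral_cst//.
    apply: le_Rintegral => //.
    - by apply: integrable_cst_on => //; rewrite -ge0_fin_numE.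
    - exact: integrable_scale.
    - by move=> x [_ /ltW].
  have e2 : b * (sigma * \int[mu]_(x in G) T h x) <= A.
    rewrite ler_pdivrMl// -RintegralZl// mulrC -Rintegral_cst//.
    apply: le_Rintegral => //.
    - exact: integrable_scale.
    - by apply: integrable_cst_on => //; rewrite -ge0_fin_numE.
    - by move=> x Gx; apply: le_trans (ler_norm _) _; rewrite normrM sigma1 mul1r hG.
  set u := \int[mu]_(x in E) _ in e1 *; set v := \int[mu]_(x in G) _ in e2 *.
  have e3 : a * (sigma * u) - b * (sigma * v) <= `|a * u - b * v|.
    rewrite -[leRHS]mul1r -sigma1 -normrM; apply: le_trans (ler_norm _).
    by rewrite [leLHS](_ : _ = sigma * (a * u - b * v))//; ring.
  apply: lt_le_trans e3; apply: lt_le_trans (lerB e1 e2).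
  have LH : 0 <= L * Hr by exact: mulr_ge0.
  apply: le_lt_trans (ler_wpM2l LH sN) _; rewrite /W; lra.
have mW (sigma : R) : measurable (carrier P `&` [set x | W < sigma * T h x]).
  apply: measurableI => //.
  rewrite (_ : [set x | _] = (fun x => sigma * T h x) @^-1` `]W, +oo[).
    by rewrite -[_ @^-1` _]setTI; apply: measurable_funM => //; exact: measurable_itv.
  by apply/seteqP; split => x /=; rewrite in_itv/= andbT.
pose Ws (sigma : R) : set (Borel X) := carrier P `&` [set x | W < sigma * T h x].
apply: (ae_notin (A := Ws 1 `|` Ws (-1))).
- by apply: measurableU; exact: mW.
- apply/eqP; rewrite eq_le measure_ge0 andbT.
  apply: le_trans (measureU2 mu (mW 1) (mW (-1))) _.
  have h1 : (mu (Ws 1%R) <= 0)%E by rewrite /Ws half ?normr1.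
  have h2 : (mu (Ws (-1)%R) <= 0)%E by rewrite /Ws half ?normrN1.
  by have := leeD h1 h2; rewrite adde0.
move=> x nx Px; rewrite ler_norml; apply/andP; split; rewrite leNgt; apply/negP => hx.
  by apply: nx; right; split => //=; rewrite -/W in hx; lra.
by apply: nx; left; split => //=; rewrite -/W in hx; lra.
Qed.

Lemma L1_le_Lp (B : set (Borel X)) (g : Borel X -> R) (t : R) : measurable B ->
  measurable_fun setT g -> (\int[mu]_(x in B) (`|g x| `^ p)%:E <= t%:E * mu B)%E ->
  (mu B < +oo)%E ->
  (\int[mu]_(x in B) `|g x|%:E <= (1 + t)%:E * mu B)%E.
Proof.
move=> mB mg hB Bf; have p1 := dualp_ge1 hr.
have mp := measurable_normpow p mg.
apply: (@le_trans _ _ (\int[mu]_(x in B) (1%:E + (`|g x| `^ p)%:E))%E).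
  apply: ge0_le_integral' => //.
  - by apply: measurable_funTS; apply/measurable_EFinP; exact: measurableT_comp.
  - by apply: emeasurable_funD => //; exact: measurable_funTS.
  - move=> x _; rewrite -EFinD lee_fin.
    have [g1|g1] := leP `|g x| 1; first by apply: le_trans g1 _; rewrite lerDl powR_ge0.
    apply: le_trans (_ : `|g x| `^ p <= _); last by rewrite lerDr.
    by rewrite -[leLHS]powRr1//; apply: ler_powR => //; exact: ltW.
rewrite ge0_integralD//; last exact: measurable_funTS.
rewrite integral_cst//; apply: le_trans (leeD2l _ hB) _.
have Bf' : mu B \is a fin_num by rewrite ge0_fin_numE.
by rewrite -(fineK Bf') -!EFinM -EFinD lee_fin; lra.
Qed.

(** [Om] collects the points where [T g] is large and those where the maximal function of [|g| ^ p]
    is large. If [P] is at most half filled, a point of [P] off [Om] controls the growth of [g] on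
    every ball around it. On part of [P] both [T g] and [T] of the part of [g] in [dil P] are
    bounded, hence so is their difference, and [osc_bound] spreads this. *)
Lemma scalar_step : exists2 A1 : R, 1 <= A1 &
  forall (e : R) Q g, 0 < e <= 1 -> D Q -> bsL mu d r g -> (forall x, ~ dil Q x -> g x = 0) ->
  (\int[mu]_x (`|g x| `^ p)%:E <= mu (dil Q))%E ->
  exists Om : set (Borel X), [/\ measurable Om, (mu Om <= e%:E * mu (carrier Q))%E,
    forall x, carrier Q x -> ~ Om x -> `|T g x| <= A1 / e ^+ 2 &
    forall P, D P -> carrier P `<=` carrier Q ->
      (mu (carrier P `&` Om) <= (1 / 2)%:E * mu (carrier P))%E ->
      {ae mu, forall x, carrier P x ->
        `|T (fun y => \1_(~` dil P) y * g y) x| <= A1 / e ^+ 2}].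
Proof.
have [CM CM1 hM] := maximal_lemma hX hc0 hdelta hD halpha.
have wk0 := wkA_gt0; have p1 := dualp_ge1 hr.
(* In order: the level of [T g] on [Q], the level of [T] applied to [g] cut to [dil P], the
   oscillation with [L = tau], and the slack of [osc_bound]. The worst power of [1 / e] among them
   is 2. *)
pose A1 := 8 * wkA + 16 * wkA * (1 + 2 * CM) + 4 * CM * Hr + 1.
have A1p : 8 * wkA < A1.
  rewrite /A1 -!addrA ltrDl ltr_wpDl//; first by rewrite mulr_ge0//; lra.
  by rewrite ltr_wpDl// mulr_ge0//; lra.
exists A1.
  have h1 : 0 <= 16 * wkA * (1 + 2 * CM) by apply: mulr_ge0; [apply: mulr_ge0 (ltW wk0)|lra].
  have h2 : 0 <= 4 * CM * Hr by apply: mulr_ge0 => //; lra.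
  by rewrite /A1; lra.
move=> e Q g /andP[e0 e1] DQ bg gs hg.
have mg : measurable_fun setT g by case: bg.
have mp := measurable_normpow p mg.
have mQ := cube_measurable hD DQ; have Qf := cube_mu_fin_num hX hD DQ.
have mdQ : measurable (dil Q) by exact: (dil_measurable hX).
have e20 : 0 < e ^+ 2 by exact: exprn_gt0.
have ehalf : 0 < e / 2 <= 1 by apply/andP; split; lra.
have p0 : p != 0 by rewrite gt_eqF//; lra.
have hg1 : (\int[mu]_x `|g x|%:E <= 2%:E * mu (dil Q))%E.
  have -> : (\int[mu]_x `|g x|%:E)%E = (\int[mu]_(x in dil Q) `|g x|%:E)%E.
    rewrite -[RHS]integral_indicM; apply: eq_integral => x _; rewrite indicE.
    have [|nx] := boolP (x \in _); first by rewrite mul1r.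
    by rewrite gs ?normr0 ?mulr0// => h; rewrite notin_setE in nx.
  apply: (L1_le_Lp (t := 1)) => //; last exact: (dil_fin hX).
  rewrite mul1e; apply: le_trans hg; apply: ge0_subset_integral => //.
pose F x := `|g x| `^ p.
have mF : measurable_fun setT F by apply/measurable_EFinP.
have F0 x : 0 <= F x by exact: powR_ge0.
have Fs x : ~ dil Q x -> F x = 0 by move=> nx; rewrite /F gs// normr0 powR0.
have hF : (\int[mu]_x (F x)%:E <= 1%:E * mu (dil Q))%E by rewrite mul1e.
have [Om2 [mO2 O2 hO2]] := hM _ _ _ _ ehalf DQ ltr01 mF F0 Fs hF.
pose tau := CM * 1 / (e / 2).
have tauE : tau = 2 * CM / e by rewrite /tau; field; rewrite gt_eqF.
have tau1 : 1 <= tau.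
  by rewrite tauE ler_pdivlMr//; lra.
pose Om1 := level (carrier Q) (T g) (wkA * 2 / (e / 2) ^+ 2).
have O1 := weak_type ehalf DQ (ltr0Sn R 1) bg gs hg1; rewrite -/Om1 in O1.
have mTg := hT.1 g bg.
have mO1 : measurable Om1 by exact: level_measurable.
have le2 (a : R) : 0 <= a -> a <= a / e ^+ 2.
  by move=> a0; rewrite ler_pdivlMr// ler_piMr// exprn_ile1// ltW.
have le1 (a : R) : 0 <= a -> a / e <= a / e ^+ 2.
  move=> a0; rewrite ler_wpM2l// lef_pV2 ?posrE// expr2 ler_piMr//; exact: ltW.
have offOm x : carrier Q x -> ~ (Om1 `|` Om2) x -> `|T g x| <= 8 * wkA / e ^+ 2.
  move=> Qx nx; rewrite leNgt; apply/negP => h; apply: nx; left; split => //=.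
  by rewrite (_ : wkA * 2 / (e / 2) ^+ 2 = 8 * wkA / e ^+ 2)//; field; rewrite gt_eqF.
exists (Om1 `|` Om2); split.
- exact: measurableU.
- apply: le_trans (measureU2 _ _ _) _ => //.
  apply: le_trans (leeD O1 O2) _.
  by rewrite -(fineK Qf) -!EFinM -!EFinD lee_fin; lra.
- move=> x Qx nx; apply: le_trans (offOm x Qx nx) _.
  by rewrite ler_wpM2r ?invr_ge0 ?ltW.
move=> P DP PQ hP; set Om := _ `|` _ in hP.
have mOm : measurable Om by exact: measurableU.
have mP := cube_measurable hD DP; have Pf := cube_mu_fin_num hX hD DP.
have P0 := cube_mu_gt0 hX hc0 hdelta hD DP.
have mdP : measurable (dil P) by exact: (dil_measurable hX).
have fP : 0 < fine (mu (carrier P)) by rewrite -lte_fin fineK.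
have sub_fin (E : set (Borel X)) : measurable E -> E `<=` carrier P -> mu E \is a fin_num.
  move=> mE EP; rewrite ge0_fin_numE// (le_lt_trans (le_measure _ _ _ EP)) ?inE//.
  by rewrite -ge0_fin_numE.
have mPO : measurable (carrier P `&` Om) by exact: measurableI.
have mPD : measurable (carrier P `\` Om) by exact: measurableD.
have PD_ge : fine (mu (carrier P)) / 2 <= fine (mu (carrier P `\` Om)).
  have f1 := sub_fin _ mPO (@subIsetl _ _ _).
  have f2 := sub_fin _ mPD (@subDsetl _ _ _).
  have hm : mu (carrier P) = (mu (carrier P `\` Om) + mu (carrier P `&` Om))%E.
    exact: measureDI.
  have h1 : fine (mu (carrier P `&` Om)) <= 1 / 2 * fine (mu (carrier P)).
    by rewrite -lee_fin EFinM !fineK.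
  have := congr1 fine hm; rewrite fineD// => h2; lra.
have [x0 [Px0 nx0]] : exists x0, (carrier P `\` Om) x0.
  apply: contrapT => no; have e0' : carrier P `\` Om = set0.
    by apply/seteqP; split => // x hx; case: no; exists x.
  by move: PD_ge; rewrite e0' measure0 /=; lra.
have growth z rho : qball d z rho x0 ->
    (\int[mu]_(y in qball d z rho) (F y)%:E <= tau%:E * mu (qball d z rho))%E.
  by apply: hO2; [exact: PQ|move=> h; apply: nx0; right].
pose h y := \1_(~` dil P) y * g y; pose gP y := \1_(dil P) y * g y.
have bh : bsL mu d r h by apply: (bsL_restr hX r1) => //; exact: measurableC.
have bgP : bsL mu d r gP by exact: (bsL_restr hX r1).
have dPx0 : dil P x0 by exact: (cube_sub_dil hX hc0 hdelta hD halpha DP).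
have t0 : 0 < 1 + tau by lra.
have gPs x : ~ dil P x -> gP x = 0.
  by move=> nx; rewrite /gP indicE memNset ?mul0r.
have hgP : (\int[mu]_x `|gP x|%:E <= (1 + tau)%:E * mu (dil P))%E.
  have -> : (\int[mu]_x `|gP x|%:E)%E = (\int[mu]_(x in dil P) `|g x|%:E)%E.
    rewrite -[RHS]integral_indicM; apply: eq_integral => x _.
    by rewrite /gP normrM ger0_norm// indicE.
  by apply: L1_le_Lp => //; [exact: growth|exact: (dil_fin hX)].
(* [Om] leaves at least half of [P] and this weak type bound removes at most a quarter, so [G] below
   has positive measure. *)
have quarter : 0 < (1 / 4 : R) <= 1 by apply/andP; split; lra.
have wk := weak_type quarter DP t0 bgP gPs hgP.
set s := wkA * _ / _ in wk.
have sE : s = 16 * wkA * (1 + tau) by rewrite /s; field.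
have mTgP := hT.1 _ bgP; have mTh := hT.1 _ bh.
pose A' := 8 * wkA / e ^+ 2 + s.
have s0 : 0 <= s by rewrite sE; apply: mulr_ge0 (ltW t0); apply: mulr_ge0 (ltW wk0).
have A'0 : 0 <= A' by apply: addr_ge0 => //; apply: divr_ge0 (ltW e20); apply: mulr_ge0 (ltW wk0).
pose G := (carrier P `\` Om) `\` (level (carrier P) (T gP) s `|` level setT (T h) A').
have mL1 : measurable (level (carrier P) (T gP) s) by exact: level_measurable.
have mL2 : measurable (level setT (T h) A') by exact: level_measurable.
have mG : measurable G by apply: measurableD => //; exact: measurableU.
have G0 : (0 < mu G)%E.
  have mV : measurable (G `|` level (carrier P) (T gP) s) by exact: measurableU.
  have h1 : (mu (carrier P `\` Om) <= mu (G `|` level (carrier P) (T gP) s))%E.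
    apply: ae_le_measure => //; apply: ae_mono (hT.2 1 h gP bh bgP) => x.
    rewrite (_ : (fun y => _) = g); last first.
      apply/funext => y; rewrite /h /gP mul1r !indicE in_setC.
      by case: (_ \in _) => /=; rewrite mul0r mul1r ?addr0 ?add0r.
    rewrite mul1r => hx [Px nx].
    have [h1|h1] := pselect (level (carrier P) (T gP) s x); [by right|left].
    split => // -[//|[_ /=]]; apply/negP; rewrite -leNgt.
    have -> : T h x = T g x - T gP x by rewrite hx addrK.
    apply: le_trans (ler_normB _ _) _; apply: lerD; first exact: (offOm x (PQ _ Px) nx).
    by rewrite leNgt; apply/negP => h2; apply: h1.
  have h2 := le_trans h1 (measureU2 _ mG mL1).
  have f1 := sub_fin _ mPD (@subDsetl _ _ _).
  have f2 : mu G \is a fin_num by apply: sub_fin => // x [[]].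
  have f3 : mu (level (carrier P) (T gP) s) \is a fin_num by apply: sub_fin => // x [].
  have h3 : fine (mu (carrier P `\` Om)) <= fine (mu G) + fine (mu (level (carrier P) (T gP) s)).
    by rewrite -lee_fin EFinD !fineK.
  have h4 : fine (mu (level (carrier P) (T gP) s)) <= 1 / 4 * fine (mu (carrier P)).
    by rewrite -lee_fin EFinM !fineK.
  by rewrite -(fineK f2) lte_fin; move: h3 h4 PD_ge fP; lra.
have hdil0 y : dil P y -> h y = 0.
  by move=> dy; rewrite /h indicE in_setC mem_set// mul0r.
have tau0 : 0 <= tau by lra.
have c1 : 1 <= cd := cd_ge1 hX.
apply: ae_mono (osc_bound (L := tau) (A := A') DP bh hdil0 tau0 A'0 _ mG _ G0 _).
- move=> x hx Px; apply: le_trans (hx Px) _.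
  have t1 : 0 <= wkA by lra.
  have tt : 1 + tau <= (1 + 2 * CM) / e ^+ 2.
    rewrite [leRHS]mulrDl tauE; apply: lerD; first exact: le2.
    by apply: le1; lra.
  have u1 : s <= 16 * wkA * (1 + 2 * CM) / e ^+ 2.
    by rewrite sE -[leRHS]mulrA ler_wpM2l//; lra.
  have u2 : 2 * tau * Hr <= 4 * CM * Hr / e ^+ 2.
    have -> : 2 * tau * Hr = 4 * CM * Hr / e by rewrite tauE; ring.
    by apply: le1; rewrite !mulr_ge0//; lra.
  have u3 : 1 <= 1 / e ^+ 2 by exact: le2.
  by rewrite /A' /A1 !mulrDl; lra.
- move=> i; set B := qball d _ _.
  have x0B : B x0.
    apply: lt_le_trans (cube_outer hD DP Px0) _; rewrite mulrA ler_peMl//.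
      by rewrite mulr_ge0 ?ltW.
    rewrite -[leLHS]mulr1 ler_pM// ?exprn_ege1//; first by lra.
    by rewrite -[leLHS]mulr1 ler_pM// ?exprn_ege1//; lra.
  apply: (@le_trans _ _ (tau%:E * mu B)%E); last first.
    apply: lee_wpmul2r => //; rewrite lee_fin -[leLHS]powRr1//.
    by apply: ler_powR.
  apply: le_trans (growth _ _ x0B).
  apply: ge0_le_integral' => //; first exact: (qball_measurable hX).
  - by apply: measurable_funTS; apply: measurable_normpow; case: bh.
  - exact: measurable_funTS.
  - move=> y _; rewrite lee_fin; apply: ge0_ler_powR => //; [lra|].
    by rewrite /h normrM ler_piMl// indicE; case: (_ \in _); rewrite ?normr0 ?normr1.
- by move=> x [[]].
- move=> x [_ nx]; rewrite leNgt; apply/negP => hx; apply: nx; right; split => //.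
Qed.

End ScalarOperator.

(** * Frames of symmetric sets *)

Section Frames.
Context {R : realType}.

(* [starlike] and [quarter_sum] are all that is used of a symmetric convex set. *)
Definition starlike n (C : set 'rV[R]_n) :=
  forall (t : R) w, `|t| <= 1 -> C w -> C (t *: w).
Definition quarter_sum n (C : set 'rV[R]_n) :=
  forall v w, C v -> C w -> C (4^-1 *: (v + w)).
Definition fat n (C : set 'rV[R]_n) :=
  exists2 kappa : R, 0 < kappa & forall w : 'rV_n, (forall i, `|w 0 i| <= kappa) -> C w.

(** Dividing an unbounded sequence of [C] by its largest coordinate gives vectors with a coordinate
    equal to 1; by compactness they have a nonzero cluster point v. Then [t *: v] is a quarter sum
    of a small multiple of a member of [C] and of a small error that fatness puts in [C]. *)
Lemma unbounded_line n (C : set 'rV[R]_n.+1) : starlike C -> quarter_sum C -> fat C ->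
  (forall N : nat, exists2 w, C w & N%:R < `|w 0 ord0|) ->
  exists2 v : 'rV_n.+1, v != 0 & forall t : R, C (t *: v).
Proof.
move=> st qs [kappa k0 fC] unb.
have /choice[a ha] : forall N : nat, exists w : 'rV_n.+1, C w /\ N%:R < `|w 0 ord0|.
  by move=> N; have [w Cw hw] := unb N; exists w.
pose jm (w : 'rV[R]_n.+1) : 'I_n.+1 := [arg max_(j > ord0) `|w 0 j|]%O.
have jmP (w : 'rV[R]_n.+1) i : `|w 0 i| <= `|w 0 (jm w)|.
  by rewrite /jm; case: arg_maxP => // j _ h; exact: h.
pose c N := a N 0 (jm (a N)).
have cN N : N%:R < `|c N| by apply: lt_le_trans (ha N).2 (jmP _ _).
have c0 N : c N != 0 by rewrite -normr_gt0; apply: le_lt_trans (cN N).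
pose b N : 'rV[R]_n.+1 := (c N)^-1 *: a N.
have bN N i : `|b N 0 i| <= 1.
  by rewrite mxE normrM normfV mulrC ler_pdivrMr ?normr_gt0// mul1r; exact: jmP.
have b1 N : b N 0 (jm (a N)) = 1 by rewrite mxE mulVf.
have cpt := rV_compact (fun _ : 'I_n.+1 => @segment_compact R (-1) 1).
have [] := cpt (b @ \oo) _.
  by exists 0%N => // N _ i; rewrite /= in_itv/= -ler_norml; exact: bN.
move=> v [_ clv].
have close (e : R) (K : nat) : 0 < e -> exists2 N, (K <= N)%N & forall i, `|v 0 i - b N 0 i| < e.
  move=> e0; have FA : (b @ \oo) (b @` [set N | (K <= N)%N]).
    by exists K => // N KN; exists N.
  have nB : nbhs v [set w : 'rV[R]_n.+1 | forall i, `|v 0 i - w 0 i| < e].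
    apply/nbhs_ballP; exists e => //= w [_ vw] i; exact: (vw 0 i).
  by have [_ [[N KN <-] h]] := clv _ _ FA nB; exists N.
exists v.
  have [N _ hN] := close (1 / 2) 0%N ltac:(lra).
  apply/eqP => v0; have := hN (jm (a N)); rewrite v0 mxE b1 sub0r normrN normr1; lra.
move=> t; have [->|t0] := eqVneq t 0.
  by rewrite scale0r; apply: fC => i; rewrite mxE normr0 ltW.
have nt0 : 0 < `|t| by rewrite normr_gt0.
have [N KN hN] := close (kappa / (4 * `|t|)) (Num.bound (4 * `|t|)) ltac:(by rewrite divr_gt0 ?mulr_gt0).
have -> : t *: v = 4^-1 *: ((4 * t / c N) *: a N + (4 * t) *: (v - b N)).
  apply/rowP => i; rewrite /b !mxE; field; exact: c0.
apply: qs.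
  apply: st (ha N).1; rewrite !normrM normfV ler_pdivrMr ?normr_gt0// mul1r ger0_norm//.
  apply: le_trans (ltW (cN N)); apply: le_trans (_ : (Num.bound (4 * `|t|))%:R <= _).
    by apply/ltW/archi_boundP; rewrite mulr_ge0.
  by rewrite ler_nat.
apply: fC => i; rewrite !mxE !normrM [`|4|]ger0_norm//.
by have := ltW (hN i); rewrite !mxE ler_pdivlMr ?mulr_gt0// mulrC.

Qed.

Section Elimination.
Variables (n : nat) (v : 'rV[R]_n.+1) (j : 'I_n.+1).
Hypothesis vj : v 0 j != 0.

(** One step of Gaussian elimination along [v]: [elim_coef] is the functional [w 0 j / v 0 j],
    [elim_proj] subtracts the corresponding multiple of [v] and drops coordinate [j], and [elim_sec]
    reinserts a zero there. *)
Definition elim_coef : 'cV[R]_n.+1 := (v 0 j)^-1 *: delta_mx j 0.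
Definition elim_proj : 'M[R]_(n.+1, n) := col' j (1%:M - elim_coef *m v).
Definition elim_sec : 'M[R]_(n, n.+1) := row' j 1%:M.

Lemma elim_coefE (w : 'rV[R]_n.+1) : w *m elim_coef = (w 0 j / v 0 j)%:M.
Proof.
rewrite -scalemxAr -colE; apply/matrixP => a b; rewrite !mxE !ord1 eqxx mulr1n.
by rewrite mulrC.
Qed.

Lemma elim_split (w : 'rV[R]_n.+1) :
  w = w *m elim_proj *m elim_sec + (w *m elim_coef) *m v.
Proof.
suff -> : w *m elim_proj *m elim_sec = w *m (1%:M - elim_coef *m v).
  by rewrite mulmxBr mulmx1 mulmxA subrK.
rewrite -mulmxA; congr (_ *m _); apply/matrixP => a b; rewrite mxE.
set M := 1%:M - _.
have -> : M a b = \sum_k M a k * (1%:M : 'M[R]_n.+1) k b.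
  by rewrite -[in LHS](mulmx1 M) mxE.
have Mj : M a j = 0.
  rewrite /M /elim_coef -scalemxAl !mxE big_ord1 !mxE eqxx andbT.
  by case: eqP => _; rewrite ?mul1r ?mulVf ?subrr// mul0r mulr0 subrr.
rewrite (bigD1_ord j)//= Mj mul0r add0r.
by apply: eq_bigr => k _; rewrite !mxE.
Qed.

Lemma elim_sec_proj : elim_sec *m elim_proj = 1%:M.
Proof.
apply/matrixP => a b; rewrite mxE.
have -> : \sum_k elim_sec a k * elim_proj k b = elim_proj (lift j a) b.
  rewrite (bigD1 (lift j a))//= big1 ?addr0 => [|k ne]; rewrite !mxE.
    by rewrite eqxx mul1r.
  by rewrite eq_sym (negbTE ne) mul0r.
rewrite !mxE big_ord1 !mxE (inj_eq lift_inj).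
by rewrite [lift j a == j]eq_sym (negbTE (neq_lift _ _)) mulr0 mul0r subr0.
Qed.

End Elimination.

Definition framed n m (c : R) (C : set 'rV[R]_n) (U : 'M[R]_(n, m)) (V : 'M[R]_(m, n)) :=
  (forall w, C w -> w = w *m U *m V) /\
  forall i, (forall t : R, C (t *: row i V)) \/
    (C (row i V) /\ forall w, C w -> `|(w *m U) 0 i| <= c).

(** The projection of w along [v], lifted back, lies in [C] after division by 8: halving w and the
    multiple of [v] keeps both in [C], and their sum costs 4. Frame vectors of the projected set are
    lifted with this factor and their coordinates multiplied by 8. *)
Lemma frame_step n (C : set 'rV[R]_n.+1) (v : 'rV[R]_n.+1) (j : 'I_n.+1) (c : R) :
  starlike C -> quarter_sum C -> fat C -> v 0 j != 0 -> 2 <= c ->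
  (forall w, C w -> C ((- (w 0 j / v 0 j) / 2) *: v)) ->
  (forall t : R, C (t *: v)) \/ (C v /\ forall w, C w -> `|w 0 j / v 0 j| <= 2) ->
  (forall C' : set 'rV[R]_n, starlike C' -> quarter_sum C' -> fat C' ->
     exists U V, @framed n n c C' U V) ->
  exists U V, @framed n.+1 (1 + n) (8 * c) C U V.
Proof.
move=> st qs [kappa k0 fC] vj c2 hv free IH.
pose Pi := elim_proj v j; pose S : 'M[R]_(n, n.+1) := elim_sec j.
have PiS w : C w -> C (8^-1 *: (w *m Pi *m S)).
  move=> Cw; have -> : 8^-1 *: (w *m Pi *m S) =
      4^-1 *: (2^-1 *: w + (- (w 0 j / v 0 j) / 2) *: v).
    have := elim_split vj w; rewrite elim_coefE mul_scalar_mx => /(canLR (addrK _)) => <-.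
    by apply/rowP => i; rewrite !mxE; field.
  apply: qs; last exact: hv.
  by apply: st => //; rewrite ger0_norm//; lra.
pose C' := [set w *m Pi | w in C].
have [|||U' [V' [dec fr]]] := IH C'.
- by move=> t _ t1 [w Cw <-]; exists (t *: w); [exact: st|rewrite -scalemxAl].
- move=> _ _ [w Cw <-] [w' Cw' <-]; exists (4^-1 *: (w + w')); first exact: qs.
  by rewrite -scalemxAl mulmxDl.
- exists kappa => // w hw; exists (w *m S).
    apply: fC => i; case: (unliftP j i) => [k ->|->].
      rewrite mxE (bigD1 k)//= big1 ?addr0 => [|l ne]; rewrite !mxE ?eqxx ?mulr1//.
      by rewrite (inj_eq lift_inj) (negbTE ne) mulr0.
    rewrite mxE big1 ?normr0 ?ltW// => l _; rewrite !mxE eq_sym (negbTE (neq_lift _ _)).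
    by rewrite mulr0.
  by rewrite -mulmxA elim_sec_proj mulmx1.
exists (row_mx (elim_coef v j) (8 *: (Pi *m U'))), (col_mx v (8^-1 *: (V' *m S))); split.
  move=> w Cw; rewrite mul_mx_row mul_row_col -!scalemxAr -scalemxAl scalerA.
  rewrite mulVf// scale1r !mulmxA -(dec (w *m Pi)); last by exists w.
  by rewrite addrC scalemxAr; exact: elim_split.
move=> i; rewrite -(fintype.splitK i); case: (fintype.split i) => k /=.
  rewrite rowKu row_id (ord1 k); case: free => [h|[h1 h2]]; [by left|right; split => //].
  move=> w Cw; rewrite mul_mx_row row_mxEl elim_coefE mxE eqxx mulr1n.
  by apply: le_trans (h2 w Cw) _; lra.
rewrite rowKd linearZ/= row_mul.
have [h|[[w Cw wE] h2]] := fr k.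
  left=> t; have [w Cw wE] := h t.
  by rewrite scalerA mulrC -scalerA scalemxAl -wE; exact: PiS.
right; split; first by rewrite -wE; exact: PiS.
move=> x Cx; rewrite mul_mx_row row_mxEr -scalemxAr mulmxA mxE normrM ger0_norm//.
by rewrite ler_pM2l//; apply: h2; exists x.
Qed.

(** Induction on the dimension. If the first coordinate is unbounded on [C], a line of [C] is
    eliminated; otherwise a vector whose first coordinate is within a factor 2 of the supremum. *)
Lemma frame_fat n (C : set 'rV[R]_n) : starlike C -> quarter_sum C -> fat C ->
  exists U V, @framed n n (2 * 8 ^+ n) C U V.
Proof.
elim: n C => [|n IH] C st qs fC.
  by exists 0, 0; split => [w _|[]//]; by apply/rowP => -[].
have c1 : 1 <= 8 ^+ n :> R by rewrite exprn_ege1//; lra.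
have c2 : 2 <= 2 * 8 ^+ n :> R by lra.
rewrite exprS mulrCA.
have [unb|] := pselect (forall N : nat, exists2 w, C w & N%:R < `|w 0 ord0|).
  have [v v0 hv] := unbounded_line st qs fC unb.
  have /rV0Pn[j vj] := v0.
  by apply: (frame_step (v := v) (j := j)) => //; left.
move=> /existsNP[N hN].
have bdd w : C w -> `|w 0 ord0| <= N%:R.
  by move=> Cw; rewrite leNgt; apply/negP => h; apply: hN; exists w.
have [kappa k0 fk] := fC.
pose E := [set `|w 0 ord0| | w in C].
have supE : has_sup E.
  split; first by exists `|(0 : 'rV[R]_n.+1) 0 ord0|, 0 => //; apply: fk => i; rewrite mxE normr0 ltW.
  by exists N%:R => _ [w Cw <-]; exact: bdd.
have sup0 : 0 < sup E.
  apply: lt_le_trans (_ : `|(const_mx kappa : 'rV[R]_n.+1) 0 ord0| <= _).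
    by rewrite mxE normr_gt0 gt_eqF.
  apply: sup_upper_bound => //; exists (const_mx kappa) => //.
  by apply: fk => i; rewrite mxE gtr0_norm.
have [_ [v Cv <-] hv] := sup_adherent (eps := sup E / 2) ltac:(by rewrite divr_gt0) supE.
have hv2 : sup E / 2 < `|v 0 ord0| by move: hv; lra.
have v0 : 0 < `|v 0 ord0| by apply: lt_trans hv2; rewrite divr_gt0.
have vj : v 0 ord0 != 0 by rewrite -normr_gt0.
have ratio w : C w -> `|w 0 ord0 / v 0 ord0| <= 2.
  move=> Cw; rewrite normrM normfV ler_pdivrMr//.
  have : `|w 0 ord0| <= sup E by apply: sup_upper_bound => //; exists w.
  by move: hv2; lra.
apply: (frame_step (v := v) (j := ord0)) => //; last by right.
move=> w Cw; apply: st => //; rewrite normrM normrN normfV [`|2|]ger0_norm//.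
by rewrite ler_pdivrMr// mul1r; exact: ratio.
Qed.

(** Each vector split off costs a quarter sum, hence coefficients of size [4^-1 ^+ m]. *)
Lemma small_combination n (C : set 'rV[R]_n) m (B : 'M[R]_(m, n)) (a : 'rV[R]_m) :
  starlike C -> quarter_sum C -> C 0 -> (forall i, C (row i B)) ->
  (forall i, `|a 0 i| <= (4^-1) ^+ m) -> C (a *m B).
Proof.
move=> st qs C0; elim: m B a => [|m IH] B a hB ha.
  by rewrite (_ : _ *m _ = 0)//; apply/matrixP => i k; rewrite !mxE big_ord0.
have -> : a *m B = 4^-1 *: ((4 * a 0 ord0) *: row ord0 B + (4 *: row' ord0 a^T)^T *m row' ord0 B).
  apply/rowP => i; rewrite !mxE (bigD1_ord ord0)//= mulrDr; congr (_ + _); first by field.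
  rewrite mulr_sumr; apply: eq_bigr => k _; by rewrite !mxE; field.
apply: qs.
  apply: st => //; rewrite normrM ger0_norm// -ler_pdivlMl// mulr1.
  apply: le_trans (ha ord0) _; rewrite exprS ler_piMr ?exprn_ile1//; lra.
apply: IH => [i|i].
  by rewrite (_ : row i _ = row (lift ord0 i) B)//; apply/rowP => k; rewrite !mxE.
rewrite !mxE normrM ger0_norm// -ler_pdivlMl//; apply: le_trans (ha _) _.
by rewrite exprS.
Qed.

(** [C] may lie in a proper subspace. In the coordinates of a maximal free family of vectors of [C],
    the set is fat by [small_combination]. *)
Lemma frame_exists n (C : set 'rV[R]_n) : starlike C -> quarter_sum C -> C 0 ->
  exists m U V, (m <= n)%N /\ @framed n m (2 * 8 ^+ m) C U V.
Proof.
move=> st qs C0.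
pose basic m := `[< exists B : 'M[R]_(m, n), row_free B /\ forall i, C (row i B) >].
have ex : exists m, basic m.
  exists 0%N; apply/asboolP; exists 0; split; last by case.
  by rewrite /row_free mxrank0.
have ub m : basic m -> (m <= n)%N.
  move=> /asboolP[B [/eqP rB _]]; have := rank_leq_col B.
  by rewrite rB.
case: (ex_maxnP ex ub) => m /[dup] /ub mn /asboolP[B [fB hB]] mmax.
have span w : C w -> (w <= B)%MS.
  move=> Cw; apply: contrapT => /negP nsub.
  suff /mmax : basic m.+1 by rewrite ltnn.
  apply/asboolP; rewrite -addn1; exists (col_mx B w); split; last first.
    move=> i; rewrite -(fintype.splitK i); case: (fintype.split i) => k /=; first by rewrite rowKu.
    by rewrite rowKd (ord1 k) row_id.
  apply: inj_row_free => x; rewrite -[x]hsubmxK mul_row_col => h.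
  have [r0|r0] := eqVneq (rsubmx x 0 0) 0.
    have rx : rsubmx x = 0 by apply/rowP => i; rewrite (ord1 i) r0 mxE.
    move: h; rewrite rx mul0mx addr0 => h0; have := mulmxKp fB (lsubmx x); rewrite /= h0 mul0mx => <-.
    by rewrite row_mx0.
  case/negP: nsub; have -> : w = (- (rsubmx x 0 0)^-1 *: lsubmx x) *m B.
    move/eqP: h; rewrite addr_eq0 => /eqP h.
    have e : rsubmx x *m w = rsubmx x 0 0 *: w by rewrite {1}[rsubmx x]mx11_scalar mul_scalar_mx.
    by rewrite -scalemxAl h e scalerN scaleNr opprK scalerA mulVf// scale1r.
  exact: submxMl.
pose C' := [set a : 'rV[R]_m | C (a *m B)].
have [||| U [V [dec fr]]] := @frame_fat m C'.
- by move=> t a t1 Ca; rewrite /C' /= -scalemxAl; exact: st.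
- by move=> a b Ca Cb; rewrite /C' /= -scalemxAl mulmxDl; exact: qs.
- exists ((4^-1) ^+ m) => [|a ha]; first by rewrite exprn_gt0// invr_gt0.
  exact: small_combination.
have C'P w : C w -> C' (w *m pinvmx B) by move=> Cw; rewrite /C' /= mulmxKpV// span.
exists m, (pinvmx B *m U), (V *m B); split => //; split.
  move=> w Cw; rewrite [w *m _]mulmxA [_ *m (V *m B)]mulmxA.
  by rewrite -(dec _ (C'P w Cw)) mulmxKpV ?span.
move=> i; rewrite row_mul; have [h|[h1 h2]] := fr i.
  by left => t; rewrite scalemxAl; exact: h.
by right; split => // w Cw; rewrite mulmxA; apply: h2; exact: C'P.
Qed.

End Frames.

(** * The set of averages against unit test functions *)

Section ConvexBody.
Context {R : realType} {X : ptopologicalType}.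
Variables (mu : {measure set (Borel X) -> \bar R}).
Hypothesis muT0 : (0 < mu setT)%E.
Variables (r : \bar R) (hr : (1 < r)%E) (B : set (Borel X)).
Hypotheses (mB : measurable B) (B0 : (0 < mu B)%E) (Bf : (mu B < +oo)%E).
Implicit Types (phi psi : Borel X -> R).
Local Notation p := (dualp r).
Let m := fine (mu B).
Let fB : mu B \is a fin_num. Proof. by rewrite ge0_fin_numE. Qed.
Let m0 : 0 < m. Proof. by rewrite -lte_fin fineK. Qed.
Let muBE : mu B = m%:E. Proof. by rewrite fineK. Qed.

Definition unit_norm phi : Prop :=
  if r is q%:E then (\int[mu]_(x in B) (`|phi x| `^ q)%:E <= mu B)%E
  else {ae mu, forall x, B x -> `|phi x| <= 1}.

(** Boundedness, with no uniform constant, makes the products with an integrable function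
    integrable, so averages exist also when the function is not in L^(r'). *)
Definition unit_test phi :=
  [/\ measurable_fun setT phi, exists M : R, forall x, `|phi x| <= M & unit_norm phi].

Lemma unit_norm_avgnorm phi : unit_norm phi -> (avgnorm mu r B phi <= 1)%E.
Proof.
rewrite /unit_norm; case: r hr => [q|_|//]; first rewrite lte_fin => q1 h.
  rewrite -[leRHS](_ : (1 `^ q^-1)%E = _); last by rewrite poweR_EFin powR1.
  apply: gt0_ler_poweR.
  - by rewrite invr_ge0 ltW// (lt_trans _ q1).
  - rewrite in_itv/= leey andbT; apply: mule_ge0; first by rewrite lee_fin invr_ge0 ltW.
    by apply: integral_ge0 => x _; rewrite lee_fin powR_ge0.
  - by rewrite in_itv/= leey andbT.
  - by rewrite lee_pdivrMl// mule1 -/m -muBE.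
move=> h; rewrite /avgnorm unlock /= muT0; apply/ess_supP; apply: ae_mono h => x h /=.
rewrite lee_fin normrM indicE; have [xB|_] := boolP (x \in B).
  by rewrite normr1 mul1r h// -in_setE.
by rewrite normr0 mul0r.
Qed.

Lemma unit_test_le phi psi : unit_test psi -> measurable_fun setT phi ->
  (forall x, `|phi x| <= `|psi x|) -> unit_test phi.
Proof.
move=> [mpsi [M hM] u] mphi le; split => //; first by exists M => x; exact: le_trans (hM x).
move: u; rewrite /unit_norm; case: r hr => [q|_|//]; last first.
  by apply: ae_mono => x h /h; exact: le_trans.
rewrite lte_fin => q1 h; apply: le_trans h.
apply: ge0_le_integral' => //.
- by apply: measurable_funTS; exact: measurable_normpow.
- by apply: measurable_funTS; exact: measurable_normpow.
- by move=> x _; rewrite lee_fin; apply: ge0_ler_powR => //; rewrite ltW// (lt_trans _ q1).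
Qed.

Lemma unit_test_le1 phi : measurable_fun setT phi -> (forall x, `|phi x| <= 1) -> unit_test phi.
Proof.
move=> mphi le; split => //; first by exists 1.
rewrite /unit_norm; case: r hr => [q|_|//]; last exact: ae_all.
rewrite lte_fin => q1; rewrite -[leRHS]mul1e -integral_cst//.
apply: ge0_le_integral' => //.
- by apply: measurable_funTS; exact: measurable_normpow.
- move=> x _; rewrite /= lee_fin -[leRHS](congr1 (fun F => F q) (powR1 R)); apply: ge0_ler_powR => //.
  by rewrite ltW// (lt_trans _ q1).
  by rewrite nnegrE.
Qed.

Lemma unit_test_scale (t : R) phi : `|t| <= 1 -> unit_test phi ->
  unit_test (fun x => t * phi x).
Proof.
move=> t1 u; have [mphi _ _] := u; apply: unit_test_le u _ _.
  exact: measurable_funM.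
by move=> x; rewrite normrM ler_piMl.
Qed.

(** With a quarter in place of a half, the sum is at most half the larger of the two functions, and
    the bound on q-th powers follows pointwise, without Minkowski's inequality. *)
Lemma unit_test_quarter phi psi : unit_test phi -> unit_test psi ->
  unit_test (fun x => 4^-1 * (phi x + psi x)).
Proof.
move=> [mphi [M hM] u] [mpsi [N hN] v].
have mq : measurable_fun setT (fun x => 4^-1 * (phi x + psi x)).
  by apply: measurable_funM => //; exact: measurable_funD.
have le x : `|4^-1 * (phi x + psi x)| <= 2^-1 * Num.max `|phi x| `|psi x|.
  rewrite normrM ger0_norm// (_ : 4^-1 = 2^-1 * 2^-1); last by field.
  rewrite -mulrA ler_pM2l// mulrC ler_pdivrMr//.
  apply: le_trans (ler_normD _ _) _; rewrite mulr_natr mulr2n.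
  by apply: lerD; rewrite le_max lexx ?orbT.
split => //.
  exists (2^-1 * (M + N)) => x; apply: le_trans (le x) _; rewrite ler_pM2l//.
  have M0 := le_trans (normr_ge0 _) (hM x); have N0 := le_trans (normr_ge0 _) (hN x).
  rewrite ge_max; apply/andP; split; first by apply: le_trans (hM x) _; rewrite lerDl.
  by apply: le_trans (hN x) _; rewrite lerDr.
move: u v; rewrite /unit_norm; case: r hr => [q|_|//]; last first.
  move=> u v; apply: ae_mono (ae_and u v) => x [h1 h2] Bx; apply: le_trans (le x) _.
  have : Num.max `|phi x| `|psi x| <= 1 by rewrite ge_max h1// h2.
  lra.
rewrite lte_fin => q1 u v; have q0 : 0 <= q by rewrite ltW// (lt_trans _ q1).
have mp1 := measurable_normpow q mphi; have mp2 := measurable_normpow q mpsi.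
apply: (@le_trans _ _ (\int[mu]_(x in B) (2^-1%:E * ((`|phi x| `^ q)%:E + (`|psi x| `^ q)%:E)))%E).
  apply: ge0_le_integral' => //.
  - by apply: measurable_funTS; exact: measurable_normpow.
  - apply: measurable_funTS; apply: measurable_funeM; exact: emeasurable_funD.
  - move=> x _; rewrite -EFinD -EFinM lee_fin.
    have mx0 : 0 <= Num.max `|phi x| `|psi x| by rewrite le_max normr_ge0.
    apply: (@le_trans _ _ ((2^-1 * Num.max `|phi x| `|psi x|) `^ q)).
      by apply: ge0_ler_powR; rewrite ?nnegrE ?mulr_ge0.
    rewrite powRM//.
    apply: ler_pM; rewrite ?powR_ge0//.
      by apply: ge1r_powR; [apply/andP; split; lra|exact: ltW].
    by have [_|_] := leP `|phi x| `|psi x|; rewrite ?lerDr ?lerDl powR_ge0.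
have mB1 : measurable_fun B (fun x => (`|phi x| `^ q)%:E) by exact: measurable_funTS.
have mB2 : measurable_fun B (fun x => (`|psi x| `^ q)%:E) by exact: measurable_funTS.
have mB12 : measurable_fun B (fun x => (`|phi x| `^ q)%:E + (`|psi x| `^ q)%:E)%E.
  exact: emeasurable_funD.
rewrite ge0_integralZl//; last first.
  by move=> x _; rewrite adde_ge0// lee_fin powR_ge0.
rewrite ge0_integralD// lee_pdivrMl//; apply: le_trans (leeD u v) _.
by rewrite muBE -EFinD -EFinM lee_fin; lra.
Qed.

Lemma unit_combination k (a : 'I_k -> R) (phi : 'I_k -> Borel X -> R) :
  (forall i, unit_test (phi i)) -> (forall i, `|a i| <= (4^-1) ^+ k) ->
  unit_test (fun x => \sum_i a i * phi i x).
Proof.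
elim: k a phi => [|k IH] a phi hphi ha.
  apply: unit_test_le1.
    by under eq_fun do rewrite big_ord0; exact: measurable_cst.
  by move=> x; rewrite big_ord0 normr0.
have q0 : 0 <= 4^-1 ^+ k :> R by rewrite exprn_ge0.
have h4 i : `|4 * a i| <= 4^-1 ^+ k.
  by rewrite normrM ger0_norm// -ler_pdivlMl//; apply: le_trans (ha i) _; rewrite exprS.
have -> : (fun x => \sum_i a i * phi i x) = (fun x => 4^-1 *
    ((\sum_(i < k) (4 * a (lift ord0 i)) * phi (lift ord0 i) x) + (4 * a ord0) * phi ord0 x)).
  apply/funext => x; rewrite big_ord_recl mulrDr addrC; congr (_ + _); last by field.
  by rewrite mulr_sumr; apply: eq_bigr => i _; field.
apply: unit_test_quarter; first by apply: IH => i; [exact: hphi|exact: h4].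
apply: unit_test_scale => //; apply: le_trans (h4 ord0) _; rewrite exprn_ile1//; lra.
Qed.

Lemma unit_test_integrable phi g : unit_test phi -> measurable_fun setT g ->
  mu.-integrable B (EFin \o g) -> mu.-integrable B (fun x => (phi x * g x)%:E).
Proof.
move=> [mphi [M hM] _] mg ig.
have iM := integrable_scale M mB ig.
apply: (le_integrable mB _ _ iM).
  by apply/measurable_EFinP; apply: measurable_funTS; exact: measurable_funM.
move=> x _ /=; rewrite lee_fin !normrM ler_wpM2r//.
by rewrite (le_trans (hM x))// ler_norm.
Qed.

(** The converse of Hölder's inequality with bounded test functions: on the set [E N] where
    [|g| <= N] the extremal function, the sign of g times [|g| ^ (p - 1)], is bounded, and N tends
    to infinity by monotone convergence. *)
Lemma dual_norm (g : Borel X -> R) (c : R) : 0 <= c -> measurable_fun setT g ->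
  mu.-integrable B (EFin \o g) ->
  (forall phi, unit_test phi -> `|m^-1 * \int[mu]_(y in B) (phi y * g y)| <= c) ->
  (\int[mu]_(y in B) (`|g y| `^ p)%:E <= (c `^ p)%:E * mu B)%E.
Proof.
move=> c0 mg ig hphi; have p1 := dualp_ge1 hr; have p0 := dualp_gt0 hr.
pose s := sign_on B g.
have us : unit_test s.
  by apply: unit_test_le1; [exact: sign_on_measurable|move=> x; exact: sign_on_le1].
have sg x : s x * g x = \1_B x * `|g x| by rewrite mulrC sign_onE.
have [rE|[q rE]] : r = +oo%E \/ exists q, r = q%:E.
    by case: r hr => [q _|_|//]; [right; exists q|left].
  have := hphi _ us.
  have ia : mu.-integrable B (fun y => `|g y|%:E) by have := integrable_abse ig.
  have -> : p = 1 by rewrite /dualp rE.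
  rewrite powRr1//; under eq_integral do rewrite powRr1//.
  have -> : \int[mu]_(y in B) (s y * g y) = \int[mu]_(y in B) `|g y|.
    by apply: eq_Rintegral => y yB; rewrite sg indicE yB mul1r.
  rewrite normrM gtr0_norm ?invr_gt0// ler_pdivrMl// => h.
  rewrite muBE -[leLHS]fineK; last exact: (integrable_fin_num _ ia).
  rewrite -EFinM lee_fin mulrC; apply: le_trans h; exact: ler_norm.
have q1 : 1 < q by move: hr; rewrite rE lte_fin.
pose p' := q / (q - 1).
have pE : p = p' by rewrite /dualp rE.
rewrite pE in p1 p0 *.
have q0 : 0 < q by lra.
have q10 : 0 < q - 1 by lra.
have pq : (p' - 1) * q = p' by rewrite /p'; field; rewrite gt_eqF.
have ip : 1 - q^-1 = p'^-1 by rewrite /p' invf_div; field; rewrite gt_eqF.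
pose E (N : nat) : set (Borel X) := B `&` [set x | `|g x| <= N%:R].
have mE N : measurable (E N).
  rewrite (_ : E N = B `\` level setT g N%:R); last first.
    apply/seteqP; split => x [Bx /= h]; split => //.
      by move=> [_ /=]; rewrite ltNge h.
    by rewrite /= leNgt; apply/negP => ?; apply: h.
  by apply: measurableD => //; exact: level_measurable.
have mp' := measurable_normpow p' mg.
have key N : (\int[mu]_(y in E N) (`|g y| `^ p')%:E <= (c `^ p')%:E * mu B)%E.
  have I1 : (\int[mu]_(y in E N) (`|g y| `^ p')%:E <= (N%:R `^ p')%:E * mu B)%E.
    rewrite -integral_cst//; apply: (@le_trans _ _ (\int[mu]_(y in E N) (cst (N%:R `^ p')%:E y))%E).
      apply: ge0_le_integral' => //; first exact: measurable_funTS.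
      by move=> y [_ hy]; rewrite lee_fin; apply: ge0_ler_powR => //; rewrite ?nnegrE ?(ltW p0).
    apply: ge0_subset_integral => //; last by move=> y [].
    by move=> y _; rewrite lee_fin powR_ge0.
  have If : (\int[mu]_(y in E N) (`|g y| `^ p')%:E)%E \is a fin_num.
    rewrite ge0_fin_numE; first by apply: le_lt_trans I1 _; rewrite muBE ltry.
    by apply: integral_ge0 => y _; rewrite lee_fin powR_ge0.
  set I := (\int[mu]_(y in _) _)%E in If *; pose x := fine I / m.
  have I0 : 0 <= fine I.
    by apply: fine_ge0; apply: integral_ge0 => y _; rewrite lee_fin powR_ge0.
  have IE : I = (x * m)%:E by rewrite /x divfK ?gt_eqF// fineK.
  rewrite IE muBE -EFinM lee_fin ler_pM2r//.
  have x0 : 0 <= x by rewrite divr_ge0// ltW.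
  have [->|xn0] := eqVneq x 0; first exact: powR_ge0.
  have {xn0}xp : 0 < x by rewrite lt_def xn0.
  pose a := (x `^ q^-1)^-1.
  have xq0 : 0 < x `^ q^-1 by exact: powR_gt0.
  have a0 : 0 < a by rewrite invr_gt0.
  pose phi y := a * (sign_on (E N) g y * `|g y| `^ (p' - 1)).
  have mphi : measurable_fun setT phi.
    apply: measurable_funM => //; apply: measurable_funM; first exact: sign_on_measurable.
    by apply/measurable_EFinP; exact: measurable_normpow.
  have aq : a `^ q * x = 1.
    rewrite /a -powRN -powRrM mulNr mulVf ?gt_eqF// powR_inv1 ?ltW//.
    by rewrite mulVf// gt_eqF.
  have s1 y : E N y -> g y != 0 -> `|sign_on (E N) g y| = 1.
    move=> Ey gy; have := congr1 Num.norm (sign_onE (E N) g y).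
    rewrite normrM normrM normr_id indicE mem_set// normr1 mul1r => h.
    by apply: (mulfI (x := `|g y|)); rewrite ?normr_eq0// mulr1.
  have pn0 : p' - 1 != 0.
    have -> : p' - 1 = (q - 1)^-1 by rewrite /p'; field; rewrite gt_eqF.
    by rewrite invr_eq0 gt_eqF.
  have phiq y : `|phi y| `^ q = a `^ q * (\1_(E N) y * `|g y| `^ p').
    have [Ey|nE] := pselect (E N y); last first.
      by rewrite /phi sign_on0// indicE memNset// !mul0r !mulr0 normr0 powR0// gt_eqF.
    rewrite indicE mem_set// mul1r.
    have [gy|gy] := eqVneq (g y) 0.
      by rewrite /phi gy normr0 (powR0 pn0) !mulr0 normr0 !powR0 ?mulr0 ?gt_eqF.
    rewrite /phi !normrM s1// mul1r (ger0_norm (powR_ge0 _ _)) (gtr0_norm a0).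
    by rewrite powRM ?powR_ge0 ?ltW// -powRrM pq.
  have mI : measurable_fun B (fun y => (\1_(E N) y * `|g y| `^ p')%:E).
    apply: measurable_funTS; apply/measurable_EFinP; apply: measurable_funM.
      exact: measurable_indic.
    by apply/measurable_EFinP.
  have vI : (\int[mu]_(y in B) (\1_(E N) y * `|g y| `^ p')%:E)%E = I.
    rewrite -[LHS]integral_indicM /I -[RHS]integral_indicM; apply: eq_integral => y _.
    rewrite mulrA; congr (_ * _)%:E; rewrite !indicE in_setI.
    by case: (y \in B) => /=; rewrite ?mul1r ?mul0r.
  have uphi : unit_test phi.
    split => //.
      exists (a * N%:R `^ (p' - 1)) => y.
      have [Ey|nE] := pselect (E N y); last first.
        by rewrite /phi sign_on0// !mul0r !mulr0 normr0 mulr_ge0 ?powR_ge0// ltW.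
      rewrite /phi !normrM (gtr0_norm a0) ler_pM2l//.
      rewrite -[leRHS]mul1r; apply: ler_pM => //; first exact: sign_on_le1.
      rewrite ger0_norm ?powR_ge0//; apply: ge0_ler_powR; rewrite ?nnegrE//; last by case: Ey.
      by rewrite subr_ge0.
    rewrite /unit_norm rE; under eq_integral do rewrite phiq EFinM.
    rewrite ge0_integralZl//; last by rewrite lee_fin powR_ge0.
    by rewrite vI IE -EFinM mulrA aq mul1r muBE.
  have := hphi _ uphi.
  have iF : mu.-integrable B (fun y => (\1_(E N) y * `|g y| `^ p')%:E).
    apply/integrableP; split => //.
    under eq_integral do rewrite gee0_abs ?lee_fin ?mulr_ge0 ?powR_ge0//.
    by rewrite vI IE ltry.
  have -> : \int[mu]_(y in B) (phi y * g y) = a * (x * m).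
    have -> : x * m = \int[mu]_(y in B) (\1_(E N) y * `|g y| `^ p').
      by rewrite /Rintegral vI IE.
    rewrite -RintegralZl//; apply: eq_Rintegral => y _.
    rewrite /phi -mulrA; congr (_ * _); rewrite mulrAC [_ * g y]mulrC sign_onE -mulrA.
    by rewrite mulr_powRB1.
  have im0 : 0 < m^-1 by rewrite invr_gt0.
  rewrite normrM (gtr0_norm im0) ger0_norm; last by rewrite (mulr_ge0 (ltW a0))// mulr_ge0// ltW.
  rewrite mulrC -!mulrA mulfV ?gt_eqF// mulr1 => hx.
  have -> : x = (x `^ p'^-1) `^ p' by rewrite -powRrM mulVf ?gt_eqF// powRr1.
  apply: ge0_ler_powR; rewrite ?nnegrE ?powR_ge0 ?(ltW p0)//.
  rewrite -ip powRB; last by apply/implyP => _; rewrite gt_eqF.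
  by rewrite powRr1 1?mulrC// ltW.
have BE : B = \bigcup_N E N.
  apply/seteqP; split => [x Bx|x [N _ []]//].
  exists (Num.bound `|g x|) => //; split => //=; apply/ltW/archi_boundP.
  exact: normr_ge0.
have cv : (\int[mu]_(y in E N) (`|g y| `^ p')%:E)%E @[N --> \oo] -->
    (\int[mu]_(y in B) (`|g y| `^ p')%:E)%E.
  rewrite [in X in _ --> X]BE; apply: ge0_nondecreasing_set_cvg_integral => //.
  - move=> i j ij; rewrite subsetEset => x [Bx h]; split => //=.
    by apply: le_trans h _; rewrite ler_nat.
  - by move=> i; exact: measurable_funTS.
rewrite -(cvg_lim _ cv)//; apply: lime_le; first by apply/cvg_ex; eexists; exact: cv.
exact: nearW.
Qed.

Section Vector.
Variables (n : nat) (f : Borel X -> 'rV[R]_n).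
Hypothesis mf : forall j, measurable_fun setT (fun x => f x 0 j).
Hypothesis if_ : forall j, mu.-integrable B (fun x => (f x 0 j)%:E).

Definition body : set 'rV[R]_n :=
  [set w | exists2 phi, unit_test phi & w = avg mu B (fun y => phi y *: f y)].

Lemma body_entry phi j : avg mu B (fun y => phi y *: f y) 0 j =
  m^-1 * \int[mu]_(y in B) (phi y * f y 0 j).
Proof. by rewrite mxE; congr (_ * _); apply: eq_Rintegral => y _; rewrite mxE. Qed.

Lemma avg_scale (t : R) phi : unit_test phi ->
  avg mu B (fun y => (t * phi y) *: f y) = t *: avg mu B (fun y => phi y *: f y).
Proof.
move=> u; apply/rowP => j; rewrite [RHS]mxE !body_entry mulrCA; congr (_ * _).
have ii := unit_test_integrable u (mf j) (if_ j).
by rewrite -RintegralZl//; apply: eq_Rintegral => y _; rewrite mulrA.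
Qed.

Lemma avg_add phi psi : unit_test phi -> unit_test psi ->
  avg mu B (fun y => (phi y + psi y) *: f y) =
  avg mu B (fun y => phi y *: f y) + avg mu B (fun y => psi y *: f y).
Proof.
move=> u v; apply/rowP => j; rewrite [RHS]mxE !body_entry -mulrDr; congr (_ * _).
have ii := unit_test_integrable u (mf j) (if_ j).
have ij := unit_test_integrable v (mf j) (if_ j).
by rewrite -RintegralD//; apply: eq_Rintegral => y _; rewrite mulrDl.
Qed.

Lemma avg_combination k (a : 'I_k -> R) (phi : 'I_k -> Borel X -> R) :
  (forall i, unit_test (phi i)) ->
  avg mu B (fun y => (\sum_i a i * phi i y) *: f y) =
  \sum_i a i *: avg mu B (fun y => phi i y *: f y).
Proof.
move=> u; apply/rowP => j; rewrite body_entry summxE.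
under [RHS]eq_bigr do rewrite mxE body_entry mulrCA.
rewrite -mulr_sumr; congr (_ * _).
have ii i : mu.-integrable B (fun y => (a i * (phi i y * f y 0 j))%:E).
  apply: integrable_scale => //; exact: (unit_test_integrable (u _) (mf j) (if_ j)).
transitivity (fine (\sum_i \int[mu]_(y in B) (a i * (phi i y * f y 0 j))%:E)%E).
  rewrite -integral_sum//; congr fine; apply: eq_integral => y _.
  rewrite sumEFin; congr EFin; rewrite mulr_suml; apply: eq_bigr => i _.
  by rewrite mulrA.
rewrite -sum_fine => [|i _]; last exact: (integrable_fin_num _ (ii i)).
by apply: eq_bigr => i _; rewrite -RintegralZl//; exact: (unit_test_integrable (u i) (mf j) (if_ j)).
Qed.

Lemma body_starlike : starlike body.
Proof.
move=> t w t1 [phi u ->]; exists (fun y => t * phi y); first exact: unit_test_scale.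
by rewrite avg_scale.
Qed.

Lemma body_quarter : quarter_sum body.
Proof.
move=> v w [phi u ->] [psi u' ->].
exists (fun y => 4^-1 * (phi y + psi y)); first exact: unit_test_quarter.
rewrite scalerDr -!avg_scale// -avg_add.
- by congr (avg mu B); apply/funext => y; rewrite mulrDr.
- by apply: unit_test_scale => //; rewrite ger0_norm//; lra.
- by apply: unit_test_scale => //; rewrite ger0_norm//; lra.
Qed.

Lemma body0 : body 0.
Proof.
exists (fun=> 0); first by apply: unit_test_le1 => // x; rewrite normr0.
apply/rowP => j; rewrite body_entry mxE; under eq_Rintegral do rewrite mul0r.
by rewrite Rintegral_cst// mul0r mulr0.
Qed.

Lemma avg_coord k (U : 'M[R]_(n, k)) phi i : unit_test phi ->
  (avg mu B (fun y => phi y *: f y) *m U) 0 i =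
  m^-1 * \int[mu]_(y in B) (phi y * (f y *m U) 0 i).
Proof.
move=> u; rewrite mxE; under eq_bigr do rewrite body_entry -mulrA.
rewrite -mulr_sumr; congr (_ * _).
have ii j : mu.-integrable B (fun y => (U j i * (phi y * f y 0 j))%:E).
  apply: integrable_scale => //; exact: (unit_test_integrable u (mf j) (if_ j)).
symmetry; transitivity (fine (\sum_j \int[mu]_(y in B) (U j i * (phi y * f y 0 j))%:E)%E).
  rewrite -integral_sum//; congr fine; apply: eq_integral => y _.
  rewrite sumEFin; congr EFin; rewrite mxE mulr_sumr; apply: eq_bigr => j _.
  by rewrite mulrA [RHS]mulrC.
rewrite -sum_fine => [|j _]; last exact: (integrable_fin_num _ (ii j)).
by apply: eq_bigr => j _; rewrite mulrC -RintegralZl//; exact: (unit_test_integrable u (mf j) (if_ j)).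
Qed.

Lemma coord_measurable k (U : 'M[R]_(n, k)) i : measurable_fun setT (fun y => (f y *m U) 0 i).
Proof.
under eq_fun do rewrite mxE; apply: measurable_sum => j.
by apply: measurable_funM.
Qed.

Lemma coord_integrable k (U : 'M[R]_(n, k)) i :
  mu.-integrable B (fun y => ((f y *m U) 0 i)%:E).
Proof.
have ii j : mu.-integrable B (fun y => (U j i * f y 0 j)%:E) by exact: (integrable_scale (U j i) mB (if_ j)).
have := integrable_sum mB (index_enum 'I_n) (P := predT) (fun j _ => ii j).
apply: eq_integrable => // y _; rewrite mxE -sumEFin.
by apply: eq_bigr => j _; rewrite mulrC.
Qed.

(** The frame identity holds for averages only. Averaging against the sign of the difference of the
    two sides in one coordinate turns it into an equality almost everywhere on [B]. *)
Lemma body_frame : exists k (U : 'M[R]_(n, k)) (V : 'M[R]_(k, n)), [/\ (k <= n)%N,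
  {ae mu, forall x, B x -> f x = f x *m U *m V} &
  forall i, (forall t : R, body (t *: row i V)) \/ (body (row i V) /\
    (\int[mu]_(y in B) (`|(f y *m U) 0 i| `^ p)%:E <= ((2 * 8 ^+ k) `^ p)%:E * mu B)%E)].
Proof.
have [k [U [V [kn [dec fr]]]]] := frame_exists body_starlike body_quarter body0.
exists k, U, V; split => //; last first.
  move=> i; have [h|[h1 h2]] := fr i; [by left|right; split => //].
  apply: dual_norm.
  - by rewrite mulr_ge0// exprn_ge0.
  - exact: coord_measurable.
  - exact: coord_integrable.
  - move=> phi u; rewrite -avg_coord//; apply: h2; by exists phi.
suff hj j : {ae mu, forall x, B x -> f x 0 j = (f x *m U *m V) 0 j}.
  apply: ae_mono (ae_finite hj) => x hx Bx; apply/rowP => j; exact: hx.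
pose e y := f y 0 j - (f y *m (U *m V)) 0 j.
have me : measurable_fun setT e by apply: measurable_funB => //; exact: coord_measurable.
have us : unit_test (sign_on B e).
  by apply: unit_test_le1; [exact: sign_on_measurable|move=> x; exact: sign_on_le1].
have i1 := unit_test_integrable us (mf j) (if_ j).
have i2 := unit_test_integrable us (coord_measurable (U *m V) j) (coord_integrable (U *m V) j).
have ie : mu.-integrable B (fun y => (e y)%:E).
  have := integrableB mB (if_ j) (coord_integrable (U *m V) j).
  by apply: eq_integrable.
have : \int[mu]_(y in B) `|e y| = 0.
  have w : body (avg mu B (fun y => sign_on B e y *: f y)) by exists (sign_on B e).
  have := congr1 (fun w : 'rV_n => w 0 j) (dec _ w).
  rewrite -mulmxA avg_coord// body_entry => /(mulfI _) h.
  have im0 : m^-1 != 0 by rewrite invr_eq0 gt_eqF.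
  have {h}h := h im0.
  have -> : \int[mu]_(y in B) `|e y| = \int[mu]_(y in B) (sign_on B e y * f y 0 j -
      sign_on B e y * (f y *m (U *m V)) 0 j).
    apply: eq_Rintegral => y yB.
    by rewrite -mulrBr -/(e y) mulrC sign_onE indicE yB mul1r.
  by rewrite RintegralB// h subrr.
move=> h0; have : (\int[mu]_(y in B) `|(e y)%:E|)%E = 0%E.
  have ia := integrable_abse ie.
  by rewrite -[LHS]fineK ?(integrable_fin_num _ ia)//; congr EFin.
move=> /(ae_eq_integral_abs mu mB (measurable_int mu ie)).
apply: ae_mono => x h Bx; have := h Bx; rewrite /e => -[] /eqP.
by rewrite subr_eq0 mulmxA => /eqP.
Qed.

End Vector.

End ConvexBody.

(** * Stopping cubes *)

Section StoppingCubes.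
Context {R : realType} {X : ptopologicalType}.
Variables (mu : {measure set (Borel X) -> \bar R}) (d : X -> X -> R).
Variables (cd cmu : R) (hX : homogeneous_type mu d cd cmu).
Variables (c0 C0 delta : R) (hc0 : 0 < c0 <= C0) (hdelta : 0 < delta < 1).
Variables (D : set (cube X)) (hD : dyadic_system d c0 C0 delta D).
Variables (alpha : R) (halpha : 3 * cd ^+ 2 / delta <= alpha).
Local Notation cub := (cub hD).
Local Notation dil := (dilate d C0 delta alpha).

Definition stopping_family Q (Om : set (Borel X)) (Ch : set (cube X)) :=
  [/\ forall P, Ch P -> [/\ D P, carrier P `<=` carrier Q, generation Q < generation P,
        dil P `<=` dil Q & (mu (carrier P `&` Om) <= (1 / 2)%:E * mu (carrier P))%E],
      countable Ch, disjoint_family Ch,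
      (mu (famU Ch carrier) <= (1 / 2)%:E * mu (carrier Q))%E &
      {ae mu, forall x, carrier Q x -> Om x -> famU Ch carrier x}].

(** The stopping cubes are the maximal cubes in which [Om] has density above [th]. Density points of
    [Om] are covered, and the total measure is at most that of [Om] divided by [th]. *)
Lemma stopping_cubes : exists2 e0 : R, 0 < e0 <= 1 & forall Q (Om : set (Borel X)),
  D Q -> measurable Om -> (mu Om <= e0%:E * mu (carrier Q))%E ->
  exists Ch, stopping_family Q Om Ch.
Proof.
have le_mu (A B : set (Borel X)) : measurable A -> measurable B -> A `<=` B ->
    (mu A <= mu B)%E by move=> mA mB AB; apply: le_measure => //; rewrite inE.
have cd0 : 0 < cd := cd_gt0 hX.
have cd1 : 1 <= cd := cd_ge1 hX.
have C00 : 0 < C0 := C0_gt0 hc0.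
have d0 : 0 < delta by case/andP: hdelta.
have dp (k : int) : 0 < delta ^ k := dpow_gt0 hdelta k.
have a3 := alpha_ge3 hX hdelta halpha.
have ag := alpha_ge hX hdelta halpha.
pose Cp := cubc cd cmu c0 C0 (2 * cd * C0 / delta ^+ 1).
have Cp1 : 1 <= Cp by exact: (cubc_ge1 hX).
(* [Cp] compares a cube with its parent: the parent being below density [th], the cube itself is at
   most half filled. *)
pose th := (2 * Cp)^-1.
have th0 : 0 < th by rewrite invr_gt0; lra.
have th2 : th <= 1 / 2.
  by rewrite /th invfM div1r ler_piMr// invf_le1//; lra.
have thC : th * Cp = 1 / 2 by rewrite /th; field; rewrite gt_eqF//; lra.
(* A subcube more than [M0] generations below [Q] has its dilate inside that of [Q]. *)
have [M0 hM0] : exists n : nat, delta ^+ n < (2 * cd)^-1.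
  by apply: (dpow_small hdelta); rewrite invr_gt0; lra.
pose CM := cubc cd cmu c0 C0 (2 * cd * C0 / delta ^+ M0).
have CM1 : 1 <= CM by exact: (cubc_ge1 hX).
(* So small that a subcube within [M0] generations of [Q] cannot reach density [th], and that
   [e0 / th] is at most a half. *)
pose e0 := th / (2 * CM).
have e00 : 0 < e0 by rewrite divr_gt0//; lra.
have e0C : e0 * CM <= th.
  have -> : e0 * CM = th / 2 by rewrite /e0; field; rewrite gt_eqF//; lra.
  by lra.
have e0t : e0 <= th / 2.
  have -> : th / 2 = e0 * CM by rewrite /e0; field; rewrite gt_eqF//; lra.
  by rewrite ler_peMr// ltW.
exists e0; first by rewrite e00/=; lra.
move=> Q Om DQ mOm hOm; set k := generation Q.
have mQ := cube_measurable hD DQ; have Qf := cube_mu_fin_num hX hD DQ.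
pose Om' := Om `&` carrier Q.
have mOm' : measurable Om' by exact: measurableI.
have O'le : (mu Om' <= e0%:E * mu (carrier Q))%E.
  exact: le_trans (le_mu _ _ mOm' mOm (@subIsetl _ _ _)) hOm.
pose bad P := (th%:E * mu (carrier P) < mu (carrier P `&` Om'))%E.
have meas_le (P : cube X) : D P -> (mu (carrier P `&` Om') <= mu Om')%E.
  move=> DP; apply: le_mu => //.
  by apply: measurableI => //; exact: (cube_measurable hD).
have mulge0 (P : cube X) : (0 <= th%:E * mu (carrier P))%E.
  by rewrite mule_ge0// lee_fin ltW.
have bad_meets P : D P -> k <= generation P -> bad P -> carrier P `<=` carrier Q.
  move=> DP kP bP.
  have [[x [Px [_ Qx]]]|no] := pselect (exists x, (carrier P `&` Om') x).
    exact: (cube_nested hD DP DQ kP Px Qx).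
  move: bP; rewrite /bad (_ : _ `&` _ = set0) ?measure0.
    by rewrite ltNge mulge0.
  by apply/seteqP; split => // x hx; case: no; exists x.
have bad_gen P : D P -> k <= generation P -> bad P -> k + M0%:Z < generation P.
  move=> DP kP bP; rewrite ltNge; apply/negP => gP.
  have PQ := bad_meets P DP kP bP.
  pose x := cube_center P; have Px : carrier P x := center_in hX hc0 hdelta hD DP.
  move: bP; rewrite /bad; apply/negP; rewrite -leNgt.
  apply: le_trans (meas_le P DP) _; apply: le_trans O'le _.
  have h1 : (mu (carrier Q) <= CM%:E * mu (carrier P))%E.
    have := cub_le_cub hX hc0 hdelta hD k M0 x.
    rewrite -(cub_uniq hD DQ (PQ _ Px)) => /le_trans; apply.
    apply: lee_wpmul2l; first by rewrite lee_fin (le_trans ler01 CM1).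
    apply: le_mu; first exact: (cube_measurable hD (cub_D hD _ _)).
      exact: (cube_measurable hD).
    apply: (cube_nested hD (cub_D hD _ _) DP _ (cub_in hD _ _) Px).
    by rewrite gen_cub.
  apply: le_trans (lee_wpmul2l _ h1) _; first by rewrite lee_fin ltW.
  by rewrite muleA -EFinM; apply: lee_wpmul2r => //; rewrite lee_fin.
have kgood P : D P -> generation P = k -> ~ bad P.
  move=> DP gP bP; have := bad_gen P DP; rewrite gP lexx => /(_ isT bP).
  by rewrite ltNge lerDl.
pose Ch := maxcubes D k bad.
have cC : countable Ch by exact: (maxcubes_countable hX hc0 hdelta hD).
have dC : disjoint_family Ch by exact: (maxcubes_disjoint hD).
have mC P : Ch P -> measurable (carrier P) by move=> [DP _ _ _]; exact: (cube_measurable hD).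
exists Ch; split => //.
- move=> P CP; have [DP kP bP _] := CP.
  have PQ := bad_meets P DP (ltW kP) bP; split => //.
  + have gP := bad_gen P DP (ltW kP) bP.
    have dle : delta ^ generation P <= delta ^ k * (2 * cd)^-1.
      apply: le_trans (dpow_le hdelta (ltW gP)) _; rewrite (dpowD hdelta) ler_pM2l//.
      exact: ltW.
    have zz := cube_outer hD DQ (PQ _ (center_in hX hc0 hdelta hD DP)).
    apply: (qball_sub hX); rewrite -/k in zz *.
    apply: (@le_trans _ _ (cd * (C0 * delta ^ k + alpha * C0 * (delta ^ k * (2 * cd)^-1)))).
      rewrite ler_pM2l// lerD ?(ltW zz)// ler_wpM2l// mulr_ge0 ?(ltW C00)//; lra.
    have -> : cd * (C0 * delta ^ k + alpha * C0 * (delta ^ k * (2 * cd)^-1)) =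
        (cd + alpha / 2) * (C0 * delta ^ k) by field; rewrite gt_eqF.
    rewrite -[leRHS]mulrA ler_pM2r ?mulr_gt0//.
    have : cd <= cd ^+ 2 by rewrite expr2 ler_peMl// ltW.
    lra.
  + have PO : carrier P `&` Om = carrier P `&` Om'.
      apply/seteqP; split => x [Px]; first by move=> Ox; split => //; split => //; exact: PQ.
      by case.
    pose x := cube_center P; have Px : carrier P x := center_in hX hc0 hdelta hD DP.
    have nb : ~ bad (cub (generation P - 1) x).
      by apply: maxcubes_parent kgood; [exact: CP|exact: Px].
    set P' := cub _ _ in nb; have DP' : D P' := cub_D hD _ _.
    have mP' := cube_measurable hD DP'.
    have PP' : carrier P `<=` carrier P'.
      by apply: (cube_nested hD DP DP' _ Px (cub_in hD _ _)); rewrite gen_cub gerBl.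
    apply: (@le_trans _ _ (mu (carrier P' `&` Om'))).
      rewrite PO; apply: le_mu; [by apply: measurableI => //; exact: mC|exact: measurableI|].
      by move=> y [Py Oy]; split => //; exact: PP'.
    apply: (@le_trans _ _ (th%:E * mu (carrier P'))%E); first by rewrite leNgt; apply/negP.
    rewrite -thC EFinM -muleA; apply: lee_wpmul2l; first by rewrite lee_fin ltW.
    have := cub_le_cub hX hc0 hdelta hD (generation P - 1) 1 x.
    by rewrite subrK -(cub_uniq hD DP Px).
- have mU : measurable (famU Ch carrier) by exact: famU_measurable.
  have mI : measurable_fun setT (fun x => (th^-1%:E * (\1_Om' x)%:E)%E : \bar R).
    by apply: measurable_funeM; apply/measurable_EFinP; exact: measurable_indic.
  have mI1 : measurable_fun setT (fun x : Borel X => (\1_Om' x : R)%:E).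
    by apply/measurable_EFinP; exact: measurable_indic.
  have h1 : (\int[mu]_(x in famU Ch carrier) (cst 1%E x) <=
      \int[mu]_(x in famU Ch carrier) (th^-1%:E * (\1_Om' x)%:E))%E.
    apply: fam_le_integral => //.
    - by move=> x; apply: mule_ge0; [rewrite lee_fin invr_ge0 ltW|rewrite lee_fin indicE].
    - move=> P CP; have [DP kP bP _] := CP; have mP := mC P CP.
      rewrite integral_cst// mul1e ge0_integralZl//.
      + by rewrite integral_indic// lee_pdivlMl// setIC ltW.
      + exact: measurable_funTS.
      + by rewrite lee_fin invr_ge0 ltW.
  rewrite integral_cst// mul1e in h1; apply: le_trans h1 _.
  rewrite ge0_integralZl//; [|exact: measurable_funTS|by rewrite lee_fin invr_ge0 ltW].
  rewrite integral_indic// lee_pdivrMl//.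
  apply: (@le_trans _ _ (mu Om')).
    by apply: le_mu => //; exact: measurableI.
  apply: le_trans O'le _; rewrite muleA -EFinM; apply: lee_wpmul2r => //.
  by rewrite lee_fin; lra.
- have := dyadic_density hX hc0 hdelta hD mOm' (e := 1 / 2) ltac:(by lra).
  apply: ae_mono => x hx Qx Ox.
  have [l kl hl] := hx (conj Ox Qx) (k + 1).
  have DP : D (cub l x) := cub_D hD l x.
  have mP : measurable (carrier (cub l x)) := cube_measurable hD DP.
  have kP : k < generation (cub l x) by rewrite gen_cub (lt_le_trans _ kl)// ltrDl.
  have [|P MP PP] := maxcubes_cover DP kP (bad := bad); last first.
    by exists P => //; apply: PP; exact: cub_in.
  rewrite /bad; set P := carrier _ in mP hl *.
  have Pf : mu P \is a fin_num by exact: (cube_mu_fin_num hX hD DP).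
  have hs : mu P = (mu (P `\` Om') + mu (P `&` Om'))%E by exact: measureDI.
  have f1 : mu (P `\` Om') \is a fin_num.
    rewrite ge0_fin_numE//; apply: le_lt_trans (le_mu _ P _ mP (@subDsetl _ P Om')) _.
      exact: measurableD.
    by rewrite -ge0_fin_numE.
  have f2 : mu (P `&` Om') \is a fin_num.
    rewrite ge0_fin_numE//; apply: le_lt_trans (le_mu _ P _ mP (@subIsetl _ P Om')) _.
      exact: measurableI.
    by rewrite -ge0_fin_numE.
  have := congr1 fine hs; rewrite fineD// => hs'.
  have hl' : fine (mu (P `\` Om')) < 1 / 2 * fine (mu P) by rewrite -lte_fin EFinM !fineK.
  have P0 : 0 <= fine (mu P) by exact: fine_ge0.
  rewrite -(fineK Pf) -(fineK f2) -EFinM lte_fin.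
  apply: le_lt_trans (ler_wpM2r P0 th2) _; lra.
Qed.

End StoppingCubes.

Lemma measurable_switch dT (T : measurableType dT) (R : realType) (N : T -> nat)
    (F : nat -> T -> R) : (forall j, measurable [set x | N x = j]) ->
  (forall j, measurable_fun setT (F j)) -> measurable_fun setT (fun x => F (N x) x).
Proof.
move=> mN mF _ Y mY; rewrite setTI.
rewrite (_ : _ @^-1` _ = \bigcup_j ([set x | N x = j] `&` F j @^-1` Y)).
  apply: bigcup_measurable => j _; apply: measurableI => //.
  by rewrite -[_ @^-1` _]setTI; exact: mF.
by apply/seteqP; split => [x /= Yx|x [j _ [/= <-]]//]; exists (N x).
Qed.

Lemma measurable_truncn dT (T : measurableType dT) (R : realType) (t : T -> R) (j : nat) :
  measurable_fun setT t -> measurable [set x | Num.truncn `|t x| = j].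
Proof.
move=> mt; rewrite (_ : [set x | _] = (fun x => `|t x|) @^-1` `[j%:R, j.+1%:R[).
  by rewrite -[_ @^-1` _]setTI; apply: measurableT_comp => //; exact: measurable_itv.
apply/seteqP; split => x /=; rewrite in_itv/= -truncn_eq//; first by move=> ->.
by move/eqP.
Qed.

Lemma finite_union_measure dT (T : measurableType dT) (R : realType)
    (mu : {measure set T -> \bar R}) (m : \bar R) k (F : 'I_k -> set T) :
  (forall i, measurable (F i) /\ (mu (F i) <= m)%E) -> (0 <= m)%E ->
  exists G, [/\ measurable G, (mu G <= k%:R%:E * m)%E & forall i, F i `<=` G].
Proof.
move=> hF m0; elim: k F hF => [|k IH] F hF.
  by exists set0; split => [//||[]//]; rewrite measure0 mul0e.
have [G [mG hG GF]] := IH (fun i => F (lift ord0 i)) (fun i => hF _).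
exists (F ord0 `|` G); split.
- by apply: measurableU => //; case: (hF ord0).
- apply: le_trans (measureU2 _ (hF ord0).1 mG) _.
  rewrite -addn1 natrD EFinD ge0_muleDl ?lee_fin// addeC mul1e.
  by apply: leeD => //; case: (hF ord0).
- by move=> i; case: (unliftP ord0 i) => [j ->|->] x Fx; [right; exact: (GF j)|left].
Qed.

(** * One step of the iteration for vector functions *)

Section VectorStep.
Context {R : realType} {X : ptopologicalType}.
Variables (mu : {measure set (Borel X) -> \bar R}) (d : X -> X -> R).
Variables (cd cmu : R) (hX : homogeneous_type mu d cd cmu).
Variables (c0 C0 delta : R) (hc0 : 0 < c0 <= C0) (hdelta : 0 < delta < 1).
Variables (D : set (cube X)) (hD : dyadic_system d c0 C0 delta D).
Variables (alpha : R) (halpha : 3 * cd ^+ 2 / delta <= alpha).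
Variables (r : \bar R) (hr : (1 < r)%E).
Variables (T Ts : (Borel X -> R) -> (Borel X -> R)).
Hypothesis hT : linear_operator mu d r T.
Hypothesis hTs : linear_operator mu d +oo%E Ts.
Hypothesis hadj : adjoint_operators mu d r +oo%E T Ts.
Local Notation p := (dualp r).
Local Notation cub := (cub hD).
Local Notation dil := (dilate d C0 delta alpha).
Let r1 : (1 <= r)%E := ltW hr.

(** [T] acts on functions and not on classes; duality against the sign of [T g] on balls shows that
    null functions have null images. *)
Lemma T_null g : bsL mu d r g -> {ae mu, forall x, g x = 0} -> {ae mu, forall x, T g x = 0}.
Proof.
move=> bg g0; have mTg := hT.1 g bg; have mg : measurable_fun setT g by case: bg.
pose B (N : nat) : set (Borel X) := qball d point N%:R.
have mB N : measurable (B N) by exact: (qball_measurable hX).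
have hN N : {ae mu, forall x, B N x -> T g x = 0}.
  pose s := sign_on (B N) (T g).
  have ts : test_fun d 1 s.
    split; [exact: sign_on_measurable|move=> x; exact: sign_on_le1|].
    exists point, (N%:R + 1); split; first by rewrite ltr_wpDl.
    move=> y ny; apply: sign_on0 => By; apply: ny; apply: lt_le_trans By _.
    by rewrite lerDl.
  have bs := test_fun_bsL (p := +oo%E) hX (leey _) ts.
  have [i1 i2 e12] := hadj bg bs.
  have mTs := hTs.1 _ bs.
  have z0 : \int[mu]_x (T g x * s x) = 0.
    rewrite e12 (Rintegral_ae_eq (g := fun=> 0)) //.
    - by rewrite Rintegral_cst// mul0r.
    - exact: measurable_funM.
    - by apply: ae_mono g0 => x -> _; rewrite mul0r.
  have : (\int[mu]_(x in B N) `|(T g x)%:E|)%E = 0%E.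
    rewrite -[LHS](_ : (\int[mu]_(x in B N) `|T g x|%:E)%E = _)//.
    rewrite -[LHS]integral_indicM; under eq_integral do rewrite -sign_onE.
    by rewrite -[LHS]fineK ?(integrable_fin_num _ i1)//; congr EFin.
  move=> /(ae_eq_integral_abs mu (mB N)) h.
  have mE : measurable_fun (B N) (fun x => (T g x)%:E).
    by apply: measurable_funTS; exact/measurable_EFinP.
  by apply: ae_mono (h mE) => x hx Bx; have [] := hx Bx.
have cN : countable [set: nat] by [].
apply: ae_mono (ae_countable (S := [set: nat]) (P := fun N x => B N x -> T g x = 0) cN (fun N _ => hN N)) => x hx.
have : (\bigcup_N qball d point N%:R) x by rewrite (bigcup_qball hX).
by move=> [N _ BN]; exact: (hx N).
Qed.

Lemma T_ae_eq f g : bsL mu d r f -> bsL mu d r g -> {ae mu, forall x, f x = g x} ->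
  {ae mu, forall x, T f x = T g x}.
Proof.
move=> bf bg fg.
have bfg := bsL_lin hX (-1) r1 bg bf.
have fg0 : {ae mu, forall x, -1 * g x + f x = 0}.
  by apply: ae_mono fg => x ->; rewrite mulN1r addNr.
apply: ae_mono (ae_and (T_null bfg fg0) (hT.2 1 _ _ bfg bg)) => x [h0].
rewrite h0 (_ : (fun y => _) = f); last by apply/funext => y; rewrite mul1r mulN1r addrAC addNr add0r.
by rewrite mulr0 add0r.
Qed.

Lemma bsL_sum k (a : 'I_k -> R) (h : 'I_k -> Borel X -> R) :
  (forall i, bsL mu d r (h i)) -> bsL mu d r (fun y => \sum_i a i * h i y).
Proof.
elim: k a h => [|k IH] a h bh.
  under eq_fun do rewrite big_ord0.
  apply: (test_fun_bsL hX r1 (M := 0)); split => //; first by move=> x; rewrite normr0.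
  by exists point, 1; split.
under eq_fun do rewrite big_ord_recl.
exact: (bsL_lin hX _ r1 (bh _) (IH _ _ (fun i => bh _))).
Qed.

Lemma T_sum k (a : 'I_k -> R) (h : 'I_k -> Borel X -> R) : (forall i, bsL mu d r (h i)) ->
  {ae mu, forall x, T (fun y => \sum_i a i * h i y) x = \sum_i a i * T (h i) x}.
Proof.
elim: k a h => [|k IH] a h bh.
  have := T_null (bsL_sum a bh) => H; apply: ae_mono (H _) => [x|].
    by rewrite big_ord0.
  by apply: ae_all => x; rewrite big_ord0.
have bs := bsL_sum (fun i => a (lift ord0 i)) (fun i => bh (lift ord0 i)).
apply: ae_mono (ae_and (hT.2 (a ord0) _ _ (bh ord0) bs) (IH (fun i => a (lift ord0 i)) _ (fun i => bh (lift ord0 i)))) => x [h1 h2].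
under eq_fun do rewrite big_ord_recl.
by rewrite h1 h2 big_ord_recl.
Qed.

Variables (A1 : R) (A11 : 1 <= A1).
Hypothesis sstep : forall (e : R) Q g, 0 < e <= 1 -> D Q -> bsL mu d r g ->
  (forall x, ~ dil Q x -> g x = 0) ->
  (\int[mu]_x (`|g x| `^ p)%:E <= mu (dil Q))%E ->
  exists Om : set (Borel X), [/\ measurable Om, (mu Om <= e%:E * mu (carrier Q))%E,
    forall x, carrier Q x -> ~ Om x -> `|T g x| <= A1 / e ^+ 2 &
    forall P, D P -> carrier P `<=` carrier Q ->
      (mu (carrier P `&` Om) <= (1 / 2)%:E * mu (carrier P))%E ->
      {ae mu, forall x, carrier P x ->
        `|T (fun y => \1_(~` dil P) y * g y) x| <= A1 / e ^+ 2}].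

Lemma coord_step (e c : R) Q g : 0 < e <= 1 -> 0 < c -> D Q -> bsL mu d r g ->
  (forall x, ~ dil Q x -> g x = 0) ->
  (\int[mu]_(x in dil Q) (`|g x| `^ p)%:E <= (c `^ p)%:E * mu (dil Q))%E ->
  exists Om : set (Borel X), [/\ measurable Om, (mu Om <= e%:E * mu (carrier Q))%E,
    {ae mu, forall x, carrier Q x -> ~ Om x -> `|T g x| <= c * (A1 / e ^+ 2)} &
    forall P, D P -> carrier P `<=` carrier Q ->
      (mu (carrier P `&` Om) <= (1 / 2)%:E * mu (carrier P))%E ->
      {ae mu, forall x, carrier P x ->
        `|T (fun y => \1_(~` dil P) y * g y) x| <= c * (A1 / e ^+ 2)}].
Proof.
move=> he cp DQ bg gs hg; have p0 := dualp_gt0 hr.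
have mdQ : measurable (dil Q) by exact: (dil_measurable hX).
have mg : measurable_fun setT g by case: bg.
have scaleT h : bsL mu d r h -> bsL mu d r (fun y => c^-1 * h y) /\
    {ae mu, forall x, T (fun y => c^-1 * h y) x = c^-1 * T h x}.
  move=> bh; have bh' : forall i : 'I_1, bsL mu d r (fun y => h y) by [].
  have := bsL_sum (fun _ : 'I_1 => c^-1) bh'; under eq_fun do rewrite big_ord1.
  split => //; have := T_sum (fun _ : 'I_1 => c^-1) bh'.
  by apply: ae_mono => x; rewrite big_ord1 => <-; congr (T _ _); apply/funext => y; rewrite big_ord1.
have [bg' Tg'] := scaleT g bg.
have gs' x : ~ dil Q x -> c^-1 * g x = 0 by move=> /gs ->; rewrite mulr0.
have hg' : (\int[mu]_x (`|c^-1 * g x| `^ p)%:E <= mu (dil Q))%E.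
  have -> : (\int[mu]_x (`|c^-1 * g x| `^ p)%:E =
      \int[mu]_(x in dil Q) ((c^-1 `^ p)%:E * (`|g x| `^ p)%:E))%E.
    under [RHS]eq_integral do rewrite -EFinM.
    rewrite -[RHS]integral_indicM; apply: eq_integral => x _.
    rewrite indicE; have [xQ|xQ] := boolP (x \in dil Q).
      by rewrite mul1r normrM gtr0_norm ?invr_gt0// powRM// invr_ge0 ltW.
    by rewrite gs' ?normr0 ?powR0 ?mul0r ?gt_eqF// => h; rewrite notin_setE in xQ.
  rewrite ge0_integralZl//; last 2 first.
    by apply: measurable_funTS; exact: measurable_normpow.
    by rewrite lee_fin powR_ge0.
  apply: le_trans (lee_wpmul2l _ hg) _; first by rewrite lee_fin powR_ge0.
  rewrite muleA -EFinM -powRM ?invr_ge0 ?(ltW cp)// mulVf ?gt_eqF//.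
  by rewrite powR1 mul1e.
have [Om [mOm hOm h1 h2]] := sstep he DQ bg' gs' hg'.
exists Om; split => //.
  apply: ae_mono Tg' => x Tx Qx nx; have := h1 x Qx nx.
  by rewrite Tx normrM gtr0_norm ?invr_gt0// ler_pdivrMl.
move=> P DP PQ hP.
have mdP : measurable (dil P) by exact: (dil_measurable hX).
have bh : bsL mu d r (fun y => \1_(~` dil P) y * g y).
  by apply: (bsL_restr hX r1) => //; exact: measurableC.
have [_ Th] := scaleT _ bh.
apply: ae_mono (ae_and Th (h2 P DP PQ hP)) => x [Tx hx] Px; have := hx Px.
rewrite (_ : (fun y => \1_(~` dil P) y * (c^-1 * g y)) = (fun y => c^-1 * (\1_(~` dil P) y * g y))); last first.
  by apply/funext => y; rewrite mulrCA.
by rewrite Tx normrM gtr0_norm ?invr_gt0// ler_pdivrMl.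
Qed.

Variables (e0 : R) (he0 : 0 < e0 <= 1).
Hypothesis stop : forall Q (Om : set (Borel X)),
  D Q -> measurable Om -> (mu Om <= e0%:E * mu (carrier Q))%E ->
  exists Ch, stopping_family mu d C0 delta D alpha Q Om Ch.

Definition cut_dil n (f : Borel X -> 'rV[R]_n) Q (y : Borel X) : 'rV[R]_n := \1_(dil Q) y *: f y.

(** [4 ^+ n] pays for combining n unit test functions, [2 * 8 ^+ n] for the frame, and the rest is
    the scalar bound at [e0 / n.+1], so that the exceptional sets of all coordinates together stay
    below [e0]. *)
Definition stepc (n : nat) : R := 4 ^+ n * (2 * 8 ^+ n * (A1 / (e0 / n.+1%:R) ^+ 2)).

(** In frame coordinates [T f] on [Q] is a combination of the frame vectors plus, on each stopping
    cube P, [T] of f cut to [dil P]. Every frame vector is an average of f against a unit test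
    function, so the combination is one average whose kernel depends on x through the
    coefficients. *)
Lemma vector_step n (f : Borel X -> 'rV[R]_n) Q :
  (forall j, bsL mu d r (fun y => f y 0 j)) -> D Q ->
  exists (Ch : set (cube X)) (k : Borel X -> Borel X -> R),
  [/\ forall P, Ch P -> [/\ D P, carrier P `<=` carrier Q & generation Q < generation P],
      disjoint_family Ch, (mu (famU Ch carrier) <= (1 / 2)%:E * mu (carrier Q))%E,
      measurable_fun setT (fun z : Borel X * Borel X => k z.1 z.2) &
      (forall x, unit_test mu r (dil Q) (k x)) /\
      {ae mu, forall x, carrier Q x -> vapply T (cut_dil f Q) x =
         stepc n *: avg mu (dil Q) (fun y => k x y *: f y) +
         \row_j piecewise Ch (fun P x => vapply T (cut_dil f P) x 0 j) x}].
Proof.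
move=> bf DQ; set B := dil Q.
have mB : measurable B by exact: (dil_measurable hX).
have B0 : (0 < mu B)%E by exact: (dil_gt0 hX hc0 hdelta halpha).
have Bf : (mu B < +oo)%E by exact: (dil_fin hX).
have mf j : measurable_fun setT (fun x => f x 0 j) by case: (bf j).
have if_ j : mu.-integrable B (fun x => (f x 0 j)%:E).
  by apply: integrableS (bsL_integrable hX r1 (bf j)).
have [k [U [V [kn fUV fr]]]] := body_frame hr mB B0 Bf mf if_.
pose c : R := 2 * 8 ^+ k; have cp : 0 < c by rewrite mulr_gt0// exprn_gt0.
pose h i y := \1_B y * (f y *m U) 0 i.
have bh i : bsL mu d r (h i).
  apply: (bsL_restr hX r1) => //.
  under eq_fun do rewrite mxE; under eq_fun do under eq_bigr do rewrite mulrC.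
  exact: bsL_sum.
have hs i x : ~ B x -> h i x = 0 by move=> nx; rewrite /h indicE memNset ?mul0r.
have hon i y : B y -> h i y = (f y *m U) 0 i by move=> By; rewrite /h indicE mem_set ?mul1r.
pose e := e0 / n.+1%:R.
have /andP[e00 e01] := he0.
have ep : 0 < e by rewrite divr_gt0.
have e1 : e <= 1 by rewrite ler_pdivrMr// mul1r (le_trans e01)// ler1n.
have he : 0 < e <= 1 by rewrite ep.
pose A2 := c * (A1 / e ^+ 2).
have A10 : 0 < A1 := lt_le_trans ltr01 A11.
have A2c : A2 <= 2 * 8 ^+ n * (A1 / e ^+ 2).
  rewrite ler_pM2r; last exact: (divr_gt0 A10 (exprn_gt0 2 ep)).
  by rewrite ler_pM2l// ler_weXn2l//; lra.
have A21 : 1 <= A2.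
  have h1 : 1 <= A1 / e ^+ 2.
    rewrite ler_pdivlMr ?exprn_gt0// mul1r; apply: le_trans A11.
    by rewrite exprn_ile1// ltW.
  have h2 : 1 <= c.
    by have : 1 <= 8 ^+ k :> R; [rewrite exprn_ege1//; lra|rewrite /c; lra].
  by rewrite -[leLHS]mulr1; apply: ler_pM.
pose free i := forall t : R, body mu r B f (t *: row i V).
have /choice[Om hOm] : forall i : 'I_k, exists Om : set (Borel X),
    [/\ measurable Om, (mu Om <= e%:E * mu (carrier Q))%E &
     free i \/ (body mu r B f (row i V) /\
       {ae mu, forall x, carrier Q x -> ~ Om x -> `|T (h i) x| <= A2} /\
       forall P, D P -> carrier P `<=` carrier Q ->
        (mu (carrier P `&` Om) <= (1 / 2)%:E * mu (carrier P))%E ->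
        {ae mu, forall x, carrier P x -> `|T (fun y => \1_(~` dil P) y * h i y) x| <= A2})].
  move=> i; have [fi|[bi hi]] := fr i.
    exists set0; split => //; last by left.
    by rewrite measure0 mule_ge0// lee_fin ltW.
  have hi' : (\int[mu]_(x in dil Q) (`|h i x| `^ p)%:E <= (c `^ p)%:E * mu (dil Q))%E.
    apply: le_trans hi; apply: ge0_le_integral' => //.
    - by apply: measurable_funTS; apply: measurable_normpow; case: (bh i).
    - by apply: measurable_funTS; apply: measurable_normpow; exact: (coord_measurable mf).
    - by move=> x Bx; rewrite hon.
  have [W [mW W1 W2 W3]] := coord_step he cp DQ (bh i) (hs i) hi'.
  by exists W; split => //; right.
have Qm0 : (0 <= e%:E * mu (carrier Q))%E by rewrite mule_ge0// lee_fin ltW.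
have [|G [mG hG OG]] := finite_union_measure (mu := mu) (m := (e%:E * mu (carrier Q))%E) (F := Om) _ Qm0.
  by move=> i; have [? ? _] := hOm i.
have hG' : (mu G <= e0%:E * mu (carrier Q))%E.
  apply: le_trans hG _; rewrite muleA -EFinM; apply: lee_wpmul2r => //.
  rewrite lee_fin /e mulrCA ler_piMr ?(ltW e00)// ler_pdivrMr// mul1r ler_nat.
  exact: leqW.
have [Ch [hCh cC dC hU hae]] := stop DQ mG hG'.
have mC P : Ch P -> measurable (carrier P) by move=> /hCh[DP _ _ _ _]; exact: (cube_measurable hD).
pose UC := famU Ch carrier.
have mUC : measurable UC by exact: famU_measurable.
have mdil P : measurable (dil P) by exact: (dil_measurable hX).
pose hP i P y := \1_(~` dil P) y * h i y.
have bhP i P : bsL mu d r (hP i P) by apply: (bsL_restr hX r1) => //; exact: measurableC.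
pose t i x := piecewise Ch (fun P => T (hP i P)) x + \1_(~` UC) x * T (h i) x.
have mt i : measurable_fun setT (t i).
  apply: measurable_funD.
    by apply: piecewise_measurable => // P _; exact: (hT.1 _ (bhP i P)).
  apply: measurable_funM; last exact: (hT.1 _ (bh i)).
  by apply: measurable_indic; exact: measurableC.
have tin i P x : Ch P -> carrier P x -> t i x = T (hP i P) x.
  move=> CP Px; rewrite /t (piecewiseE _ dC CP Px) indicE memNset ?mul0r ?addr0//.
  by apply; exists P.
have tout i x : ~ UC x -> t i x = T (h i) x.
  by move=> nU; rewrite /t piecewise0// indicE mem_set// mul1r add0r.
(* In a free direction the coefficient has no bound. The test function used at x has average [j.+1]
   times the frame vector, with j the integer part of the coefficient; countably many functions
   suffice and the quotient [u] stays bounded. *)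
pose N i x := Num.truncn `|t i x|.
have /choice[Phm hPhm] : forall i : 'I_k, exists Phm : (nat -> Borel X -> R) * (nat -> R),
    [/\ forall j, unit_test mu r B (Phm.1 j),
        forall j, avg mu B (fun y => Phm.1 j y *: f y) = Phm.2 j *: row i V,
        forall j, 0 < Phm.2 j &
        {ae mu, forall x, carrier Q x -> `|t i x| <= A2 * Phm.2 (N i x)}].
  move=> i; have [mO _ [fi|[[phi u phiE] [h1 h2]]]] := hOm i.
    have /choice[Ph hPh] : forall j : nat, exists phi, unit_test mu r B phi /\
        j.+1%:R *: row i V = avg mu B (fun y => phi y *: f y).
      by move=> j; have [phi u e'] := fi j.+1%:R; exists phi.
    exists (Ph, fun j => j.+1%:R); split => /=.
    - by move=> j; case: (hPh j).
    - by move=> j; case: (hPh j).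
    - by move=> j; rewrite ltr0n.
    - apply: ae_all => x _; apply: le_trans (ltW (truncnS_gt _)) _.
      by rewrite ler_peMl.
  exists (fun=> phi, fun=> 1); split => //=; first by move=> j; rewrite scale1r phiE.
  have hCP P : Ch P -> {ae mu, forall x, carrier P x -> `|T (hP i P) x| <= A2}.
    move=> CP; have [DP PQ _ _ PG] := hCh P CP; apply: h2 => //.
    apply: le_trans PG; apply: le_measure; rewrite ?inE; try by apply: measurableI => //; exact: mC.
    by move=> x [Px Ox]; split => //; exact: (OG i).
  apply: ae_mono (ae_and (ae_countable cC hCP) (ae_and h1 hae)) => x [hC [hx hxU]] Qx.
  rewrite mulr1; have [[P CP Px]|nU] := pselect (UC x).
    by rewrite (tin i P x CP Px); exact: hC.
  rewrite tout//; apply: hx => // Ox; apply: nU; apply: hxU => //; exact: (OG i).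
pose Ph i := (Phm i).1; pose mm i := (Phm i).2.
pose u i x := t i x / mm i (N i x).
have mN i j : measurable [set x | N i x = j] by exact: measurable_truncn.
have mu_ i : measurable_fun setT (u i).
  apply: measurable_funM => //.
  by apply: (measurable_switch (F := fun j _ => (mm i j)^-1) (mN i)) => j.
(* The cut makes the bound [A2] hold at every x, as [unit_test] is required of [kk x] everywhere. On
   almost all of [Q] it changes nothing. *)
pose ci i x := \1_(~` level setT (u i) A2) x * u i x.
have mci i : measurable_fun setT (ci i).
  apply: measurable_funM => //; apply: measurable_indic; apply: measurableC.
  exact: level_measurable.
have cile i x : `|ci i x| <= A2.
  rewrite /ci indicE; have [hx|_] := boolP (x \in _); last by rewrite mul0r normr0; lra.
  rewrite mul1r leNgt; apply/negP => hl; rewrite inE in hx; apply: hx; split => //.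
pose cn := stepc n.
have cnE : cn = 4 ^+ n * (2 * 8 ^+ n * (A1 / e ^+ 2)) by [].
have cn0 : 0 < cn.
  rewrite cnE !mulr_gt0 ?exprn_gt0 ?invr_gt0 ?exprn_gt0//; lra.
pose kk x y := \sum_i (ci i x / cn) * Ph i (N i x) y.
have coefle i x : `|ci i x / cn| <= 4^-1 ^+ k.
  rewrite normrM [`|cn^-1|]gtr0_norm ?invr_gt0// ler_pdivrMr//.
  apply: le_trans (cile i x) _; apply: le_trans A2c _.
  rewrite cnE [leRHS]mulrA -[leLHS]mul1r ler_pM2r.
    rewrite exprVn mulrC ler_pdivlMr ?exprn_gt0// mul1r ler_weXn2l//; lra.
  by rewrite !mulr_gt0 ?exprn_gt0 ?invr_gt0 ?exprn_gt0//; lra.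
have uP i j : unit_test mu r B (Ph i j) by have [hu _ _ _] := hPhm i; exact: hu.
exists Ch, kk; split => //.
- by move=> P /hCh[].
- apply: measurable_sum => i; apply: measurable_funM.
    by apply: measurable_funM => //; apply: (measurable_comp_fst (g := ci i)).
  apply: (measurable_switch (T := (Borel X * Borel X)%type) (N := fun z => N i z.1) (F := fun j z => Ph i j z.2)).
    move=> j; rewrite (_ : [set z | _] = [set x | N i x = j] `*` setT).
      by apply: measurableX => //; exact: mN.
    by apply/seteqP; split => [z|z []].
  by move=> j; apply: measurable_comp_snd; case: (uP i j).
split; first by move=> x; apply: (unit_combination hr mB Bf) => // i; exact: uP.
pose F j y := \1_B y * f y 0 j.
have bF j : bsL mu d r (F j) by exact: (bsL_restr hX r1).
have Fae j : {ae mu, forall y, F j y = \sum_i V i j * h i y}.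
  apply: ae_mono fUV => y hy; have [By|nB] := pselect (B y).
    rewrite /F indicE mem_set// mul1r (hy By) mxE; apply: eq_bigr => i _.
    by rewrite hon// mulrC.
  rewrite /F indicE memNset// mul0r big1// => i _; by rewrite hs// mulr0.
have TF j : {ae mu, forall x, T (F j) x = \sum_i V i j * T (h i) x}.
  apply: ae_mono (ae_and (T_ae_eq (bF j) (bsL_sum (fun i => V i j) bh) (Fae j)) (T_sum (fun i => V i j) bh)) => x [-> ->].
  by [].
have TP j P : Ch P -> {ae mu, forall x, T (F j) x =
    \sum_i V i j * T (hP i P) x + T (fun y => \1_(dil P) y * f y 0 j) x}.
  move=> CP; have [_ _ _ PB _] := hCh P CP.
  have b2 : bsL mu d r (fun y => \1_(dil P) y * f y 0 j) by exact: (bsL_restr hX r1).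
  have b1 := bsL_sum (fun i => V i j) (fun i => bhP i P).
  have b3 := bsL_lin hX 1 r1 b1 b2.
  have eqF : {ae mu, forall y, F j y = 1 * (\sum_i V i j * hP i P y) + \1_(dil P) y * f y 0 j}.
    apply: ae_mono (Fae j) => y Fy; rewrite mul1r.
    have [Py|nP] := pselect (dil P y).
      rewrite big1 ?add0r => [|i _]; last by rewrite /hP indicE memNset ?mul0r ?mulr0//; apply.
      by rewrite /F !indicE !mem_set//; exact: PB.
    rewrite [X in _ + X](_ : _ = 0) ?addr0; last by rewrite indicE memNset// mul0r.
    by rewrite Fy; apply: eq_bigr => i _; rewrite /hP indicE mem_set// mul1r.
  apply: ae_mono (ae_and (T_ae_eq (bF j) b3 eqF) (ae_and (hT.2 1 _ _ b1 b2) (T_sum (fun i => V i j) (fun i => bhP i P)))) => x [-> [-> ->]].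
  by rewrite mul1r.
have cutE P j : (fun y => cut_dil f P y 0 j) = (fun y => \1_(dil P) y * f y 0 j).
  by apply/funext => y; rewrite mxE.
have hae2 : {ae mu, forall x, forall i, carrier Q x -> `|t i x| <= A2 * mm i (N i x)}.
  by apply: ae_finite => i; case: (hPhm i).
have hTF := ae_finite TF.
have hTP := ae_countable cC (fun P CP => ae_finite (fun j => TP j P CP)).
apply: ae_mono (ae_and hae2 (ae_and hTF hTP)) => x [ht [hx1 hx2]] Qx.
have -> : avg mu B (fun y => kk x y *: f y) = cn^-1 *: \sum_i t i x *: row i V.
  rewrite (avg_combination mB mf if_ (fun i => ci i x / cn) (fun i => uP i (N i x))).
  rewrite scaler_sumr; apply: eq_bigr => i _.
  have [_ aE mm0 _] := hPhm i; rewrite aE !scalerA; congr (_ *: _).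
  have nl : (~` level setT (u i) A2) x.
    move=> [_ /=]; apply/negP; rewrite -leNgt /u normrM normfV [`|mm i _|]gtr0_norm ?mm0//.
    by rewrite ler_pdivrMr ?mm0//; exact: ht.
  have m0 : mm i (N i x) != 0 by rewrite gt_eqF//; exact: mm0.
  have n0 : cn != 0 by rewrite gt_eqF.
  rewrite /ci indicE mem_set// mul1r /u [(Phm i).2 _](_ : _ = mm i (N i x))//.
  by field; rewrite m0 n0.
rewrite -/cn scalerA mulfV ?gt_eqF// scale1r; apply/rowP => j.
rewrite !mxE cutE -/(F j) summxE.
have [[P CP Px]|nU] := pselect (UC x).
  rewrite (piecewiseE _ dC CP Px) mxE cutE (hx2 P CP j).
  by congr (_ + _); apply: eq_bigr => i _; rewrite !mxE (tin i P x CP Px) mulrC.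
rewrite piecewise0// addr0 hx1; apply: eq_bigr => i _.
by rewrite !mxE tout// mulrC.
Qed.

End VectorStep.

(** * Sparse families *)

Section Layers.
Context {R : realType} {X : ptopologicalType}.
Variables (mu : {measure set (Borel X) -> \bar R}) (d : X -> X -> R).
Variables (cd cmu : R) (hX : homogeneous_type mu d cd cmu).
Variables (c0 C0 delta : R) (hc0 : 0 < c0 <= C0) (hdelta : 0 < delta < 1).
Variables (D : set (cube X)) (hD : dyadic_system d c0 C0 delta D).
Variable (Ch : cube X -> set (cube X)).
Hypothesis hCh : forall Q P, D Q -> Ch Q P ->
  [/\ D P, carrier P `<=` carrier Q & generation Q < generation P].
Hypothesis dCh : forall Q, D Q -> disjoint_family (Ch Q).
Hypothesis muCh : forall Q, D Q ->
  (mu (famU (Ch Q) carrier) <= (1 / 2)%:E * mu (carrier Q))%E.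

Fixpoint layer (S0 : set (cube X)) (i : nat) : set (cube X) :=
  if i is j.+1 then [set P | exists2 Q, layer S0 j Q & Ch Q P] else S0.

Section FromTops.
Variable S0 : set (cube X).
Hypotheses (S0D : S0 `<=` D) (dS0 : disjoint_family S0).

Lemma layer_D i : layer S0 i `<=` D.
Proof.
elim: i => [|i IH] P /=; first exact: S0D.
by move=> [Q /IH DQ /(hCh DQ)[]].
Qed.

Lemma layer_uniq i P Q x : layer S0 i P -> layer S0 i Q -> carrier P x -> carrier Q x -> P = Q.
Proof.
elim: i P Q => [|i IH] P Q /=.
  move=> SP SQ Px Qx; apply: contrapT => ne; have := dS0 SP SQ ne.
  by rewrite -subset0 => /(_ x); apply.
move=> [P' LP' CP] [Q' LQ' CQ] Px Qx.
have DP' := layer_D LP'; have DQ' := layer_D LQ'.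
have [_ PP' _] := hCh DP' CP; have [_ QQ' _] := hCh DQ' CQ.
have e := IH P' Q' LP' LQ' (PP' _ Px) (QQ' _ Qx); subst Q'.
apply: contrapT => ne; have := dCh DP' CP CQ ne.
by rewrite -subset0 => /(_ x); apply.
Qed.

Lemma layer_descent i j Q x : layer S0 (j + i.+1) Q -> carrier Q x ->
  exists P P', [/\ layer S0 i P, carrier P x, Ch P P' & carrier P' x].
Proof.
elim: j Q => [|j IH] Q /=.
  move=> [P LP CP] Qx; exists P, Q; split => //.
  by have [_ PQ _] := hCh (layer_D LP) CP; exact: PQ.
move=> [P LP CP] Qx; apply: (IH P) => //.
by have [_ PQ _] := hCh (layer_D LP) CP; exact: PQ.
Qed.

Lemma layer_countable i : countable (layer S0 i).
Proof. exact: sub_countable (subset_card_le (@layer_D i)) (countable_D hX hc0 hdelta hD). Qed.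

Lemma layer_disjoint i : disjoint_family (layer S0 i).
Proof.
move=> P Q LP LQ ne; rewrite -subset0 => x [Px Qx]; apply: ne.
exact: (layer_uniq LP LQ Px Qx).
Qed.

Lemma layer_measurable i P : layer S0 i P -> measurable (carrier P).
Proof. by move=> /layer_D; exact: (cube_measurable hD). Qed.

Lemma layer_measure i : (mu (famU (layer S0 i.+1) carrier) <=
  (1 / 2)%:E * mu (famU (layer S0 i) carrier))%E.
Proof.
have -> : famU (layer S0 i.+1) carrier = famU (layer S0 i) (fun Q => famU (Ch Q) carrier).
  apply/seteqP; split => x.
    by move=> [P [Q LQ CP] Px]; exists Q => //; exists P.
  by move=> [Q LQ [P CP Px]]; exists P => //; exists Q.
apply: fam_le_measure => //.
- exact: layer_countable.
- exact: layer_measurable.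
- exact: layer_disjoint.
- move=> Q LQ; apply: famU_measurable.
    apply: sub_countable (countable_D hX hc0 hdelta hD); apply: subset_card_le.
    by move=> P /(hCh (layer_D LQ))[].
  by move=> P /(hCh (layer_D LQ))[DP _ _]; exact: (cube_measurable hD).
- by move=> Q LQ; apply: muCh; exact: layer_D LQ.
Qed.

Definition all_layers : set (cube X) := \bigcup_i layer S0 i.

Lemma all_layers_D : all_layers `<=` D.
Proof. by move=> P [i _]; exact: layer_D. Qed.

(** The sparse part of a cube is what its children leave, at least half. If two selected cubes of
    different layers meet at a point, the deeper one lies in a child of the other, so these parts
    are disjoint. *)
Lemma all_layers_sparse : eta_sparse mu (1 / 2) all_layers.
Proof.
exists (fun Q => carrier Q `\` famU (Ch Q) carrier); split.
  move=> Q SQ; have DQ := all_layers_D SQ; have mQ := cube_measurable hD DQ.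
  have Qf := cube_mu_fin_num hX hD DQ.
  have mU : measurable (famU (Ch Q) carrier).
    apply: famU_measurable; last by move=> P /(hCh DQ)[DP _ _]; exact: (cube_measurable hD).
    apply: sub_countable (countable_D hX hc0 hdelta hD); apply: subset_card_le.
    by move=> P /(hCh DQ)[].
  split; [exact: measurableD|by move=> x []|].
  have UQ : famU (Ch Q) carrier `<=` carrier Q.
    by move=> x [P /(hCh DQ)[_ PQ _] Px]; exact: PQ.
  have Uf : mu (famU (Ch Q) carrier) \is a fin_num.
    rewrite ge0_fin_numE//; apply: le_lt_trans (muCh DQ) _.
    by rewrite -(fineK Qf) -EFinM ltry.
  have f1 : mu (carrier Q `\` famU (Ch Q) carrier) \is a fin_num.
    rewrite ge0_fin_numE//; apply: (@le_lt_trans _ _ (mu (carrier Q))).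
      by apply: le_measure; rewrite ?inE//; exact: measurableD.
    by rewrite -ge0_fin_numE.
  have hs : mu (carrier Q) = (mu (carrier Q `\` famU (Ch Q) carrier) + mu (famU (Ch Q) carrier))%E.
    rewrite [in LHS](measureDI mu mQ mU); congr (_ + mu _)%E.
    by apply/seteqP; split => [x []//|x Ux]; split => //; exact: UQ.
  have := congr1 fine hs; rewrite fineD// => hs'.
  have h2 : fine (mu (famU (Ch Q) carrier)) <= 1 / 2 * fine (mu (carrier Q)).
    by rewrite -lee_fin EFinM !fineK//; exact: muCh.
  by rewrite -(fineK Qf) -(fineK f1) -EFinM lee_fin; lra.
move=> P Q [i _ LP] [j _ LQ] ne; rewrite -subset0 => x [[Px nPx] [Qx nQx]].
have aux a b A B : (a < b)%N -> layer S0 a A -> layer S0 b B -> carrier A x -> carrier B x ->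
    famU (Ch A) carrier x.
  move=> ab LA LB Ax Bx.
  have LB' : layer S0 ((b - a.+1) + a.+1) B by rewrite subnK.
  have [P' [P'' [LP' P'x CP'' P''x]]] := layer_descent LB' Bx.
  by exists P'' => //; rewrite (layer_uniq LA LP' Ax P'x).
have [ij|ji|ij] := ltngtP i j.
- by apply: nPx; exact: (aux i j P Q).
- by apply: nQx; exact: (aux j i Q P).
- by apply: ne; subst j; exact: (layer_uniq LP LQ Px Qx).
Qed.

Section Identity.
Variables (n : nat) (TQ G : cube X -> Borel X -> 'rV[R]_n) (x : X).
Hypothesis hTQ : forall Q, D Q -> carrier Q x ->
  TQ Q x = G Q x + \row_j piecewise (Ch Q) (fun P x => TQ P x 0 j) x.

(** At x the cubes from layer i on form a finite chain, one per layer, until the layers cease to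
    contain x. The identity telescopes along it, and strictly increasing generations keep the list
    free of duplicates. *)
Lemma chain_identity m i Q : layer S0 i Q -> carrier Q x ->
  ~ famU (layer S0 (m + i)) carrier x ->
  exists s : seq (cube X), [/\ uniq s,
    forall P, P \in s -> [/\ all_layers P, carrier P x & generation Q <= generation P],
    forall P j, (i <= j)%N -> layer S0 j P -> carrier P x -> P \in s &
    TQ Q x = \sum_(P <- s) G P x].
Proof.
elim: m i Q => [|m IH] i Q LQ Qx nU; first by case: nU; exists Q.
have DQ := layer_D LQ.
have [[P CP Px]|noU] := pselect (famU (Ch Q) carrier x); last first.
  exists [:: Q]; split => //.
  - by move=> P; rewrite inE => /eqP ->; split => //; exists i.
  - move=> P j; rewrite leq_eqVlt => /predU1P[<-|ij] LP Px.
      by rewrite inE (layer_uniq LP LQ Px Qx).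
    have LP' : layer S0 ((j - i.+1) + i.+1) P by rewrite subnK.
    have [A [A' [LA Ax CA A'x]]] := layer_descent LP' Px.
    by case: noU; exists A' => //; rewrite (layer_uniq LQ LA Qx Ax).
  - rewrite big_seq1 (hTQ DQ Qx) [X in _ + X](_ : _ = 0) ?addr0//.
    by apply/rowP => j; rewrite !mxE piecewise0.
have LP : layer S0 i.+1 P by exists Q.
have [s [us ss cov TP]] := IH i.+1 P LP Px ltac:(by rewrite addnS -addSn).
have [DP PQ gQP] := hCh DQ CP.
exists (Q :: s); split.
- rewrite /= us andbT; apply/negP => /ss[_ _].
  by rewrite leNgt gQP.
- move=> A; rewrite inE => /predU1P[->|/ss[? ? gA]]; first by split => //; exists i.
  by split => //; apply: le_trans gA; exact: ltW.
- move=> A j; rewrite leq_eqVlt => /predU1P[<-|ij] LA Ax.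
    by rewrite inE (layer_uniq LA LQ Ax Qx) eqxx.
  by rewrite inE (cov A j ij LA Ax) orbT.
- rewrite big_cons -TP (hTQ DQ Qx); congr (_ + _); apply/rowP => j.
  by rewrite mxE (piecewiseE _ (dCh DQ) CP Px).
Qed.

End Identity.
End FromTops.

Lemma layer_split (S0 : set (cube X)) i P : layer S0 i P ->
  exists2 Q, S0 Q & layer [set Q] i P.
Proof.
elim: i P => [|i IH] P /=; first by move=> SP; exists P.
by move=> [Q /IH[A SA LA] CP]; exists A => //; exists Q.
Qed.

Lemma layer_sub Q i P : D Q -> layer [set Q] i P -> carrier P `<=` carrier Q.
Proof.
move=> DQ; elim: i P => [|i IH] P /=; first by move=> ->.
have sD : [set Q] `<=` D by move=> _ ->.
move=> [A LA CP]; have [_ PA _] := hCh (layer_D sD LA) CP.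
exact: subset_trans PA (IH A LA).
Qed.

(** The measures of the layers below [Q] decrease geometrically, so at almost every point the sum is
    finite and raises no question of convergence. *)
Lemma layer_vanish Q : D Q -> {ae mu, forall x, exists i, ~ famU (layer [set Q] i) carrier x}.
Proof.
move=> DQ; have sD : [set Q] `<=` D by move=> _ ->.
have dS : disjoint_family [set Q] by move=> A B -> -> [].
have Qf := cube_mu_fin_num hX hD DQ.
pose U i := famU (layer [set Q] i) carrier.
have mU i : measurable (U i).
  by apply: famU_measurable; [exact: layer_countable|move=> P; exact: layer_measurable].
have hU i : (mu (U i) <= ((1 / 2) ^+ i)%:E * mu (carrier Q))%E.
  elim: i => [|i IH].
    by rewrite expr0 mul1e /U /famU /= bigcup_set1.
  apply: le_trans (layer_measure sD dS i) _; rewrite exprS [X in (_ <= X * _)%E]EFinM -muleA.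
  by apply: lee_wpmul2l => //; rewrite lee_fin; lra.
apply: (ae_notin (A := \bigcap_i U i)).
- by apply: bigcap_measurable => //; exists 0%N.
- apply/eqP; rewrite eq_le measure_ge0 andbT leNgt; apply/negP => h0.
  have Cf : mu (\bigcap_i U i) \is a fin_num.
    rewrite ge0_fin_numE//; apply: le_lt_trans (_ : mu (U 0%N) < +oo)%E.
      apply: le_measure; rewrite ?inE//; last by move=> x; exact.
      by apply: bigcap_measurable => //; exists 0%N.
    by apply: le_lt_trans (hU 0%N) _; rewrite -(fineK Qf) -EFinM ltry.
  have c0' : 0 < fine (mu (\bigcap_i U i)) by rewrite -lte_fin fineK.
  have q0 : 0 < fine (mu (carrier Q)) by rewrite -lte_fin fineK// (cube_mu_gt0 hX hc0 hdelta hD DQ).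
  have half1 : 0 < (1 / 2 : R) < 1 by apply/andP; split; lra.
  have [m hm] := dpow_small half1 (divr_gt0 c0' q0).
  have : (mu (\bigcap_i U i) <= ((1 / 2) ^+ m)%:E * mu (carrier Q))%E.
    apply: le_trans (hU m); apply: le_measure; rewrite ?inE//; last by move=> x; exact.
    by apply: bigcap_measurable => //; exists 0%N.
  rewrite -(fineK Cf) -(fineK Qf) -EFinM lee_fin leNgt => /negP; apply.
  by rewrite -ltr_pdivlMr.
- move=> x nx; apply: contrapT => h; apply: nx => i _; apply: contrapT => nU.
  by apply: h; exists i.
Qed.

Lemma sparse_identity (S0 : set (cube X)) n (TQ G : cube X -> Borel X -> 'rV[R]_n) :
  S0 `<=` D -> disjoint_family S0 -> (forall x, exists2 Q, S0 Q & carrier Q x) ->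
  (forall Q, D Q -> {ae mu, forall x, carrier Q x ->
    TQ Q x = G Q x + \row_j piecewise (Ch Q) (fun P x => TQ P x 0 j) x}) ->
  {ae mu, forall x, exists s : seq (cube X), [/\ uniq s,
    forall P, P \in s <-> (all_layers S0 P /\ carrier P x) &
    exists Q, [/\ S0 Q, carrier Q x & TQ Q x = \sum_(P <- s) G P x]]}.
Proof.
move=> SD dS cov hTQ; have cD := countable_D hX hc0 hdelta hD.
apply: ae_mono (ae_and (ae_countable cD hTQ) (ae_countable cD (fun Q DQ => layer_vanish DQ))) => x [h1 h2].
have [Q SQ Qx] := cov x; have [i hi] := h2 Q (SD _ SQ).
have nU : ~ famU (layer S0 (i + 0)) carrier x.
  rewrite addn0 => -[P LP Px]; have [A SA LA] := layer_split LP.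
  have Ax := layer_sub (SD _ SA) LA Px.
  have e : A = Q.
    apply: contrapT => ne; have := dS _ _ SA SQ ne.
    by rewrite -subset0 => /(_ x); apply.
  by apply: hi; exists P => //; rewrite -e.
have [s [us ss cv eT]] := chain_identity SD dS h1 (i := 0%N) SQ Qx nU.
exists s; split => //; last by exists Q.
by move=> P; split => [/ss[]//|[[j _ LP] Px]]; exact: (cv P j).
Qed.

(** With radius [2 * cd * C0] every coarse enough ancestor of a given point is good, whatever the
    position of the point relative to [B]. *)
Definition top_bad (B : set X) (Q : cube X) : Prop :=
  ~ (B `<=` qball d (cube_center Q) (2 * cd * C0 * delta ^ generation Q)).

(* Cubes of generation at most 0, maximal among the bad ones; a top cube need not contain [B],
   but its parent is good, whence the inclusion of [B] in the dilated cube. *)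
Definition top_cubes (B : set X) : set (cube X) :=
  [set Q | [/\ D Q, generation Q <= 0, top_bad B Q \/ generation Q = 0 &
    forall P, D P -> generation P < generation Q -> carrier Q `<=` carrier P -> ~ top_bad B P]].

Lemma top_disjoint B : disjoint_family (top_cubes B).
Proof.
have aux P Q x : top_cubes B P -> top_cubes B Q -> carrier P x -> carrier Q x ->
    generation P < generation Q -> False.
  move=> [DP _ bP _] [DQ gQ _ mQ] Px Qx lt.
  have PQ := cube_nested hD DQ DP (ltW lt) Qx Px.
  case: bP; first exact: (mQ P).
  by move=> g0; move: lt; rewrite g0 ltNge gQ.
move=> P Q tP tQ ne; rewrite -subset0 => x [Px Qx].
have [lt|lt|eq] := ltgtP (generation P) (generation Q).
- exact: (aux P Q x).
- exact: (aux Q P x).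
- by apply: ne; case: tP tQ => [DP _ _ _] [DQ _ _ _]; exact: (cube_eq hD DP DQ eq Px Qx).
Qed.

(** All ancestors of x of generation at most [K] are good. The first bad generation after [K], or
    generation 0 if none comes before it, gives the top cube. *)
Lemma top_cover z rho : 0 < rho -> forall x, exists2 Q, top_cubes (qball d z rho) Q & carrier Q x.
Proof.
move=> r0 x; have cd0 := cd_gt0 hX; have C00 := C0_gt0 hc0.
pose M := cd * (d x z + rho).
have [K [K0 hK]] := dpow_large_to hdelta 0 (M / C0).
have good k : k <= K -> ~ top_bad (qball d z rho) (cub hD k x).
  move=> kK; apply => y zy; rewrite gen_cub /qball/=.
  apply: le_lt_trans (qd_tri hX x _ _) _.
  have h1 := cube_outer hD (cub_D hD k x) (cub_in hD k x); rewrite gen_cub in h1.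
  have h2 : d x y < C0 * delta ^ k.
    apply: (@lt_le_trans _ _ (C0 * delta ^ K)); last first.
      by rewrite ler_pM2l//; exact: (dpow_le hdelta).
    apply: le_lt_trans (_ : M < _); last by rewrite mulrC -ltr_pdivrMr.
    apply: le_trans (qd_tri hX z _ _) _; rewrite ler_pM2l// lerD2l.
    exact: ltW.
  have -> : 2 * cd * C0 * delta ^ k = cd * (C0 * delta ^ k + C0 * delta ^ k) by ring.
  by rewrite ltr_pM2l//; exact: ltrD.
pose Pr (k : int) := top_bad (qball d z rho) (cub hD k x) \/ k = 0.
have ex : exists m : nat, `[< Pr (K + m%:Z) >].
  by exists `|K|%N; apply/asboolP; right; rewrite lez0_abs// subrr.
case: (ex_minnP ex) => m /asboolP Pm mmin.
have mle : K + m%:Z <= 0.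
  have := mmin `|K|%N; rewrite lez0_abs// => h.
  have {}h : (m <= `|K|)%N by apply: h; apply/asboolP; right; rewrite subrr.
  rewrite -lerBrDl sub0r -lez0_abs//.
exists (cub hD (K + m%:Z) x); last exact: cub_in.
split; [exact: cub_D|by rewrite gen_cub|by rewrite gen_cub|].
move=> P DP; rewrite gen_cub => gP sub bP.
have PE : P = cub hD (generation P) x by apply: (cub_uniq hD DP); apply: sub; exact: cub_in.
have [gK|gK] := leP (generation P) K; first by apply: (good _ gK); rewrite -PE.
have gE : generation P = K + `|generation P - K|%:Z.
  by rewrite gez0_abs ?subr_ge0 ?(ltW gK)// addrCA subrr addr0.
have : (m <= `|generation P - K|)%N.
  by apply: mmin; apply/asboolP; left; rewrite -gE -PE.
by move=> hm; move: gP; rewrite {1}gE ltrD2l ltz_nat ltnNge hm.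
Qed.

(** The parent of a top cube is good, and centering its ball at the top cube multiplies the radius
    by at most [cd * (1 + 2 * cd) / delta] in units of [C0], which is below
    [3 * cd ^+ 2 / delta]. *)
Lemma top_dilate (alpha : R) z rho Q : 3 * cd ^+ 2 / delta <= alpha ->
  top_cubes (qball d z rho) Q -> qball d z rho `<=` dilate d C0 delta alpha Q.
Proof.
move=> ha [DQ gQ _ mQ]; have cd0 := cd_gt0 hX; have C00 := C0_gt0 hc0.
have cd1 : 1 <= cd := cd_ge1 hX.
have d0 : 0 < delta by case/andP: hdelta.
pose g := generation Q; pose x := cube_center Q.
have Qx : carrier Q x := center_in hX hc0 hdelta hD DQ.
pose Q' := cub hD (g - 1) x; have DQ' : D Q' := cub_D hD _ _.
have sub : carrier Q `<=` carrier Q'.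
  by apply: (cube_nested hD DQ DQ' _ Qx (cub_in hD _ _)); rewrite gen_cub gerBl.
have /contrapT good : ~ top_bad (qball d z rho) Q'.
  by apply: mQ => //; rewrite gen_cub gtrBl.
move=> y /good; rewrite /qball /dilate /= gen_cub -/g => h1.
have h2 := cube_outer hD DQ' (sub _ Qx); rewrite gen_cub in h2.
apply: le_lt_trans (qd_tri hX (cube_center Q') _ _) _.
apply: (@lt_le_trans _ _ (cd * (C0 * delta ^ (g - 1) + 2 * cd * C0 * delta ^ (g - 1)))).
  by rewrite ltr_pM2l//; apply: ltrD => //; rewrite (qd_sym hX).
have -> : delta ^ (g - 1) = delta ^ g / delta by rewrite (dpowD hdelta) exprN1.
have p0 : 0 < C0 * delta ^ g by rewrite mulr_gt0// (dpow_gt0 hdelta).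
have -> : cd * (C0 * (delta ^ g / delta) + 2 * cd * C0 * (delta ^ g / delta)) =
  (cd * (1 + 2 * cd) / delta) * (C0 * delta ^ g) by field; rewrite gt_eqF.
rewrite -[leRHS]mulrA ler_pM2r//; apply: le_trans ha; rewrite ler_pM2r ?invr_gt0//.
by rewrite expr2 mulrA [3 * cd]mulrC -mulrA ler_pM2l//; lra.
Qed.

End Layers.

Section FiniteSums.
Context {R : realType} {I : choiceType} {n : nat}.
Implicit Types (S : set I) (w : I -> 'rV[R]_n).

Lemma esum_finite (S : set I) (s : seq I) (a : I -> R) : uniq s -> (forall i, i \in s -> S i) ->
  (forall i, 0 <= a i) -> (forall i, S i -> i \notin s -> a i = 0) ->
  (\esum_(i in S) (a i)%:E = (\sum_(i <- s) a i)%:E)%E.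
Proof.
move=> us sS a0 az.
rewrite (esumID [set` s])//; last by move=> i _; rewrite lee_fin.
rewrite [X in (_ + X)%E]esum1 ?adde0; last first.
  by move=> i [Si /negP ns]; rewrite az.
rewrite (_ : S `&` [set` s] = [set` s]); last first.
  by apply/seteqP; split => [i []//|i si]; split => //; exact: sS.
rewrite esum_fset//; last by move=> i _; rewrite lee_fin.
by rewrite -fsbig_seq// sumEFin.
Qed.

Lemma vsum_finite S (s : seq I) w : uniq s -> (forall i, i \in s -> S i) ->
  (forall i, S i -> i \notin s -> w i = 0) ->
  vsummable S w /\ vsum S w = \sum_(i <- s) w i.
Proof.
move=> us sS wz; split.
  move=> j; rewrite /summable.
  have h := esum_finite us sS (a := fun i => `|w i 0 j|) (fun i => normr_ge0 _).
  rewrite (_ : \esum_(i in S) _ = (\sum_(i <- s) `|w i 0 j|)%:E)%E ?ltry//.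
  by apply: h => i Si ni; rewrite wz// mxE normr0.
apply/rowP => j; rewrite mxE summxE.
rewrite (esum_finite us sS (a := fun i => Num.max (w i 0 j) 0)); last 2 first.
- by move=> i; rewrite le_max lexx orbT.
- by move=> i Si ni; rewrite wz// mxE maxxx.
rewrite (esum_finite us sS (a := fun i => Num.max (- w i 0 j) 0)); last 2 first.
- by move=> i; rewrite le_max lexx orbT.
- by move=> i Si ni; rewrite wz// mxE oppr0 maxxx.
rewrite /= -sumrB; apply: eq_bigr => i _.
by case: (leP (w i 0 j) 0) => h; [rewrite max_l ?oppr_ge0// sub0r opprK|rewrite max_r ?oppr_le0 ?ltW// subr0].
Qed.

End FiniteSums.

(** * Sparse domination *)

Section UnitKernels.
Context {R : realType} {X : ptopologicalType}.
Variables (mu : {measure set (Borel X) -> \bar R}).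
Hypothesis muT0 : (0 < mu setT)%E.
Variables (r : \bar R) (hr : (1 < r)%E).

Lemma unit_kernel_intro (Q B : set (Borel X)) (k : Borel X -> Borel X -> R) :
  measurable B -> (0 < mu B)%E -> (mu B < +oo)%E ->
  measurable_fun setT (fun z : Borel X * Borel X => k z.1 z.2) ->
  (forall x, unit_test mu r B (k x)) -> unit_kernel mu r Q B k.
Proof.
move=> mB B0 Bf mk uk; split; first exact: measurable_funTS.
rewrite unlock /= muT0; apply/ess_supP; apply: ae_all => x /=.
have h : (avgnorm mu r B (k x) <= 1)%E.
  by apply: (unit_norm_avgnorm muT0 hr B0 Bf); case: (uk x).
have h0 := avgnorm_ge0 mu r B (k x).
rewrite indicE; case: (_ \in _); last by rewrite mul0e abse0.
by rewrite mul1e gee0_abs.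
Qed.

Lemma unit_test_restrict (A B : set (Borel X)) (phi : Borel X -> R) :
  measurable A -> measurable B -> A `<=` B -> unit_test mu r A phi ->
  unit_test mu r B (fun y => \1_A y * phi y).
Proof.
move=> mA mB AB [mphi [M hM] u]; split.
- by apply: measurable_funM => //; exact: measurable_indic.
- exists M => x; rewrite normrM; apply: le_trans (hM x); rewrite ler_piMl// indicE.
  by case: (_ \in _); rewrite ?normr0 ?normr1.
move: u; rewrite /unit_norm; have [rE|[q rE]] : r = +oo%E \/ exists q, r = q%:E.
    by case: r hr => [q _|_|//]; [right; exists q|left].
  rewrite rE; apply: ae_mono => x h _; rewrite indicE; have [xA|_] := boolP (x \in A).
    by rewrite mul1r; apply: h; rewrite inE in xA.
  by rewrite mul0r normr0.
rewrite rE => h; have q0 : 0 < q by move: hr; rewrite rE lte_fin => /(lt_trans _); apply.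
apply: (@le_trans _ _ (mu A)); last by apply: le_measure; rewrite ?inE.
apply: le_trans h; rewrite -[leRHS]integral_indicM -integral_indicM.
apply: ge0_le_integral' => //.
- apply/measurable_EFinP; apply: measurable_funM; first exact: measurable_indic.
  apply/measurable_EFinP; apply: measurable_normpow; exact: measurable_funM.
- apply/measurable_EFinP; apply: measurable_funM; first exact: measurable_indic.
  by apply/measurable_EFinP; exact: measurable_normpow.
- move=> x _; rewrite lee_fin !indicE; have [xA|xA] := boolP (x \in A); last first.
    by rewrite mul0r normr0 powR0 ?gt_eqF// mulr0 mul0r.
  by rewrite !mul1r; case: (x \in B); rewrite ?mul1r// mul0r powR_ge0.
Qed.

Lemma vintegrable_unit n (B : set (Borel X)) (phi : Borel X -> R) (f : Borel X -> 'rV[R]_n) :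
  measurable B -> unit_test mu r B phi -> (forall j, measurable_fun setT (fun x => f x 0 j)) ->
  (forall j, mu.-integrable setT (fun x => (f x 0 j)%:E)) ->
  vintegrable mu B (fun y => phi y *: f y).
Proof.
move=> mB u mf if_ j.
have := unit_test_integrable mB u (mf j) (integrableS measurableT mB (@subsetT _ B) (if_ j)).
by apply: eq_integrable => // y _; rewrite mxE.
Qed.

End UnitKernels.

(** * Domination by a sparse family *)

Section Domination.
Context {R : realType} {X : ptopologicalType}.
Variables (mu : {measure set (Borel X) -> \bar R}) (d : X -> X -> R).
Variables (cd cmu : R) (hX : homogeneous_type mu d cd cmu).
Variables (c0 C0 delta : R) (hc0 : 0 < c0 <= C0) (hdelta : 0 < delta < 1).
Variables (D : set (cube X)) (hD : dyadic_system d c0 C0 delta D).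
Variables (alpha : R) (halpha : 3 * cd ^+ 2 / delta <= alpha).
Variables (r : \bar R) (hr : (1 < r)%E).
Local Notation dil := (dilate d C0 delta alpha).
Local Notation p := (dualp r).
Let r1 : (1 <= r)%E := ltW hr.
Let muT0 := muT_gt0 hX.
Let mdil Q : measurable (dil Q) := dil_measurable hX C0 delta alpha Q.
Let dil0 Q : (0 < mu (dil Q))%E := dil_gt0 hX hc0 hdelta halpha Q.
Let dilf Q : (mu (dil Q) < +oo)%E := dil_fin hX C0 delta alpha Q.

Lemma enormE n (v : 'rV[R]_n) : enorm v = (\sum_(i < n) v 0 i ^+ 2) `^ 2^-1.
Proof. by rewrite powR12_sqrt// sumr_ge0// => i _; exact: sqr_ge0. Qed.

Lemma admissible_bsL n (f : Borel X -> 'rV[R]_n) j : admissible mu d r f ->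
  bsL mu d r (fun y => f y 0 j).
Proof.
move=> [mf bf Nf].
have me : measurable_fun setT (fun x => enorm (f x)).
  under eq_fun do rewrite enormE.
  apply: (measurableT_comp (measurable_powR _)); apply: measurable_sum => i.
  exact: measurable_funX.
have be : bsL mu d r (fun x => enorm (f x)).
  split => //; apply: (bounded_support_sub hX bf) => y ->.
  by rewrite /enorm big1 ?sqrtr0// => i _; rewrite mxE expr0n.
apply: (bsL_sub hX r1 be (mf j)) => x; rewrite [leRHS]ger0_norm ?sqrtr_ge0//.
rewrite -sqrtr_sqr ler_wsqrtr// (bigD1 j)//= lerDl.
by apply: sumr_ge0 => i _; exact: sqr_ge0.
Qed.

(** The common source of both representations: at almost every point a finite sum over the list of
    selected cubes containing it, with one constant in front. *)
Definition sparse_data n (c : R) (f F : Borel X -> 'rV[R]_n) (S : set (cube X))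
    (k : cube X -> Borel X -> Borel X -> R) :=
  [/\ S `<=` D, eta_sparse mu (1 / 2) S,
      forall Q, S Q -> measurable_fun setT (fun z : Borel X * Borel X => k Q z.1 z.2) /\
        forall x, unit_test mu r (dil Q) (k Q x) &
      {ae mu, forall x, exists s : seq (cube X), [/\ uniq s,
        forall P, P \in s <-> (S P /\ carrier P x) &
        F x = c *: \sum_(P <- s) avg mu (dil P) (fun y => k P x y *: f y)]}].

Section Operator.
Variables (T Ts : (Borel X -> R) -> (Borel X -> R)).
Hypothesis hT : linear_operator mu d r T.
Hypothesis hTs : linear_operator mu d +oo%E Ts.
Hypothesis hadj : adjoint_operators mu d r +oo%E T Ts.
Variables (A1 : R) (A11 : 1 <= A1).
Hypothesis sstep : forall (e : R) Q g, 0 < e <= 1 -> D Q -> bsL mu d r g ->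
  (forall x, ~ dil Q x -> g x = 0) ->
  (\int[mu]_x (`|g x| `^ p)%:E <= mu (dil Q))%E ->
  exists Om : set (Borel X), [/\ measurable Om, (mu Om <= e%:E * mu (carrier Q))%E,
    forall x, carrier Q x -> ~ Om x -> `|T g x| <= A1 / e ^+ 2 &
    forall P, D P -> carrier P `<=` carrier Q ->
      (mu (carrier P `&` Om) <= (1 / 2)%:E * mu (carrier P))%E ->
      {ae mu, forall x, carrier P x ->
        `|T (fun y => \1_(~` dil P) y * g y) x| <= A1 / e ^+ 2}].
Variables (e0 : R) (he0 : 0 < e0 <= 1).
Hypothesis stop : forall Q (Om : set (Borel X)),
  D Q -> measurable Om -> (mu Om <= e0%:E * mu (carrier Q))%E ->
  exists Ch, stopping_family mu d C0 delta D alpha Q Om Ch.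

(** Children and kernels are chosen once for every cube of [D]. On a top cube nothing is lost by
    cutting f to the dilate, which contains its support, so the iteration there starts from [T f]
    itself. *)
Lemma sparse_dom n (f : Borel X -> 'rV[R]_n) : admissible mu d r f ->
  exists S k, sparse_data (stepc A1 e0 n) f (vapply T f) S k.
Proof.
move=> af; have bf j := admissible_bsL j af.
have [_ [z [rho [rho0 fs]]] _] := af.
have /choice[CK hCK] : forall Q : cube X, exists CK : set (cube X) * (Borel X -> Borel X -> R), D Q ->
    [/\ forall P, CK.1 P -> [/\ D P, carrier P `<=` carrier Q & generation Q < generation P],
      disjoint_family CK.1, (mu (famU CK.1 carrier) <= (1 / 2)%:E * mu (carrier Q))%E,
      measurable_fun setT (fun z : Borel X * Borel X => CK.2 z.1 z.2) &
      (forall x, unit_test mu r (dil Q) (CK.2 x)) /\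
      {ae mu, forall x, carrier Q x -> vapply T (cut_dil d C0 delta alpha f Q) x =
         stepc A1 e0 n *: avg mu (dil Q) (fun y => CK.2 x y *: f y) +
         \row_j piecewise CK.1 (fun P x => vapply T (cut_dil d C0 delta alpha f P) x 0 j) x}].
  move=> Q; have [DQ|nD] := pselect (D Q); last by exists (set0, fun _ _ => 0).
  have [Ch [k h]] := vector_step hX hc0 hdelta hD halpha hr hT hTs hadj A11 sstep he0 stop bf DQ.
  by exists (Ch, k).
pose Ch Q := (CK Q).1; pose k Q := (CK Q).2.
have hCh Q P : D Q -> Ch Q P -> [/\ D P, carrier P `<=` carrier Q & generation Q < generation P].
  by move=> DQ; have [h _ _ _ _] := hCK Q DQ; exact: h.
have dCh Q : D Q -> disjoint_family (Ch Q) by move=> DQ; case: (hCK Q DQ).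
have muCh Q : D Q -> (mu (famU (Ch Q) carrier) <= (1 / 2)%:E * mu (carrier Q))%E.
  by move=> DQ; case: (hCK Q DQ).
pose S0 := top_cubes d cd C0 delta D (qball d z rho).
have S0D : S0 `<=` D by move=> Q [].
have dS0 : disjoint_family S0 by exact: (top_disjoint hD).
have cov x : exists2 Q, S0 Q & carrier Q x by exact: (top_cover hX hc0 hdelta hD).
exists (all_layers Ch S0), k; split.
- exact: (all_layers_D hCh S0D).
- exact: (all_layers_sparse hX hc0 hdelta hD hCh dCh muCh S0D dS0).
- move=> Q /(all_layers_D hCh S0D) DQ; have [_ _ _ mk [uk _]] := hCK Q DQ.
  by split.
have hG Q : D Q -> {ae mu, forall x, carrier Q x ->
    vapply T (cut_dil d C0 delta alpha f Q) x =
      stepc A1 e0 n *: avg mu (dil Q) (fun y => k Q x y *: f y) +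
      \row_j piecewise (Ch Q) (fun P x => vapply T (cut_dil d C0 delta alpha f P) x 0 j) x}.
  by move=> DQ; have [_ _ _ _ [_ h]] := hCK Q DQ.
apply: ae_mono (sparse_identity hX hc0 hdelta hD hCh dCh muCh S0D dS0 cov hG) => x.
move=> [s [us ss [Q [SQ Qx eT]]]]; exists s; split => //.
rewrite scaler_sumr -eT; congr (vapply T _ x); apply/funext => y; rewrite /cut_dil.
have [yB|nB] := pselect (qball d z rho y); last by rewrite fs// scaler0.
by rewrite indicE mem_set ?scale1r//; exact: (top_dilate hX hc0 hdelta hD halpha SQ).
Qed.

End Operator.

Section Representation.
Variables (n : nat) (f F : Borel X -> 'rV[R]_n) (c : R) (S : set (cube X)).
Variable (k : cube X -> Borel X -> Borel X -> R).
Hypotheses (c0' : 0 < c) (data : sparse_data c f F S k).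
Hypothesis mf : forall j, measurable_fun setT (fun x => f x 0 j).
Hypothesis if_ : forall j, mu.-integrable setT (fun x => (f x 0 j)%:E).
Let if_on B (mB : measurable B) j : mu.-integrable B (fun x => (f x 0 j)%:E).
Proof. exact: integrableS (if_ j). Qed.

(** Enlarging the constant shrinks the kernels by [c / c'], which keeps them of unit norm; one
    constant can thus serve for both forms of the theorem. *)
Lemma representation (c' : R) : c <= c' ->
  exists k' : cube X -> Borel X -> Borel X -> R,
  [/\ forall Q, S Q -> unit_kernel mu r (carrier Q) (dil Q) (k' Q),
      forall Q x, S Q -> unit_test mu r (dil Q) (k' Q x) &
  {ae mu, forall x : Borel X,
     sparse_series_cvg mu S dil k' f x /\
     F x = c' *: vsum S (fun Q => sparse_term mu (carrier Q) (dil Q) (k' Q) f x)}].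
Proof.
move=> cc'; have [SD _ hk ae] := data; have c'0 : 0 < c' := lt_le_trans c0' cc'.
pose k' Q x y := c / c' * k Q x y.
have uk' Q x : S Q -> unit_test mu r (dil Q) (k' Q x).
  move=> SQ; apply: (unit_test_scale hr (mdil Q)); last exact: (hk Q SQ).2.
  have q0 : 0 <= c / c' by rewrite divr_ge0// ltW.
  by rewrite ger0_norm// ler_pdivrMr// mul1r.
exists k'; split => //.
  move=> Q SQ; apply: (unit_kernel_intro muT0 hr) => //; last by move=> x; exact: uk'.
  by apply: measurable_funM => //; exact: (hk Q SQ).1.
apply: ae_mono ae => x [s [us ss Fx]].
have vi Q : S Q -> vintegrable mu (dil Q) (fun y => k' Q x y *: f y).
  by move=> SQ; exact: (vintegrable_unit (mdil Q) (uk' Q x SQ)).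
have [] := vsum_finite (S := S) (w := fun Q => sparse_term mu (carrier Q) (dil Q) (k' Q) f x) us.
- by move=> Q /ss[].
- move=> Q SQ ns; rewrite /sparse_term indicE memNset ?scale0r// => Qx.
  by move/negP: ns; apply; apply/ss.
move=> sm ->; split; first by split => // Q SQ _; exact: vi.
rewrite Fx scaler_sumr scaler_sumr big_seq [RHS]big_seq; apply: eq_bigr => Q /ss[SQ Qx].
rewrite /sparse_term indicE mem_set// scale1r.
rewrite (avg_scale (mdil Q) mf (if_on (mdil Q)) (c / c') ((hk Q SQ).2 x)) scalerA.
by rewrite mulrCA mulfV ?mulr1// gt_eqF.
Qed.

Lemma representation_body (c' : R) (k' : cube X -> Borel X -> Borel X -> R) (x : Borel X) :
  (forall Q, S Q -> unit_test mu r (dil Q) (k' Q x)) ->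
  sparse_series_cvg mu S dil k' f x ->
  F x = c' *: vsum S (fun Q => sparse_term mu (carrier Q) (dil Q) (k' Q) f x) ->
  [set c' *: v | v in minkowski_sum S (fun Q =>
     [set (\1_(carrier Q) x : R) *: v | v in convex_body mu (hoelder_conjugate r) (dil Q) f])] (F x).
Proof.
move=> uk [_ sm] ->; eexists; last reflexivity.
exists (fun Q => sparse_term mu (carrier Q) (dil Q) (k' Q) f x); split => // Q SQ.
exists (avg mu (dil Q) (fun y => k' Q x y *: f y)) => //.
have u := uk Q SQ; have [mk _ un] := u.
exists (k' Q x); split => //.
- exact: measurable_funTS.
- by rewrite hoelder_conjugateK; exact: (unit_norm_avgnorm muT0 hr (dil0 Q) (dilf Q)).
- exact: (vintegrable_unit (mdil Q) u).
Qed.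

End Representation.

(** * Transport of the sparse family to the adjacent systems *)

Section Adjacent.
Variables (M N : nat) (tc0 tC0 : R) (Ds : nat -> set (cube X)).
Variables (col : cube X -> nat) (cl : int -> cube X -> cube X).
Hypotheses (M0 : (0 < M)%N) (htc : 0 < tc0 <= tC0).
Hypothesis hDs : forall j, dyadic_system d tc0 tC0 (delta ^+ M) (Ds j).
Hypothesis hcol : forall Q, D Q -> (col Q < N)%N.
Hypothesis hcl : forall (k : int) Q, D Q -> generation Q = k * M%:Z ->
  [/\ Ds (col Q) (cl k Q), generation (cl k Q) = k, cube_center (cl k Q) = cube_center Q &
      qball d (cube_center Q) (cd * (C0 + alpha * C0) * delta ^ generation Q) `<=` carrier (cl k Q)].
Local Notation cub := (cub hD).

(** A cube is sent to the cell of its ancestor of generation a multiple of [M]. Its new colour joins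
    that of the ancestor with the residue of its own generation, so that colour and cell together
    determine the generation. *)
Definition adj_gen (Q : cube X) : int := (generation Q %/ M%:Z)%Z.
Definition adj_res (Q : cube X) : nat := `|(generation Q %% M%:Z)%Z|%N.
Definition adj_anc (Q : cube X) : cube X := cub (adj_gen Q * M%:Z) (cube_center Q).
Definition adj_cube (Q : cube X) : cube X := cl (adj_gen Q) (adj_anc Q).
Definition adj_color (Q : cube X) : 'I_(N * M).+1 :=
  inord (col (adj_anc Q) * M + adj_res Q).
Definition adjc : R := cubc cd cmu c0 0 (cd * (C0 + tC0) / delta ^+ M).

Let d0 : 0 < delta. Proof. by case/andP: hdelta. Qed.
Let dM0 : 0 < delta ^+ M < 1.
Proof. by rewrite exprn_gt0//= exprn_ilt1// ?ltW//; case/andP: hdelta; case: (M) M0. Qed.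
Let M0z : (M%:Z != 0 :> int). Proof. by rewrite eqz_nat -lt0n. Qed.

Lemma adj_resE Q : generation Q = adj_gen Q * M%:Z + (adj_res Q)%:Z.
Proof. by rewrite /adj_res gez0_abs ?modz_ge0// -divz_eq. Qed.

Lemma adj_res_lt Q : (adj_res Q < M)%N.
Proof. by rewrite -ltz_nat /adj_res gez0_abs ?modz_ge0// ltz_pmod. Qed.

Lemma adj_ancD Q : D (adj_anc Q) /\ generation (adj_anc Q) = adj_gen Q * M%:Z.
Proof. by split; [exact: cub_D|exact: gen_cub]. Qed.

Lemma adj_colorE Q : D Q -> adj_color Q = (col (adj_anc Q) * M + adj_res Q)%N :> nat.
Proof.
move=> DQ; rewrite inordK// ltnS; apply: ltnW.
apply: (@leq_trans ((col (adj_anc Q)).+1 * M)).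
  by rewrite mulSn addnC ltn_add2r adj_res_lt.
by rewrite leq_mul2r hcol ?orbT//; case: (adj_ancD Q).
Qed.

Lemma adj_color_div Q : D Q -> (adj_color Q %/ M)%N = col (adj_anc Q).
Proof. by move=> DQ; rewrite adj_colorE// divnMDl// divn_small ?addn0// adj_res_lt. Qed.

Lemma adj_color_mod Q : D Q -> (adj_color Q %% M)%N = adj_res Q.
Proof. by move=> DQ; rewrite adj_colorE// modnMDl modn_small// adj_res_lt. Qed.

Lemma adj_cubeP Q : D Q -> [/\ Ds (adj_color Q %/ M) (adj_cube Q),
  generation (adj_cube Q) = adj_gen Q, carrier Q `<=` carrier (adj_cube Q) &
  dil Q `<=` carrier (adj_cube Q)].
Proof.
move=> DQ; have [DA gA] := adj_ancD Q; have [h1 h2 h3 h4] := hcl DA gA.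
have cd0 := cd_gt0 hX; have C00 := C0_gt0 hc0.
have a3 := alpha_ge3 hX hdelta halpha.
have dsub : dil Q `<=` carrier (adj_cube Q).
  apply: subset_trans h4; apply: (qball_sub hX).
  have zz := cube_outer hD DA (cub_in hD _ _); rewrite gA -[leRHS]mulrA ler_pM2l// mulrDl.
  rewrite gA in zz; apply: lerD; first exact: ltW.
  rewrite ler_pM2l ?mulr_gt0//; last by lra.
  by apply: (dpow_le hdelta); rewrite [leRHS]adj_resE lerDl.
split => //; first by rewrite adj_color_div.
exact: subset_trans (cube_sub_dil hX hc0 hdelta hD halpha DQ) dsub.
Qed.

Lemma adjc_ge1 : 1 <= adjc. Proof. exact: (cubc_ge1 hX). Qed.

Lemma adj_measure Q : D Q -> (mu (carrier (adj_cube Q)) <= adjc%:E * mu (carrier Q))%E.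
Proof.
move=> DQ; have [DA gA] := adj_ancD Q; have [h1 h2 h3 h4] := hcl DA gA.
have cd0 := cd_gt0 hX; have C00 := C0_gt0 hc0.
have dp (k : int) : 0 < delta ^ k := dpow_gt0 hdelta k.
have tC00 : 0 < tC0 by case/andP: htc => t0 /(lt_le_trans t0).
have zz := cube_outer hD DA (cub_in hD (adj_gen Q * M%:Z) (cube_center Q)); rewrite gA in zz.
have powE : (delta ^+ M) ^ adj_gen Q = delta ^ (adj_gen Q * M%:Z).
  by rewrite [delta ^+ M]exprnP exprz_exp mulrC.
have dle : delta ^ (adj_gen Q * M%:Z) <= delta ^ generation Q / delta ^+ M.
  rewrite ler_pdivlMr ?exprn_gt0// [delta ^+ M]exprnP -(dpowD hdelta).
  apply: (dpow_le hdelta); rewrite [leLHS]adj_resE lerD2l lez_nat; apply: ltnW.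
  exact: adj_res_lt.
have sub : carrier (adj_cube Q) `<=` qball d (cube_center Q)
    (cd * (C0 + tC0) / delta ^+ M * delta ^ generation Q).
  apply: subset_trans (ds_outer (hDs _) h1) _; rewrite h2 h3 powE.
  apply: (qball_sub hX); rewrite (qd_sym hX).
  apply: (@le_trans _ _ (cd * (C0 * delta ^ (adj_gen Q * M%:Z) + tC0 * delta ^ (adj_gen Q * M%:Z)))).
    by rewrite ler_pM2l// lerD2r ltW.
  rewrite -mulrDl mulrA -[leRHS]mulrA ler_pM2l; first by rewrite [leRHS]mulrC.
  by rewrite mulr_gt0// addr_gt0.
have := ball_le_cube hX hc0 hdelta hD (a := 0) (cd * (C0 + tC0) / delta ^+ M) (x := cube_center Q) DQ.
rewrite (qdxx hX) mul0r => /(_ (lexx _)); apply: le_trans.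
apply: (le_qball hX) => //; exact: (cube_measurable (hDs _) h1).
Qed.

(** Many cubes may share a cell and a colour, but these have one generation and hence are disjoint.
    This is why a single kernel per cell is enough. *)
Lemma adj_inj Q Q' x : D Q -> D Q' -> carrier Q x -> carrier Q' x ->
  adj_color Q = adj_color Q' -> adj_cube Q = adj_cube Q' -> Q = Q'.
Proof.
move=> DQ DQ' Qx Q'x ec eP; apply: (cube_eq hD DQ DQ' _ Qx Q'x).
have [_ g1 _ _] := adj_cubeP DQ; have [_ g2 _ _] := adj_cubeP DQ'.
rewrite (adj_resE Q) (adj_resE Q') -g1 -g2 eP.
by rewrite -(adj_color_mod DQ) -(adj_color_mod DQ') ec.
Qed.

Variables (n : nat) (f F : Borel X -> 'rV[R]_n) (c : R) (S : set (cube X)).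
Variable (k : cube X -> Borel X -> Borel X -> R).
Hypotheses (c0' : 0 < c) (data : sparse_data c f F S k).
Hypothesis mf : forall j, measurable_fun setT (fun x => f x 0 j).
Hypothesis if_ : forall j, mu.-integrable setT (fun x => (f x 0 j)%:E).

Definition adj_family (j : 'I_(N * M).+1) (P : cube X) : set (cube X) :=
  [set Q | [/\ S Q, adj_color Q = j & adj_cube Q = P]].
Definition adj_sparse (j : 'I_(N * M).+1) : set (cube X) :=
  [set P | exists Q, adj_family j P Q].
(** The kernels of the disjoint cubes sent to [P] are glued. The ratio of measures turns an average
    over [P] into one over [dil Q]; it is at most [adjc], and dividing by [adjc] restores the unit
    norm. *)
Definition adj_kernel (j : 'I_(N * M).+1) (P : cube X) (x y : Borel X) : R :=
  piecewise (adj_family j P) (fun Q x => adjc^-1 *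
    (fine (mu (carrier P)) / fine (mu (dil Q))) * (\1_(dil Q) y * k Q x y)) x.

Lemma adj_family_disjoint j P : disjoint_family (adj_family j P).
Proof.
have [SD _ _ _] := data.
move=> Q Q' [SQ cQ pQ] [SQ' cQ' pQ'] ne; rewrite -subset0 => x [Qx Q'x]; apply: ne.
by apply: (adj_inj (SD _ SQ) (SD _ SQ') Qx Q'x); rewrite ?cQ ?cQ' ?pQ ?pQ'.
Qed.

Lemma adj_family_countable j P : countable (adj_family j P).
Proof.
have [SD _ _ _] := data.
apply: sub_countable (countable_D hX hc0 hdelta hD); apply: subset_card_le.
by move=> Q [/SD].
Qed.

Lemma adj_sparse_Ds j : adj_sparse j `<=` Ds (j %/ M).
Proof.
have [SD _ _ _] := data.
by move=> P [Q [SQ <- <-]]; have [] := adj_cubeP (SD _ SQ).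
Qed.

Let mP j P (h : adj_sparse j P) : measurable (carrier P) :=
  cube_measurable (hDs _) (adj_sparse_Ds h).
Let P0 j P (h : adj_sparse j P) : (0 < mu (carrier P))%E :=
  cube_mu_gt0 hX htc dM0 (hDs _) (adj_sparse_Ds h).
Let Pf j P (h : adj_sparse j P) : (mu (carrier P) < +oo)%E :=
  cube_mu_fin hX (hDs _) (adj_sparse_Ds h).

Lemma adj_ratio j P Q : adj_sparse j P -> adj_family j P Q ->
  [/\ 0 < fine (mu (carrier P)), 0 < fine (mu (dil Q)) &
   fine (mu (carrier P)) / fine (mu (dil Q)) <= adjc].
Proof.
move=> aP [SQ cQ pQ]; have [SD _ _ _] := data; have DQ := SD _ SQ.
have fP : mu (carrier P) \is a fin_num by rewrite ge0_fin_numE//; exact: Pf aP.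
have fd : mu (dil Q) \is a fin_num by rewrite ge0_fin_numE.
have p0 : 0 < fine (mu (carrier P)) by rewrite -lte_fin fineK//; exact: P0 aP.
have q0 : 0 < fine (mu (dil Q)) by rewrite -lte_fin fineK.
split => //; rewrite ler_pdivrMr// -lee_fin EFinM !fineK// -pQ.
apply: le_trans (adj_measure DQ) _; apply: lee_wpmul2l.
  by rewrite lee_fin (le_trans ler01 adjc_ge1).
apply: le_measure; rewrite ?inE//; first exact: (cube_measurable hD).
exact: (cube_sub_dil hX hc0 hdelta hD halpha).
Qed.

Lemma adj_kernel_in j P Q x : adj_family j P Q -> carrier Q x ->
  adj_kernel j P x = (fun y => adjc^-1 * (fine (mu (carrier P)) / fine (mu (dil Q))) *
    (\1_(dil Q) y * k Q x y)).
Proof.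
by move=> fQ Qx; apply/funext => y; rewrite /adj_kernel (piecewiseE _ (@adj_family_disjoint j P) fQ Qx).
Qed.

Lemma adj_kernel_out j P x : ~ famU (adj_family j P) carrier x -> adj_kernel j P x = fun=> 0.
Proof. by move=> nU; apply/funext => y; rewrite /adj_kernel piecewise0. Qed.

Lemma adj_kernel_unit j P x : adj_sparse j P -> unit_test mu r (carrier P) (adj_kernel j P x).
Proof.
move=> aP; have [SD _ hk _] := data.
have [[Q fQ Qx]|nU] := pselect (famU (adj_family j P) carrier x); last first.
  rewrite adj_kernel_out//; apply: unit_test_le1 => //; [exact: mP aP|move=> y].
  by rewrite normr0.
rewrite (adj_kernel_in fQ Qx); have [SQ cQ pQ] := fQ; have DQ := SD _ SQ.
have [p0 q0 rat] := adj_ratio aP fQ; have a1 := adjc_ge1.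
have a0 : 0 < adjc := lt_le_trans ltr01 a1.
apply: (unit_test_scale hr (mP aP)).
  rewrite ger0_norm; last by rewrite mulr_ge0 ?invr_ge0 ?divr_ge0// ltW.
  by rewrite ler_pdivrMl// mulr1.
apply: (unit_test_restrict hr (mdil Q) (mP aP)); last exact: (hk Q SQ).2.
by rewrite -pQ; have [] := adj_cubeP DQ.
Qed.

Lemma adj_kernel_measurable j P : adj_sparse j P ->
  measurable_fun setT (fun z : Borel X * Borel X => adj_kernel j P z.1 z.2).
Proof.
move=> aP; have [SD _ hk _] := data.
have mQ Q : adj_family j P Q -> measurable (carrier Q) by move=> [/SD DQ _ _]; exact: (cube_measurable hD).
pose phi Q (z : Borel X * Borel X) := adjc^-1 * (fine (mu (carrier P)) / fine (mu (dil Q))) *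
  (\1_(dil Q) z.2 * k Q z.1 z.2).
have mphi Q : adj_family j P Q -> measurable_fun setT (phi Q).
  move=> [SQ _ _]; apply: measurable_funM => //; apply: measurable_funM.
    by apply: (measurable_comp_snd (g := \1_(dil Q))); exact: measurable_indic.
  exact: (hk Q SQ).1.
have cF := adj_family_countable j P.
pose U := famU (adj_family j P) carrier.
have mU : measurable U by exact: famU_measurable.
move=> _ Y mY; rewrite setTI.
have -> : (fun z : Borel X * Borel X => adj_kernel j P z.1 z.2) @^-1` Y =
    (\bigcup_(Q in adj_family j P) ((carrier Q `*` setT) `&` phi Q @^-1` Y)) `|`
    ((~` U `*` setT) `&` [set _ | Y 0]).
  apply/seteqP; split => [[x y] /= Yx|[x y] [[Q fQ [[/= Qx _] Yx]]|[[/= nU _] Y0]]] /=.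
  - have [[Q fQ Qx]|nU] := pselect (U x).
      by left; exists Q => //; split => //=; move: Yx; rewrite (adj_kernel_in fQ Qx).
    by right; split => //=; move: Yx; rewrite adj_kernel_out.
  - by rewrite (adj_kernel_in fQ Qx).
  - by rewrite adj_kernel_out.
apply: measurableU.
  apply: countable_bigcup_measurable => // Q fQ; apply: measurableI.
    by apply: measurableX => //; exact: mQ.
  by rewrite -[_ @^-1` _]setTI; exact: mphi.
apply: measurableI; first by apply: measurableX => //; exact: measurableC.
have [Y0|nY0] := pselect (Y 0).
  by rewrite (_ : [set _ | _] = setT)//; apply/seteqP; split.
by rewrite (_ : [set _ | _] = set0)//; apply/seteqP; split.
Qed.

(** One representative is kept for each cell, together with its sparse part. Cell and representative
    have comparable measures, and distinct cells have distinct representatives. *)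
Lemma adj_sparse_sparse j : sparse mu (adj_sparse j).
Proof.
have [SD [E [hE dE]] _ _] := data; have a1 := adjc_ge1.
exists (2 * adjc)^-1.
  apply/andP; split; first by rewrite invr_gt0; lra.
  by rewrite invf_lt1; lra.
have sel P : exists Q, adj_sparse j P -> adj_family j P Q.
  by have [[Q fQ]|no] := pselect (adj_sparse j P); [exists Q|exists P].
have [q hq] := choice sel.
exists (fun P => E (q P)); split.
  move=> P aP; have [SQ cQ pQ] := hq P aP; have DQ := SD _ SQ.
  have [mE EQ hEQ] := hE _ SQ; split => //.
    by have [_ _ h _] := adj_cubeP DQ; rewrite pQ in h; exact: subset_trans EQ h.
  have hm := adj_measure DQ; rewrite pQ in hm.
  apply: le_trans hEQ; apply: (@le_trans _ _ ((2 * adjc)^-1%:E * (adjc%:E * mu (carrier (q P))))%E).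
    by apply: lee_wpmul2l => //; rewrite lee_fin invr_ge0; lra.
  rewrite muleA -EFinM; apply: lee_wpmul2r => //; rewrite lee_fin.
  by rewrite [leLHS](_ : _ = 1 / 2)//; field; rewrite gt_eqF//; lra.
move=> P P' aP aP' ne; have [SQ cQ pQ] := hq P aP; have [SQ' cQ' pQ'] := hq P' aP'.
by apply: dE => // e; apply: ne; rewrite -pQ -pQ' e.
Qed.

Lemma adj_avg j P Q x : adj_sparse j P -> adj_family j P Q -> carrier Q x ->
  avg mu (carrier P) (fun y => adj_kernel j P x y *: f y) =
  adjc^-1 *: avg mu (dil Q) (fun y => k Q x y *: f y).
Proof.
move=> aP fQ Qx; rewrite (adj_kernel_in fQ Qx); have [SQ cQ pQ] := fQ.
have [SD _ hk _] := data; have DQ := SD _ SQ.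
have [p0 q0 _] := adj_ratio aP fQ.
apply/rowP => i; rewrite !mxE.
set a := adjc^-1 * _.
have ik : mu.-integrable (dil Q) (EFin \o (fun y => k Q x y * f y 0 i)).
  apply: (unit_test_integrable (mdil Q) ((hk Q SQ).2 x) (mf i)).
  exact: integrableS (if_ i).
have -> : \int[mu]_(y in carrier P) ((a * (\1_(dil Q) y * k Q x y)) *: f y) 0 i =
    a * \int[mu]_(y in dil Q) (k Q x y * f y 0 i).
  rewrite -RintegralZl// -[LHS]Rintegral_indicM -[RHS]Rintegral_indicM.
  apply: eq_Rintegral => y _; rewrite !mxE !indicE.
  have dP : dil Q `<=` carrier P by rewrite -pQ; have [] := adj_cubeP DQ.
  have [yQ|_] := boolP (y \in dil Q); last by rewrite !mul0r mulr0 mul0r mulr0.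
  by rewrite (mem_set (dP _ (set_mem yQ))) !mul1r mulrA.
have -> : \int[mu]_(y in dil Q) ((k Q x y *: f y) 0 i) = \int[mu]_(y in dil Q) (k Q x y * f y 0 i).
  by apply: eq_Rintegral => y _; rewrite mxE.
by rewrite /a !mulrA; congr (_ * _); field; rewrite !gt_eqF//; have := adjc_ge1; lra.
Qed.

Lemma adj_representation : 
  [/\ forall j, sparse mu (adj_sparse j),
      forall j P, adj_sparse j P -> unit_kernel mu r (carrier P) (carrier P) (adj_kernel j P) &
      {ae mu, forall x : Borel X,
        (forall j, sparse_series_cvg mu (adj_sparse j) carrier (adj_kernel j) f x) /\
        F x = (c * adjc) *: \sum_(j < (N * M).+1) vsum (adj_sparse j) (fun P =>
          sparse_term mu (carrier P) (carrier P) (adj_kernel j P) f x)}].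
Proof.
have [SD _ hk ae] := data; have a1 := adjc_ge1.
split; first exact: adj_sparse_sparse.
  move=> j P aP; apply: (unit_kernel_intro muT0 hr).
  - exact: mP aP.
  - exact: P0 aP.
  - exact: Pf aP.
  - exact: adj_kernel_measurable.
  - by move=> x; exact: adj_kernel_unit.
apply: ae_mono ae => x [s [us ss Fx]].
pose sj j := [seq adj_cube Q | Q <- s & adj_color Q == j].
have fam j Q : Q \in s -> adj_color Q == j -> adj_family j (adj_cube Q) Q.
  by move=> /ss[SQ _] /eqP.
have fin j : vsummable (adj_sparse j) (fun P => sparse_term mu (carrier P) (carrier P) (adj_kernel j P) f x) /\
    vsum (adj_sparse j) (fun P => sparse_term mu (carrier P) (carrier P) (adj_kernel j P) f x) =
    \sum_(P <- sj j) sparse_term mu (carrier P) (carrier P) (adj_kernel j P) f x.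
  apply: vsum_finite.
  - rewrite map_inj_in_uniq ?filter_uniq// => Q Q'; rewrite !mem_filter.
    move=> /andP[/eqP cQ /ss[SQ Qx]] /andP[/eqP cQ' /ss[SQ' Q'x]] e.
    by apply: (adj_inj (SD _ SQ) (SD _ SQ') Qx Q'x); rewrite ?cQ ?cQ'.
  - move=> P /mapP[Q]; rewrite mem_filter => /andP[cQ Qs] ->.
    by exists Q; exact: fam.
  - move=> P aP nP; rewrite /sparse_term adj_kernel_out.
      apply/rowP => i; rewrite !mxE; under eq_Rintegral do rewrite scale0r mxE.
      by rewrite Rintegral_cst ?mul0r ?mulr0//; exact: mP aP.
    move=> [Q [SQ cQ pQ] Qx]; move/negP: nP; apply; apply/mapP; exists Q => //.
    by rewrite mem_filter cQ eqxx/=; apply/ss.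
split.
  move=> j; split; last by case: (fin j).
  move=> P aP _; exact: (vintegrable_unit (mP aP) (adj_kernel_unit x aP)).
have -> : \sum_(j < (N * M).+1) vsum (adj_sparse j) (fun P =>
      sparse_term mu (carrier P) (carrier P) (adj_kernel j P) f x) =
    \sum_(Q <- s) adjc^-1 *: avg mu (dil Q) (fun y => k Q x y *: f y).
  (* The cubes at x are sorted by colour; within a colour they correspond to cells one to one. *)
  rewrite [RHS](partition_big (adj_color : cube X -> 'I_(N * M).+1) predT)//=.
  apply: eq_bigr => j _; rewrite (fin j).2 big_map big_filter.
  rewrite big_seq_cond [RHS]big_seq_cond; apply: eq_bigr => Q /andP[Qs cQ].
  have fQ := fam j Q Qs cQ; have [SQ Qx] := (ss Q).1 Qs.
  have aP : adj_sparse j (adj_cube Q) by exists Q.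
  rewrite /sparse_term (adj_avg aP fQ Qx) indicE mem_set ?scale1r//.
  by have [_ _ h _] := adj_cubeP (SD _ SQ); exact: h.
rewrite Fx -scaler_sumr scalerA -mulrA mulfV ?mulr1// gt_eqF//; lra.
Qed.

End Adjacent.
End Domination.

(** * Assembly of the estimates and choice of constants *)

Lemma avg_hoelder1 (R : realType) (X : ptopologicalType)
    (mu : {measure set (Borel X) -> \bar R}) (B : set (Borel X)) (phi h : Borel X -> R) (L : R) :
  measurable B -> (0 < mu B)%E -> (mu B < +oo)%E -> measurable_fun setT phi ->
  measurable_fun setT h -> 0 <= L -> (forall y, `|h y| <= L) ->
  (\int[mu]_(y in B) (`|phi y| * `|h y|)%:E <= L%:E * (mu B * avgnorm mu 1%:E B phi))%E.
Proof.
move=> mB B0 Bf mphi mh L0 hL.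
have fB : mu B \is a fin_num by rewrite ge0_fin_numE.
have b0 : 0 < fine (mu B) by rewrite -lte_fin fineK.
have mn g : measurable_fun setT g -> measurable_fun B (fun y : Borel X => `|g y : R|%:E).
  by move=> mg; apply: measurable_funTS; apply/measurable_EFinP; exact: measurableT_comp.
have mphiB := mn _ mphi.
have -> : (mu B * avgnorm mu 1%:E B phi = \int[mu]_(y in B) `|phi y|%:E)%E.
  rewrite /avgnorm invr1; under eq_integral do rewrite powRr1//.
  rewrite poweRe1; last first.
    by apply: mule_ge0; [rewrite lee_fin invr_ge0 ltW|exact: integral_ge0].
  by rewrite muleA -{1}(fineK fB) -EFinM mulfV ?gt_eqF// mul1e.
rewrite -ge0_integralZl//; apply: ge0_le_integral' => //.
- apply: measurable_funTS; apply/measurable_EFinP.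
  by apply: measurable_funM; exact: measurableT_comp.
- exact: measurable_funeM.
- by move=> y _; rewrite -EFinM lee_fin mulrC ler_wpM2r.
Qed.

Theorem theorem4 (R : realType) (X : ptopologicalType)
  (mu : {measure set (Borel X) -> \bar R}) (d : X -> X -> R) (cd cmu : R)
  (hX : homogeneous_type mu d cd cmu) (hCc : Cc_dense_L1 mu)
  (c0 C0 delta : R) (hc0 : 0 < c0 <= C0) (hdelta : 0 < delta < 1)
  (D : set (cube X)) (hD : dyadic_system d c0 C0 delta D)
  (alpha : R) (halpha : 3 * cd ^+ 2 / delta <= alpha) :
  exists (cnd : nat -> R) (tc0 tC0 tdelta : R) (m : nat)
         (Ds : 'I_m -> set (cube X)),
    [/\ forall n, 0 < cnd n,
        0 < tc0 <= tC0,
        0 < tdelta < 1,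
        forall j, dyadic_system d tc0 tC0 tdelta (Ds j) &
    forall (r : \bar R) (K : Borel X -> Borel X -> R)
           (T Ts : (Borel X -> R) -> (Borel X -> R)),
      (1 < r)%E ->
      offdiag_measurable K ->
      linear_operator mu d r T ->
      associated_kernel mu T K ->
      linear_operator mu d +oo%E Ts ->
      associated_kernel mu Ts (transpose K) ->
      adjoint_operators mu d r +oo%E T Ts ->
      hormander mu d cd r K ->
      hormander mu d cd 1%E (transpose K) ->
      testing mu d Ts ->
      exists2 cT : R, 0 < cT &
      forall (n : nat) (f : Borel X -> 'rV[R]_n), admissible mu d r f ->
        (exists S : set (cube X),
           [/\ S `<=` D,
               sparse mu S,
               {ae mu, forall x : Borel X,
                  [set (cnd n * cT) *: v | v in
                     minkowski_sum S (fun Q =>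
                       [set (\1_(carrier Q) x : R) *: v | v in
                          convex_body mu (hoelder_conjugate r)
                            (dilate d C0 delta alpha Q) f])]
                  (vapply T f x)} &
               exists k : cube X -> Borel X -> Borel X -> R,
                 (forall Q, S Q ->
                    unit_kernel mu r (carrier Q)
                      (dilate d C0 delta alpha Q) (k Q)) /\
                 {ae mu, forall x : Borel X,
                    sparse_series_cvg mu S (dilate d C0 delta alpha) k f x /\
                    vapply T f x = (cnd n * cT) *:
                      vsum S (fun Q => sparse_term mu (carrier Q)
                        (dilate d C0 delta alpha Q) (k Q) f x)}]) /\
        (exists (S : 'I_m -> set (cube X))
                (k : 'I_m -> cube X -> Borel X -> Borel X -> R),
           [/\ forall j, S j `<=` Ds j,
               forall j, sparse mu (S j),
               forall j Q, S j Q ->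
                 unit_kernel mu r (carrier Q) (carrier Q) (k j Q) &
               {ae mu, forall x : Borel X,
                  (forall j, sparse_series_cvg mu (S j) carrier (k j) f x) /\
                  vapply T f x = (cnd n * cT) *:
                    \sum_(j < m) vsum (S j) (fun Q => sparse_term mu
                      (carrier Q) (carrier Q) (k j Q) f x)}])].
Proof.
have cd0 := cd_gt0 hX; have C00 := C0_gt0 hc0.
have a3 := alpha_ge3 hX hdelta halpha.
have [e0 he0 stop] := stopping_cubes hX hc0 hdelta hD halpha.
have e00 : 0 < e0 by case/andP: he0.
(* A ball of this radius about the center of an ancestor contains the dilates of all its
   descendants, which is what the adjacent cells must absorb. *)
have A20 : 0 <= cd * (C0 + alpha * C0).
  by rewrite mulr_ge0 ?(ltW cd0)// addr_ge0 ?(ltW C00)// mulr_ge0 ?(ltW C00)//; lra.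
have [M [N [tc0 [tC0 [Ds [col [cl [M0 htc hDs hcol hcl]]]]]]]] :=
  adjacent_systems hX hc0 hdelta hD A20.
pose Cq := adjc cd cmu c0 C0 delta M tC0.
have Cq1 : 1 <= Cq := adjc_ge1 hX c0 C0 delta M tC0.
(* The constant [stepc] without its factor [A1], times the loss [Cq] of the transport. It involves
   the geometry and n only; [A1], obtained after the operator is given, becomes the constant of the
   operator. *)
pose cnd (n : nat) := Cq * (4 ^+ n * (2 * 8 ^+ n / (e0 / n.+1%:R) ^+ 2)).
have Cq0 : 0 < Cq := lt_le_trans ltr01 Cq1.
have en0 (n : nat) : 0 < (e0 / n.+1%:R) ^+ 2 by rewrite exprn_gt0// divr_gt0.
have cnd0 n : 0 < cnd n.
  apply: mulr_gt0 => //; apply: mulr_gt0; first exact: exprn_gt0.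
  by apply: divr_gt0 => //; apply: mulr_gt0 => //; exact: exprn_gt0.
exists cnd, tc0, tC0, (delta ^+ M), (N * M).+1, (fun j => Ds (j %/ M)%N).
split => //.
  have /andP[d0 d1] := hdelta.
  by rewrite exprn_gt0//= exprn_ilt1// ?(ltW d0)//; move: M0; rewrite lt0n.
move=> r K T Ts hr mK hT _ hTs hass hadj hK hKs [ct ct0 htest].
have mk0 := K0_measurable hX hc0 hdelta hD mK.
have k0E x y : x <> y -> K0 K (x, y) = K x y by exact: K0E.
have [Hr Hr0 HR] := hormander_annuli hX (fun B phi h L => @avg_hoelder _ _ mu r hr B phi h L) k0E mk0 hK.
have mk0t : measurable_fun setT (fun z : Borel X * Borel X => K0 K (z.2, z.1)).
  apply: (measurableT_comp mk0); apply/measurable_fun_pairP.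
  by split; [exact: measurable_snd|exact: measurable_fst].
have k0tE x y : x <> y -> (fun z : Borel X * Borel X => K0 K (z.2, z.1)) (x, y) = transpose K x y.
  by move=> xy /=; rewrite k0E//; exact: nesym.
have [H1 H10 HH1'] := hormander_annuli hX (@avg_hoelder1 R X mu) k0tE mk0t hKs.
have HH1 y0 rho y z : 0 < rho ->
    qball d y0 (rho / (2 * cd)) y -> qball d y0 (rho / (2 * cd)) z ->
    (\int[mu]_(x in ~` qball d y0 rho) `|K0 K (x, y) - K0 K (x, z)|%:E <= H1%:E)%E.
  move=> rho0 yy zz.
  have := HH1' y0 rho y z (fun=> 1) 1 rho0 yy zz (measurable_cst _) ler01 (fun _ _ => _).
  rewrite mul1r; under eq_integral do rewrite normr1 mulr1.
  by apply => _; rewrite normr1 lexx.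
have oscT := dual_osc_T hX hCc hr hT hTs hass hadj k0E mk0 Hr0 HR HH1 hc0 hdelta hD.
have oscTs := dual_osc_Ts hX hCc hr hT hTs hass hadj k0E mk0 Hr0 HR HH1 hc0 hdelta hD.
have [A1 A11 sstep] :=
  scalar_step hX hc0 hdelta hD halpha hr hT hTs hadj ct0 htest Hr0 H10 oscT oscTs.
have A10 : 0 < A1 := lt_le_trans ltr01 A11.
exists A1 => // n f af.
have bf j := admissible_bsL hX hr j af.
have mf j : measurable_fun setT (fun x => f x 0 j) by case: (bf j).
have if_ j : mu.-integrable setT (fun x => (f x 0 j)%:E) by exact: (bsL_integrable hX (ltW hr) (bf j)).
have [S [k data]] := sparse_dom hX hc0 hdelta hD halpha hr hT hTs hadj A11 sstep he0 stop af.
have cE : cnd n * A1 = stepc A1 e0 n * Cq.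
  by rewrite /cnd /stepc; ring.
have c0' : 0 < stepc A1 e0 n.
  by have := mulr_gt0 (cnd0 n) A10; rewrite cE pmulr_lgt0.
split.
  have le : stepc A1 e0 n <= cnd n * A1 by rewrite cE ler_peMr// ltW.
  have [k' [uk ut aeF]] := representation hX hc0 hdelta halpha hr c0' data mf if_ le.
  have [SD Ss _ _] := data.
  exists S; split => //.
  - by exists (1 / 2) => //; apply/andP; split; lra.
  - apply: ae_mono aeF => x [h1 h2].
    apply: (representation_body hX hc0 hdelta halpha hr mf if_ (k' := k')) => // Q SQ.
    exact: ut.
  - by exists k'.
have [h1 h2 h3] := adj_representation hX hc0 hdelta hD halpha hr M0 htc hDs hcol hcl data mf if_.
exists (fun j => adj_sparse hD col cl S j), (fun j => adj_kernel mu cd cmu hD alpha tC0 col cl S k j).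
split => //.
- move=> j; exact: (adj_sparse_Ds hX hc0 hdelta halpha M0 hcol hcl data).
- by rewrite cE.
Qed.
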